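(* Let $\tau>0$. If $f\in H^1\setminus\{0\}$ and its argument function $\varphi=\bar f/f$ (defined a.e. on $\mathbb{S}$) is in $\Lambda_\tau$, then $f\in\Lambda_\tau$.
   Context: $\mathbb{B}$ is the open unit ball of $\mathbb{C}^n$ ($n\ge1$), $\mathbb{S}$ its boundary. $H^1$ is the Hardy space of holomorphic functions on $\mathbb{B}$; functions of $H^1$ are identified with their boundary values on $\mathbb{S}$ (so ''$f\in\Lambda_\tau$'' means that the boundary function is in $\Lambda_\tau$). Membership in $\Lambda_\tau$ of an a.e. defined function means that it agrees a.e. with a function of $\Lambda_\tau$. $\Lambda_\tau=\Lambda_\tau(\mathbb{S})$, $\tau>0$, is the classical (Euclidean) Lipschitz-Zygmund space: for $0<\tau<1$, the continuous functions $\varphi$ on $\mathbb{S}$ with $\sup_{\zeta\ne\eta}|\varphi(\zeta)-\varphi(\eta)|/|\zeta-\eta|^\tau<\infty$; for $k<\tau<k+1$ with $k$ a positive integer, the $\mathcal{C}^k$ functions whose derivatives of order $k$ are in $\Lambda_{\tau-k}$; for integer $\tau$, it is defined analogously with second order differences. Equivalently, a continuous $\varphi$ on $\mathbb{S}$ is in $\Lambda_\tau$ iff for some (any) integer $k>\tau$ its harmonic extension $\Phi$ to $\mathbb{B}$ satisfies $\sup_{z\in\mathbb{B}}(1-|z|^2)^{k-\tau}|d^k\Phi(z)|<\infty$, where $|d^k\Phi|=\sum_{|\alpha|+|\beta|=k}|\partial_\alpha\bar\partial_\beta\Phi|$. *)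

(* Defs.v *)
From HB Require Import structures.
From mathcomp Require Import all_boot all_order all_algebra.
From mathcomp Require Import all_classical all_reals all_analysis.
From mathcomp Require Import measurable_realfun.
From mathcomp Require Import complex.

Set Implicit Arguments.
Unset Strict Implicit.
Unset Printing Implicit Defensive.

Import Order.TTheory GRing.Theory Num.Theory.
Import numFieldNormedType.Exports.

Local Open Scope classical_set_scope.
Local Open Scope ring_scope.

(* The ascription gives R[i] the norm topology of a numClosedFieldType. *)
Definition Cx (R : realType) : numClosedFieldType := R[i].

Definition cabs (R : realType) (z : Cx R) : R :=
  Num.sqrt (complex.Re z ^+ 2 + complex.Im z ^+ 2).

Definition creal (R : realType) (x : R) : Cx R := (x%:C)%C.

Section ComplexSpace.
Variables (R : realType) (n : nat).
Implicit Types z w : 'rV[Cx R]_n.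

(* The library norm of 'rV is the sup norm; it is used below only through the
   topology and the notion of differentiability, which do not depend on it. *)
Definition enorm z : R := Num.sqrt (\sum_j cabs (z ord0 j) ^+ 2).

Definition redot z w : R :=
  \sum_j complex.Re (z ord0 j * (w ord0 j)^*).

Definition unit_ball : set 'rV[Cx R]_n := [set z | enorm z < 1].

Definition unit_sphere : set 'rV[Cx R]_n := [set z | enorm z = 1].

Definition sphere_proj z : 'rV[Cx R]_n := creal (enorm z)^-1 *: z.

End ComplexSpace.

(* The library's sigma-finite instance of a product measure is hidden by the one
   for subprobabilities. *)
Lemma sigma_finite_prodmeas d1 d2 (T1 : measurableType d1)
    (T2 : measurableType d2) (R : realType)
    (m1 : {sigma_finite_measure set T1 -> \bar R})
    (m2 : {sigma_finite_measure set T2 -> \bar R}) :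
  sigma_finite setT (m1 \x m2)%E.
Proof.
have /sigma_finiteP[F [TF ndF Foo]] := sigma_finiteT m1.
have /sigma_finiteP[G [TG ndG Goo]] := sigma_finiteT m2.
exists (fun k => F k `*` G k).
  rewrite -setXTT TF TG; apply/seteqP; split => -[x y].
    move=> [/= [k _ Fkx] [l _ Gly]]; exists (maxn k l) => //; split.
      by move: x Fkx; exact/subsetPset/ndF/leq_maxl.
    by move: y Gly; exact/subsetPset/ndG/leq_maxr.
  by move=> [k _ []/= ? ?]; split; exists k.
move=> k; have [? ?] := Foo k; have [? ?] := Goo k.
split; first exact: measurableX.
by rewrite product_measure1E// lte_mul_pinfty// ge0_fin_numE.
Qed.

Section LebesgueMeasure.
Variable R : realType.

Local Notation Rm := (measurableTypeR R).

Section Step.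
Variables (m : nat) (mu : {sigma_finite_measure set (m.-tuple Rm) -> \bar R}).

Definition tuple_cons (x : Rm * m.-tuple Rm) : m.+1.-tuple Rm :=
  [the m.+1.-tuple Rm of x.1 :: x.2].

Lemma measurable_tuple_cons : measurable_fun setT tuple_cons.
Proof. by apply: measurable_cons; [exact: measurable_fst|exact: measurable_snd]. Qed.

HB.instance Definition _ :=
  isMeasurableFun.Build _ _ _ _ tuple_cons measurable_tuple_cons.

Definition lebesgue_step : set (m.+1.-tuple Rm) -> \bar R :=
  pushforward (@lebesgue_measure R \x mu)%E tuple_cons.

Let step0 : lebesgue_step set0 = 0%E.
Proof. exact: measure0. Qed.

Let step_ge0 A : (0 <= lebesgue_step A)%E.
Proof. exact: measure_ge0. Qed.

Let step_sigma_additive : semi_sigma_additive lebesgue_step.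
Proof. exact: measure_semi_sigma_additive. Qed.

HB.instance Definition _ := isMeasure.Build _ _ _ lebesgue_step
  step0 step_ge0 step_sigma_additive.

Let step_sigma_finite : sigma_finite setT lebesgue_step.
Proof.
have [F FT mF] := sigma_finite_prodmeas (@lebesgue_measure R) mu.
pose g (t : m.+1.-tuple Rm) : Rm * m.-tuple Rm := (thead t, [tuple of behead t]).
have gK : cancel tuple_cons g.
  by move=> [x t]; congr pair; apply/val_inj.
have mg : measurable_fun setT g.
  apply/measurable_fun_pairP; split => /=; last exact: measurable_behead.
  exact: measurable_tnth.
exists (fun k => g @^-1` F k).
  by rewrite -preimage_bigcup -FT preimage_setT.
move=> k; split.
  by rewrite -[X in measurable X]setTI; apply: mg => //; exact: (mF k).1.
rewrite /lebesgue_step /pushforward -comp_preimage.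
by rewrite (_ : g \o tuple_cons = id) ?preimage_id; [exact: (mF k).2|exact/funext].
Qed.

HB.instance Definition _ := Measure_isSigmaFinite.Build _ _ _ lebesgue_step
  step_sigma_finite.

End Step.

Fixpoint lebesgue_tuple m : {sigma_finite_measure set (m.-tuple Rm) -> \bar R} :=
  match m with
  | 0 => \d_([tuple] : 0.-tuple Rm)
  | k.+1 => lebesgue_step (lebesgue_tuple k)
  end.

End LebesgueMeasure.

Section SurfaceMeasure.
Variables (R : realType) (n : nat).

Local Notation Rm := (measurableTypeR R).

Definition real_coords (z : 'rV[Cx R]_n) : (n + n).-tuple Rm :=
  [tuple match fintype.split i with
         | inl j => complex.Re (z ord0 j)
         | inr j => complex.Im (z ord0 j)
         end | i < n + n].

Definition of_real_coords (t : (n + n).-tuple Rm) : 'rV[Cx R]_n :=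
  \row_j (tnth t (lshift n j) +i* tnth t (rshift n j))%C.

(* C^n with the sigma-algebra pulled back from R^(n + n), i.e. the Borel one. *)
Definition CnBorel := g_sigma_algebra_preimageType real_coords.

Lemma measurable_of_real_coordsP d (T : measurableType d) (f : T -> CnBorel) :
  (forall j, measurable_fun setT
     (fun x => complex.Re ((f x : 'rV[Cx R]_n) ord0 j) : Rm)) ->
  (forall j, measurable_fun setT
     (fun x => complex.Im ((f x : 'rV[Cx R]_n) ord0 j) : Rm)) ->
  measurable_fun setT f.
Proof.
move=> mRe mIm _ _ [B mB <-]; rewrite !setTI -comp_preimage -[X in measurable X]setTI.
suff : measurable_fun setT (real_coords \o f : T -> (n + n).-tuple Rm) by apply.
apply/measurable_fun_tnthP => i.
rewrite (_ : _ \o _ = fun x => match fintype.split i with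
         | inl j => complex.Re ((f x : 'rV[Cx R]_n) ord0 j)
         | inr j => complex.Im ((f x : 'rV[Cx R]_n) ord0 j)
         end); last by apply/funext => x /=; rewrite tnth_mktuple.
by case: (fintype.split i).
Qed.

Definition tuple_norm (t : (n + n).-tuple Rm) : R := enorm (of_real_coords t).

Lemma tuple_normE t : tuple_norm t = Num.sqrt (\sum_j tnth t j ^+ 2).
Proof.
rewrite /tuple_norm /enorm big_split_ord /= -big_split /=; congr Num.sqrt.
apply: eq_bigr => j _; rewrite /cabs sqr_sqrtr ?addr_ge0 ?sqr_ge0// mxE /=.
by [].
Qed.

Lemma measurable_tuple_norm : measurable_fun setT tuple_norm.
Proof.
rewrite (_ : tuple_norm = (@Num.sqrt R : Rm -> Rm) \o
    (fun t : (n + n).-tuple Rm => \sum_j tnth t j ^+ 2 : Rm)); last first.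
  by apply/funext => t; rewrite tuple_normE.
apply: measurableT_comp.
  by apply: continuous_measurable_fun; exact: sqrt_continuous.
apply: measurable_sum => j; apply: measurable_funX; exact: measurable_tnth.
Qed.

Definition punctured_ball : set ((n + n).-tuple Rm) :=
  [set t | 0 < tuple_norm t < 1].

Lemma measurable_punctured_ball : measurable punctured_ball.
Proof.
rewrite (_ : punctured_ball = setT `&` tuple_norm @^-1` `]0, 1[); last first.
  by apply/seteqP; split=> t; rewrite /= in_itv//= => -[].
by apply: measurable_tuple_norm => //; exact: measurable_itv.
Qed.

Definition tuple_proj (t : (n + n).-tuple Rm) : CnBorel :=
  sphere_proj (of_real_coords t).

Lemma measurable_inv : measurable_fun setT (fun x : Rm => x^-1 : Rm).
Proof.
rewrite -(setUv [set 0 : R]); apply/measurable_funU => //.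
  exact: measurableC.
split; first exact: measurable_fun_set1.
apply: open_continuous_measurable_fun.
  by rewrite openC; exact: closed_eq.
by move=> x; rewrite inE /= => /eqP x0; exact: inv_continuous.
Qed.

Lemma measurable_tuple_proj : measurable_fun setT tuple_proj.
Proof.
have mV : measurable_fun setT (fun t => (tuple_norm t)^-1 : Rm).
  exact: (measurableT_comp measurable_inv measurable_tuple_norm).
apply: measurable_of_real_coordsP => j.
  rewrite (_ : (fun _ => _) = fun t => (tuple_norm t)^-1 * tnth t (lshift n j)).
    by apply: measurable_funM => //; exact: measurable_tnth.
  by apply/funext => t; rewrite !mxE /= mul0r subr0.
rewrite (_ : (fun _ => _) = fun t => (tuple_norm t)^-1 * tnth t (rshift n j)).
  by apply: measurable_funM => //; exact: measurable_tnth.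
by apply/funext => t; rewrite !mxE /= mul0r addr0.
Qed.

HB.instance Definition _ :=
  isMeasurableFun.Build _ _ _ _ tuple_proj measurable_tuple_proj.

Definition cone_measure : set CnBorel -> \bar R :=
  pushforward (mrestr (lebesgue_tuple R (n + n)) measurable_punctured_ball)
    tuple_proj.

Let cone0 : cone_measure set0 = 0%E.
Proof. exact: measure0. Qed.

Let cone_ge0 A : (0 <= cone_measure A)%E.
Proof. exact: measure_ge0. Qed.

Let cone_sigma_additive : semi_sigma_additive cone_measure.
Proof. exact: measure_semi_sigma_additive. Qed.

HB.instance Definition _ := isMeasure.Build _ _ _ cone_measure
  cone0 cone_ge0 cone_sigma_additive.

(* Euclidean surface measure of A: the real dimension times the volume of the
   cone { r z | z in A, 0 < r < 1 }. It is not normalized; this is immaterial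
   for null sets and for the finiteness of integrals. *)
Definition surface_measure : {measure set CnBorel -> \bar R} :=
  mscale (n + n)%:R%:nng cone_measure.

End SurfaceMeasure.

Section HardySpace.
Variables (R : realType) (n : nat).
Local Notation Cn := 'rV[Cx R]_n.
Implicit Types f : Cn -> Cx R.

Definition holomorphic_on_ball f :=
  forall z, unit_ball z -> differentiable f z.

Definition sphere_mean f (r : R) : \bar R :=
  (\int[surface_measure R n]_(z in @unit_sphere R n)
     (cabs (f (creal r *: (z : Cn))))%:E)%E.

(* f matters only through its values on the open ball. *)
Definition hardy1 f :=
  holomorphic_on_ball f /\
  (ereal_sup (sphere_mean f @` `]0%R, 1%R[) < +oo)%E.

Definition boundary_value f (z : Cn) : Cx R :=
  lim (f (creal r *: z) @[r --> (1 : R)^'-]).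

End HardySpace.

Section LipschitzZygmund.
Variables (R : realType) (n : nat).
Local Notation Cn := 'rV[Cx R]_n.
Local Notation S := (@unit_sphere R n).
Implicit Types (phi : Cn -> Cx R) (tau : R).

(* The functions phi below matter only through their values on the sphere. *)

Definition holder tau phi :=
  exists M : R, forall z w, S z -> S w ->
    cabs (phi z - phi w) <= M * enorm (z - w) `^ tau.

(* The point symmetric to w with respect to z along the great circle of the
   sphere through z and w. *)
Definition sphere_reflect (z w : Cn) : Cn := creal (2 * redot w z) *: z - w.

Definition zygmund phi :=
  exists M : R, forall z w, S z -> S w ->
    cabs (phi w + phi (sphere_reflect z w) - 2 * phi z) <= M * enorm (w - z).

(* The space Lambda_tau for 0 < tau <= 1. *)
Definition lambda_base tau phi :=
  {within S, continuous phi} /\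
  if tau < 1 then holder tau phi else zygmund phi.

(* Difference quotients at z, in the direction v, of the extension of phi to
   C^n \ {0} that is homogeneous of degree 0. *)
Definition sphere_quotient (v : Cn) phi (z : Cn) (h : R) : Cx R :=
  creal h^-1 * (phi (sphere_proj (z + creal h *: v)) - phi z).

(* The derivative of phi at z in the direction of the tangential part of v. *)
Definition sphere_deriv (v : Cn) phi (z : Cn) : Cx R :=
  lim (sphere_quotient v phi z h @[h --> (0 : R)^']).

Definition sphere_derivable (v : Cn) phi :=
  forall z, S z -> cvg (sphere_quotient v phi z h @[h --> (0 : R)^']).

Fixpoint sphere_Ck (k : nat) phi : Prop :=
  {within S, continuous phi} /\
  if k is j.+1 then
    forall v, sphere_derivable v phi /\ sphere_Ck j (sphere_deriv v phi)
  else True.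

Definition Lambda tau phi :=
  exists2 k : nat, k%:R < tau <= k.+1%:R &
    sphere_Ck k phi /\
    forall vs : k.-tuple Cn, lambda_base (tau - k%:R) (foldr sphere_deriv phi vs).

Definition Lambda_ae tau phi :=
  exists2 psi, Lambda tau psi &
    {ae surface_measure R n, forall z, phi z = psi z}.

End LipschitzZygmund.

(* Main.v *)
(** On the sphere the dilates f_r satisfy f_r = phi conj(f_r) + e_r, where phi = conj(psi) has
    modulus one and e_r tends to 0 in measure. Since the mean of |f| over r S increases with
    r, testing against the multiplier 1 / (1 + Q), with Re Q close to min(1, |e_r|),
    shows that e_r tends to 0 in L^1 as well. Along each slice l |-> f (l z) let D_j be the
    convolution with a kernel whose frequencies lie between 2^j and 2^(j + 2). It annihilates
    p conj(f) for every trigonometric polynomial p of degree at most 2^j, so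
    D_j f = D_j ((phi - p_j) conj(f)), where by Jackson's theorem phi - p_j is O(2^(- tau j)).
    Iterating this identity, with a gain of 1/2 each time, bounds f, and one more use bounds
    D_j f by O(2^(- tau j)). As D_j f is a polynomial of degree O(2^j), Bernstein's inequality
    along great circles gives f in Lambda_tau. Averages over roots of unity replace integrals
    over circles. The case |psi| = 1 is the only one with f not zero almost everywhere on the
    sphere, because psi is continuous, |psi| takes its values in {0, 1} and the sphere is
    connected. *)

Require Import Defs.
From HB Require Import structures.
From mathcomp Require Import all_boot all_order all_algebra.
From mathcomp Require Import all_classical all_reals all_analysis.
From mathcomp Require Import measurable_realfun.
From mathcomp Require Import complex.
From mathcomp Require Import ring lra zify.

Set Implicit Arguments.
Unset Strict Implicit.
Unset Printing Implicit Defensive.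

Import Order.TTheory GRing.Theory Num.Theory.
Import numFieldNormedType.Exports.

Local Open Scope classical_set_scope.
Local Open Scope ring_scope.

(** * Complex moduli and the unit circle *)

(** Two obstacles shape the estimates. The H^1 bound does not prevent the mass of |f_r| from
    concentrating, and an error that is small only in measure says nothing after a convolution.
    Dividing by 1 + Q lowers the mass on the sphere where the error is large, yet hardly changes f
    on a smaller sphere that already carries almost all the mass; since the means of |f| grow with
    the radius, little mass can sit where the error is large. Secondly, no supremum of |f| can be
    absorbed, as it might be infinite. What is halved at each iteration is the distance in mean of f
    to the continuous functions bounded by a fixed constant, and this distance is finite from the
    outset. The surface integral enters the estimates as an abstract rotation-invariant functional
    on continuous functions; f itself is therefore handled through partial sums of its homogeneous
    expansion at radii below 1. Holomorphy is given as differentiability at each point, so this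
    expansion starts from Goursat's bisection, carried out on Riemann sums, and the polynomiality of
    its terms is recovered by interpolation. *)

Notation cconj := (@Num.conj _).

Section ComplexAbs.
Variable R : realType.
Implicit Types (x y : R) (z w : Cx R).

HB.instance Definition _ := GRing.RMorphism.copy (@creal R) (real_complex R).

Lemma normCx z : `|z| = creal (cabs z).
Proof. exact: normc_def. Qed.

Lemma creal0 : creal 0 = 0 :> Cx R. Proof. by []. Qed.
Lemma creal1 : creal 1 = 1 :> Cx R. Proof. by []. Qed.
Lemma crealD x y : creal (x + y) = creal x + creal y.
Proof. exact: rmorphD. Qed.
Lemma crealN x : creal (- x) = - creal x.
Proof. exact: rmorphN. Qed.
Lemma crealB x y : creal (x - y) = creal x - creal y.
Proof. exact: rmorphB. Qed.
Lemma crealM x y : creal (x * y) = creal x * creal y.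
Proof. exact: rmorphM. Qed.
Lemma crealV x : creal x^-1 = (creal x)^-1.
Proof. exact: fmorphV. Qed.
Lemma crealX x k : creal (x ^+ k) = creal x ^+ k.
Proof. exact: rmorphXn. Qed.
Lemma creal_nat k : creal (k%:R : R) = k%:R.
Proof. exact: rmorph_nat. Qed.
Lemma creal_sum I (r : seq I) (P : pred I) (F : I -> R) :
  creal (\sum_(i <- r | P i) F i) = \sum_(i <- r | P i) creal (F i).
Proof. exact: rmorph_sum. Qed.

Lemma creal_inj : injective (@creal R).
Proof. exact: complexI. Qed.

Lemma ler_creal x y : (creal x <= creal y) = (x <= y).
Proof. exact: lecR. Qed.

Lemma ltr_creal x y : (creal x < creal y) = (x < y).
Proof. exact: ltcR. Qed.

Lemma conj_creal x : (creal x)^* = creal x.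
Proof. by rewrite -[LHS]/(conjc _); exact: conjc_real. Qed.

Lemma cabs_ge0 z : 0 <= cabs z.
Proof. exact: sqrtr_ge0. Qed.
Hint Resolve cabs_ge0 : core.

Lemma cabsE z x : `|z| = creal x -> cabs z = x.
Proof. by rewrite normCx => /creal_inj. Qed.

Lemma cabs_sqr z : creal (cabs z ^+ 2) = z * z^*.
Proof. by rewrite crealX -normCx normCK. Qed.

Lemma cabs0 : cabs (0 : Cx R) = 0.
Proof. by apply: cabsE; rewrite normr0 rmorph0. Qed.

Lemma cabs1 : cabs (1 : Cx R) = 1.
Proof. by apply: cabsE; rewrite normr1 rmorph1. Qed.

Lemma cabsN z : cabs (- z) = cabs z.
Proof. by apply: cabsE; rewrite normrN normCx. Qed.

Lemma cabsBC z w : cabs (z - w) = cabs (w - z).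
Proof. by rewrite -cabsN opprB. Qed.

Lemma cabsM z w : cabs (z * w) = cabs z * cabs w.
Proof. by apply: cabsE; rewrite normrM !normCx crealM. Qed.

Lemma cabsX z k : cabs (z ^+ k) = cabs z ^+ k.
Proof. by apply: cabsE; rewrite normrX !normCx crealX. Qed.

Lemma cabsV z : cabs z^-1 = (cabs z)^-1.
Proof. by apply: cabsE; rewrite normfV !normCx crealV. Qed.

Lemma cabs_conj z : cabs z^* = cabs z.
Proof. by apply: cabsE; rewrite norm_conjC normCx. Qed.

Lemma cabs_creal x : cabs (creal x) = `|x|.
Proof. by rewrite /cabs /= expr0n addr0 sqrtr_sqr. Qed.

Lemma cabs_nat k : cabs (k%:R : Cx R) = k%:R.
Proof. by rewrite -(rmorph_nat (@creal R)) cabs_creal normr_nat. Qed.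

Lemma cabs_eq0 z : (cabs z == 0) = (z == 0).
Proof.
by rewrite -[RHS]normr_eq0 normCx -(inj_eq creal_inj) rmorph0.
Qed.

Lemma cabsD z w : cabs (z + w) <= cabs z + cabs w.
Proof. rewrite -ler_creal crealD -!normCx.
by have := @ler_normD _ (Cx R) z w. Qed.

Lemma cabsB z w : cabs (z - w) <= cabs z + cabs w.
Proof. by rewrite -(cabsN w) cabsD. Qed.

Lemma cabs_triangle v z w : cabs (z - w) <= cabs (z - v) + cabs (v - w).
Proof. by rewrite (le_trans _ (cabsD _ _))// addrA subrK. Qed.

Lemma cabs_subl z w : cabs z - cabs w <= cabs (z - w).
Proof. by rewrite lerBlDr (le_trans _ (cabsD _ _))// subrK. Qed.

Lemma cabs_dist z w : `|cabs z - cabs w| <= cabs (z - w).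
Proof.
by rewrite ler_norml lerNl opprB cabs_subl andbT cabsBC cabs_subl.
Qed.

Lemma cabs_sum I (r : seq I) (P : pred I) (F : I -> Cx R) :
  cabs (\sum_(i <- r | P i) F i) <= \sum_(i <- r | P i) cabs (F i).
Proof.
elim/big_ind2 : _ => //; first by rewrite cabs0.
by move=> a b c e ab ce; rewrite (le_trans (cabsD _ _))// lerD.
Qed.

Lemma Re_le_cabs z : `|complex.Re z| <= cabs z.
Proof. by rewrite /cabs -sqrtr_sqr ler_wsqrtr// lerDl sqr_ge0. Qed.

Lemma Im_le_cabs z : `|complex.Im z| <= cabs z.
Proof. by rewrite /cabs -sqrtr_sqr ler_wsqrtr// lerDr sqr_ge0. Qed.

Lemma cabs_le_ReIm z : cabs z <= `|complex.Re z| + `|complex.Im z|.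
Proof.
rewrite -(@ler_pXn2r _ 2) ?nnegrE ?addr_ge0//.
rewrite /cabs sqr_sqrtr ?addr_ge0 ?sqr_ge0// -(real_normK (num_real (complex.Re z))).
rewrite -(real_normK (num_real (complex.Im z))).
have := normr_ge0 (complex.Re z); have := normr_ge0 (complex.Im z); nra.
Qed.

Lemma ReImE z : z = creal (complex.Re z) + 'i * creal (complex.Im z).
Proof. by rewrite [LHS]complexE complexiE. Qed.

Lemma cReD z w : complex.Re (z + w) = complex.Re z + complex.Re w.
Proof. by case: z w => [? ?] [? ?]. Qed.

Lemma cImD z w : complex.Im (z + w) = complex.Im z + complex.Im w.
Proof. by case: z w => [? ?] [? ?]. Qed.

Lemma cReB z w : complex.Re (z - w) = complex.Re z - complex.Re w.
Proof. by case: z w => [? ?] [? ?]. Qed.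

Lemma cImB z w : complex.Im (z - w) = complex.Im z - complex.Im w.
Proof. by case: z w => [? ?] [? ?]. Qed.

Lemma cReM z w : complex.Re (z * w) =
  complex.Re z * complex.Re w - complex.Im z * complex.Im w.
Proof. by case: z w => [? ?] [? ?]. Qed.

Lemma cImM z w : complex.Im (z * w) =
  complex.Re z * complex.Im w + complex.Im z * complex.Re w.
Proof. by case: z w => [? ?] [? ?]. Qed.

Lemma cRe_conj z : complex.Re z^* = complex.Re z.
Proof. by case: z. Qed.

Lemma cIm_conj z : complex.Im z^* = - complex.Im z.
Proof. by case: z. Qed.

Lemma Re_crealM x z : complex.Re (creal x * z) = x * complex.Re z.
Proof. by rewrite cReM mul0r subr0. Qed.

Lemma Im_crealM x z : complex.Im (creal x * z) = x * complex.Im z.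
Proof. by rewrite cImM mul0r addr0. Qed.

Lemma Re_sum I (r : seq I) (P : pred I) (F : I -> Cx R) :
  complex.Re (\sum_(i <- r | P i) F i) = \sum_(i <- r | P i) complex.Re (F i).
Proof. by elim/big_ind2 : _ => // a b c e <- <-; rewrite cReD. Qed.

Lemma Cx_eqP z w : complex.Re z = complex.Re w -> complex.Im z = complex.Im w -> z = w.
Proof. by case: z w => [? ?] [? ?] /= -> ->. Qed.

Lemma cabs_small z : (forall e, 0 < e -> cabs z <= e) -> z = 0.
Proof.
move=> h; apply/eqP; rewrite -cabs_eq0 eq_le cabs_ge0 andbT.
by apply/ler_addgt0Pl => e e0; rewrite addr0 h.
Qed.

Lemma conj_unit z : cabs z = 1 -> z^* = z^-1.
Proof.
move=> z1; have z0 : z != 0 by rewrite -cabs_eq0 z1 oner_eq0.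
by apply: (mulfI z0); rewrite -cabs_sqr z1 expr1n mulfV// rmorph1.
Qed.

Lemma mul_conj_unit z : cabs z = 1 -> z * z^* = 1.
Proof. by move=> z1; rewrite -cabs_sqr z1 expr1n rmorph1. Qed.

End ComplexAbs.
#[global] Hint Resolve cabs_ge0 : core.

Section ComplexLimits.
Variable R : realType.

Lemma cvg_cabsP T (F : set_system T) {FF : Filter F} (f : T -> Cx R) (l : Cx R) :
  f x @[x --> F] --> l <->
  (forall e : R, 0 < e -> \forall x \near F, cabs (f x - l) < e).
Proof.
split=> [/cvgrPdist_lt h e e0|h].
  have := h (creal e); rewrite -(rmorph0 (@creal R)) ltr_creal => /(_ e0).
  by apply: filterS => x; rewrite normCx ltr_creal cabsBC.
apply/cvgrPdist_lt => e e0.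
have : (complex.Re e) > 0 by move: e0; case: e => a b; rewrite ltcE /= => /andP[].
move=> /h; apply: filterS => x; rewrite normCx cabsBC => fe.
have -> : e = creal (complex.Re e); last by rewrite ltr_creal.
by move: e0; case: e {fe} => a b; rewrite ltcE /= => /andP[/eqP ->].
Qed.

Lemma cvg_cabs T (F : set_system T) {FF : Filter F} (f : T -> Cx R) (l : Cx R) :
  f x @[x --> F] --> l -> cabs (f x) @[x --> F] --> cabs l.
Proof.
move=> /cvg_cabsP h; apply/cvgrPdist_lt => e /h; apply: filterS => x.
by rewrite distrC; exact/le_lt_trans/cabs_dist.
Qed.

Lemma cvg_conj T (F : set_system T) {FF : Filter F} (f : T -> Cx R) (l : Cx R) :
  f x @[x --> F] --> l -> (f x)^* @[x --> F] --> l^*.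
Proof.
move=> /cvg_cabsP h; apply/cvg_cabsP => e /h; apply: filterS => x.
by rewrite -rmorphB cabs_conj.
Qed.

Lemma cvg_creal T (F : set_system T) {FF : Filter F} (f : T -> R) (l : R) :
  f x @[x --> F] --> l -> creal (f x) @[x --> F] --> creal l.
Proof.
move=> /cvgrPdist_lt h; apply/cvg_cabsP => e /h; apply: filterS => x.
by rewrite -rmorphB cabs_creal distrC.
Qed.

Lemma cvg_Re T (F : set_system T) {FF : Filter F} (f : T -> Cx R) (l : Cx R) :
  f x @[x --> F] --> l -> complex.Re (f x) @[x --> F] --> complex.Re l.
Proof.
move=> /cvg_cabsP h; apply/cvgrPdist_lt => e /h; apply: filterS => x.
by rewrite distrC -cReB; exact/le_lt_trans/Re_le_cabs.
Qed.

Lemma cvg_Im T (F : set_system T) {FF : Filter F} (f : T -> Cx R) (l : Cx R) :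
  f x @[x --> F] --> l -> complex.Im (f x) @[x --> F] --> complex.Im l.
Proof.
move=> /cvg_cabsP h; apply/cvgrPdist_lt => e /h; apply: filterS => x.
by rewrite distrC -cImB; exact/le_lt_trans/Im_le_cabs.
Qed.

Lemma cvg_ReIm T (F : set_system T) {FF : Filter F} (f : T -> Cx R) (l : Cx R) :
  complex.Re (f x) @[x --> F] --> complex.Re l ->
  complex.Im (f x) @[x --> F] --> complex.Im l -> f x @[x --> F] --> l.
Proof.
move=> hR hI; rewrite (ReImE l) (_ : (fun x => _) = fun x =>
  creal (complex.Re (f x)) + 'i * creal (complex.Im (f x))); last first.
  by apply/funext => x; rewrite -ReImE.
by apply: cvgD; [exact: cvg_creal|apply: cvgMr; exact: cvg_creal].
Qed.

End ComplexLimits.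

Section Circle.
Variable R : realType.
Implicit Types (s t : R).

Definition cis t : Cx R := (cos t +i* sin t)%C.

Lemma cisD s t : cis (s + t) = cis s * cis t.
Proof. by apply: Cx_eqP; rewrite ?cReM ?cImM /= ?cosD ?sinD// addrC mulrC (mulrC (sin t)). Qed.

Lemma cis0 : cis 0 = 1.
Proof. by apply: Cx_eqP; rewrite /= ?cos0 ?sin0. Qed.

Lemma cabs_cis t : cabs (cis t) = 1.
Proof. by rewrite /cabs /= cos2Dsin2 sqrtr1. Qed.

Lemma cisN t : cis (- t) = (cis t)^*.
Proof. by apply: Cx_eqP; rewrite ?cRe_conj ?cIm_conj /= ?cosN ?sinN. Qed.

Lemma cisX t k : cis t ^+ k = cis (k%:R * t).
Proof.
elim: k => [|k ih]; first by rewrite mul0r cis0.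
by rewrite exprS ih -cisD -[in RHS]natr1 mulrDl mul1r addrC.
Qed.

Lemma cis_2pi : cis (2 * pi) = 1.
Proof. by apply: Cx_eqP; rewrite /= mulrC ?cos2pi ?sin2pi// mulrC mulr_natl ?cos2pi ?sin2pi. Qed.

Lemma cis_surj (z : Cx R) : cabs z = 1 -> exists2 t, `|t| <= pi & z = cis t.
Proof.
move=> z1; have z2 : complex.Re z ^+ 2 + complex.Im z ^+ 2 = 1.
  by move/(congr1 (fun x => x ^+ 2)): z1; rewrite /cabs sqr_sqrtr ?addr_ge0 ?sqr_ge0// expr1n.
have rz : -1 <= complex.Re z <= 1.
  by have := sqr_ge0 (complex.Im z) => i0; apply/andP; split; nra.
have cz := acosK rz; have a0 := acos_ge0 rz; have api := acos_lepi rz.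
have sz : sin (acos (complex.Re z)) = `|complex.Im z|.
  rewrite sin_acos// -z2 -sqrtr_sqr; congr Num.sqrt; ring.
have [i0|i0] := lerP 0 (complex.Im z).
  exists (acos (complex.Re z)); first by rewrite ger0_norm.
  by apply: Cx_eqP; rewrite /= ?cz// sz ger0_norm.
exists (- acos (complex.Re z)); first by rewrite normrN ger0_norm.
by apply: Cx_eqP; rewrite /= ?cosN ?cz// sinN sz ltr0_norm// opprK.
Qed.

Lemma cabs_cisB1 t : cabs (cis t - 1) ^+ 2 = 2 - 2 * cos t.
Proof.
rewrite /cabs sqr_sqrtr ?addr_ge0 ?sqr_ge0// cReB cImB /= subr0.
have := cos2Dsin2 t; nra.
Qed.

Lemma cis_neq1 t : 0 < t < 2 * pi -> cis t != 1.
Proof.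
move=> /andP[t0 t2]; rewrite -subr_eq0 -cabs_eq0 -(sqrf_eq0 (cabs _)) cabs_cisB1.
have : 0 < sin (t / 2) by apply: sin_gt0_pi; apply/andP; split; lra.
have -> : cos t = 1 - 2 * sin (t / 2) ^+ 2.
  rewrite [in LHS](_ : t = t / 2 + t / 2); last by field.
  by rewrite cosD -!expr2; have := cos2Dsin2 (t / 2); nra.
by move=> s0; apply/negP => /eqP; nra.
Qed.

Lemma cos_half t : cos t = 1 - 2 * sin (t / 2) ^+ 2.
Proof.
rewrite [in LHS](_ : t = t / 2 + t / 2); last by field.
by rewrite cosD -!expr2; have := cos2Dsin2 (t / 2); nra.
Qed.

Lemma cabs_cisB1_half t : cabs (cis t - 1) = 2 * `|sin (t / 2)|.
Proof.
apply/eqP; rewrite -(@eqrXn2 _ 2) ?mulr_ge0 ?cabs_ge0//; apply/eqP.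
by rewrite cabs_cisB1 cos_half exprMn real_normK ?num_real//; ring.
Qed.

Lemma sin_mvt s : 0 < s -> exists2 c, 0 < c < s & sin s = cos c * s.
Proof.
move=> s0; have [|c] := @MVT R (@sin R) (@cos R) 0 s s0.
- by apply: continuous_subspaceT => x; exact: continuous_sin.
- by rewrite in_itv /= sin0 !subr0; exists c.
Qed.

Lemma sin_le_norm s : `|sin s| <= `|s|.
Proof.
wlog s0 : s / 0 <= s.
  move=> h; have [/h//|/ltW s0] := lerP 0 s.
  by rewrite -normrN -sinN -(normrN s) h// oppr_ge0.
have [->|sn0] := eqVneq s 0; first by rewrite sin0.
have [|c _ ->] := @sin_mvt s; first by rewrite lt_def sn0.
by rewrite normrM ler_piMl// cos_max.
Qed.

Lemma cabs_cisB1_le t : cabs (cis t - 1) <= `|t|.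
Proof.
rewrite cabs_cisB1_half; have := sin_le_norm (t / 2).
rewrite normrM (@ger0_norm _ 2^-1)//; lra.
Qed.

(** The chord is 2 |sin (t / 2)|. For t / 2 <= 1 the mean value theorem gives sin (t / 2) >= cos 1 *
    (t / 2); beyond that the sine is at least sin 1 while t / 2 stays below 2. The two constants are
    added rather than compared. *)
Lemma chord_bound : exists2 C : R, 0 < C &
  forall t, `|t| <= pi -> `|t| <= C * cabs (cis t - 1).
Proof.
have s1 : 0 < sin (1 : R) by apply: sin2_gt0; apply/andP; split; lra.
have c1 : 0 < cos (1 : R) := cos1_gt0 R.
exists (2 / sin 1 + 1 / cos 1); first by rewrite addr_gt0// divr_gt0.
move=> t; wlog t0 : t / 0 <= t.
  move=> h; have [/h//|/ltW t0 tpi] := lerP 0 t.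
  have := h (- t); rewrite oppr_ge0 normrN => /(_ t0 tpi) /le_trans; apply.
  by rewrite cisN -(conjC1 (Cx R)) -rmorphB cabs_conj conjC1.
rewrite ger0_norm// => tpi; rewrite cabs_cisB1_half.
have [->|tn0] := eqVneq t 0; first by rewrite mul0r sin0 normr0 !mulr0.
have {tn0}t0 : 0 < t by rewrite lt_def tn0.
have pi2 : pi / 2 < (2 : R) := pihalf_lt2 R.
have sp : 0 < sin (t / 2) by apply: sin_gt0_pi; apply/andP; split; lra.
rewrite (gtr0_norm sp) mulrDl.
have [t1|t1] := lerP (t / 2) 1.
  have [|c /andP[c0 ct] ->] := @sin_mvt (t / 2); first by lra.
  have cc : cos 1 <= cos c.
    have [->//|c1'] := eqVneq c 1.
    apply/ltW; rewrite ltr_cos ?in_itv/=; [by lra|by lra|].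
    by have ph := pihalf_ge1 R; apply/andP; split; lra.
  have : t <= 1 / cos 1 * (2 * (cos c * (t / 2))).
    by rewrite mul1r mulrC ler_pdivlMr//; nra.
  move=> h; rewrite (le_trans h)// lerDr mulr_ge0//.
    by rewrite divr_ge0// ltW.
  by rewrite !mulr_ge0//; [exact/(le_trans (ltW c1))|lra].
have : sin 1 <= sin (t / 2).
  apply/ltW; rewrite ltr_sin ?in_itv//=; [|].
    by have ph := pihalf_ge1 R; apply/andP; split; lra.
  by apply/andP; split; lra.
move=> ss; have : t <= 2 / sin 1 * (2 * sin (t / 2)).
  rewrite mulrAC ler_pdivlMr//; nra.
move=> h; rewrite (le_trans h)// lerDl mulr_ge0//.
  by rewrite divr_ge0// ltW.
by rewrite mulr_ge0// ltW.
Qed.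

End Circle.

(** * Averages over roots of unity and the Fejer kernel *)

Section RootAverages.
Variable R : realType.
Local Notation C := (Cx R).
Implicit Types (M L k a b : nat) (z l : C).

Definition uroot M : C := cis (2 * pi / M%:R).

Lemma cabs_urootX M k : cabs (uroot M ^+ k) = 1.
Proof. by rewrite cabsX cabs_cis expr1n. Qed.

Lemma urootXM M : (0 < M)%N -> uroot M ^+ M = 1.
Proof.
move=> M0; rewrite cisX mulrC divfK ?cis_2pi//.
by rewrite pnatr_eq0 -lt0n.
Qed.

Lemma urootX_neq1 M k : (0 < k < M)%N -> uroot M ^+ k != 1.
Proof.
move=> /andP[k0 kM]; have M0 := ltn_trans k0 kM.
rewrite cisX; apply: cis_neq1; have pi0 := pi_gt0 R.
apply/andP; split; first by rewrite !mulr_gt0 ?invr_gt0 ?ltr0n.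
by rewrite mulrCA gtr_pMr ?mulr_gt0// ltr_pdivrMr ?ltr0n// mul1r ltr_nat.
Qed.

(* Averages over the M-th roots of unity stand in for integrals over the circle. *)
Definition mean M (u : C -> C) : C := M%:R^-1 * \sum_(i < M) u (uroot M ^+ i).

Definition rmean M (v : C -> R) : R := M%:R^-1 * \sum_(i < M) v (uroot M ^+ i).

Lemma eq_mean M (u v : C -> C) : (forall l, cabs l = 1 -> u l = v l) ->
  mean M u = mean M v.
Proof.
by move=> uv; congr (_ * _); apply: eq_bigr => i _; rewrite uv// cabs_urootX.
Qed.

Lemma meanD M u v : mean M (fun l => u l + v l) = mean M u + mean M v.
Proof. by rewrite /mean big_split mulrDr. Qed.

Lemma meanZ M c u : mean M (fun l => c * u l) = c * mean M u.
Proof. by rewrite /mean -mulr_sumr mulrCA. Qed.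

Lemma meanZr M c u : mean M (fun l => u l * c) = mean M u * c.
Proof. by rewrite /mean -mulr_suml mulrA. Qed.

Lemma meanB M u v : mean M (fun l => u l - v l) = mean M u - mean M v.
Proof. by rewrite /mean sumrB mulrBr. Qed.

Lemma mean_sum M I (r : seq I) (P : pred I) (u : I -> C -> C) :
  mean M (fun l => \sum_(i <- r | P i) u i l) = \sum_(i <- r | P i) mean M (u i).
Proof. by rewrite /mean exchange_big mulr_sumr. Qed.

Lemma mean_conj M u : mean M (fun l => (u l)^*) = (mean M u)^*.
Proof. by rewrite /mean rmorphM fmorphV rmorph_nat rmorph_sum. Qed.

Lemma mean_creal M v : mean M (fun l => creal (v l)) = creal (rmean M v).
Proof. by rewrite /mean /rmean rmorphM fmorphV rmorph_nat rmorph_sum. Qed.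

Lemma mean_cst M c : (0 < M)%N -> mean M (fun=> c) = c.
Proof.
move=> M0; rewrite /mean sumr_const card_ord -[c *+ M]mulr_natl mulrA mulVf ?mul1r//.
by rewrite pnatr_eq0 -lt0n.
Qed.

Lemma rmeanZ M c v : rmean M (fun l => c * v l) = c * rmean M v.
Proof. by rewrite /rmean -mulr_sumr mulrCA. Qed.

Lemma rmeanD M u v : rmean M (fun l => u l + v l) = rmean M u + rmean M v.
Proof. by rewrite /rmean big_split mulrDr. Qed.

Lemma rmean_ge0 M v : (forall l, cabs l = 1 -> 0 <= v l) -> 0 <= rmean M v.
Proof.
move=> v0; rewrite mulr_ge0 ?invr_ge0// sumr_ge0// => i _.
by rewrite v0// cabs_urootX.
Qed.

Lemma ler_rmean M u v : (forall l, cabs l = 1 -> u l <= v l) ->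
  rmean M u <= rmean M v.
Proof.
move=> uv; rewrite ler_wpM2l ?invr_ge0// ler_sum// => i _.
by rewrite uv// cabs_urootX.
Qed.

Lemma cabs_mean M u : cabs (mean M u) <= rmean M (fun l => cabs (u l)).
Proof.
rewrite cabsM cabsV cabs_nat ler_wpM2l ?invr_ge0//.
exact: cabs_sum.
Qed.

Lemma cabs_mean_le M (u : C -> C) (v : C -> R) :
  (forall l, cabs l = 1 -> cabs (u l) <= v l) -> cabs (mean M u) <= rmean M v.
Proof. by move=> uv; rewrite (le_trans (cabs_mean _ _))// ler_rmean. Qed.

Lemma mean_rot M (u : C -> C) k : mean M (fun l => u (uroot M ^+ k * l)) = mean M u.
Proof.
case: M => [|M]; first by rewrite /mean !big_ord0.
elim: k => [|k ih]; first by apply: eq_mean => l _; rewrite expr0 mul1r.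
rewrite -[RHS]ih /mean; congr (_ * _).
rewrite big_ord_recr big_ord_recl /= addrC.
rewrite expr0 mulr1 -exprD addSnnS exprD urootXM// mulr1; congr (_ + _).
by apply: eq_bigr => i _; rewrite -!exprD addSnnS.
Qed.

(** Orthogonality of characters. The bounds on [a] and [b] exclude aliasing, because the grid sees
    exponents only modulo [M]; most later lower bounds on [M] come from here. *)
Lemma mean_mono M a b : (a < M)%N -> (b < M)%N ->
  mean M (fun l => l ^+ a * l^* ^+ b) = (a == b)%:R.
Proof.
wlog ba : a b / (b <= a)%N.
  move=> h aM bM; have [/h|/ltnW ab] := leqP b a; first exact.
  rewrite -[LHS]conjCK -mean_conj -(conjC_nat _ (a == b)) eq_sym -h//.
  congr (_^*); apply: eq_mean => l _.
  by rewrite rmorphM !rmorphXn/= conjCK mulrC.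
move=> aM bM; transitivity (mean M (fun l => l ^+ (a - b))).
  apply: eq_mean => l l1; rewrite -[in LHS](subnK ba) exprD -mulrA -exprMn.
  by rewrite mul_conj_unit// expr1n mulr1.
have M0 : (0 < M)%N by case: M aM {bM}.
have [->|ab] := eqVneq a b.
  by rewrite subnn [LHS](@eq_mean _ _ (fun=> 1))// mean_cst.
have x1 : uroot M ^+ (a - b) != 1.
  by apply: urootX_neq1; move: ba aM ab; clear; lia.
rewrite /mean; apply/eqP; rewrite mulf_eq0; apply/orP; right.
have : (uroot M ^+ (a - b) - 1) * (\sum_(i < M) (uroot M ^+ (a - b)) ^+ i) = 0.
  by rewrite -subrX1 exprAC urootXM// expr1n subrr.
move/eqP; rewrite mulf_eq0 subr_eq0 (negPf x1) /= => /eqP.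
move=> h.
by under eq_bigr do rewrite exprAC; rewrite h.
Qed.

End RootAverages.

Section Fejer.
Variable R : realType.
Local Notation C := (Cx R).
Implicit Types (M L k a b : nat) (z l : C).

Definition fejer L l : R := L%:R^-1 * cabs (\sum_(a < L) l ^+ a) ^+ 2.

Lemma fejer_ge0 L l : 0 <= fejer L l.
Proof. by rewrite mulr_ge0 ?invr_ge0// sqr_ge0. Qed.

(** The multiplier (1 - |k - k'| / L)_+ of the Fejer kernel: the two truncated differences add up to
    |k - k'|, and the outer subtraction truncates at 0. *)
Definition tri L k k' : R := (L - ((k - k') + (k' - k)))%N%:R / L%:R.

Lemma tri_ge0 L k k' : 0 <= tri L k k'.
Proof. by rewrite divr_ge0. Qed.

Lemma card_diff L d :
  (\sum_(a < L) \sum_(b < L) (a == b + d :> nat) = L - d)%N.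
Proof.
rewrite exchange_big /=.
rewrite (eq_bigr (fun b : 'I_L => (b + d < L)%N : nat)); last first.
  move=> b _; have [bd|bd] := ltnP (b + d) L.
    rewrite (bigD1 (Ordinal bd))//= eqxx big1// => i /negPf.
    by rewrite -val_eqE /= => ->.
  by rewrite big1// => i _; case: eqP => // e; move: (ltn_ord i) bd; rewrite e; lia.
rewrite -(big_mkord xpredT (fun b => (b + d < L)%N : nat)).
have [dL|dL] := leqP L d.
  by rewrite big_nat big1 => [|b bL]; lia.
rewrite (@big_cat_nat _ _ _ (L - d)%N)//=; last by lia.
rewrite [X in (_ + X)%N]big_nat [X in (_ + X)%N]big1 => [|b bL]; last by lia.
rewrite big_nat (eq_bigr (fun=> 1%N)) => [|b bL]; last by lia.
by rewrite -big_nat sum_nat_const_nat; lia.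
Qed.

Lemma fejerE L l : creal (fejer L l) =
  L%:R^-1 * \sum_(a < L) \sum_(b < L) l ^+ a * l^* ^+ b.
Proof.
rewrite /fejer crealM crealV creal_nat cabs_sqr; congr (_ * _).
rewrite rmorph_sum mulr_suml; apply: eq_bigr => a _.
by rewrite mulr_sumr; apply: eq_bigr => b _; rewrite rmorphXn.
Qed.

Lemma mean_fejer M L k k' : (L + k <= M)%N -> (L + k' <= M)%N ->
  mean M (fun l => creal (fejer L l) * (l ^+ k * l^* ^+ k')) = creal (tri L k k').
Proof.
move=> kM k'M.
rewrite (@eq_mean _ _ _ (fun l => L%:R^-1 * (\sum_(a < L) \sum_(b < L)
    l ^+ (a + k) * l^* ^+ (b + k')))); last first.
  move=> l _; rewrite fejerE -mulrA mulr_suml; congr (_ * _).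
  apply: eq_bigr => a _; rewrite mulr_suml; apply: eq_bigr => b _.
  by rewrite !exprD mulrACA.
rewrite meanZ mean_sum /tri crealM crealV !creal_nat mulrC; congr (_ * _).
under eq_bigr => a _.
  rewrite mean_sum; under eq_bigr => b _.
    rewrite mean_mono; [over|by have := ltn_ord a; lia|by have := ltn_ord b; lia].
  rewrite -natr_sum; over.
rewrite -natr_sum; congr _%:R.
have [kk|kk] := leqP k k'.
  rewrite (_ : k - k' + (k' - k) = k' - k)%N; last by lia.
  rewrite -card_diff; apply: eq_bigr => a _; apply: eq_bigr => b _.
  by congr (nat_of_bool _); apply/eqP/eqP; lia.
rewrite (_ : k - k' + (k' - k) = k - k')%N; last by lia.
rewrite -card_diff exchange_big; apply: eq_bigr => a _; apply: eq_bigr => b _.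
by congr (nat_of_bool _); apply/eqP/eqP; lia.
Qed.

Lemma rmean_fejer M L : (0 < L <= M)%N -> rmean M (@fejer L) = 1.
Proof.
move=> /andP[L0 LM]; apply: creal_inj; rewrite -mean_creal.
have := @mean_fejer M L 0 0; rewrite addn0 => /(_ LM LM).
under eq_mean do rewrite !expr0 !mulr1.
by move->; congr creal; rewrite /tri subnn addn0 subn0 divff// pnatr_eq0 -lt0n.
Qed.

(* The averages of |l - 1|^2 against the kernel only involve the multipliers 0 and 1. *)
Lemma rmean_fejer_moment M L : (0 < L < M)%N ->
  rmean M (fun l => fejer L l * cabs (l - 1) ^+ 2) = 2 / L%:R.
Proof.
move=> /andP[L0 LM]; apply: creal_inj; rewrite -mean_creal.
rewrite (@eq_mean _ _ _ (fun l => 2 * (creal (fejer L l) * (l ^+ 0 * l^* ^+ 0)) -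
  (creal (fejer L l) * (l ^+ 1 * l^* ^+ 0) + creal (fejer L l) * (l ^+ 0 * l^* ^+ 1)))).
  have LM' : (L <= M)%N := ltnW LM.
  rewrite meanB meanD meanZ !mean_fejer; [|rewrite ?addn0 ?addn1; done..].
  rewrite -(creal_nat R 2) -crealM -crealD -crealB /tri; congr creal.
  rewrite !subn0 !add0n addn0 natrB//; field.
  by rewrite pnatr_eq0 -lt0n.
move=> l l1; rewrite crealM cabs_sqr rmorphB rmorph1 !expr0 !expr1.
have := mul_conj_unit l1 => h.
rewrite (_ : (l - 1) * (l^* - 1) = l * l^* - l - l^* + 1); last by ring.
by rewrite h; ring.
Qed.

End Fejer.

(** * Euclidean norm and continuity on the sphere *)

Section Euclidean.
Variables (R : realType) (n : nat).
Local Notation C := (Cx R).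
Local Notation Cn := 'rV[Cx R]_n.
Local Notation S := (@unit_sphere R n).
Implicit Types (z w v : Cn) (l : C) (h : R).

Lemma enorm_ge0 z : 0 <= enorm z.
Proof. exact: sqrtr_ge0. Qed.

Lemma enorm_sqr z : enorm z ^+ 2 = \sum_j cabs (z ord0 j) ^+ 2.
Proof. by rewrite sqr_sqrtr// sumr_ge0// => j _; exact: sqr_ge0. Qed.

Lemma enormZ l z : enorm (l *: z) = cabs l * enorm z.
Proof.
apply/eqP; rewrite -(@eqrXn2 _ 2) ?mulr_ge0 ?enorm_ge0 ?cabs_ge0//.
rewrite exprMn !enorm_sqr mulr_sumr; apply/eqP; apply: eq_bigr => j _.
by rewrite mxE cabsM exprMn.
Qed.

Lemma redotC z w : redot z w = redot w z.
Proof.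
by apply: eq_bigr => j _; case: (z ord0 j) (w ord0 j) => [a b] [c d] /=; ring.
Qed.

Lemma redotDl z v w : redot (z + v) w = redot z w + redot v w.
Proof. by rewrite -big_split; apply: eq_bigr => j _; rewrite mxE mulrDl cReD. Qed.

Lemma redotZl h z w : redot (creal h *: z) w = h * redot z w.
Proof.
by rewrite mulr_sumr; apply: eq_bigr => j _; rewrite mxE -mulrA Re_crealM.
Qed.

Lemma redotDr z v w : redot z (v + w) = redot z v + redot z w.
Proof. by rewrite redotC redotDl ![redot _ z]redotC. Qed.

Lemma redotZr h z w : redot z (creal h *: w) = h * redot z w.
Proof. by rewrite redotC redotZl redotC. Qed.

Lemma redotNl z w : redot (- z) w = - redot z w.
Proof. by rewrite -scaleN1r -creal1 -crealN redotZl mulN1r. Qed.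

Lemma redotNr z w : redot z (- w) = - redot z w.
Proof. by rewrite redotC redotNl redotC. Qed.

Lemma redot_self z : redot z z = enorm z ^+ 2.
Proof.
by rewrite enorm_sqr; apply: eq_bigr => j _; rewrite -cabs_sqr.
Qed.

Lemma enormD_sqr z w : enorm (z + w) ^+ 2 = enorm z ^+ 2 + 2 * redot z w + enorm w ^+ 2.
Proof.
by rewrite -redot_self redotDl !redotDr !redot_self (redotC w z); ring.
Qed.

Lemma enormN z : enorm (- z) = enorm z.
Proof. by rewrite -scaleN1r enormZ cabsN cabs1 mul1r. Qed.

Lemma enormB_sqr z w : enorm (z - w) ^+ 2 = enorm z ^+ 2 - 2 * redot z w + enorm w ^+ 2.
Proof. by rewrite enormD_sqr redotNr enormN; ring. Qed.

Lemma cabs_le_enorm z j : cabs (z ord0 j) <= enorm z.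
Proof.
rewrite -(@ler_pXn2r _ 2) ?nnegrE ?enorm_ge0 ?cabs_ge0// enorm_sqr (bigD1 j)//= lerDl.
by rewrite sumr_ge0// => i _; exact: sqr_ge0.
Qed.

Lemma enorm_eq0 z : (enorm z == 0) = (z == 0).
Proof.
apply/eqP/eqP => [z0|->].
  apply/rowP => j; rewrite mxE; apply/eqP; rewrite -cabs_eq0 eq_le cabs_ge0 andbT.
  by rewrite -z0 cabs_le_enorm.
by rewrite -(scale0r (0 : Cn)) enormZ cabs0 mul0r.
Qed.

Lemma redot_le z w : redot z w <= enorm z * enorm w.
Proof.
have [->|z0] := eqVneq z 0.
  by rewrite -(scale0r (0 : Cn)) -creal0 redotZl mul0r mulr_ge0 ?enorm_ge0.
have [->|w0] := eqVneq w 0.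
  by rewrite -(scale0r (0 : Cn)) -creal0 redotZr mul0r mulr_ge0 ?enorm_ge0.
have {}z0 : 0 < enorm z by rewrite lt_def enorm_eq0 z0 enorm_ge0.
have {}w0 : 0 < enorm w by rewrite lt_def enorm_eq0 w0 enorm_ge0.
have := sqr_ge0 (enorm (creal (enorm w) *: z - creal (enorm z) *: w)).
rewrite enormB_sqr !enormZ !cabs_creal !ger0_norm ?enorm_ge0// redotZl redotZr.
move=> h; rewrite -(@ler_pM2l _ (2 * (enorm w * enorm z))) ?mulr_gt0//.
by rewrite -subr_ge0; move: h; rewrite !exprMn !expr2; lra.
Qed.

Lemma enormD z w : enorm (z + w) <= enorm z + enorm w.
Proof.
rewrite -(@ler_pXn2r _ 2) ?nnegrE ?addr_ge0 ?enorm_ge0// enormD_sqr.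
by have := redot_le z w; nra.
Qed.

Lemma enormB_sub z w : enorm z - enorm w <= enorm (z - w).
Proof. by rewrite lerBlDr (le_trans _ (enormD _ _))// subrK. Qed.

Lemma enorm_dist z w : `|enorm z - enorm w| <= enorm (z - w).
Proof.
by rewrite ler_norml lerNl opprB enormB_sub andbT -(enormN (z - w)) opprB enormB_sub.
Qed.

Lemma enorm_le_sum z : enorm z <= \sum_j cabs (z ord0 j).
Proof.
have h : 0 <= \sum_j cabs (z ord0 j) by apply: sumr_ge0 => j _; exact: cabs_ge0.
rewrite -(@ler_pXn2r _ 2) ?nnegrE ?enorm_ge0// enorm_sqr [leRHS]expr2 mulr_suml.
apply: ler_sum => j _; rewrite expr2 ler_wpM2l ?cabs_ge0// (bigD1 j)//= lerDl.
by apply: sumr_ge0 => i _; exact: cabs_ge0.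
Qed.

Lemma sphereZ l z : cabs l = 1 -> S z -> S (l *: z).
Proof. by move=> l1 Sz; rewrite /unit_sphere/= enormZ l1 mul1r. Qed.

Lemma sphere_proj_id z : S z -> sphere_proj z = z.
Proof. by move=> Sz; rewrite /sphere_proj Sz invr1 creal1 scale1r. Qed.

Lemma sphere_proj_in z : z != 0 -> S (sphere_proj z).
Proof.
move=> z0; rewrite /unit_sphere /= enormZ cabs_creal ger0_norm ?invr_ge0 ?enorm_ge0//.
by rewrite mulVf// enorm_eq0.
Qed.

Lemma cvg_rowP T (F : set_system T) {FF : Filter F} (f : T -> Cn) z :
  f x @[x --> F] --> z <-> forall j, f x ord0 j @[x --> F] --> z ord0 j.
Proof.
split=> [fz j|h A [P Pz PA]].
  exact: (cvg_comp _ _ fz (@coord_continuous C 1 n ord0 j z)).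
have : \forall x \near F, forall i j, P i j (f x i j).
  apply: filter_forall => i; apply: filter_forall => j.
  by rewrite (ord1 i); apply: h; have := Pz ord0 j.
by apply: filterS => x /PA.
Qed.

Lemma cvg_enormP T (F : set_system T) {FF : Filter F} (f : T -> Cn) z :
  f x @[x --> F] --> z <->
  forall e : R, 0 < e -> \forall x \near F, enorm (f x - z) < e.
Proof.
split=> [/cvg_rowP h e e0|h].
  have ne : 0 < e / n.+1%:R by rewrite divr_gt0.
  have : \forall x \near F, forall j, cabs (f x ord0 j - z ord0 j) < e / n.+1%:R.
    by apply: filter_forall => j; have /cvg_cabsP := h j; exact.
  apply: filterS => x hx; rewrite (le_lt_trans (enorm_le_sum _))//.
  apply: (@le_lt_trans _ _ (\sum_(j < n) e / n.+1%:R)).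
    by apply: ler_sum => j _; rewrite !mxE ltW.
  rewrite sumr_const card_ord -[X in X < _]mulr_natl mulrCA gtr_pMr//.
  by rewrite ltr_pdivrMr// mul1r ltr_nat.
apply/cvg_rowP => j; apply/cvg_cabsP => e /h; apply: filterS => x.
by apply: le_lt_trans; have := cabs_le_enorm (f x - z) j; rewrite !mxE.
Qed.

Lemma nbhs_enorm z (A : set Cn) :
  nbhs z A -> exists2 e : R, 0 < e & forall w, enorm (w - z) < e -> A w.
Proof.
move=> [P Pz PA].
have : forall j, exists e : R, 0 < e /\ forall l, cabs (l - z ord0 j) < e -> P ord0 j l.
  move=> j; have /nbhs_ballP[e/= e0 he] := Pz ord0 j.
  have ee : e = creal (complex.Re e).
    by move: e0; case: e {he} => a b; rewrite ltcE /= => /andP[/eqP ->].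
  exists (complex.Re e); split; first by rewrite -ltr_creal -ee.
  by move=> l hl; apply: he; rewrite /ball /= normCx cabsBC ee ltr_creal.
move=> /choice[e he].
exists (\big[Num.min/1]_j e j).
  by elim/big_ind : _ => // [x y x0 y0|j _]; [rewrite lt_min x0|exact: (he j).1].
move=> w wz; apply: PA => i j; rewrite ord1; apply: (he j).2.
have := cabs_le_enorm (w - z) j; rewrite !mxE => /le_lt_trans; apply.
by rewrite (lt_le_trans wz)// bigmin_le_cond.
Qed.

Lemma cvg_enorm T (F : set_system T) {FF : Filter F} (f : T -> Cn) z :
  f x @[x --> F] --> z -> enorm (f x) @[x --> F] --> enorm z.
Proof.
move=> /cvg_enormP h; apply/cvgrPdist_lt => e /h; apply: filterS => x.
by rewrite distrC; exact/le_lt_trans/enorm_dist.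
Qed.

Lemma sphere_compact : compact S.
Proof.
pose Q : set C := (fun p : R * R => (p.1 +i* p.2)%C) @` (`[-1, 1] `*` `[-1, 1]).
have cQ : compact Q.
  apply: continuous_compact.
    by apply: continuous_subspaceT => p; apply: cvg_ReIm => /=;
      [exact: cvg_fst|exact: cvg_snd].
  by apply: compact_setX; exact: segment_compact.
apply: (@subclosed_compact _ _ [set z : Cn | forall j, Q (z ord0 j)]).
- apply: (@closed_comp _ _ (@enorm R n) [set 1]); last exact: closed_eq.
  by move=> z _; exact: (cvg_enorm (@cvg_id _ (nbhs z))).
- by have := @rV_compact C n (fun=> Q); apply.
- move=> z Sz j; exists (complex.Re (z ord0 j), complex.Im (z ord0 j)) => /=.
    have zj : cabs (z ord0 j) <= 1 by rewrite -[leRHS]Sz cabs_le_enorm.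
    split; rewrite /= in_itv /= -ler_norml (le_trans _ zj)//.
      exact: Re_le_cabs.
    exact: Im_le_cabs.
  by case: (z ord0 j).
Qed.

End Euclidean.

Section SphereContinuity.
Variables (R : realType) (n : nat).
Local Notation C := (Cx R).
Local Notation Cn := 'rV[Cx R]_n.
Local Notation S := (@unit_sphere R n).

Definition scont (V : topologicalType) (u : Cn -> V) :=
  forall z, S z -> u w @[w --> within S (nbhs z)] --> u z.

Lemma scontP (V : topologicalType) (u : Cn -> V) :
  {within S, continuous u} <-> scont u.
Proof. exact: subspace_continuousP. Qed.

Lemma scont_ext (V : topologicalType) (u v : Cn -> V) :
  (forall z, v z = u z) -> scont u -> scont v.
Proof. by move=> uv; rewrite (funext uv). Qed.

Lemma scont_cst (V : topologicalType) (c : V) : scont (fun=> c).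
Proof. by move=> z _; exact: cvg_cst. Qed.

Lemma scontD (u v : Cn -> C) : scont u -> scont v -> scont (fun z => u z + v z).
Proof. by move=> hu hv z Sz; apply: cvgD; [exact: hu|exact: hv]. Qed.

Lemma scontB (u v : Cn -> C) : scont u -> scont v -> scont (fun z => u z - v z).
Proof. by move=> hu hv z Sz; apply: cvgB; [exact: hu|exact: hv]. Qed.

Lemma scontM (u v : Cn -> C) : scont u -> scont v -> scont (fun z => u z * v z).
Proof. by move=> hu hv z Sz; apply: cvgM; [exact: hu|exact: hv]. Qed.

Lemma scontZ (c : C) (u : Cn -> C) : scont u -> scont (fun z => c * u z).
Proof. by apply: scontM; exact: scont_cst. Qed.

Lemma scont_sum I (r : seq I) (P : pred I) (u : I -> Cn -> C) :
  (forall i, P i -> scont (u i)) -> scont (fun z => \sum_(i <- r | P i) u i z).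
Proof.
move=> hu; elim: r => [|i r ih].
  rewrite (_ : (fun _ => _) = fun=> 0); first exact: scont_cst.
  by apply/funext => z; rewrite big_nil.
case Pi : (P i).
  by apply: (scont_ext _ (scontD (hu i Pi) ih)) => z; rewrite big_cons Pi.
by apply: (scont_ext _ ih) => z; rewrite big_cons Pi.
Qed.

Lemma scont_conj (u : Cn -> C) : scont u -> scont (fun z => (u z)^*).
Proof. by move=> hu z Sz; apply: cvg_conj; exact: hu. Qed.

Lemma scont_creal (u : Cn -> R) : scont u -> scont (fun z => creal (u z)).
Proof. by move=> hu z Sz; apply: cvg_creal; exact: hu. Qed.

Lemma scont_cabs (u : Cn -> C) : scont u -> scont (fun z => cabs (u z)).
Proof. by move=> hu z Sz; apply: cvg_cabs; exact: hu. Qed.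

Lemma scontDr (u v : Cn -> R) : scont u -> scont v -> scont (fun z => u z + v z).
Proof. by move=> hu hv z Sz; apply: cvgD; [exact: hu|exact: hv]. Qed.

Lemma scontBr (u v : Cn -> R) : scont u -> scont v -> scont (fun z => u z - v z).
Proof. by move=> hu hv z Sz; apply: cvgB; [exact: hu|exact: hv]. Qed.

Lemma scontMr (u v : Cn -> R) : scont u -> scont v -> scont (fun z => u z * v z).
Proof. by move=> hu hv z Sz; apply: cvgM; [exact: hu|exact: hv]. Qed.

Lemma scontZr c (u : Cn -> R) : scont u -> scont (fun z => c * u z).
Proof. by apply: scontMr; exact: scont_cst. Qed.

Lemma scont_norm (u : Cn -> R) : scont u -> scont (fun z => `|u z|).
Proof. by move=> hu z Sz; apply: cvg_norm; exact: hu. Qed.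

Lemma scont_min (u v : Cn -> R) : scont u -> scont v ->
  scont (fun z => Num.min (u z) (v z)).
Proof.
move=> hu hv; under eq_fun do rewrite minr_absE.
apply: scontMr; last exact: scont_cst.
by apply: scontBr; [exact: scontDr|exact/scont_norm/scontBr].
Qed.

Lemma scont_max (u v : Cn -> R) : scont u -> scont v ->
  scont (fun z => Num.max (u z) (v z)).
Proof.
move=> hu hv; under eq_fun do rewrite maxr_absE.
apply: scontMr; last exact: scont_cst.
by apply: scontDr; [exact: scontDr|exact/scont_norm/scontBr].
Qed.

Lemma scont_inv (u : Cn -> R) : scont u -> (forall z, S z -> u z != 0) ->
  scont (fun z => (u z)^-1).
Proof. by move=> hu u0 z Sz; apply: cvgV; [exact: u0|exact: hu]. Qed.

Lemma cvg_sphere_rot (l : C) (z : Cn) : cabs l = 1 ->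
  (l *: w : Cn) @[w --> within S (nbhs z)] --> within S (nbhs (l *: z)).
Proof.
move=> l1 A hA.
have [e e0 he] := nbhs_enorm (hA : nbhs (l *: z) [set x | S x -> A x]).
have /cvg_enormP/(_ e e0) := @cvg_id _ (nbhs z).
apply: filterS => w wz Sw; apply: he; last exact: sphereZ.
by rewrite -scalerBr enormZ l1 mul1r.
Qed.

Lemma scont_rot (V : topologicalType) (u : Cn -> V) (l : C) : cabs l = 1 ->
  scont u -> scont (fun z => u (l *: z)).
Proof.
move=> l1 hu z Sz.
apply: (@cvg_comp _ _ _ (fun w => l *: w) u _ _ _ (cvg_sphere_rot l1)).
exact: (hu _ (sphereZ l1 Sz)).
Qed.

Lemma scont_mean M (u : C -> Cn -> C) :
  (forall l, cabs l = 1 -> scont (u l)) -> scont (fun z => mean M (u^~ z)).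
Proof.
move=> hu; apply: scontM; first exact: scont_cst.
by apply: scont_sum => i _; apply: hu; exact: cabs_urootX.
Qed.

Lemma scont_bounded (u : Cn -> R) : scont u ->
  exists2 B : R, 0 <= B & forall z, S z -> `|u z| <= B.
Proof.
move=> hu; have [S0|S0] := pselect (S !=set0); last first.
  by exists 0 => // z Sz; exfalso; apply: S0; exists z.
have [c _ hc] := compact_EVT_max S0 (@sphere_compact R n)
  ((scontP _).2 (scont_norm hu)).
by exists `|u c| => // z Sz; apply: hc; rewrite inE.
Qed.

Lemma scont_rot_unif (u : Cn -> R) : scont u -> forall e : R, 0 < e ->
  exists2 d : R, 0 < d & forall z l, S z -> cabs l = 1 -> cabs (l - 1) < d ->
    `|u (l *: z) - u z| < e.
Proof.
move=> hu e e0.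
have := (compact_near_coveringP S).1 (@sphere_compact R n) R (0^'+)
  (fun d z => forall l, S z -> cabs l = 1 -> cabs (l - 1) < d -> `|u (l *: z) - u z| < e).
case.
- move=> z Sz; have e2 : 0 < e / 2 by rewrite divr_gt0.
  have /cvgrPdist_lt/(_ _ e2) := hu z Sz.
  rewrite /within /= => /nbhs_enorm[d d0 hd].
  exists ([set w | enorm (w - z) < d / 2], [set d' | d' < d / 2]) => /=.
    split; last by apply: nbhs_right_lt; rewrite divr_gt0.
    by have /cvg_enormP := @cvg_id _ (nbhs z); apply; rewrite divr_gt0.
  move=> [w d'] /= [wz dd] l Sw l1 ld.
  have h1 : `|u z - u w| < e / 2 by apply: hd => //; rewrite (lt_le_trans wz)//; lra.
  have h2 : `|u z - u (l *: w)| < e / 2.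
    apply: hd; last exact: sphereZ.
    have -> : l *: w - z = (l - 1) *: w + (w - z) by rewrite scalerBl scale1r addrA subrK.
    by rewrite (le_lt_trans (enormD _ _))// enormZ Sw mulr1; lra.
  have -> : u (l *: w) - u w = (u z - u w) - (u z - u (l *: w)) by ring.
  by rewrite (le_lt_trans (ler_normB _ _))//; lra.
- move=> d' /= d0 h.
  have hd : 0 < d' / 2 by rewrite divr_gt0.
  exists (d' / 2) => // z l Sz l1 ld; apply: (h (d' / 2)) => //.
  by rewrite /ball /= sub0r normrN gtr0_norm//; lra.
Qed.

(** The excess is quadratic in |l - 1| because the moments of the Fejer kernel that are available
    are those of 1 and |l - 1|^2. Beyond the radius of uniform continuity the crude bound 2 B is
    absorbed by the quadratic term. *)
Lemma scont_rot_modulus (u : Cn -> R) : scont u -> forall e : R, 0 < e ->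
  exists2 K : R, 0 <= K & forall z l, S z -> cabs l = 1 ->
    `|u (l *: z) - u z| <= e + K * cabs (l - 1) ^+ 2.
Proof.
move=> hu e e0; have [d d0 hd] := scont_rot_unif hu e0.
have [B B0 hB] := scont_bounded hu.
exists (2 * B / d ^+ 2); first by rewrite divr_ge0 ?mulr_ge0 ?exprn_ge0// ltW.
move=> z l Sz l1; have [ld|ld] := ltP (cabs (l - 1)) d.
  rewrite (le_trans (ltW (hd _ _ Sz l1 ld)))// lerDl mulr_ge0 ?exprn_ge0 ?cabs_ge0//.
  by rewrite divr_ge0 ?mulr_ge0 ?exprn_ge0// ltW.
apply: (@le_trans _ _ (2 * B)).
  by rewrite (le_trans (ler_normB _ _))// mulrDl mul1r lerD// hB//; exact: sphereZ.
have h : 2 * B <= 2 * B / d ^+ 2 * cabs (l - 1) ^+ 2.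
  rewrite mulrAC ler_pdivlMr ?exprn_gt0// ler_wpM2l ?mulr_ge0//.
  by rewrite ler_pXn2r ?nnegrE ?cabs_ge0// ltW.
by rewrite (le_trans h)// lerDr ltW.
Qed.

Lemma scontZ_rot (c : R) (u : Cn -> R) (l : C) : cabs l = 1 -> scont u ->
  scont (fun z => c * u (l *: z)).
Proof. by move=> l1 hu; apply: scontZr; exact: scont_rot. Qed.

Lemma scont_sumr I (r : seq I) (P : pred I) (u : I -> Cn -> R) :
  (forall i, P i -> scont (u i)) -> scont (fun z => \sum_(i <- r | P i) u i z).
Proof.
move=> hu; elim: r => [|i r ih].
  rewrite (_ : (fun _ => _) = fun=> 0); first exact: scont_cst.
  by apply/funext => z; rewrite big_nil.
case Pi : (P i).
  by apply: (scont_ext _ (scontDr (hu i Pi) ih)) => z; rewrite big_cons Pi.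
by apply: (scont_ext _ ih) => z; rewrite big_cons Pi.
Qed.

End SphereContinuity.

#[global] Opaque scont.

(** * Poisson weights and rotation-invariant functionals *)

Section PoissonKernel.
Variable R : realType.
Local Notation C := (Cx R).

(* Decomposition of k |-> rho ^ k on [0, m + 1] into triangles j |-> (j - k)_+. *)
Lemma geometric_triangles (rho : R) m k : (k <= m.+1)%N ->
  \sum_(i < m) rho ^+ i * (1 - rho) ^+ 2 * (i.+1 - k)%N%:R +
  rho ^+ m * (1 - rho) * (m.+1 - k)%N%:R + rho ^+ m.+1 = rho ^+ k.
Proof.
elim: m => [|m ih] km.
  by rewrite big_ord0; case: k km => [|[|]]// _; rewrite ?subn0 ?subnn; ring.
rewrite big_ord_recr /=; have [km'|km'] := leqP k m.+1.
  rewrite -[RHS](ih km') (subSn km') -[(m.+1 - k).+1%:R]natr1 !exprS.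
  by ring.
have -> : k = m.+2 by apply/eqP; rewrite eqn_leq km.
rewrite big1 => [|i _]; last first.
  by rewrite (_ : _ - _ = 0)%N ?mulr0//; have := ltn_ord i; lia.
by rewrite subnn (_ : m.+1 - m.+2 = 0)%N; [ring|lia].
Qed.

Lemma mulr_tri L k : (0 < L)%N -> L%:R * tri R L k 0 = (L - k)%N%:R.
Proof.
by move=> L0; rewrite /tri subn0 sub0n addn0 mulrC divfK// pnatr_eq0 -lt0n.
Qed.

(** A Poisson kernel with only finitely many frequencies prescribed. The sequence rho^k is convex
    and decreasing, hence a nonnegative combination of triangles, and each triangle is the
    multiplier of a nonnegative Fejer kernel. *)
Lemma poisson_kernel (rho : R) m : 0 <= rho < 1 ->
  exists (K : C -> R) (M0 : nat), (forall l, 0 <= K l) /\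
    forall M k, (M0 <= M)%N -> (k <= m)%N ->
      mean M (fun l => creal (K l) * l ^+ k) = creal rho ^+ k.
Proof.
move=> /andP[r0 r1].
(* The constant rho^(m+1) left over by [geometric_triangles] is rho^(m+1) / T times the difference
   of the triangles of widths m + 1 + T and m + 1, which equals T for k <= m. The narrower triangle
   then has coefficient rho^m ((1 - rho) - rho / T), nonnegative for this T. *)
pose T := (Num.Def.truncn (rho / (1 - rho))).+1.
have rT : rho / T%:R <= 1 - rho.
  have /ltW : rho / (1 - rho) < T%:R by exact: truncnS_gt.
  by rewrite ler_pdivrMr ?subr_gt0// ler_pdivrMr ?ltr0n// mulrC.
pose K l := \sum_(i < m) rho ^+ i * (1 - rho) ^+ 2 * (i.+1%:R * fejer i.+1 l) +
  (rho ^+ m * (1 - rho) - rho ^+ m.+1 / T%:R) * (m.+1%:R * fejer m.+1 l) +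
  rho ^+ m.+1 / T%:R * ((m.+1 + T)%:R * fejer (m.+1 + T) l).
have r1' : 0 <= 1 - rho by rewrite subr_ge0 ltW.
exists K, (m.+1 + T + m.+1)%N; split=> [l|M k M0 km].
  rewrite /K; apply: addr_ge0; first apply: addr_ge0.
    apply: sumr_ge0 => i _; apply: mulr_ge0; first by rewrite mulr_ge0 ?exprn_ge0.
    by apply: mulr_ge0 => //; exact: fejer_ge0.
    apply: mulr_ge0; last by apply: mulr_ge0 => //; exact: fejer_ge0.
    by rewrite subr_ge0 exprSr -mulrA ler_wpM2l ?exprn_ge0.
  apply: mulr_ge0; first by rewrite divr_ge0 ?exprn_ge0.
  by apply: mulr_ge0 => //; exact: fejer_ge0.
have mf L (c : R) : (0 < L)%N -> (L + m <= M)%N ->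
    mean M (fun l => creal (c * (L%:R * fejer L l)) * l ^+ k) =
    creal (c * (L - k)%N%:R).
  move=> L0 LM; rewrite -(mulr_tri k L0).
  rewrite (@eq_mean _ _ _ (fun l => creal (c * L%:R) *
    (creal (fejer L l) * (l ^+ k * l^* ^+ 0)))); last first.
    by move=> l _; rewrite expr0 mulr1 !crealM; ring.
  rewrite meanZ mean_fejer; [|lia|lia].
  by rewrite -crealM mulrA.
rewrite /K.
rewrite (@eq_mean _ _ _ (fun l =>
  (\sum_(i < m) creal (rho ^+ i * (1 - rho) ^+ 2 * (i.+1%:R * fejer i.+1 l)) * l ^+ k +
  creal ((rho ^+ m * (1 - rho) - rho ^+ m.+1 / T%:R) * (m.+1%:R * fejer m.+1 l)) * l ^+ k) +
  creal (rho ^+ m.+1 / T%:R * ((m.+1 + T)%:R * fejer (m.+1 + T) l)) * l ^+ k)); last first.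
  by move=> l _; rewrite !crealD creal_sum !mulrDl mulr_suml.
rewrite !meanD mean_sum !mf//; [|lia|lia].
under eq_bigr => i _ do (rewrite mf//; last by have := ltn_ord i; lia).
rewrite -creal_sum -!crealD -crealX; congr creal.
rewrite -[RHS](@geometric_triangles rho m); last exact: leqW.
rewrite -!addrA; congr (_ + _).
rewrite [in X in _ + X](_ : (m.+1 + T - k = (m.+1 - k) + T)%N); last by lia.
rewrite natrD; field.
by rewrite pnatr_eq0.
Qed.

End PoissonKernel.

(** * Functionals invariant under rotation of the slices *)

Section RotationFunctional.
Variables (R : realType) (n : nat).
Local Notation C := (Cx R).
Local Notation Cn := 'rV[Cx R]_n.
Local Notation S := (@unit_sphere R n).

(** All that the estimates use of the surface integral. The rotations are only the unimodular
    multiples z -> l z, which preserve slices. *)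
Record rot_functional (I : (Cn -> R) -> R) : Prop := RotFunctional {
  rotfD : forall u v : Cn -> R, scont u -> scont v -> I (fun z => u z + v z) = I u + I v;
  rotfZ : forall (c : R) (u : Cn -> R), scont u -> I (fun z => c * u z) = c * I u;
  rotf_le : forall u v : Cn -> R, scont u -> scont v -> (forall z, S z -> u z <= v z) ->
    I u <= I v;
  rotf_rot : forall (u : Cn -> R) (l : C), scont u -> cabs l = 1 -> I (fun z => u (l *: z)) = I u;
  rotf_faithful : forall u : Cn -> R, scont u -> (forall z, S z -> 0 <= u z) -> I u <= 0 ->
    forall z, S z -> u z = 0 }.

Variable I : (Cn -> R) -> R.
Hypothesis HI : rot_functional I.

Lemma rotf0 : I (fun=> 0) = 0.
Proof.
transitivity (0 * I (fun=> 0)); last by rewrite mul0r.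
rewrite -(rotfZ HI); last exact: scont_cst.
by congr I; apply/funext => z; rewrite mul0r.
Qed.

Lemma rotf_ge0 (u : Cn -> R) : scont u -> (forall z, S z -> 0 <= u z) -> 0 <= I u.
Proof.
by move=> hu u0; rewrite -rotf0 (rotf_le HI)//; exact: scont_cst.
Qed.

Lemma rotf_cst c : I (fun=> c) = c * I (fun=> 1).
Proof.
rewrite -(rotfZ HI); last exact: scont_cst.
by congr I; apply/funext => z; rewrite mulr1.
Qed.

Lemma scont_rmean M (K : C -> R) (u : Cn -> R) : scont u ->
  scont (fun z => rmean M (fun l => K l * u (l *: z))).
Proof.
move=> hu; apply: scontZr; apply: scont_sumr => i _.
by apply: scontZ_rot => //; exact: cabs_urootX.
Qed.

Lemma rotf_rmean M (K : C -> R) (u : Cn -> R) : scont u ->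
  I (fun z => rmean M (fun l => K l * u (l *: z))) = rmean M K * I u.
Proof.
move=> hu; rewrite /rmean.
have h k : scont (fun z => \sum_(i < k) K (uroot R M ^+ i) * u (uroot R M ^+ i *: z)) /\
    I (fun z => \sum_(i < k) K (uroot R M ^+ i) * u (uroot R M ^+ i *: z)) =
    (\sum_(i < k) K (uroot R M ^+ i)) * I u.
  elim: k => [|k [ih1 ih2]].
    split; last first.
      rewrite big_ord0 mul0r -[RHS]rotf0; congr I.
      by apply/funext => z; rewrite big_ord0.
    by apply: (scont_ext _ (@scont_cst R n R 0)) => z; rewrite big_ord0.
  have hk := @scontZ_rot R n (K (uroot R M ^+ k)) u _ (cabs_urootX R M k) hu.
  split.
    by apply: (scont_ext _ (scontDr ih1 hk)) => z; rewrite big_ord_recr.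
  rewrite big_ord_recr /= mulrDl -ih2 -(rotf_rot HI hu (cabs_urootX R M k)).
  rewrite -(rotfZ HI) -?(rotfD HI) //; last exact: scont_rot (cabs_urootX R M k) hu.
  by congr I; apply/funext => z; rewrite big_ord_recr.
by rewrite (rotfZ HI) ?(h M).2 ?mulrA//; exact: (h M).1.
Qed.

Lemma rmean_poisson M (K : C -> R) : mean M (fun l => creal (K l) * l ^+ 0) = 1 ->
  rmean M K = 1.
Proof.
move=> h; apply: creal_inj; rewrite -mean_creal creal1 -[RHS]h.
by apply: eq_mean => l _; rewrite expr0 mulr1.
Qed.

Lemma horner_poisson (rho : R) m M (K : C -> R) (p : {poly C}) :
  (forall k, (k <= m)%N -> mean M (fun l => creal (K l) * l ^+ k) = creal rho ^+ k) ->
  (size p <= m.+1)%N ->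
  p.[creal rho] = mean M (fun l => creal (K l) * p.[l]).
Proof.
move=> hK sp; rewrite (horner_coef_wide _ sp).
rewrite (@eq_mean _ _ _ (fun l => \sum_(i < m.+1) p`_i * (creal (K l) * l ^+ i))).
  rewrite mean_sum; apply: eq_bigr => i _.
  by rewrite meanZ hK// -ltnS.
by move=> l _; rewrite (horner_coef_wide _ sp) mulr_sumr; apply: eq_bigr => i _; rewrite mulrCA.
Qed.

(* Slice polynomials need to be equivariant only under the grid of M-th roots of unity. *)
Lemma damping_poly (rho : R) m : 0 <= rho < 1 ->
  exists M0, forall M (h : Cn -> {poly C}), (M0 <= M)%N ->
    (forall z, (size (h z) <= m.+1)%N) ->
    (forall z i, (h (uroot R M ^+ i *: z)).[1] = (h z).[uroot R M ^+ i]) ->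
    scont (fun z => (h z).[1]) ->
    [/\ scont (fun z => (h z).[creal rho]),
       I (fun z => cabs (h z).[creal rho]) <= I (fun z => cabs (h z).[1]),
       (forall b, (forall z, S z -> cabs (h z).[1] <= b) ->
          forall z, S z -> cabs (h z).[creal rho] <= b) &
       ((forall z, S z -> 0 <= complex.Re (h z).[1]) ->
          forall z, S z -> 0 <= complex.Re (h z).[creal rho])].
Proof.
move=> /(poisson_kernel m)[K [M0 [K0 hK]]]; exists M0 => M h M0M sh hh ch.
have K1 : rmean M K = 1 by apply: rmean_poisson; rewrite hK.
have hE z : (h z).[creal rho] = mean M (fun l => creal (K l) * (h (l *: z)).[1]).
  rewrite (horner_poisson (fun k => hK M k M0M) (sh z)).
  by congr (_ * _); apply: eq_bigr => i _; rewrite hh.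
have hle z : cabs (h z).[creal rho] <= rmean M (fun l => K l * cabs (h (l *: z)).[1]).
  rewrite hE; apply: cabs_mean_le => l _.
  by rewrite cabsM cabs_creal ger0_norm.
have c1 : scont (fun z => (h z).[creal rho]).
  apply: (scont_ext hE); apply: scont_mean => l l1.
  by apply: scontZ; exact: (scont_rot l1 ch).
split => //.
- apply: le_trans (_ : _ <= rmean M K * I (fun z => cabs (h z).[1])) _; last first.
    by rewrite K1 mul1r.
  rewrite -(rotf_rmean M K (scont_cabs ch)).
  apply: (rotf_le HI) => //; first exact: scont_cabs.
  exact: (@scont_rmean M K _ (scont_cabs ch)).
- move=> b hb z Sz; rewrite (le_trans (hle z))//.
  rewrite (le_trans (_ : _ <= rmean M (fun l => b * K l)))//.
    apply: ler_rmean => l l1; rewrite [leRHS]mulrC ler_wpM2l// hb//; exact: sphereZ.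
  by rewrite rmeanZ K1 mulr1.
- move=> hb z Sz; rewrite hE /mean -creal_nat -crealV Re_crealM mulr_ge0 ?invr_ge0//.
  rewrite Re_sum sumr_ge0// => i _; rewrite Re_crealM mulr_ge0// hb//.
  by apply: sphereZ => //; exact: cabs_urootX.
Qed.

End RotationFunctional.

(** * Herglotz polynomials and multipliers *)

Section HerglotzPolynomial.
Variables (R : realType) (n : nat).
Local Notation C := (Cx R).
Local Notation Cn := 'rV[Cx R]_n.
Local Notation S := (@unit_sphere R n).

Lemma cabsD_sqr (x y : C) :
  cabs (x + y) ^+ 2 = cabs x ^+ 2 + cabs y ^+ 2 + 2 * complex.Re (x * y^*).
Proof.
rewrite /cabs !sqr_sqrtr ?addr_ge0 ?sqr_ge0// cReD cImD cReM cRe_conj cIm_conj.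
by ring.
Qed.

Lemma exp_small (t e : R) : 0 <= t < 1 -> 0 < e -> exists T : nat, t ^+ T <= e.
Proof.
move=> /andP[t0 t1] e0.
have tn : `|t| < 1 by rewrite ger0_norm.
have /cvgrPdist_le/(_ e e0)[N _ /(_ N (leqnn N))] := cvg_expr tn.
by rewrite sub0r normrN ger0_norm ?exprn_ge0//; exists N.
Qed.

(** Positive frequencies carry a factor 2 because taking the real part folds the frequencies k and
    -k together. *)
Definition fejer_coef L k : R := if k == 0%N then 1 else 2 * (L - k)%N%:R / L%:R.

Lemma fejer_coef_bound L k : 0 <= fejer_coef L k <= 2.
Proof.
rewrite /fejer_coef; case: eqP => _; first by rewrite ler01 ler1n.
rewrite divr_ge0 ?mulr_ge0//= -mulrA ger_pMr//.
case: L => [|L]; first by rewrite invr0 mulr0.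
by rewrite ler_pdivrMr// mul1r ler_nat leq_subr.
Qed.

Lemma cabs_geometric_sum L (l : C) : cabs l = 1 ->
  cabs (\sum_(a < L) l ^+ a) ^+ 2 =
  L%:R + 2 * \sum_(k < L) (L - k.+1)%N%:R * complex.Re (l^* ^+ k.+1).
Proof.
move=> l1; elim: L => [|L ih].
  by rewrite !big_ord0 cabs0 expr0n mulr0 addr0.
rewrite big_ord_recr /= cabsD_sqr ih cabsX l1 expr1n.
rewrite [in RHS]big_ord_recr /= subnn mul0r addr0.
rewrite (_ : complex.Re _ = \sum_(k < L) complex.Re (l^* ^+ k.+1)); last first.
  rewrite mulr_suml Re_sum (reindex_inj rev_ord_inj) /=.
  apply: eq_bigr => k _; congr complex.Re; rewrite rmorphXn.
  rewrite -[in X in _ * X](subnK (ltn_ord k)).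
  by rewrite exprD mulrA -exprMn mul_conj_unit// expr1n mul1r.
rewrite [X in _ = _ + 2 * X](eq_bigr (fun k : 'I_L => (L - k.+1)%N%:R * complex.Re (l^* ^+ k.+1) +
   complex.Re (l^* ^+ k.+1))); last first.
  move=> k _; rewrite subSS (_ : L - k = (L - k.+1).+1)%N; last first.
    by have := ltn_ord k; lia.
  by rewrite -natr1 mulrDl mul1r.
by rewrite big_split /= -natr1; ring.
Qed.

Lemma Re_fejer_coef L (l : C) : (0 < L)%N -> cabs l = 1 ->
  complex.Re (\sum_(k < L) creal (fejer_coef L k) * l^* ^+ k) = fejer L l.
Proof.
case: L => // L _ l1; rewrite /fejer cabs_geometric_sum// mulrDr mulVf ?pnatr_eq0//.
rewrite Re_sum big_ord_recl /= /fejer_coef/= mul1r mul0r subr0; congr (_ + _).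
rewrite [in RHS]big_ord_recr /= subnn mul0r addr0 mulrCA !mulr_sumr.
apply: eq_bigr => k _; rewrite Re_crealM.
by rewrite /bump /= add1n; ring.
Qed.

(** A discrete Fourier coefficient of chi along the slice through z. *)
Definition circle_coef M (chi : Cn -> R) k z : C :=
  mean M (fun l => creal (chi (l *: z)) * l^* ^+ k).

(* On the grid, the real part at 1 is the Fejer mean of chi. *)
Definition herglotz L M (chi : Cn -> R) z : {poly C} :=
  \poly_(k < L) (creal (fejer_coef L k) * circle_coef M chi k z).

Lemma hornerE_poly (L : nat) (a : nat -> C) x :
  (\poly_(k < L) a k).[x] = \sum_(k < L) a k * x ^+ k.
Proof.
rewrite (horner_coef_wide _ (size_poly _ _)); apply: eq_bigr => k _.
by rewrite coef_poly ltn_ord.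
Qed.

Variables (L M : nat) (chi : Cn -> R).

Lemma circle_coef_rot k i z :
  circle_coef M chi k (uroot R M ^+ i *: z) = uroot R M ^+ i ^+ k * circle_coef M chi k z.
Proof.
rewrite /circle_coef -[in RHS](mean_rot M _ i) -meanZ; apply: eq_mean => l l1.
rewrite scalerA mulrCA (mulrC l); congr (_ * _).
rewrite rmorphM exprMn mulrA -exprMn mul_conj_unit ?cabs_urootX//.
by rewrite expr1n mul1r.
Qed.

Lemma herglotz_rot i z x :
  (herglotz L M chi (uroot R M ^+ i *: z)).[x] = (herglotz L M chi z).[uroot R M ^+ i * x].
Proof.
rewrite !hornerE_poly; apply: eq_bigr => k _.
by rewrite circle_coef_rot exprMn; ring.
Qed.

Hypotheses (L0 : (0 < L)%N) (chi_cont : scont chi).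
Hypothesis chi_bound : forall z, S z -> 0 <= chi z <= 1.

Lemma scont_circle_coef k : scont (circle_coef M chi k).
Proof.
apply: scont_mean => l l1; apply: scontM; last exact: scont_cst.
by apply: scont_creal; exact: scont_rot.
Qed.

Lemma scont_herglotz x : scont (fun z => (herglotz L M chi z).[x]).
Proof.
apply: (scont_ext (fun z => hornerE_poly _ _ x)); apply: scont_sum => k _.
apply: scontM; last exact: scont_cst.
by apply: scontZ; exact: scont_circle_coef.
Qed.

Lemma circle_coef_le k z : S z ->
  cabs (circle_coef M chi k z) <= rmean M (fun l => 1 * chi (l *: z)).
Proof.
move=> Sz; apply: cabs_mean_le => l l1.
rewrite mul1r cabsM cabs_creal cabsX cabs_conj l1 expr1n mulr1.
by rewrite ger0_norm//; have /andP[] := chi_bound (sphereZ l1 Sz).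
Qed.

Lemma Re_herglotz z : S z -> complex.Re (herglotz L M chi z).[1] =
  rmean M (fun l => fejer L l * chi (l *: z)).
Proof.
move=> Sz; rewrite hornerE_poly.
under eq_bigr do rewrite expr1n mulr1 -meanZ.
rewrite -mean_sum /mean -creal_nat -crealV Re_crealM Re_sum; congr (_ * _).
apply: eq_bigr => i _.
rewrite -(Re_fejer_coef L0 (cabs_urootX R M i)) mulrC -Re_crealM mulr_sumr.
by congr complex.Re; apply: eq_bigr => k _; rewrite mulrCA.
Qed.

Lemma rmean_chi_le1 z : S z -> rmean M (fun l => 1 * chi (l *: z)) <= 1.
Proof.
move=> Sz; case: (posnP M) => [->|M0].
  by rewrite /rmean big_ord0 mulr0.
apply: (@le_trans _ _ (rmean M (fun=> 1))); last first.
  rewrite (_ : rmean M _ = 1)//; apply: creal_inj.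
  by rewrite -mean_creal mean_cst.
by apply: ler_rmean => l l1; rewrite mul1r; have /andP[] := chi_bound (sphereZ l1 Sz).
Qed.

(** Each circle coefficient of the nonnegative chi is at most its mean, and the factors 2 rho^k sum
    to at most 2 / (1 - rho). At radius rho the polynomial is therefore small in mean as soon as chi
    is, whatever its size on the sphere. *)
Lemma herglotz_le z (rho : R) : S z -> 0 <= rho < 1 ->
  cabs (herglotz L M chi z).[creal rho] <=
  2 / (1 - rho) * rmean M (fun l => 1 * chi (l *: z)).
Proof.
move=> Sz /andP[r0 r1]; rewrite hornerE_poly (le_trans (cabs_sum _ _ _))//.
have m0 : 0 <= rmean M (fun l => 1 * chi (l *: z)).
  by apply: rmean_ge0 => l l1; rewrite mul1r; have /andP[] := chi_bound (sphereZ l1 Sz).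
have r10 : 0 < 1 - rho by rewrite subr_gt0.
apply: (@le_trans _ _ (\sum_(k < L) rho ^+ k * (2 * rmean M (fun l => 1 * chi (l *: z))))).
  apply: ler_sum => k _.
  rewrite cabsM [cabs (creal _ * _)]cabsM -crealX !cabs_creal mulrC.
  have /andP[c0 c2] := fejer_coef_bound L k.
  rewrite !ger0_norm ?exprn_ge0//; apply: ler_wpM2l; first exact: exprn_ge0.
  by apply: ler_pM => //; [exact: cabs_ge0|exact: circle_coef_le].
rewrite -mulr_suml (_ : 2 / (1 - rho) * _ = (1 - rho)^-1 *
  (2 * rmean M (fun l => 1 * chi (l *: z)))); last by ring.
apply: ler_wpM2r; first by rewrite mulr_ge0.
rewrite -[leRHS]div1r ler_pdivlMr//.
have := subrX1 rho L; have := exprn_ge0 L r0; nra.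
Qed.

Lemma herglotz_bound z x : S z -> cabs x <= 1 ->
  cabs (herglotz L M chi z).[x] <= 2 * L%:R.
Proof.
move=> Sz x1; rewrite hornerE_poly (le_trans (cabs_sum _ _ _))//.
apply: (@le_trans _ _ (\sum_(k < L) 2)); last first.
  by rewrite sumr_const card_ord -[_ *+ _]mulr_natr.
apply: ler_sum => k _.
rewrite cabsM [cabs (creal _ * _)]cabsM cabs_creal cabsX.
have /andP[c0 c2] := fejer_coef_bound L k.
have h1 : cabs (circle_coef M chi k z) <= 1.
  by rewrite (le_trans (circle_coef_le k Sz))// rmean_chi_le1.
have h2 : cabs x ^+ k <= 1 by rewrite exprn_ile1 ?cabs_ge0.
have h3 : 0 <= cabs x ^+ k by rewrite exprn_ge0 ?cabs_ge0.
have := cabs_ge0 (circle_coef M chi k z); move: h1.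
rewrite ger0_norm//; move: (cabs (circle_coef _ _ _ _)) => t t1 t0.
rewrite -[leRHS]mulr1 ler_pM ?mulr_ge0//.
by rewrite -[leRHS]mulr1 ler_pM.
Qed.

End HerglotzPolynomial.

Lemma leq_pred_add a b m t : (a <= m)%N -> (b <= t.+1)%N -> ((a + b).-1 <= (m + t).+1)%N.
Proof. lia. Qed.

Section FejerMean.
Variables (R : realType) (n : nat).
Local Notation C := (Cx R).
Local Notation Cn := 'rV[Cx R]_n.
Local Notation S := (@unit_sphere R n).

Lemma fejer_mean_close (u : Cn -> R) (e : R) : scont u -> 0 < e ->
  exists2 L, (0 < L)%N & forall M z, (L < M)%N -> S z ->
    `|rmean M (fun l => fejer L l * u (l *: z)) - u z| <= e.
Proof.
move=> hu e0; have e2 : 0 < e / 2 by rewrite divr_gt0.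
have [K K0 hK] := scont_rot_modulus hu e2.
pose L := (Num.Def.truncn (4 * K / e)).+1.
have hL : K * (2 / L%:R) <= e / 2.
  have /ltW : 4 * K / e < L%:R by exact: truncnS_gt.
  by rewrite ler_pdivrMr// mulrA ler_pdivrMr ?ltr0n//; nra.
exists L => // M z LM Sz.
have f1 : rmean M (@fejer R L) = 1 by apply: rmean_fejer; rewrite /= ltnW.
have -> : rmean M (fun l => fejer L l * u (l *: z)) - u z =
    rmean M (fun l => fejer L l * (u (l *: z) - u z)).
  rewrite -[X in _ - X]mulr1 -f1 -rmeanZ /rmean -mulrBr -sumrB; congr (_ * _).
  by apply: eq_bigr => i _; rewrite mulrBr [u z * _]mulrC.
apply: (@le_trans _ _ (rmean M (fun l => fejer L l * `|u (l *: z) - u z|))).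
  rewrite /rmean normrM ger0_norm ?invr_ge0// ler_wpM2l ?invr_ge0//.
  rewrite (le_trans (ler_norm_sum _ _ _))// ler_sum// => i _.
  by rewrite normrM (ger0_norm (fejer_ge0 _ _)).
apply: (@le_trans _ _ (rmean M (fun l => e / 2 * fejer L l +
    K * (fejer L l * cabs (l - 1) ^+ 2)))).
  apply: ler_rmean => l l1; rewrite [e / 2 * _]mulrC [K * (_ * _)]mulrCA -mulrDr.
  by apply: ler_wpM2l; [exact: fejer_ge0|exact: hK].
have mom := @rmean_fejer_moment R M L LM.
rewrite rmeanD rmeanZ rmeanZ mom -/(fejer L) [rmean M _]f1.
by move: hL; lra.
Qed.

End FejerMean.

(** * Slice polynomials and their division by 1 + Q *)

Section SlicePolynomials.
Variables (R : realType) (n : nat).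
Local Notation C := (Cx R).
Local Notation Cn := 'rV[Cx R]_n.
Local Notation S := (@unit_sphere R n).
Implicit Types (F : nat -> Cn -> C).

(** What the estimates retain of the homogeneous terms of f on the sphere; their growth is the
    separate condition [slice_growth]. *)
Record homogeneous_seq F : Prop := HomogeneousSeq {
  hom_cont : forall k : nat, scont (F k);
  hom_rot : forall (k : nat) (l : C) (z : Cn), cabs l = 1 -> F k (l *: z) = l ^+ k * F k z }.

Definition slice_poly F m z : {poly C} := \poly_(k < m) F k z.

Lemma slice_polyE F m z x : (slice_poly F m z).[x] = \sum_(k < m) F k z * x ^+ k.
Proof. exact: hornerE_poly. Qed.

Lemma size_slice_poly F m z : (size (slice_poly F m z) <= m)%N.
Proof. exact: size_poly. Qed.

Lemma coef_slice_poly F m z k : (slice_poly F m z)`_k = if (k < m)%N then F k z else 0.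
Proof. exact: coef_poly. Qed.

Lemma slice_poly_rot F m l z x : homogeneous_seq F -> cabs l = 1 ->
  (slice_poly F m (l *: z)).[x] = (slice_poly F m z).[l * x].
Proof.
move=> HF l1; rewrite !hornerE_poly; apply: eq_bigr => k _.
by rewrite (hom_rot HF)// exprMn; ring.
Qed.

Lemma scont_slice_poly F m x : homogeneous_seq F ->
  scont (fun z => (slice_poly F m z).[x]).
Proof.
move=> HF; apply: (scont_ext (fun z => hornerE_poly _ _ x)); apply: scont_sum => k _.
by apply: scontM; [exact: (hom_cont HF)|exact: scont_cst].
Qed.

Variable I : (Cn -> R) -> R.
Hypothesis HI : rot_functional I.

Section Multiplier.
Variables (F : nat -> Cn -> C) (m : nat).
Hypothesis HF : homogeneous_seq F.
Variables (chi : Cn -> R) (rho B : R).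
Hypotheses (chi_cont : scont chi) (chi_bound : forall z, S z -> 0 <= chi z <= 1).
Hypothesis rho01 : 0 <= rho < 1.
Hypothesis HB : forall z, S z -> cabs (slice_poly F m z).[creal rho] <= B.

Local Notation q := (fun z => (slice_poly F m z).[1]).
Local Notation qrho := (fun z => (slice_poly F m z).[creal rho]).

Let chi1 z : S z -> 0 < 1 + chi z.
Proof. by move=> /chi_bound/andP[h _]; rewrite ltr_pwDl. Qed.

Let cont_quot : scont (fun z => cabs (q z) / (1 + chi z)).
Proof.
apply: scontMr; first by apply: scont_cabs; exact: scont_slice_poly.
apply: scont_inv; first by apply: scontDr => //; exact: scont_cst.
by move=> z /chi1 h; rewrite gt_eqF.
Qed.

(* The multiplier approximates 1 / (1 + Q) by a geometric sum, Q being the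
   analytic polynomial whose real part is a Fejer mean of chi. *)
Let multiplier_eps (e : R) : 0 < e <= 2^-1 ->
  I (fun z => cabs (qrho z)) <= I (fun z => cabs (q z) / (1 + chi z)) +
    B * (2 / (1 - rho)) * I chi +
    e * (8 * I (fun z => cabs (q z)) + B * I (fun=> 1)).
Proof.
move=> /andP[e0 e2].
have [L L0 hL] := fejer_mean_close chi_cont e0.
(* [c] bounds |1 + Q|^2. As Re (1 + Q) >= 1, the polynomial Y = 1 - (1 + Q) / c satisfies |Y|^2 <= 1
   - 2 / c + 1 / c <= t^2. The geometric sum G then satisfies (1 + Q) G = 1 - Y^T, so it inverts 1 +
   Q up to t^T <= e. *)
pose c : R := (1 + 2 * L%:R) ^+ 2.
have L1 : 1 <= L%:R :> R by rewrite ler1n.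
have c1 : 1 <= c by rewrite /c exprn_ege1//; lra.
have c0 : 0 < c by rewrite (lt_le_trans _ c1).
pose t : R := 1 - (2 * c)^-1.
have ci : 0 < c^-1 <= 1 by rewrite invr_gt0 c0 invf_le1.
have tc : t = 1 - c^-1 / 2 by rewrite /t invfM mulrC.
have t01 : 0 <= t < 1 by rewrite tc; lra.
have [T hT] := exp_small t01 e0.
pose Q M (z : Cn) : {poly C} := herglotz L M chi z.
pose Y M (z : Cn) : {poly C} := 1 - (creal c^-1)%:P * (1 + Q M z).
pose G M (z : Cn) : {poly C} := (creal c^-1)%:P * \sum_(i < T) Y M z ^+ i.
pose h M (z : Cn) : {poly C} := slice_poly F m z * G M z.
have sQ M z : (size (1 + Q M z)%R <= L)%N.
  by rewrite (leq_trans (size_polyD _ _))// geq_max size_polyC oner_eq0 L0 size_poly.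
have sY M z : (size (Y M z) <= L)%N.
  rewrite (leq_trans (size_polyD _ _))// geq_max size_polyC oner_eq0 L0 size_polyN/=.
  by rewrite mul_polyC (leq_trans (size_scale_leq _ _)).
have sG M z : (size (G M z) <= (L * T).+1)%N.
  rewrite /G mul_polyC (leq_trans (size_scale_leq _ _))// (leq_trans (size_sum _ _ _))//.
  apply/bigmax_leqP => i _; rewrite (leq_trans (size_poly_exp_leq _ _))//.
  by rewrite ltnS leq_mul// ?(leq_trans (leq_pred _))// ltnW.
have sh M z : (size (h M z) <= (m + L * T).+1)%N.
  have s1 : (size (slice_poly F m z) <= m)%N by exact: size_poly.
  exact: leq_trans (size_polyMleq _ _) (leq_pred_add s1 (sG M z)).
(* Two polynomials are carried from the circle to radius rho: the product of the slice with G, for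
   its mass, and Q itself, to keep Re Q >= 0 there. *)
have [M1 hM1] := damping_poly HI (m + L * T) rho01.
have [M2 hM2] := damping_poly HI L rho01.
pose M := (maxn L.+1 (maxn M1 M2)).
have ML : (L < M)%N by rewrite leq_max leqnn.
have MM1 : (M1 <= M)%N by rewrite !leq_max leqnn orbT.
have MM2 : (M2 <= M)%N by rewrite !leq_max leqnn !orbT.
have QE i z x : (Q M (uroot R M ^+ i *: z)).[x] = (Q M z).[uroot R M ^+ i * x].
  exact: herglotz_rot.
have YE z x : (Y M z).[x] = 1 - creal c^-1 * (1 + (Q M z).[x]).
  by rewrite !hornerE.
have GE z x : (G M z).[x] = creal c^-1 * \sum_(i < T) (Y M z).[x] ^+ i.
  by rewrite hornerM hornerC horner_sum; under eq_bigr do rewrite horner_exp.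
have Grot i z x : (G M (uroot R M ^+ i *: z)).[x] = (G M z).[uroot R M ^+ i * x].
  by rewrite !GE; congr (_ * _); apply: eq_bigr => j _; rewrite !YE QE.
have Gid z x : (1 + (Q M z).[x]) * (G M z).[x] = 1 - (Y M z).[x] ^+ T.
  have := subrX1 (Y M z).[x] T; rewrite GE.
  have -> : (Y M z).[x] - 1 = - (creal c^-1 * (1 + (Q M z).[x])) by rewrite YE; ring.
  by move=> E; rewrite -[RHS]opprB E; ring.
have cQ x : scont (fun z => (Q M z).[x]) by exact: scont_herglotz.
have cG x : scont (fun z => (G M z).[x]).
  apply: (scont_ext (fun z => GE z x)); apply: scontZ; apply: scont_sum => i _.
  have cY : scont (fun z => (Y M z).[x]).
    apply: (scont_ext (fun z => YE z x)); apply: scontB; first exact: scont_cst.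
    by apply: scontZ; apply: scontD => //; exact: scont_cst.
  elim: (i : nat) => [|j ih].
    rewrite (_ : (fun _ => _) = fun=> 1); first exact: scont_cst.
    by apply/funext => z; rewrite expr0.
  by apply: (scont_ext _ (scontM cY ih)) => z; rewrite exprS.
have hE z x : (h M z).[x] = (slice_poly F m z).[x] * (G M z).[x] by exact: hornerM.
have ch : scont (fun z => (h M z).[1]).
  apply: (scont_ext _ (scontM (@scont_slice_poly F m 1 HF) (cG 1))) => z; exact: hE.
have hrot z i : (h M (uroot R M ^+ i *: z)).[1] = (h M z).[uroot R M ^+ i].
  by rewrite !hE slice_poly_rot ?cabs_urootX// Grot mulr1.
have [chr Ih _ _] := hM1 M (h M) MM1 (sh M) hrot ch.
have szQ z : (size (Q M z) <= L.+1)%N by rewrite (leq_trans (size_poly _ _)).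
have ReQ1 z : S z -> chi z - e <= complex.Re (Q M z).[1].
  move=> Sz; rewrite Re_herglotz//; have := hL M z ML Sz.
  by rewrite ler_norml => /andP[]; lra.
have ReQ0 z : S z -> 0 <= complex.Re (Q M z).[1].
  move=> Sz; rewrite Re_herglotz//; apply: rmean_ge0 => l l1.
  rewrite mulr_ge0 ?fejer_ge0//.
  by have /andP[] := chi_bound (sphereZ l1 Sz).
have Qrot z i : (Q M (uroot R M ^+ i *: z)).[1] = (Q M z).[uroot R M ^+ i].
  by rewrite QE mulr1.
have [_ _ _ /(_ ReQ0) ReQrho] := hM2 M (Q M) MM2 szQ Qrot (cQ 1).
have Ybound z x : S z -> cabs x <= 1 -> 0 <= complex.Re (Q M z).[x] ->
    cabs (Y M z).[x] ^+ T <= e.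
  move=> Sz x1 Re0; rewrite (le_trans _ hT)//; have /andP[t0 _] := t01.
  apply: lerXn2r; rewrite ?nnegrE ?cabs_ge0//.
  rewrite -(@ler_pXn2r _ 2) ?nnegrE ?cabs_ge0// YE cabsD_sqr cabs1 expr1n.
  rewrite cabsN cabsM cabs_creal ger0_norm; last by case/andP: ci => /ltW.
  have w2 : cabs (1 + (Q M z).[x]) ^+ 2 <= c.
    rewrite /c; apply: lerXn2r; rewrite ?nnegrE ?cabs_ge0//.
    rewrite (le_trans (cabsD _ _))// cabs1 lerD2l.
    exact: herglotz_bound.
  rewrite mul1r cRe_conj -mulNr -crealN Re_crealM cReD /= exprMn.
  have : c^-1 ^+ 2 * cabs (1 + (Q M z).[x]) ^+ 2 <= c^-1.
    rewrite expr2 -mulrA ler_piMr//; first by case/andP: ci => /ltW.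
    by rewrite mulrC ler_pdivrMr// mul1r.
  by case/andP: ci => i0 _; rewrite tc; nra.
have w_ge1 z x : 0 <= complex.Re (Q M z).[x] ->
    1 + complex.Re (Q M z).[x] <= cabs (1 + (Q M z).[x]).
  move=> Re0; rewrite (le_trans _ (Re_le_cabs _))// cReD /= ger0_norm//.
  by rewrite addr_ge0.
have h1_le z : S z ->
    cabs (h M z).[1] <= cabs (q z) / (1 + chi z) + 8 * e * cabs (q z).
  move=> Sz; rewrite hE cabsM.
  have GQ : (1 + chi z - e) * cabs (G M z).[1] <= 1 + e.
    apply: (@le_trans _ _ (cabs (1 + (Q M z).[1]) * cabs (G M z).[1])).
      rewrite ler_wpM2r ?cabs_ge0// (le_trans _ (w_ge1 _ _ (ReQ0 _ Sz)))//.
      by have := ReQ1 z Sz; lra.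
    rewrite -cabsM Gid (le_trans (cabsB _ _))// cabs1 lerD2l cabsX.
    by apply: Ybound => //; [rewrite cabs1|exact: ReQ0].
  have /andP[x0 x1] := chi_bound Sz.
  have G0 := cabs_ge0 (G M z).[1].
  suff : cabs (G M z).[1] <= (1 + chi z)^-1 + 8 * e.
    move=> hG; rewrite [8 * e * _]mulrC -mulrDr.
    by apply: ler_wpM2l => //; exact: cabs_ge0.
  rewrite -(@ler_pM2l _ (1 + chi z)) ?chi1// mulrDr mulfV ?gt_eqF ?chi1//.
  (* From (1 + chi - e) |G| <= 1 + e with e <= 1 / 2. Then (1 + chi) |G| <= 1 + e + 3 e, which the
     factor 8 covers amply. *)
  have G3 : cabs (G M z).[1] <= 3 by nra.
  by nra.
have hrho_ge z : S z -> cabs (qrho z) <= cabs (h M z).[creal rho] +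
    B * (2 / (1 - rho) * rmean M (fun l => 1 * chi (l *: z)) + e).
  move=> Sz; have /andP[r0 r1] := rho01.
  have cr1 : cabs (creal rho) <= 1 by rewrite cabs_creal ger0_norm// ltW.
  have Q0 := ReQrho z Sz.
  have hG : cabs (1 - (G M z).[creal rho]) <=
      2 / (1 - rho) * rmean M (fun l => 1 * chi (l *: z)) + e.
    (* Multiplication by 1 + Q, of modulus at least 1, turns 1 - G into Q + Y^T. *)
    apply: (@le_trans _ _ (cabs (1 + (Q M z).[creal rho]) * cabs (1 - (G M z).[creal rho]))).
      rewrite ler_peMl ?cabs_ge0// (le_trans _ (w_ge1 _ _ Q0))//.
      by rewrite lerDl.
    rewrite -cabsM mulrBr mulr1 Gid.
    rewrite (_ : _ - _ = (Q M z).[creal rho] + (Y M z).[creal rho] ^+ T); last by ring.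
    rewrite (le_trans (cabsD _ _))// lerD//.
      exact: herglotz_le.
    by rewrite cabsX Ybound.
  rewrite hE.
  have -> : qrho z = qrho z * (G M z).[creal rho] + qrho z * (1 - (G M z).[creal rho]).
    by ring.
  rewrite (le_trans (cabsD _ _))// [in X in _ <= X + _](_ : qrho z * _ + _ = qrho z); last by ring.
  rewrite lerD2l [cabs (_ * (1 - _))]cabsM ler_pM ?cabs_ge0// HB//.
have one_ge0 : 0 <= I (fun=> 1) by apply: (rotf_ge0 HI) => //; exact: scont_cst.
have ca : scont (fun z => cabs (q z)) by apply: scont_cabs; exact: scont_slice_poly.
have step1 : I (fun z => cabs (qrho z)) <= I (fun z => cabs (h M z).[creal rho]) +
    (B * (2 / (1 - rho)) * I chi + e * (B * I (fun=> 1))).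
  have cm : scont (fun z => rmean M (fun l => 1 * chi (l *: z))) by exact: scont_rmean.
  have M0 : (0 < M)%N by rewrite (leq_trans _ ML).
  have m1 : I (fun z => rmean M (fun l => 1 * chi (l *: z))) = I chi.
    rewrite (rotf_rmean HI)// (_ : rmean M _ = 1) ?mul1r//; apply: creal_inj.
    by rewrite -mean_creal mean_cst.
  have c2 := @scontZr R n (B * (2 / (1 - rho))) _ cm.
  rewrite -m1 -(rotfZ HI _ cm).
  have c3 := @scont_cst R n R (e * B).
  have c23 := scontDr c2 c3; have chr' := scont_cabs chr.
  rewrite [e * (B * _)]mulrA -(rotf_cst HI) -(rotfD HI c2 c3) -(rotfD HI chr' c23).
  apply: (rotf_le HI); [|exact: scontDr chr' c23|].
    by apply: scont_cabs; exact: scont_slice_poly.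
  move=> z Sz; rewrite (le_trans (hrho_ge z Sz))// lerD2l mulrDr mulrA lerD2l.
  by rewrite mulrC.
rewrite (le_trans step1)//.
have step2 : I (fun z => cabs (h M z).[1]) <=
    I (fun z => cabs (q z) / (1 + chi z)) + 8 * e * I (fun z => cabs (q z)).
  have ca8 := @scontZr R n (8 * e) _ ca.
  rewrite -(rotfZ HI _ ca) -(rotfD HI cont_quot ca8).
  apply: (rotf_le HI); [exact: (scont_cabs ch)|exact: scontDr cont_quot ca8|exact: h1_le].
by have := le_trans Ih step2; lra.
Qed.

(** The two radii see the multiplier differently. At radius 1 the division by 1 + chi removes mass
    where chi is near 1; at radius rho the price is the mean of chi, with a constant that does not
    depend on chi. *)
Lemma multiplier_bound :
  I (fun z => cabs (qrho z)) <= I (fun z => cabs (q z) / (1 + chi z)) +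
    B * (2 / (1 - rho)) * I chi.
Proof.
set a := I _; set b := _ + _.
pose D := 8 * I (fun z => cabs (q z)) + B * I (fun=> 1).
have D1 : 0 < `|D| + 1 by rewrite ltr_wpDl.
apply/ler_addgt0Pl => e e0.
pose d := Num.min 2^-1 (e / (`|D| + 1)).
have d0 : 0 < d by rewrite lt_min divr_gt0// invr_gt0 ltr0n.
have := @multiplier_eps d; rewrite d0 ge_min lexx/= => /(_ isT) h.
rewrite (le_trans h)// -/b addrC lerD2r -/D.
have de : d * (`|D| + 1) <= e by rewrite -ler_pdivlMr// ge_min lexx orbT.
by have := ler_norm D; nra.
Qed.

End Multiplier.

End SlicePolynomials.

#[global] Opaque slice_poly.

(** * De la Vallee-Poussin blocks *)

Section DyadicKernels.
Variable R : realType.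
Local Notation C := (Cx R).
Implicit Types (L M k m : nat) (l : C).

(** The de la Vallee-Poussin trapezoid: 1 up to L, then linear down to 0 at 2 L, where the natural
    subtraction truncates it. *)
Definition low_mult L k : R := (minn L (2 * L - k))%:R / L%:R.

(** The difference of the trapezoids for 2 L and L rises on [L, 2 L] with slope 1 / L and falls on
    [2 L, 4 L] with slope -1 / (2 L). Hence a triangle at 2 L and half a triangle at 3 L; each is
    the multiplier of a modulated Fejer kernel, which makes the L^1 norm at most 3 / 2. *)
Definition block_mult L k : R := tri R L k (2 * L) + tri R L k (3 * L) / 2.

Lemma tri_eq0 L k k' : (L <= (k - k') + (k' - k))%N -> tri R L k k' = 0.
Proof.
by move=> h; rewrite /tri (_ : L - _ = 0)%N ?mul0r//; apply/eqP.
Qed.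

Lemma low_multS L k : (0 < L)%N -> low_mult (2 * L) k = low_mult L k + block_mult L k.
Proof.
move=> L0; rewrite /low_mult /block_mult /tri.
have LR : L%:R != 0 :> R by rewrite pnatr_eq0 -lt0n.
have h : (minn (2 * L) (2 * (2 * L) - k) = 2 * minn L (2 * L - k) +
  (2 * (L - ((k - 2 * L) + (2 * L - k))) + (L - ((k - 3 * L) + (3 * L - k)))))%N by lia.
rewrite h natrD natrM natrD natrM natrM.
by field.
Qed.

Lemma low_mult_iter J K k : (J <= K)%N ->
  low_mult (2 ^ K) k = low_mult (2 ^ J) k + \sum_(J <= j < K) block_mult (2 ^ j) k.
Proof.
move=> /subnKC <-; elim: (K - J)%N => [|d ih].
  by rewrite addn0 big_geq// addr0.
rewrite addnS big_nat_recr ?leq_addr//= expnS low_multS ?expn_gt0// ih.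
by rewrite -addrA.
Qed.

Lemma low_mult_bound L k : 0 <= low_mult L k <= 1.
Proof.
rewrite /low_mult divr_ge0//=; case: (posnP L) => [->|L0].
  by rewrite invr0 mulr0.
by rewrite ler_pdivrMr ?ltr0n// mul1r ler_nat geq_minl.
Qed.

Lemma low_mult1 L k : (0 < L)%N -> (k <= L)%N -> low_mult L k = 1.
Proof.
move=> L0 kL; rewrite /low_mult (minn_idPl _); last by lia.
by rewrite divff// pnatr_eq0 -lt0n.
Qed.

Lemma low_mult0 L k : (2 * L <= k)%N -> low_mult L k = 0.
Proof. by move=> kL; rewrite /low_mult (_ : 2 * L - k = 0)%N ?minn0 ?mul0r//; lia. Qed.

Lemma block_mult0 L k : (4 * L <= k)%N -> block_mult L k = 0.
Proof.
move=> kL; rewrite /block_mult !tri_eq0; [by rewrite mul0r addr0|lia..].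
Qed.

Definition block_kernel L l : C :=
  creal (fejer L l) * l^* ^+ (2 * L) + creal (2^-1 * fejer L l) * l^* ^+ (3 * L).

Lemma cabs_block_kernel L l : cabs l = 1 -> cabs (block_kernel L l) <= 3 / 2 * fejer L l.
Proof.
move=> l1; rewrite (le_trans (cabsD _ _))// !cabsM !cabs_creal !cabsX cabs_conj l1.
rewrite !expr1n !mulr1 !ger0_norm ?fejer_ge0//; first by lra.
by rewrite mulr_ge0 ?fejer_ge0.
Qed.

Lemma rmean_block_kernel M L : (0 < L <= M)%N ->
  rmean M (fun l => cabs (block_kernel L l)) <= 3 / 2.
Proof.
move=> LM; rewrite -[leRHS]mulr1 -[X in _ <= _ * X](rmean_fejer R LM) -rmeanZ.
by apply: ler_rmean => l l1; exact: cabs_block_kernel.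
Qed.

Lemma block_mean M L m (a : nat -> C) : (0 < L)%N -> (m + 4 * L <= M)%N ->
  mean M (fun l => block_kernel L l * \sum_(k < m) a k * l ^+ k) =
  \sum_(k < m) creal (block_mult L k) * a k.
Proof.
move=> L0 mM; rewrite (@eq_mean _ _ _ (fun l => \sum_(k < m)
  (a k * (creal (fejer L l) * (l ^+ k * l^* ^+ (2 * L))) +
   a k * creal 2^-1 * (creal (fejer L l) * (l ^+ k * l^* ^+ (3 * L)))))); last first.
  move=> l _; rewrite mulr_sumr; apply: eq_bigr => k _.
  by rewrite /block_kernel (crealM 2^-1); ring.
rewrite mean_sum; apply: eq_bigr => k _; have := ltn_ord k => km.
rewrite meanD !meanZ !mean_fejer; [|lia..].
by rewrite /block_mult crealD !crealM; ring.
Qed.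

(** All frequencies of the product are at most i <= L, hence at distance at least L from the centres
    2 L and 3 L of the two triangles. Conjugation only lowers frequencies, so the degree of the
    conjugated factor affects nothing but the size of the grid. *)
Lemma block_annihilates M L m (a : nat -> C) i j : (0 < L)%N -> (m + i + j + 5 * L <= M)%N ->
  (i <= L)%N ->
  mean M (fun l => block_kernel L l * (l ^+ i * l^* ^+ j * (\sum_(k < m) a k * l ^+ k)^*)) = 0.
Proof.
move=> L0 mM iL; rewrite (@eq_mean _ _ _ (fun l => \sum_(k < m)
  ((a k)^* * (creal (fejer L l) * (l ^+ i * l^* ^+ (2 * L + j + k))) +
   (a k)^* * creal 2^-1 * (creal (fejer L l) * (l ^+ i * l^* ^+ (3 * L + j + k)))))).
  rewrite mean_sum big1// => k _; have := ltn_ord k => km.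
  rewrite meanD !meanZ !mean_fejer; [|lia..].
  by rewrite !tri_eq0; [rewrite creal0 !mulr0 addr0|lia..].
move=> l _; rewrite rmorph_sum !mulr_sumr; apply: eq_bigr => k _.
by rewrite rmorphM rmorphXn /= /block_kernel (crealM 2^-1) !exprD; ring.
Qed.

(** Twice the triangle of half-width 2 L minus the triangle of half-width L is 1 on the frequencies
    from -L to L. *)
Definition vp_kernel L l : R := 2 * fejer (2 * L) l - fejer L l.

Lemma rmean_vp_kernel M L : (0 < L)%N -> (2 * L <= M)%N ->
  rmean M (fun l => `|vp_kernel L l|) <= 3.
Proof.
move=> L0 LM.
apply: (@le_trans _ _ (rmean M (fun l => 2 * fejer (2 * L) l + 1 * fejer L l))).
  apply: ler_rmean => l _; rewrite (le_trans (ler_normB _ _))// mul1r.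
  rewrite (ger0_norm (fejer_ge0 L l)) ger0_norm//.
  by apply: mulr_ge0 => //; exact: fejer_ge0.
have f1 : rmean M (fun l => fejer L l) = 1 by apply: rmean_fejer; lia.
have f2 : rmean M (fun l => fejer (2 * L) l) = 1 by apply: rmean_fejer; lia.
by rewrite rmeanD rmeanZ rmeanZ f1 f2; lra.
Qed.

Lemma vp_reproduces M L i : (0 < L)%N -> (4 * L <= M)%N -> (i <= 2 * L)%N ->
  mean M (fun l => creal (vp_kernel L l) * (l ^+ i * l^* ^+ L)) = 1.
Proof.
move=> L0 LM iL; rewrite (@eq_mean _ _ _ (fun l =>
  2 * (creal (fejer (2 * L) l) * (l ^+ i * l^* ^+ L)) -
  creal (fejer L l) * (l ^+ i * l^* ^+ L))); last first.
  by move=> l _; rewrite /vp_kernel crealB crealM (creal_nat R 2); ring.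
rewrite meanB meanZ !mean_fejer; [|lia..].
rewrite -(creal_nat R 2) -crealM -crealB -creal1; congr creal.
rewrite /tri; have LR : L%:R != 0 :> R by rewrite pnatr_eq0 -lt0n.
have -> : (2 * L - (i - L + (L - i)) = L + (L - (i - L + (L - i))))%N by lia.
by rewrite natrD natrM; field.
Qed.

(** Used with w as the variable of an outer mean: the kernel becomes a trigonometric polynomial in w
    of degree below 2 L, a combination of monomials to which [block_annihilates] applies. *)
Lemma vp_kernel_shift L l : exists c : nat -> nat -> C, forall w,
  creal (vp_kernel L (l * w^*)) =
  \sum_(a < 2 * L) \sum_(b < 2 * L) c a b * (w ^+ b * w^* ^+ a).
Proof.
have fe K w : creal (fejer K (l * w^*)) = \sum_(a < K) \sum_(b < K)
    (K%:R^-1 * l ^+ a * l^* ^+ b) * (w ^+ b * w^* ^+ a).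
  rewrite fejerE mulr_sumr; apply: eq_bigr => a _; rewrite mulr_sumr.
  by apply: eq_bigr => b _; rewrite rmorphM /= conjCK !exprMn; ring.
have wid (c : nat -> nat -> C) K w : (K <= 2 * L)%N ->
    \sum_(a < K) \sum_(b < K) c a b * (w ^+ b * w^* ^+ a) =
    \sum_(a < 2 * L) \sum_(b < 2 * L)
      ((if (a < K)%N && (b < K)%N then c a b else 0) * (w ^+ b * w^* ^+ a)).
  move=> KL; rewrite (big_ord_widen _ (fun a => \sum_(b < K) c a b * (w ^+ b * w^* ^+ a)) KL).
  rewrite big_mkcond; apply: eq_bigr => a _; case: ltnP => aK /=; last first.
    by rewrite big1// => b _; rewrite mul0r.
  rewrite (big_ord_widen _ (fun b => c a b * (w ^+ b * w^* ^+ a)) KL) big_mkcond.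
  by apply: eq_bigr => b _; case: ltnP => //; rewrite mul0r.
exists (fun a b => 2 * ((2 * L)%:R^-1 * l ^+ a * l^* ^+ b) -
  (if (a < L)%N && (b < L)%N then L%:R^-1 * l ^+ a * l^* ^+ b else 0)).
move=> w; rewrite /vp_kernel crealB crealM creal_nat !fe.
rewrite (wid (fun a b => L%:R^-1 * l ^+ a * l^* ^+ b) L); last by lia.
rewrite mulr_sumr -sumrB; apply: eq_bigr => a _.
rewrite mulr_sumr -sumrB; apply: eq_bigr => b _.
by rewrite mulrBl -!mulrA.
Qed.

End DyadicKernels.

(** * The reflection error in the mean *)

Section SliceGrowth.
Variables (R : realType) (n : nat).
Local Notation C := (Cx R).
Local Notation Cn := 'rV[Cx R]_n.
Local Notation S := (@unit_sphere R n).
Implicit Types F : nat -> Cn -> C.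

Definition scale_seq (s : R) F : nat -> Cn -> C := fun k z => creal (s ^+ k) * F k z.

Lemma homogeneous_mult F (b : nat -> C) : homogeneous_seq F ->
  homogeneous_seq (fun k z => b k * F k z).
Proof.
move=> HF; split=> [k|k l z l1]; first by apply: scontZ; exact: (hom_cont HF).
by rewrite (hom_rot HF)// mulrCA.
Qed.

Lemma homogeneous_scale F s : homogeneous_seq F -> homogeneous_seq (scale_seq s F).
Proof. exact: homogeneous_mult. Qed.

Lemma slice_poly_scale F m s z x :
  (slice_poly (scale_seq s F) m z).[x] = (slice_poly F m z).[creal s * x].
Proof.
rewrite !slice_polyE; apply: eq_bigr => k _.
by rewrite /scale_seq crealX exprMn; ring.
Qed.

Lemma slice_poly_scale1 F m s z :
  (slice_poly (scale_seq s F) m z).[1] = (slice_poly F m z).[creal s].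
Proof. by rewrite slice_poly_scale mulr1. Qed.

Lemma slice_poly_scaleV F m (rho s : R) z : s != 0 ->
  (slice_poly (scale_seq s F) m z).[creal (rho / s)] = (slice_poly F m z).[creal rho].
Proof. by move=> s0; rewrite slice_poly_scale -crealM mulrC divfK. Qed.

Lemma geometric_sum_le (t : R) n0 m : 0 <= t < 1 ->
  \sum_(n0 <= k < m) t ^+ k <= t ^+ n0 / (1 - t).
Proof.
move=> /andP[t0 t1]; have t1' : 0 < 1 - t by rewrite subr_gt0.
have [mn|nm] := leqP m n0.
  by rewrite big_geq// divr_ge0 ?exprn_ge0// ltW.
rewrite ler_pdivlMr//.
suff -> : (\sum_(n0 <= k < m) t ^+ k) * (1 - t) = t ^+ n0 - t ^+ m.
  by rewrite lerBlDr lerDl exprn_ge0.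
rewrite mulrBr mulr1 mulr_suml -sumrB -[RHS]opprB -telescope_sumr; last exact: ltnW.
by rewrite -sumrN; apply: eq_bigr => k _; rewrite opprB exprSr.
Qed.

(** Cauchy's estimates on the spheres of radius s < 1, uniform in k and z. *)
Definition slice_growth F := forall s : R, 0 < s < 1 ->
  exists2 B : R, 0 <= B & forall k z, S z -> cabs (F k z) * s ^+ k <= B.

Lemma slice_growth_tail F (rho : R) : slice_growth F -> 0 <= rho < 1 ->
  exists B t : R, [/\ 0 <= B, 0 <= t < 1 & forall n0 m z, S z ->
    \sum_(n0 <= k < m) cabs (F k z) * rho ^+ k <= B * t ^+ n0].
Proof.
move=> GF /andP[r0 r1]; pose s := (1 + rho) / 2.
have s01 : 0 < s < 1 by rewrite /s; lra.
have [B B0 hB] := GF s s01; have /andP[s0 s1] := s01.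
have t01 : 0 <= rho / s < 1.
  rewrite divr_ge0 ?(ltW s0)//=.
  have : rho < 1 * s by rewrite mul1r /s; lra.
  by rewrite -ltr_pdivrMr.
exists (B / (1 - rho / s)), (rho / s); split => //.
  by rewrite divr_ge0// subr_ge0; case/andP: t01 => _ /ltW.
move=> n0 m z Sz; rewrite mulrAC -mulrA.
rewrite (le_trans _ (ler_wpM2l B0 (geometric_sum_le n0 m t01)))//.
rewrite mulr_sumr; apply: ler_sum => k _.
rewrite expr_div_n mulrA ler_pdivlMr ?exprn_gt0// mulrAC.
by rewrite ler_wpM2r ?exprn_ge0// hB.
Qed.

Lemma slice_poly_le F m (rho : R) z : 0 <= rho ->
  cabs (slice_poly F m z).[creal rho] <= \sum_(0 <= k < m) cabs (F k z) * rho ^+ k.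
Proof.
move=> r0; rewrite slice_polyE big_mkord (le_trans (cabs_sum _ _ _))//.
by apply: ler_sum => k _; rewrite cabsM -crealX cabs_creal ger0_norm// exprn_ge0.
Qed.

Variable I : (Cn -> R) -> R.
Hypothesis HI : rot_functional I.

Lemma slice_poly_damp F m (rho s : R) : homogeneous_seq F -> 0 <= rho < s ->
  I (fun z => cabs (slice_poly F m z).[creal rho]) <=
  I (fun z => cabs (slice_poly F m z).[creal s]) /\
  forall b, (forall z, S z -> cabs (slice_poly F m z).[creal s] <= b) ->
    forall z, S z -> cabs (slice_poly F m z).[creal rho] <= b.
Proof.
move=> HF /andP[r0 rs]; have s0 : 0 < s by rewrite (le_lt_trans r0).
have d01 : 0 <= rho / s < 1 by rewrite divr_ge0 ?(ltW s0)//= ltr_pdivrMr// mul1r.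
have [M0 hM] := damping_poly HI m d01.
have HFs := homogeneous_scale s HF.
have [] := hM M0 (slice_poly (scale_seq s F) m) (leqnn _).
    by move=> z; rewrite (leq_trans (size_slice_poly _ _ _)).
  by move=> z i; rewrite slice_poly_rot ?cabs_urootX// mulr1.
  exact: scont_slice_poly.
have E1 : (fun z => (slice_poly (scale_seq s F) m z).[creal (rho / s)]) =
    (fun z => (slice_poly F m z).[creal rho]).
  by apply/funext => z; rewrite slice_poly_scaleV// gt_eqF.
have E2 : (fun z => (slice_poly (scale_seq s F) m z).[1]) =
    (fun z => (slice_poly F m z).[creal s]).
  by apply/funext => z; rewrite slice_poly_scale1.
move=> _ h1 h2 _; split.
  move: h1; congr (_ <= _); congr I; apply/funext => z.
    by rewrite -[RHS]/(cabs ((fun z => _) z)) -E1.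
  by rewrite -[RHS]/(cabs ((fun z => _) z)) -E2.
move=> b hb z Sz; rewrite -(congr1 (fun u => u z) E1); apply: h2 => // w Sw.
by rewrite (congr1 (fun u => u w) E2) hb.
Qed.

End SliceGrowth.

Section ReflectionError.
Variables (R : realType) (n : nat).
Local Notation C := (Cx R).
Local Notation Cn := 'rV[Cx R]_n.
Local Notation S := (@unit_sphere R n).
Variable I : (Cn -> R) -> R.
Hypothesis HI : rot_functional I.

Local Notation T F m rho z := (slice_poly F m z).[creal rho].

(* Partial sums q_i of the dilates f_(r_i) along which f = phi conj f holds on the
   sphere up to an error tending to 0 in measure. *)
Record reflected_seq (F : nat -> Cn -> C) (phi : Cn -> C) (r : nat -> R)
    (m : nat -> nat) (N : R) : Prop := ReflectedSeq {
  refl_hom : homogeneous_seq F;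
  refl_growth : slice_growth F;
  refl_cont : scont phi;
  refl_phi1 : forall z, S z -> cabs (phi z) <= 1;
  refl_r01 : forall i, 0 < r i < 1;
  refl_rlim : forall e : R, 0 < e -> exists i0, forall i, (i0 <= i)%N -> 1 - e <= r i;
  refl_m : forall i, (i <= m i)%N;
  refl_tail : forall i k z, S z -> (m i <= k)%N ->
    cabs (T F k (r i) z - T F (m i) (r i) z) <= i.+1%:R^-1;
  refl_mass : forall i, I (fun z => cabs (T F (m i) (r i) z)) <= N;
  refl_err : forall e : R, 0 < e -> exists i0, forall i, (i0 <= i)%N ->
    I (fun z => Num.min 1 (cabs (T F (m i) (r i) z - phi z * (T F (m i) (r i) z)^*))) <= e }.

Variables (F : nat -> Cn -> C) (phi : Cn -> C) (r : nat -> R) (m : nat -> nat) (N : R).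
Hypothesis HR : reflected_seq F phi r m N.

Local Notation q i := (fun z => T F (m i) (r i) z).
Local Notation err i := (fun z => T F (m i) (r i) z - phi z * (T F (m i) (r i) z)^*).
Local Notation one := (I (fun=> 1)).
Let HF := refl_hom HR.

Lemma scont_slice k rho : scont (fun z => T F k rho z).
Proof. exact: scont_slice_poly. Qed.

Lemma scont_err i : scont (err i).
Proof.
apply: scontB; first exact: scont_slice.
by apply: scontM; [exact: (refl_cont HR)|apply: scont_conj; exact: scont_slice].
Qed.

Lemma one_ge0 : 0 <= one.
Proof. by apply: (rotf_ge0 HI) => //; exact: scont_cst. Qed.

Lemma rotf_dist (u v : Cn -> C) e : scont u -> scont v ->
  (forall z, S z -> cabs (u z - v z) <= e) ->
  I (fun z => cabs (u z)) <= I (fun z => cabs (v z)) + e * one.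
Proof.
move=> cu cv uv; have ce := @scont_cst R n R e.
have cv' := scont_cabs cv.
rewrite -(rotf_cst HI) -(rotfD HI cv' ce).
apply: (rotf_le HI); [exact: scont_cabs|exact: scontDr|].
by move=> z /uv; have := cabs_subl (u z) (v z); lra.
Qed.

Lemma inv_small (e : R) : 0 < e -> exists i0, forall i, (i0 <= i)%N -> i.+1%:R^-1 <= e.
Proof.
move=> e0; exists (Num.Def.truncn e^-1) => i hi.
rewrite invf_ple ?posrE//; have /ltW/le_trans : e^-1 < (Num.Def.truncn e^-1).+1%:R.
  exact: truncnS_gt.
by apply; rewrite ler_nat.
Qed.

(** The inequality is pointwise. Where |err| <= 1, chi is |err| itself. Elsewhere chi = 1 and the
    loss |q| - |q| / 2 is at least |err| / 4, since |err| <= 2 |q|. *)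
Lemma err_split i (chi := fun z => Num.min 1 (cabs (err i z))) :
  I (fun z => cabs (err i z)) <= I chi + 4 * (I (fun z => cabs (q i z)) -
    I (fun z => cabs (q i z) / (1 + chi z))).
Proof.
have ce := scont_cabs (@scont_err i).
have cq := scont_cabs (@scont_slice (m i) (r i)).
have cchi : scont chi by apply: scont_min => //; exact: scont_cst.
have chi0 z : 0 <= chi z by rewrite /chi le_min ler01 cabs_ge0.
have cinv : scont (fun z => cabs (q i z) / (1 + chi z)).
  apply: scontMr => //; apply: scont_inv.
    by apply: scontDr => //; exact: scont_cst.
  by move=> z _; rewrite gt_eqF// ltr_pwDl.
have cN := @scontZr R n (-1) _ cinv.
have cB := scontDr cq cN; have cB4 := @scontZr R n 4 _ cB.
rewrite -[in leRHS]mulN1r -(rotfZ HI _ cinv) -(rotfD HI cq cN) -(rotfZ HI _ cB).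
rewrite -(rotfD HI cchi cB4).
apply: (rotf_le HI); [exact: ce|exact: scontDr|] => z Sz.
have q0 := cabs_ge0 (q i z).
have e2 : cabs (err i z) <= 2 * cabs (q i z).
  rewrite (le_trans (cabsB _ _))// cabsM cabs_conj mulrDl mul1r lerD2l.
  by rewrite ler_piMl//; exact: (refl_phi1 HR).
have [e1|e1] := leP (cabs (err i z)) 1.
  have -> : chi z = cabs (err i z) by rewrite /chi; apply/min_idPr.
  rewrite lerDl mulr_ge0// mulN1r subr_ge0 ler_pdivrMr; last by rewrite ltr_pwDl// cabs_ge0.
  by rewrite ler_peMr// lerDl cabs_ge0.
have -> : chi z = 1 by rewrite /chi; apply/min_idPl; exact: ltW.
rewrite -[1 + 1]/(2%:R) mulN1r; move: q0 e2; move: (cabs _) (cabs (_ - _)) => u v.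
by lra.
Qed.

Lemma mass_bound rho : 0 <= rho < 1 -> exists k0, forall k, (k0 <= k)%N ->
  I (fun z => cabs (T F k rho z)) <= N + one.
Proof.
move=> /andP[r0 r1].
have [i0 hi0] : exists i0, forall i, (i0 <= i)%N -> 1 - (1 - rho) / 2 <= r i.
  by apply: (refl_rlim HR); lra.
have rr : 0 <= rho < r i0 by have := hi0 i0 (leqnn _); lra.
exists (m i0) => k mk; rewrite (le_trans (slice_poly_damp HI _ HF rr).1)//.
rewrite (le_trans (@rotf_dist _ (q i0) i0.+1%:R^-1 _ _ _))//; try exact: scont_slice.
  by move=> z Sz; apply: (refl_tail HR).
rewrite lerD ?(refl_mass HR)// ler_piMl ?one_ge0//.
by rewrite invf_le1// ler1n.
Qed.

(* The total mass of |f| on small spheres exhausts the supremum, and the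
   multiplier bound prevents it from concentrating where the error is large. *)
Lemma err_L1 (e : R) : 0 < e -> exists i0, forall i, (i0 <= i)%N ->
  I (fun z => cabs (err i z)) <= e.
Proof.
(* sup X stands for the supremum over rho of the mean of |f| at radius rho, expressed through
   partial sums. A radius rho is chosen that carries all but e / 20 of it. *)
move=> e0; pose X : set R := [set x | exists rho m0, 0 <= rho < 1 /\
  forall k, (m0 <= k)%N -> x <= I (fun z => cabs (T F k rho z))].
have X0 : X 0.
  exists 0, 0%N; split; first by rewrite lexx ltr01.
  move=> k _; apply: (rotf_ge0 HI); last by move=> z _; exact: cabs_ge0.
  by apply: scont_cabs; exact: scont_slice.
have Xub : has_ubound X.
  exists (N + one) => x [rho [m0 [r01 hx]]]; have [k0 hk0] := mass_bound r01.
  by rewrite (le_trans (hx (maxn m0 k0) (leq_maxl _ _)))// hk0// leq_maxr.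
have hX : has_sup X by split => //; exists 0.
have e5 : 0 < e / 20 by rewrite divr_gt0.
have [x [rho [m0 [r01 hx]]] xs] := sup_adherent e5 hX.
have /andP[r0 r1] := r01.
have [B [t [B0 /andP[t0 t1] hB]]] := slice_growth_tail (refl_growth HR) r01.
(* For late i the relative radius satisfies 2 / (1 - rho / r i) <= 4 / (1 - rho), so the constant of
   [multiplier_bound] is uniform in i. *)
pose K := B * (4 / (1 - rho)).
have r1' : 0 < 1 - rho by rewrite subr_gt0.
have K0 : 0 <= K by rewrite mulr_ge0// divr_ge0// ltW.
have [i1 hi1] : exists i0, forall i, (i0 <= i)%N -> 1 - (1 - rho) / 2 <= r i.
  by apply: (refl_rlim HR); lra.
have [i2 hi2] : exists i0, forall i, (i0 <= i)%N ->
    I (fun z => Num.min 1 (cabs (err i z))) <= e / 4 / (1 + 4 * K).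
  by apply: (refl_err HR); rewrite !divr_gt0// ltr_pwDl// mulr_ge0.
have [i3 hi3] : exists i0, forall i, (i0 <= i)%N -> i.+1%:R^-1 <= e / 20 / (one + 1).
  by apply: inv_small; rewrite !divr_gt0// ltr_wpDl// one_ge0.
exists (maxn m0 (maxn i1 (maxn i2 i3))) => i.
rewrite !geq_max => /and4P[im0 ii1 ii2 ii3].
have /andP[ri0 ri1] := refl_r01 HR i.
have mass : I (fun z => cabs (q i z)) <= sup X + e / 20.
  have : I (fun z => cabs (q i z)) - i.+1%:R^-1 * one <= sup X.
    apply: sup_upper_bound => //; exists (r i), (m i); split; first by rewrite ltW.
    move=> k mk; rewrite lerBlDr.
    apply: rotf_dist; try exact: scont_slice.
    by move=> z Sz; rewrite cabsBC; exact: (refl_tail HR).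
  have : i.+1%:R^-1 * one <= e / 20.
    apply: (@le_trans _ _ (e / 20 / (one + 1) * (one + 1))).
      rewrite ler_pM ?invr_ge0 ?one_ge0 ?hi3//; last by rewrite lerDl.
    by rewrite divfK// gt_eqF// ltr_wpDl// one_ge0.
  by move=> h1; rewrite lerBlDr => /le_trans; apply; rewrite lerD2l.
have rr : rho / r i <= 2 * rho / (1 + rho).
  have := hi1 i ii1 => h.
  by rewrite ler_pdivrMr// mulrAC ler_pdivlMr; nra.
have rri : 0 <= rho / r i < 1.
  rewrite divr_ge0 ?(ltW ri0)//= ltr_pdivrMr// mul1r.
  by have := hi1 i ii1; lra.
pose chi z := Num.min 1 (cabs (err i z)).
have cchi : scont chi.
  by apply: scont_min; [exact: scont_cst|apply: scont_cabs; exact: scont_err].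
have chi01 z : S z -> 0 <= chi z <= 1.
  by move=> _; rewrite /chi le_min ler01 cabs_ge0 ge_min lexx.
have Bz z : S z -> cabs (slice_poly (scale_seq (r i) F) (m i) z).[creal (rho / r i)] <= B.
  move=> Sz; rewrite slice_poly_scaleV ?gt_eqF// (le_trans (slice_poly_le _ _ _ r0))//.
  by have := hB 0%N (m i) z Sz; rewrite expr0 mulr1.
have := multiplier_bound HI (homogeneous_scale (r i) HF) cchi chi01 rri Bz.
have -> : (fun z => cabs (slice_poly (scale_seq (r i) F) (m i) z).[creal (rho / r i)]) =
    (fun z => cabs (T F (m i) rho z)).
  by apply/funext => z; rewrite slice_poly_scaleV// gt_eqF.
have -> : (fun z => cabs (slice_poly (scale_seq (r i) F) (m i) z).[1] / (1 + chi z)) =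
    (fun z => cabs (q i z) / (1 + chi z)).
  by apply/funext => z; rewrite slice_poly_scale1.
move=> mb.
have Ichi0 : 0 <= I chi by apply: (rotf_ge0 HI) => // z /chi01/andP[].
have hK : B * (2 / (1 - rho / r i)) * I chi <= K * I chi.
  apply: ler_wpM2r => //; apply: ler_wpM2l => //.
  have h : (1 - rho) / 2 <= 1 - rho / r i.
    apply: (@le_trans _ _ ((1 - rho) / (1 + rho))).
      by rewrite ler_pM2l// lef_pV2 ?posrE; lra.
    apply: (@le_trans _ _ (1 - 2 * rho / (1 + rho))); last by lra.
    rewrite ler_pdivrMr; last by lra.
    rewrite mulrBl mul1r divfK; last by apply/eqP; lra.
    by lra.
  rewrite ler_pdivrMr; last by lra.
  rewrite mulrAC ler_pdivlMr//; lra.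
have split := err_split i; rewrite -/chi in split.
have chie : (1 + 4 * K) * I chi <= e / 4.
  rewrite mulrC -ler_pdivlMr; first exact: hi2.
  by rewrite ltr_pwDl// mulr_ge0.
have hx' := le_trans (hx (m i) (leq_trans im0 (refl_m HR i))) mb.
have xs' : sup X - e / 20 < x by [].
(* The mass lost on division by 1 + chi is at most e / 10 + K * I chi. Four times this plus I chi is
   at most 2 e / 5 + (1 + 4 K) * I chi, and the last term is at most e / 4. *)
by rewrite (le_trans split)//; lra.
Qed.

End ReflectionError.

(** * Blocks of a reflected sequence *)

Section BlockDecay.
Variables (R : realType) (n : nat).
Local Notation C := (Cx R).
Local Notation Cn := 'rV[Cx R]_n.
Local Notation S := (@unit_sphere R n).
Variable I : (Cn -> R) -> R.
Hypothesis HI : rot_functional I.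

Local Notation T F m rho z := (slice_poly F m z).[creal rho].

Lemma rotf_sum (J : Type) (s : seq J) (u : J -> Cn -> R) :
  (forall j, scont (u j)) ->
  I (fun z => \sum_(j <- s) u j z) = \sum_(j <- s) I (u j).
Proof.
move=> cu; elim: s => [|j s ih].
  rewrite big_nil -[RHS](rotf0 HI); congr I.
  by apply/funext => z; rewrite big_nil.
rewrite big_cons -ih -(rotfD HI (cu j)); last exact: scont_sumr.
by congr I; apply/funext => z; rewrite big_cons.
Qed.

Lemma eq_mean_grid M (u v : C -> C) :
  (forall k, u (uroot R M ^+ k) = v (uroot R M ^+ k)) -> mean M u = mean M v.
Proof. by move=> uv; congr (_ * _); apply: eq_bigr => i _. Qed.

Lemma mean_exchange M (u : C -> C -> C) :
  mean M (fun w => mean M (fun l => u w l)) = mean M (fun l => mean M (fun w => u w l)).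
Proof.
rewrite /mean; congr (_ * _).
rewrite -!mulr_sumr exchange_big; congr (_ * _).
Qed.

(** On the circle the monomials l^i conj(l)^(2^j) with i <= 2 * 2^j are the frequencies from -2^j to
    2^j. Nothing is asked of the way [c] depends on z. *)
Definition slice_approx (phi : Cn -> C) (a B : R) := forall j z, S z ->
  exists c : nat -> C, forall l, cabs l = 1 ->
    cabs (phi (l *: z) - \sum_(i < (2 * 2 ^ j).+1) c i * (l ^+ i * l^* ^+ (2 ^ j))) <=
    B * a ^+ j.

Section Operators.
Variables (phi : Cn -> C) (a B : R).
Hypotheses (phi_cont : scont phi) (phi_approx : slice_approx phi a B).

(** A replacement for the approximants of [slice_approx] that is continuous in z and loses only a
    constant factor. *)
Definition vp_mean M L z := mean M (fun l => creal (vp_kernel L l) * phi (l *: z)).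

Lemma scont_vp_mean M L : scont (vp_mean M L).
Proof. by apply: scont_mean => l l1; apply: scontZ; exact: scont_rot. Qed.

Lemma vp_mean_approx M j z : (4 * 2 ^ j <= M)%N -> S z ->
  cabs (phi z - vp_mean M (2 ^ j) z) <= 4 * (B * a ^+ j).
Proof.
move=> jM Sz; have [c hc] := phi_approx j Sz.
have L0 : (0 < 2 ^ j)%N by rewrite expn_gt0.
pose p l : C := \sum_(i < (2 * 2 ^ j).+1) c i * (l ^+ i * l^* ^+ (2 ^ j)).
have p1 : mean M (fun l => creal (vp_kernel (2 ^ j) l) * p l) = p 1.
  rewrite (@eq_mean _ _ _ (fun l => \sum_(i < (2 * 2 ^ j).+1)
    c i * (creal (vp_kernel (2 ^ j) l) * (l ^+ i * l^* ^+ (2 ^ j))))); last first.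
    by move=> l _; rewrite /p mulr_sumr; apply: eq_bigr => i _; rewrite mulrCA.
  rewrite mean_sum; apply: eq_bigr => i _.
  rewrite meanZ vp_reproduces//; last by rewrite -ltnS.
  by rewrite [in RHS]conjC1 !expr1n !mulr1.
have h1 := hc 1 (cabs1 R); rewrite scale1r -/(p 1) in h1.
have -> : phi z - vp_mean M (2 ^ j) z = (phi z - p 1) -
    mean M (fun l => creal (vp_kernel (2 ^ j) l) * (phi (l *: z) - p l)).
  rewrite (@eq_mean _ M _ (fun l => creal (vp_kernel (2 ^ j) l) * phi (l *: z) -
    creal (vp_kernel (2 ^ j) l) * p l)); last by move=> l _; rewrite mulrBr.
  by rewrite meanB p1 /vp_mean; ring.
(* One unit for the approximation at the centre, three for the L^1 norm of the kernel. *)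
have -> : 4 * (B * a ^+ j) = B * a ^+ j + B * a ^+ j * 3 by ring.
rewrite (le_trans (cabsB _ _))// lerD//.
have Ba : 0 <= B * a ^+ j by rewrite (le_trans (cabs_ge0 _) h1).
apply: (@le_trans _ _ (rmean M (fun l => B * a ^+ j * `|vp_kernel (2 ^ j) l|))).
  apply: cabs_mean_le => l l1; rewrite cabsM cabs_creal mulrC.
  by apply: ler_wpM2r; [exact: normr_ge0|exact: hc].
rewrite rmeanZ; apply: ler_wpM2l => //; apply: rmean_vp_kernel => //.
by rewrite (leq_trans _ jM)// leq_mul2r orbT.
Qed.

(** The kernel sits at scale 2^(j+1) and not 2^j, because the subtracted mean has degree below 2 *
    2^j and must be annihilated. *)
Definition reflect_block M j (u : Cn -> C) z : C :=
  mean M (fun l => block_kernel (2 ^ j.+1) l *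
    ((phi (l *: z) - vp_mean M (2 ^ j) (l *: z)) * (u (l *: z))^*)).

Lemma scont_reflect_block M j u : scont u -> scont (reflect_block M j u).
Proof.
move=> cu; apply: scont_mean => l l1; apply: scontZ.
apply: scontM; last by apply: scont_conj; exact: scont_rot.
by apply: scontB; [exact: scont_rot|apply: (scont_rot l1); exact: scont_vp_mean].
Qed.

Lemma reflect_block_le M j u z : (4 * 2 ^ j <= M)%N -> S z ->
  cabs (reflect_block M j u z) <= 4 * (B * a ^+ j) *
    rmean M (fun l => cabs (block_kernel (2 ^ j.+1) l) * cabs (u (l *: z))).
Proof.
move=> jM Sz; rewrite -rmeanZ; apply: cabs_mean_le => l l1.
rewrite cabsM mulrCA; apply: ler_wpM2l; first exact: cabs_ge0.
rewrite cabsM cabs_conj; apply: ler_wpM2r; first exact: cabs_ge0.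
by apply: vp_mean_approx => //; exact: sphereZ.
Qed.

Lemma leq_block M j : (4 * 2 ^ j <= M)%N -> (0 < 2 ^ j.+1 <= M)%N.
Proof. by rewrite expn_gt0/= expnS => /(leq_trans _); apply; rewrite leq_mul2r orbT. Qed.

(** The constant 6 is 4 * 3 / 2: the distance of phi to its mean times the L^1 norm of the block
    kernel. *)
Lemma reflect_block_sup M j u b z : (4 * 2 ^ j <= M)%N -> 0 <= b -> 0 <= B * a ^+ j ->
  (forall w, S w -> cabs (u w) <= b) -> S z ->
  cabs (reflect_block M j u z) <= 6 * (B * a ^+ j) * b.
Proof.
move=> jM b0 Ba ub Sz; rewrite (le_trans (reflect_block_le _ jM Sz))//.
have -> : 6 * (B * a ^+ j) * b = 4 * (B * a ^+ j) * (b * (3 / 2)) by field.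
apply: ler_wpM2l; first exact: mulr_ge0.
apply: (@le_trans _ _ (rmean M (fun l => b * cabs (block_kernel (2 ^ j.+1) l)))).
  apply: ler_rmean => l l1; rewrite mulrC; apply: ler_wpM2r; first exact: cabs_ge0.
  by apply: ub; exact: sphereZ.
by rewrite rmeanZ; apply: ler_wpM2l => //; apply: rmean_block_kernel; exact: leq_block.
Qed.

Lemma rotf_block_kernel M j u : (4 * 2 ^ j <= M)%N -> scont u ->
  I (fun z => rmean M (fun l => cabs (block_kernel (2 ^ j.+1) l) * cabs (u (l *: z)))) <=
  3 / 2 * I (fun z => cabs (u z)).
Proof.
move=> jM cu; have cu' := scont_cabs cu.
rewrite (rotf_rmean HI M (fun l => cabs (block_kernel (2 ^ j.+1) l)) cu').
apply: ler_wpM2r; last by apply: rmean_block_kernel; exact: leq_block.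
by apply: (rotf_ge0 HI) => // z _; exact: cabs_ge0.
Qed.

Lemma reflect_blockB M j u v z :
  reflect_block M j u z - reflect_block M j v z = reflect_block M j (fun w => u w - v w) z.
Proof.
rewrite /reflect_block -meanB; apply: eq_mean => l _.
by rewrite -!mulrBr -rmorphB.
Qed.

Variables (F : nat -> Cn -> C) (m : nat) (r : R).
Hypothesis HF : homogeneous_seq F.

Definition mult_seq (b : nat -> R) (G : nat -> Cn -> C) : nat -> Cn -> C :=
  fun k z => creal (b k) * G k z.

Lemma slice_rotE l z : cabs l = 1 ->
  T F m r (l *: z) = \sum_(k < m) (F k z * creal r ^+ k) * l ^+ k.
Proof.
move=> l1; rewrite slice_poly_rot// slice_polyE; apply: eq_bigr => k _.
by rewrite exprMn; ring.
Qed.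

Lemma block_meanE M L z : (0 < L)%N -> (m + 4 * L <= M)%N ->
  T (mult_seq (@block_mult R L) F) m r z =
  mean M (fun l => block_kernel L l * T F m r (l *: z)).
Proof.
move=> L0 mM; rewrite slice_polyE.
rewrite (@eq_mean _ M _ (fun l => block_kernel L l *
  \sum_(k < m) (F k z * creal r ^+ k) * l ^+ k)); last by move=> l l1; rewrite slice_rotE.
rewrite (@block_mean R M L m (fun k => F k z * creal r ^+ k))//.
by apply: eq_bigr => k _; rewrite mulrA.
Qed.

(** For w on the grid the rotation can be moved from phi to the kernel, l w becoming l. For each
    fixed l the dependence on w is then a polynomial of degree below 2^(j+1) times a conjugated
    slice, which the block annihilates. *)
Lemma vp_mean_annihilated M j z : (m + 16 * 2 ^ j <= M)%N ->
  mean M (fun w => block_kernel (2 ^ j.+1) w *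
    (vp_mean M (2 ^ j) (w *: z) * (T F m r (w *: z))^*)) = 0.
Proof.
move=> mM; pose L := (2 ^ j)%N; have L0 : (0 < L)%N by rewrite expn_gt0.
have -> : (2 ^ j.+1 = 2 * L)%N by rewrite expnS.
rewrite (@eq_mean_grid _ _ (fun w => mean M (fun l => phi (l *: z) *
   (block_kernel (2 * L) w * (creal (vp_kernel L (l * w^*)) * (T F m r (w *: z))^*))))).
  rewrite mean_exchange (@eq_mean _ _ _ (fun=> 0)); last first.
    move=> l l1; rewrite meanZ (_ : mean M _ = 0) ?mulr0//.
    have [c hc] := vp_kernel_shift L l.
    rewrite (@eq_mean _ _ _ (fun w => \sum_(a' < 2 * L) \sum_(b' < 2 * L) c a' b' *
      (block_kernel (2 * L) w * (w ^+ b' * w^* ^+ a' *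
        (\sum_(k < m) (F k z * creal r ^+ k) * w ^+ k)^*)))); last first.
      move=> w w1; rewrite hc slice_rotE//; move: (_^*) => X; rewrite mulr_suml mulr_sumr.
      apply: eq_bigr => a' _; rewrite mulr_suml mulr_sumr; apply: eq_bigr => b' _.
      by ring.
    rewrite mean_sum big1// => a' _; rewrite mean_sum big1// => b' _.
    rewrite meanZ (@block_annihilates R M (2 * L) m (fun k => F k z * creal r ^+ k)) ?mulr0//; last exact: ltnW.
      by rewrite muln_gt0.
    by have := ltn_ord a'; have := ltn_ord b'; rewrite -/L in mM; lia.
  by rewrite /mean big1 ?mulr0.
move=> k; have w1 := cabs_urootX R M k; set w := uroot R M ^+ k.
rewrite (_ : vp_mean M L (w *: z) =
    mean M (fun l => phi (l *: z) * creal (vp_kernel L (l * w^*)))); last first.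
  rewrite -(mean_rot M _ k); apply: eq_mean => l _; rewrite scalerA mulrC.
  by rewrite -/w [w * l]mulrC -mulrA mul_conj_unit// mulr1.
rewrite mulrCA -meanZr; apply: eq_mean => l _.
by ring.
Qed.

Lemma block_reflect M j z : (m + 16 * 2 ^ j <= M)%N ->
  T (mult_seq (@block_mult R (2 ^ j.+1)) F) m r z =
  reflect_block M j (fun w => T F m r w) z +
  mean M (fun l => block_kernel (2 ^ j.+1) l *
    (T F m r (l *: z) - phi (l *: z) * (T F m r (l *: z))^*)).
Proof.
move=> mM; rewrite (@block_meanE M) ?expn_gt0//; last first.
  by rewrite expnS; move: mM; lia.
rewrite -[LHS]subr0 -[X in _ - X](vp_mean_annihilated z mM) /reflect_block -meanB -meanD.
by apply: eq_mean => l _; ring.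
Qed.

End Operators.

End BlockDecay.

#[global] Opaque reflect_block vp_mean.

Lemma leq_add_pow m j K : (j < K)%N -> (m + 16 * 2 ^ j <= m + 16 * 2 ^ K)%N.
Proof. by move=> jK; rewrite leq_add2l leq_mul2l leq_exp2l// ltnW. Qed.

Lemma leq_pow_add m j M : (m + 16 * 2 ^ j <= M)%N -> (4 * 2 ^ j <= M)%N.
Proof. lia. Qed.

Lemma chain_bound (R : realType) (x1 x2 x3 xb xq Q e : R) : x1 <= e -> e <= 1 ->
  xb <= Q -> xq - xb <= x2 -> x2 <= x1 + x3 -> xq <= x3 + (Q + 1).
Proof. by lra. Qed.

(** * From convergence in mean to bounded slices and decaying blocks *)

Section Bootstrap.
Variables (R : realType) (n : nat).
Local Notation C := (Cx R).
Local Notation Cn := 'rV[Cx R]_n.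
Local Notation S := (@unit_sphere R n).
Variable I : (Cn -> R) -> R.
Hypothesis HI : rot_functional I.

Local Notation T F m rho z := (slice_poly F m z).[creal rho].

Variables (F : nat -> Cn -> C) (phi : Cn -> C) (r : nat -> R) (m : nat -> nat) (N : R).
Hypothesis HR : reflected_seq I F phi r m N.
Variables (a B : R).
Hypotheses (a01 : 0 < a < 1) (B0 : 0 <= B) (phi_approx : slice_approx phi a B).

Local Notation q i := (fun z => T F (m i) (r i) z).
Local Notation err i := (fun z => T F (m i) (r i) z - phi z * (T F (m i) (r i) z)^*).
Local Notation one := (I (fun=> 1)).
Let HF := refl_hom HR.
Let cphi := refl_cont HR.

Let Ba j : 0 <= B * a ^+ j.
Proof. by rewrite mulr_ge0// exprn_ge0// ltW; case/andP: a01. Qed.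

Lemma coef_bound k0 : exists2 D : R, 0 <= D &
  forall z, S z -> \sum_(k < k0) cabs (F k z) <= D.
Proof.
have cs : scont (fun z => \sum_(k < k0) cabs (F k z)).
  by apply: scont_sumr => k _; apply: scont_cabs; exact: (hom_cont HF).
have [D D0 hD] := scont_bounded cs.
by exists D => // z Sz; rewrite (le_trans (ler_norm _))// hD.
Qed.

Lemma low_slice_bound L : exists2 D : R, 0 <= D & forall i z, S z ->
  cabs (T (mult_seq (@low_mult R L) F) (m i) (r i) z) <= D.
Proof.
have [D D0 hD] := coef_bound (2 * L); exists D => // i z Sz.
have /andP[r0 r1] := refl_r01 HR i.
rewrite (le_trans _ (hD z Sz))// slice_polyE (le_trans (cabs_sum _ _ _))//.
have h k : cabs (mult_seq (@low_mult R L) F k z * creal (r i) ^+ k) <=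
    if (k < 2 * L)%N then cabs (F k z) else 0.
  rewrite cabsM -crealX cabs_creal [cabs (mult_seq _ _ _ _)]cabsM cabs_creal.
  have /andP[l0 l1] := low_mult_bound R L k.
  case: ltnP => kL; last by rewrite low_mult0// normr0 !mul0r.
  rewrite !ger0_norm ?exprn_ge0 ?(ltW r0)// mulrAC.
  by rewrite ler_piMl ?cabs_ge0// mulr_ile1 ?exprn_ge0 ?exprn_ile1 ?(ltW r0) ?(ltW r1).
apply: (@le_trans _ _ (\sum_(k < m i) if (k < 2 * L)%N then cabs (F k z) else 0)).
  by apply: ler_sum => k _; exact: h.
rewrite -(big_mkord xpredT (fun k => if (k < 2 * L)%N then cabs (F k z) else 0)).
rewrite -(big_mkord xpredT (fun k => cabs (F k z))).
have [mL|Lm] := leqP (m i) (2 * L).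
  rewrite [leRHS](@big_cat_nat _ _ _ (m i))//= -[leLHS]addr0 lerD//.
    by apply: ler_sum => k _; case: ifP => // _; exact: cabs_ge0.
  by apply: sumr_ge0 => k _; exact: cabs_ge0.
rewrite (@big_cat_nat _ _ _ (2 * L)%N _ (m i))//=; last exact: ltnW.
rewrite -[leRHS]addr0 lerD//; first by apply: ler_sum => k _; case: ifP => // _; exact: cabs_ge0.
by rewrite big_nat big1// => k /andP[Lk _]; rewrite ltnNge Lk.
Qed.

Lemma slice_low_split J K k rho z : (J <= K)%N ->
  T (mult_seq (@low_mult R (2 ^ K)) F) k rho z =
  T (mult_seq (@low_mult R (2 ^ J)) F) k rho z +
  \sum_(J <= j < K) T (mult_seq (@block_mult R (2 ^ j)) F) k rho z.
Proof.
move=> JK; rewrite !slice_polyE.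
rewrite (eq_bigr (fun i : 'I_k => mult_seq (@low_mult R (2 ^ J)) F i z * creal rho ^+ i +
   \sum_(J <= j < K) mult_seq (@block_mult R (2 ^ j)) F i z * creal rho ^+ i)); last first.
  move=> i _; rewrite /mult_seq (low_mult_iter R i JK) crealD creal_sum.
  by rewrite !mulrDl !mulr_suml.
rewrite big_split exchange_big; congr (_ + _); apply: eq_bigr => j _.
by rewrite slice_polyE.
Qed.

Lemma slice_high_small rho : 0 <= rho < 1 -> forall e : R, 0 < e ->
  exists K0, forall K k z, (K0 <= K)%N -> S z ->
    cabs (T F k rho z - T (mult_seq (@low_mult R (2 ^ K)) F) k rho z) <= e.
Proof.
move=> r01 e e0; have /andP[r0 r1] := r01.
have [D [t [D0 t01 hD]]] := slice_growth_tail (refl_growth HR) r01.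
have eD : 0 < e / (D + 1) by rewrite divr_gt0// ltr_wpDl.
have [K0 hK0] := exp_small t01 eD.
exists K0 => K k z K0K Sz; have /andP[t0 t1] := t01.
have De : D * t ^+ (2 ^ K) <= e.
  apply: (@le_trans _ _ (D * (e / (D + 1)))).
    rewrite ler_wpM2l// (le_trans _ hK0)// ler_wiXn2l//; first exact: ltW.
    by rewrite (leq_trans K0K)// ltnW// ltn_expl.
  by rewrite mulrCA ler_piMr ?(ltW e0)// ler_pdivrMr ?mul1r ?lerDl// ltr_wpDl.
rewrite (le_trans _ De)// !slice_polyE -sumrB (le_trans (cabs_sum _ _ _))//.
have h i : cabs (F i z * creal rho ^+ i - mult_seq (@low_mult R (2 ^ K)) F i z * creal rho ^+ i)
    <= if (i < 2 ^ K)%N then 0 else cabs (F i z) * rho ^+ i.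
  rewrite -mulrBl /mult_seq -[X in X - _]mul1r -mulrBl -creal1 -crealB.
  rewrite cabsM -crealX cabs_creal [cabs (creal _ * _)]cabsM cabs_creal.
  have /andP[l0 l1] := low_mult_bound R (2 ^ K) i.
  rewrite (ger0_norm (exprn_ge0 i r0)).
  case: ltnP => iK.
    by rewrite low_mult1 ?expn_gt0// ?subrr ?normr0 ?mul0r// ltnW.
  rewrite ler_wpM2r ?exprn_ge0// ler_piMl ?cabs_ge0//.
  by rewrite ger0_norm ?subr_ge0// gerBl.
apply: (@le_trans _ _ (\sum_(i < k) if (i < 2 ^ K)%N then 0 else cabs (F i z) * rho ^+ i)).
  by apply: ler_sum => i _; exact: h.
rewrite -(big_mkord xpredT (fun i => if (i < 2 ^ K)%N then 0 else cabs (F i z) * rho ^+ i)).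
rewrite (le_trans _ (hD (2 ^ K)%N k z Sz))//.
have [mL|Lm] := leqP k (2 ^ K).
  rewrite big_nat big1 ?big_geq// => i /andP[_ ik].
  by rewrite (leq_trans ik mL).
rewrite (@big_cat_nat _ _ _ (2 ^ K)%N _ k)//=; last exact: ltnW.
rewrite -[leRHS]add0r lerD//.
  by rewrite big_nat big1// => i /andP[_ ->].
apply: ler_sum => i _; case: ifP => // _.
by rewrite mulr_ge0 ?cabs_ge0// exprn_ge0.
Qed.

Lemma block_err_le i j M u : (m i + 16 * 2 ^ j <= M)%N -> scont u ->
  I (fun z => cabs (T (mult_seq (@block_mult R (2 ^ j.+1)) F) (m i) (r i) z -
                    reflect_block phi M j u z)) <=
  6 * (B * a ^+ j) * I (fun z => cabs (q i z - u z)) +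
  3 / 2 * I (fun z => cabs (err i z)).
Proof.
move=> mM cu; have jM := leq_pow_add mM.
have cq := @scont_slice _ _ _ _ _ _ _ _ HR (m i) (r i).
have cd : scont (fun z => q i z - u z) by exact: scontB.
have ce := @scont_err _ _ _ _ _ _ _ _ HR i.
have c1 := @scont_rmean R n M (fun l => cabs (block_kernel (2 ^ j.+1) l)) _ (scont_cabs cd).
have c2 := @scont_rmean R n M (fun l => cabs (block_kernel (2 ^ j.+1) l)) _ (scont_cabs ce).
have c1' := @scontZr R n (4 * (B * a ^+ j)) _ c1.
have -> : 6 * (B * a ^+ j) * I (fun z => cabs (q i z - u z)) =
    4 * (B * a ^+ j) * (3 / 2 * I (fun z => cabs (q i z - u z))) by field.
apply: (@le_trans _ _ (I (fun z => 4 * (B * a ^+ j) *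
   rmean M (fun l => cabs (block_kernel (2 ^ j.+1) l) * cabs (q i (l *: z) - u (l *: z))) +
   rmean M (fun l => cabs (block_kernel (2 ^ j.+1) l) * cabs (err i (l *: z)))))).
  apply: (rotf_le HI); [|exact: scontDr|].
    apply: scont_cabs; apply: scontB; last exact: scont_reflect_block.
    apply: scont_slice_poly; exact: homogeneous_mult.
  move=> z Sz; rewrite (@block_reflect R n phi F (m i) (r i) HF M j z mM).
  rewrite addrAC reflect_blockB (le_trans (cabsD _ _))// lerD//.
    exact: (@reflect_block_le R n phi a B phi_approx M j (fun w => q i w - u w) z jM Sz).
  by apply: cabs_mean_le => l l1; rewrite cabsM.
rewrite (rotfD HI c1' c2) (rotfZ HI _ c1) lerD//.
  apply: ler_wpM2l; first by rewrite mulr_ge0.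
  exact: (rotf_block_kernel HI jM cd).
exact: (rotf_block_kernel HI jM ce).
Qed.

(** The distance in mean to the continuous functions bounded by [M1], uniformly over all radii.
    Unlike the supremum of |f|, it is controlled by the H^1 bound alone. *)
Definition approx_by (M1 d : R) := forall rho, 0 <= rho < 1 ->
  exists b : Cn -> C, [/\ scont b, forall z, S z -> cabs (b z) <= M1 &
    exists k0, forall k, (k0 <= k)%N -> I (fun z => cabs (T F k rho z - b z)) <= d].

(** The new approximant keeps the low frequencies exactly and replaces conj f by conj b in the
    blocks. One and the same sum, at most 1 / 2, bounds its supremum by M0 + M1 / 2 and its distance
    to the slice by d / 2; the reflection error enters once per block, whence the factor K. *)
Lemma reflect_step i J K b M0 M1 d e : (J <= K)%N -> 0 <= M1 -> M0 + M1 / 2 <= M1 ->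
  (forall z, S z -> cabs (T (mult_seq (@low_mult R (2 ^ J.+1)) F) (m i) (r i) z) <= M0) ->
  \sum_(J <= j < K) 6 * (B * a ^+ j) <= 2^-1 ->
  scont b -> (forall z, S z -> cabs (b z) <= M1) ->
  I (fun z => cabs (q i z - b z)) <= d -> I (fun z => cabs (err i z)) <= e ->
  exists b1, [/\ scont b1, forall z, S z -> cabs (b1 z) <= M1 &
    I (fun z => cabs (T (mult_seq (@low_mult R (2 ^ K.+1)) F) (m i) (r i) z - b1 z)) <=
    d / 2 + K%:R * (3 / 2 * e)].
Proof.
move=> JK M1ge M01 hlow hsum cb bM qb ee.
pose M := (m i + 16 * 2 ^ K)%N.
have jM j : (j < K)%N -> (m i + 16 * 2 ^ j <= M)%N by exact: leq_add_pow.
pose b1 z := T (mult_seq (@low_mult R (2 ^ J.+1)) F) (m i) (r i) z +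
  \sum_(J <= j < K) reflect_block phi M j b z.
have cT c : scont (fun z => T (mult_seq c F) (m i) (r i) z).
  by apply: scont_slice_poly; exact: homogeneous_mult.
have cb1 : scont b1.
  by apply: scontD; [exact: cT|apply: scont_sum => j _; exact: scont_reflect_block].
have d0 : 0 <= d.
  rewrite (le_trans _ qb)//; apply: (rotf_ge0 HI); last by move=> z _; exact: cabs_ge0.
  by apply: scont_cabs; apply: scontB cb; exact: (@scont_slice _ _ _ _ _ _ _ _ HR).
have e0 : 0 <= e.
  rewrite (le_trans _ ee)//; apply: (rotf_ge0 HI); last by move=> z _; exact: cabs_ge0.
  by apply: scont_cabs; exact: (@scont_err _ _ _ _ _ _ _ _ HR).
exists b1; split => //.
  move=> z Sz; rewrite (le_trans _ M01)// (le_trans (cabsD _ _))// lerD ?hlow//.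
  rewrite (le_trans (cabs_sum _ _ _))//.
  apply: (@le_trans _ _ (\sum_(J <= j < K) 6 * (B * a ^+ j) * M1)).
    rewrite big_nat [leRHS]big_nat; apply: ler_sum => j /andP[_ jK].
    by apply: (reflect_block_sup phi_approx) => //; exact: leq_pow_add (jM j jK).
  by rewrite -mulr_suml mulrC ler_wpM2l.
have UE z : T (mult_seq (@low_mult R (2 ^ K.+1)) F) (m i) (r i) z - b1 z =
    \sum_(J <= j < K) (T (mult_seq (@block_mult R (2 ^ j.+1)) F) (m i) (r i) z -
      reflect_block phi M j b z).
  by rewrite (@slice_low_split J.+1 K.+1)// big_add1 /= sumrB /b1; ring.
pose V j z := if (j < K)%N then cabs (T (mult_seq (@block_mult R (2 ^ j.+1)) F) (m i) (r i) z -
  reflect_block phi M j b z) else 0.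
have cV j : scont (V j).
  rewrite /V; case: (j < K)%N; last exact: scont_cst.
  by apply: scont_cabs; apply: scontB; [exact: cT|exact: scont_reflect_block].
apply: (@le_trans _ _ (I (fun z => \sum_(j <- index_iota J K) V j z))).
  apply: (rotf_le HI).
      by apply: scont_cabs; apply: scontB; [exact: cT|exact: cb1].
    by apply: scont_sumr => j _; exact: cV.
  move=> z Sz; rewrite UE (le_trans (cabs_sum _ _ _))//.
  by rewrite big_nat [leRHS]big_nat; apply: ler_sum => j /andP[_ jK]; rewrite /V jK.
rewrite (rotf_sum HI _ cV).
apply: (@le_trans _ _ (\sum_(J <= j < K) (6 * (B * a ^+ j) * d + 3 / 2 * e))).
  rewrite big_nat [leRHS]big_nat; apply: ler_sum => j /andP[_ jK].
  rewrite /V jK (le_trans (block_err_le (jM j jK) cb))// lerD//.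
    by apply: ler_wpM2l => //; exact: mulr_ge0.
  by apply: ler_wpM2l.
rewrite big_split /= -mulr_suml; apply: lerD.
  by rewrite mulrC ler_wpM2l.
rewrite sumr_const_nat -[leLHS]mulr_natl ler_wpM2r//.
  by rewrite mulr_ge0.
by rewrite ler_nat leq_subr.
Qed.

(** The reflection identity is available at the radii r i, whereas [approx_by] concerns every
    radius. A nonnegative kernel of mean 1 carries an approximant to a smaller radius without
    increasing its bound or its distance. *)
Lemma damp_step G k rho s b M1 d : homogeneous_seq G -> 0 <= rho < s ->
  scont b -> (forall z, S z -> cabs (b z) <= M1) ->
  I (fun z => cabs (T G k s z - b z)) <= d ->
  exists b1, [/\ scont b1, forall z, S z -> cabs (b1 z) <= M1 &
    I (fun z => cabs (T G k rho z - b1 z)) <= d].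
Proof.
move=> HG /andP[r0 rs] cb bM hd; have s0 : 0 < s by rewrite (le_lt_trans r0).
have d01 : 0 <= rho / s < 1 by rewrite divr_ge0 ?(ltW s0)//= ltr_pdivrMr// mul1r.
have [K [M [K0 hK]]] := poisson_kernel k d01.
have K1 : rmean M K = 1 by apply: rmean_poisson; rewrite hK.
have cT : scont (fun z => T G k s z) by exact: scont_slice_poly.
have TE z : T G k rho z = mean M (fun l => creal (K l) * T G k s (l *: z)).
  rewrite -(@slice_poly_scaleV _ _ _ _ rho s) ?gt_eqF//.
  rewrite (horner_poisson (fun j => hK M j (leqnn M))); last first.
    by rewrite (leq_trans (size_slice_poly _ _ _)).
  apply: eq_mean => l l1; congr (_ * _).
  by rewrite slice_poly_scale mulrC slice_poly_rot.
pose b1 z := mean M (fun l => creal (K l) * b (l *: z)).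
have cb1 : scont b1.
  by apply: scont_mean => l l1; apply: scontZ; exact: (scont_rot l1 cb).
exists b1; split => //.
  move=> z Sz; apply: (@le_trans _ _ (rmean M (fun l => M1 * K l))).
    apply: cabs_mean_le => l l1; rewrite cabsM cabs_creal ger0_norm// mulrC.
    by rewrite ler_wpM2r// bM//; exact: sphereZ.
  by rewrite rmeanZ K1 mulr1.
have cd := scont_cabs (scontB cT cb).
rewrite (le_trans _ hd)// -[leRHS]mul1r -K1 -(rotf_rmean HI M K cd).
apply: (rotf_le HI).
    by apply: scont_cabs; apply: scontB cb1; exact: scont_slice_poly.
  exact: (@scont_rmean R n M K _ cd).
move=> z Sz; rewrite TE -meanB; apply: cabs_mean_le => l l1.
by rewrite -mulrBr cabsM cabs_creal ger0_norm.
Qed.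

Lemma slice_poly_trunc (G : nat -> Cn -> C) k0 k z : (k0 <= k)%N ->
  (forall j, (k0 <= j)%N -> G j z = 0) -> slice_poly G k z = slice_poly G k0 z.
Proof.
move=> kk G0; apply/polyP => j; rewrite !coef_slice_poly.
case: ltnP => [jk|kj]; first by case: ltnP => // /G0.
by rewrite ltnNge (leq_trans kk kj).
Qed.

Lemma rotf_dist_cst (u v w : Cn -> C) e : scont u -> scont v -> scont w ->
  (forall z, S z -> cabs (u z - v z) <= e) ->
  I (fun z => cabs (u z - w z)) <= I (fun z => cabs (v z - w z)) + e * one.
Proof.
move=> cu cv cw uv; apply: (rotf_dist HI (scontB cu cw) (scontB cv cw)) => z Sz.
rewrite (_ : _ - _ = u z - v z); first exact: uv.
by ring.
Qed.

Lemma le_divD1 (e o : R) : 0 <= e -> 0 <= o -> e / (o + 1) * o <= e.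
Proof.
by move=> e0 o0; rewrite mulrAC ler_pdivrMr ?ltr_wpDl// ler_wpM2l// lerDl.
Qed.

(* One application of f = S + sum_j D_j ((phi - phi_j) conj f) nearly halves the
   distance in mean to the continuous functions bounded by M1. *)
Lemma approx_by_step J M0 M1 : 0 <= M1 -> M0 + M1 / 2 <= M1 ->
  (forall i z, S z -> cabs (T (mult_seq (@low_mult R (2 ^ J.+1)) F) (m i) (r i) z) <= M0) ->
  (forall K, \sum_(J <= j < K) 6 * (B * a ^+ j) <= 2^-1) ->
  forall d, 0 < d -> approx_by M1 d -> approx_by M1 (3 / 4 * d).
Proof.
move=> M1ge M01 hlow hsum d d0 Hd rho r01; have /andP[r0 r1] := r01.
have o0 := one_ge0 HI; have o1 : 0 < one + 1 by rewrite ltr_wpDl.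
have e1 : 0 < d / 16 / (one + 1) by rewrite !divr_gt0.
have [K0 hK0] := slice_high_small r01 e1.
pose K := maxn J K0; have JK : (J <= K)%N by exact: leq_maxl.
have KK0 : (K0 <= K.+1)%N by rewrite leqW// leq_maxr.
have [i1 hi1] : exists i0, forall i, (i0 <= i)%N -> 1 - (1 - rho) / 2 <= r i.
  by apply: (refl_rlim HR); lra.
have e2 : 0 < d / 16 / (3 / 2 * K.+1%:R) by rewrite !divr_gt0// mulr_gt0.
have [i2 hi2] := err_L1 HI HR e2.
have [i3 hi3] := @inv_small R _ e1.
(* The last term makes m i exceed the degree of the low-pass part, so that truncation at m i, or at
   any later k, leaves it unchanged. *)
pose i := maxn i1 (maxn i2 (maxn i3 (2 * 2 ^ K.+1))).
have [ii1 ii2 ii3 ii4] : [/\ (i1 <= i)%N, (i2 <= i)%N, (i3 <= i)%N & (2 * 2 ^ K.+1 <= i)%N].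
  by rewrite /i !leq_max !leqnn !orbT.
have /andP[ri0 ri1] := refl_r01 HR i.
have ri01 : 0 <= r i < 1 by rewrite (ltW ri0).
have rri : 0 <= rho < r i by rewrite r0; have := hi1 i ii1; lra.
have [b [cb bM [k0 hk0]]] := Hd (r i) ri01.
have cq k s : scont (fun z => T F k s z) by exact: scont_slice_poly.
have small : i.+1%:R^-1 * one <= d / 16.
  rewrite (le_trans (ler_wpM2r o0 (hi3 i ii3)))// le_divD1//.
  by rewrite divr_ge0// ltW.
have qb : I (fun z => cabs (q i z - b z)) <= d + d / 16.
  pose k := maxn k0 (m i).
  have h : forall z, S z -> cabs (q i z - T F k (r i) z) <= i.+1%:R^-1.
    by move=> z Sz; rewrite cabsBC; apply: (refl_tail HR) => //; exact: leq_maxr.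
  apply: le_trans (rotf_dist_cst (cq _ _) (cq _ _) cb h) _.
  by rewrite lerD// hk0// leq_maxl.
have [b1 [cb1 b1M hb1]] := reflect_step JK M1ge M01 (hlow i) (hsum K) cb bM qb (hi2 i ii2).
have HG : homogeneous_seq (mult_seq (@low_mult R (2 ^ K.+1)) F).
  exact: homogeneous_mult.
have [b2 [cb2 b2M hb2]] := damp_step HG rri cb1 b1M hb1.
exists b2; split => //; exists (m i) => k mk.
have h z : S z -> cabs (T F k rho z - T (mult_seq (@low_mult R (2 ^ K.+1)) F) (m i) rho z) <=
    d / 16 / (one + 1).
  move=> Sz; rewrite -(@slice_poly_trunc _ (m i) k)//; first exact: hK0.
  move=> j mj; rewrite /mult_seq low_mult0 ?creal0 ?mul0r//.
  exact: leq_trans ii4 (leq_trans (refl_m HR i) mj).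
have cG : scont (fun z => T (mult_seq (@low_mult R (2 ^ K.+1)) F) (m i) rho z).
  exact: scont_slice_poly.
apply: le_trans (rotf_dist_cst (cq k rho) cG cb2 h) _.
have h1 : d / 16 / (one + 1) * one <= d / 16 by rewrite le_divD1// divr_ge0// ltW.
have h2 : K%:R * (3 / 2 * (d / 16 / (3 / 2 * K.+1%:R))) <= d / 16.
  have -> : 3 / 2 * (d / 16 / (3 / 2 * K.+1%:R)) = d / 16 / K.+1%:R.
    have : K.+1%:R != 0 :> R by rewrite pnatr_eq0.
    by move: (K.+1%:R : R) => x x0; field.
  by rewrite mulrCA ler_piMr ?ler_pdivrMr ?mul1r ?ler_nat ?ltr0n//; lra.
apply: (@le_trans _ _ ((d + d / 16) / 2 + d / 16 + d / 16)); last by lra.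
by apply: lerD h1; apply: le_trans hb2 _; rewrite lerD2l.
Qed.

Lemma approx_by_small J M0 M1 : 0 <= M1 -> M0 + M1 / 2 <= M1 ->
  (forall i z, S z -> cabs (T (mult_seq (@low_mult R (2 ^ J.+1)) F) (m i) (r i) z) <= M0) ->
  (forall K, \sum_(J <= j < K) 6 * (B * a ^+ j) <= 2^-1) ->
  forall e, 0 < e -> approx_by M1 e.
Proof.
move=> M1ge M01 hlow hsum e e0.
have N0 : 0 <= N.
  rewrite (le_trans _ (refl_mass HR 0))//; apply: (rotf_ge0 HI).
    by apply: scont_cabs; exact: scont_slice_poly.
  by move=> z _; exact: cabs_ge0.
have o0 := one_ge0 HI; have D0 : 0 < N + one + 1 by rewrite ltr_wpDl// addr_ge0.
have H k : approx_by M1 ((3 / 4) ^+ k * (N + one + 1)).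
  elim: k => [|k ih].
    move=> rho r01; have [k0 hk0] := mass_bound HI HR r01.
    exists (fun=> 0); split; first exact: scont_cst.
      by move=> z _; rewrite cabs0.
    exists k0 => k /hk0; rewrite expr0 mul1r => h.
    under eq_fun do rewrite subr0.
    by rewrite (le_trans h)// lerDl.
  rewrite exprS -mulrA; apply: (approx_by_step M1ge M01 hlow hsum) ih.
  by rewrite mulr_gt0 ?exprn_gt0.
have t01 : 0 <= (3 / 4 : R) < 1 by lra.
have [k hk] := exp_small t01 (divr_gt0 e0 D0).
move=> rho /(H k)[b [cb bM [k0 hb]]]; exists b; split => //; exists k0 => j /hb h.
by rewrite (le_trans h)// -ler_pdivlMr.
Qed.

Lemma slice_bounded : exists2 Q : R, 0 <= Q & forall i z, S z -> cabs (q i z) <= Q.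
Proof.
have /andP[a0 a1] := a01.
have a01' : 0 <= a < 1 by rewrite (ltW a0).
have a1' : 0 < 1 - a by rewrite subr_gt0.
(* Once a^J is below this number, the geometric tail 6 B a^J / (1 - a) is at most 1 / 2. *)
have c0 : 0 < (1 - a) / (12 * B + 1) by rewrite divr_gt0// ltr_wpDl// mulr_ge0.
have [J hJ] := exp_small a01' c0.
have hsum K : \sum_(J <= j < K) 6 * (B * a ^+ j) <= 2^-1.
  under eq_bigr do rewrite mulrA.
  rewrite -mulr_sumr (le_trans (ler_wpM2l _ (geometric_sum_le J K a01')))//.
    by rewrite mulr_ge0.
  have hB : a ^+ J * (12 * B + 1) <= 1 - a by rewrite -ler_pdivlMr// ltr_wpDl// mulr_ge0.
  have := exprn_ge0 J (ltW a0) => aJ.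
  by rewrite mulrA ler_pdivrMr//; nra.
have [M0 M00 hM0] := low_slice_bound (2 ^ J.+1).
(* 2 M0 is the fixed point of x -> M0 + x / 2. *)
have M1ge : 0 <= 2 * M0 by rewrite mulr_ge0.
have M01 : M0 + 2 * M0 / 2 <= 2 * M0 by lra.
have H := approx_by_small M1ge M01 hM0 hsum.
exists (2 * M0 + 1); first by rewrite addr_ge0.
move=> i; have /andP[ri0 ri1] := refl_r01 HR i.
(* The mean of this continuous excess is at most the distance in mean to functions bounded by 2 M0,
   hence 0, and faithfulness makes it vanish at every point. The extra 1 absorbs the tail beyond m
   i. *)
pose u z := Num.max 0 (cabs (q i z) - (2 * M0 + 1)).
have cq k : scont (fun z => T F k (r i) z) by exact: scont_slice_poly.
have cu : scont u.
  apply: scont_max; first exact: scont_cst.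
  by apply: scontBr (@scont_cst R n R _); apply: scont_cabs; exact: cq.
have u0 z : 0 <= u z by rewrite /u le_max lexx.
have Iu : I u <= 0.
  apply/ler_addgt0Pl => e e0; rewrite addr0.
  have ri01 : 0 <= r i < 1 by rewrite (ltW ri0).
  have [b [cb bM [k0 hk0]]] := H e e0 (r i) ri01.
  rewrite (le_trans _ (hk0 (maxn k0 (m i)) (leq_maxl _ _)))//.
  apply: (rotf_le HI); [exact: cu|exact: (scont_cabs (scontB (cq _) cb))|].
  move=> z Sz; rewrite /u ge_max cabs_ge0/= lerBlDr.
  have h1 := refl_tail HR Sz (leq_maxr k0 (m i)).
  have h2 : i.+1%:R^-1 <= 1 :> R by rewrite invf_le1// ler1n.
  have := cabs_triangle (T F (maxn k0 (m i)) (r i) z) (q i z) (b z).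
  have := cabs_subl (q i z) (b z); have := bM z Sz.
  rewrite cabsBC in h1; exact: chain_bound h1 h2.
move=> z Sz; have := rotf_faithful HI cu (fun w _ => u0 w) Iu Sz.
by rewrite /u => /eqP; rewrite eq_maxl subr_le0.
Qed.

(** For a fixed block the radii r i may tend to 1: it has finitely many frequencies, its reflected
    part is bounded by 6 B a^j Q uniformly in i, and the remainder tends to 0 in mean. Continuity
    and faithfulness make the bound pointwise. *)
Lemma block_decay : exists2 D : R, 0 <= D & forall j z, S z ->
  cabs (\sum_(k < 4 * 2 ^ j) creal (block_mult R (2 ^ j) k) * F k z) <= D * a ^+ j.
Proof.
have /andP[a0 a1] := a01; have [Q Q0 hQ] := slice_bounded.
have o0 := one_ge0 HI.
have cG L : scont (fun z => \sum_(k < 4 * L) creal (block_mult R L k) * F k z).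
  by apply: scont_sum => k _; apply: scontZ; exact: (hom_cont HF).
have [D1 D10 hD1] := scont_bounded (scont_cabs (cG 1%N)).
(* The block of index j + 1 is estimated through the approximation of index j, whence the division
   by a; [D1] covers the block of index 0. *)
exists (D1 + 6 * B * Q / a).
  by rewrite addr_ge0// divr_ge0 ?(ltW a0)// !mulr_ge0.
move=> [|j] z Sz.
  rewrite expr0 mulr1 (le_trans (ler_norm _))// (le_trans (hD1 z Sz))//.
  by rewrite lerDl divr_ge0 ?(ltW a0)// !mulr_ge0.
suff : cabs (\sum_(k < 4 * 2 ^ j.+1) creal (block_mult R (2 ^ j.+1) k) * F k z) <=
    6 * (B * a ^+ j) * Q.
  move=> /le_trans; apply; rewrite exprS [in leRHS]mulrDl.
  have -> : 6 * B * Q / a * (a * a ^+ j) = 6 * (B * a ^+ j) * Q.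
    by field; rewrite gt_eqF.
  by rewrite lerDr !mulr_ge0// ?exprn_ge0// ltW.
pose L := (2 ^ j.+1)%N; rewrite -/L; pose G z := \sum_(k < 4 * L) creal (block_mult R L k) * F k z.
rewrite -/(G z); set Dj := 6 * _ * _.
pose u z := Num.max 0 (cabs (G z) - Dj).
have cu : scont u.
  apply: scont_max; first exact: scont_cst.
  by apply: scontBr (@scont_cst R n R _); apply: scont_cabs; exact: cG.
have u0 w : 0 <= u w by rewrite /u le_max lexx.
have [A A0 hA] := coef_bound (4 * L).
have block_close i w : (4 * L <= m i)%N -> S w ->
    cabs (G w - T (mult_seq (@block_mult R L) F) (m i) (r i) w) <=
    2 * (4 * L)%:R * A * (1 - r i).
  move=> Lm Sw; have /andP[ri0 ri1] := refl_r01 HR i.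
  rewrite (@slice_poly_trunc _ (4 * L)%N)//; last first.
    by move=> k Lk; rewrite /mult_seq block_mult0 ?creal0 ?mul0r.
  rewrite slice_polyE -sumrB (le_trans (cabs_sum _ _ _))//.
  have -> : 2 * (4 * L)%:R * A * (1 - r i) = 2 * (4 * L)%:R * (1 - r i) * A by ring.
  apply: le_trans (ler_wpM2l _ (hA w Sw)); last by rewrite !mulr_ge0// subr_ge0 ltW.
  rewrite mulr_sumr; apply: ler_sum => k _.
  rewrite -[X in X - _]mulr1 /mult_seq -mulrBr -creal1 -crealX -crealB.
  rewrite cabsM [cabs (creal _ * _)]cabsM !cabs_creal mulrAC ler_wpM2r ?cabs_ge0//.
  have t1 k0 k1 : tri R L k0 k1 <= 1.
    rewrite /tri ler_pdivrMr ?ltr0n ?expn_gt0// mul1r ler_nat leq_subr//.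
  have bm : `|block_mult R L k| <= 2.
    rewrite /block_mult ger0_norm; last by rewrite addr_ge0 ?divr_ge0 ?tri_ge0.
    by have := t1 k (2 * L)%N; have := t1 k (3 * L)%N; lra.
  have rk : `|1 - r i ^+ k| <= (4 * L)%:R * (1 - r i).
    rewrite ger0_norm ?subr_ge0 ?exprn_ile1 ?(ltW ri0) ?(ltW ri1)//.
    apply: (@le_trans _ _ (k%:R * (1 - r i))); last first.
      by rewrite ler_wpM2r ?subr_ge0 ?(ltW ri1)// ler_nat ltnW.
    elim: (k : nat) => [|p ih]; first by rewrite expr0 subrr mul0r.
    rewrite exprS -natr1 mulrDl mul1r.
    have p1 : r i ^+ p <= 1 by rewrite exprn_ile1 ?(ltW ri0) ?(ltW ri1).
    by move: ih p1; nra.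
  by rewrite -mulrA ler_pM.
have Iu : I u <= 0.
  apply/ler_addgt0Pl => e e0; rewrite addr0.
  have c0 : 0 <= 2 * (4 * L)%:R * A by rewrite !mulr_ge0.
  have e1 : 0 < e / 2 / (2 * (4 * L)%:R * A * one + 1).
    by rewrite !divr_gt0// ltr_wpDl// mulr_ge0.
  have [i1 hi1] := refl_rlim HR e1.
  have e2 : 0 < e / 3 by rewrite divr_gt0.
  have [i2 hi2] := err_L1 HI HR e2.
  pose i := maxn i1 (maxn i2 (4 * L)).
  have [ii1 ii2 ii3] : [/\ (i1 <= i)%N, (i2 <= i)%N & (4 * L <= i)%N].
    by rewrite /i !leq_max !leqnn !orbT.
  pose M := (m i + 16 * 2 ^ j)%N.
  have ce := @scont_err _ _ _ _ _ _ _ _ HR i.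
  have cE := @scont_rmean R n M (fun l => cabs (block_kernel (2 ^ j.+1) l)) _ (scont_cabs ce).
  have cst := @scont_cst R n R (2 * (4 * L)%:R * A * (1 - r i)).
  apply: (@le_trans _ _ (I (fun z => 2 * (4 * L)%:R * A * (1 - r i) +
    rmean M (fun l => cabs (block_kernel (2 ^ j.+1) l) * cabs (err i (l *: z)))))).
    apply: (rotf_le HI); [exact: cu|exact: (scontDr cst cE)|].
    move=> w Sw; rewrite /u ge_max; apply/andP; split.
      rewrite addr_ge0//; last first.
        by apply: rmean_ge0 => l l1; rewrite mulr_ge0 ?cabs_ge0.
      by rewrite mulr_ge0// subr_ge0 ltW//; case/andP: (refl_r01 HR i).
    have h1 := block_close i w (leq_trans ii3 (refl_m HR i)) Sw.
    have jM := leq_pow_add (leqnn M).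
    have h2 := reflect_block_sup phi_approx jM Q0 (Ba j) (hQ i) Sw.
    have h3 : cabs (mean M (fun l => block_kernel (2 ^ j.+1) l * err i (l *: w))) <=
        rmean M (fun l => cabs (block_kernel (2 ^ j.+1) l) * cabs (err i (l *: w))).
      by apply: cabs_mean_le => l l1; rewrite cabsM.
    have E := @block_reflect R n phi F (m i) (r i) HF M j w (leqnn M).
    have h4 := cabsD (reflect_block phi M j (q i) w)
      (mean M (fun l => block_kernel (2 ^ j.+1) l * err i (l *: w))).
    rewrite -E in h4; have h5 := cabs_subl (G w) (T (mult_seq (@block_mult R L) F) (m i) (r i) w).
    by move: h1 h2 h3 h4 h5; rewrite -/L -/Dj; lra.
  rewrite (rotfD HI cst cE) (rotf_cst HI).
  have -> : e = e / 2 + 3 / 2 * (e / 3) by field.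
  apply: lerD.
    have hr : 1 - r i <= e / 2 / (2 * (4 * L)%:R * A * one + 1).
      by have := hi1 i ii1; lra.
    apply: (@le_trans _ _ (2 * (4 * L)%:R * A * one * (e / 2 / (2 * (4 * L)%:R * A * one + 1)))).
      by rewrite mulrAC ler_wpM2l// mulr_ge0.
    by rewrite mulrC le_divD1 ?mulr_ge0 ?divr_ge0 ?(ltW e0).
  apply: le_trans (rotf_block_kernel HI (leq_pow_add (leqnn M)) ce) _.
  by rewrite ler_wpM2l// hi2.
have := rotf_faithful HI cu (fun w _ => u0 w) Iu Sz.
by rewrite /u => /eqP; rewrite eq_maxl subr_le0.
Qed.

End Bootstrap.

(** * Circle invariance of holomorphic means *)

Section Goursat.
Variable R : realType.
Local Notation C := (Cx R).

(** Complex differentiability in the variable s + i t, stated in the two real variables in which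
    rectangles are bisected. *)
Definition plane_diff (G : R -> R -> C) (s0 t0 : R) := exists D : C,
  forall e : R, 0 < e -> exists2 d : R, 0 < d & forall s t : R,
    `|s - s0| < d -> `|t - t0| < d ->
    cabs (G s t - G s0 t0 - D * (creal (s - s0) + 'i * creal (t - t0))) <=
      e * (`|s - s0| + `|t - t0|).

(* Left Riemann sums of G(ds + i dt) along the boundary of [a, a + w] x [c, c + h]. *)
Definition boundary_sum (N : nat) (G : R -> R -> C) (a c w h : R) : C :=
  creal (w / N%:R) *
    (\sum_(k < N) (G (a + k%:R * (w / N%:R)) c - G (a + k%:R * (w / N%:R)) (c + h))) +
  'i * creal (h / N%:R) *
    (\sum_(k < N) (G (a + w) (c + k%:R * (h / N%:R)) - G a (c + k%:R * (h / N%:R)))).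

Lemma sum_halves (N : nat) (u : R -> C) (a w : R) : (0 < N)%N ->
  \sum_(k < N + N) u (a + k%:R * (w / (N + N)%:R)) =
  \sum_(k < N) u (a + k%:R * (w / 2 / N%:R)) +
  \sum_(k < N) u (a + w / 2 + k%:R * (w / 2 / N%:R)).
Proof.
move=> N0; have NR : (N%:R : R) != 0 by rewrite pnatr_eq0 -lt0n.
have E : w / (N + N)%:R = w / 2 / N%:R.
  by rewrite addnn -mul2n natrM invfM mulrA.
rewrite big_split_ord E; congr (_ + _); apply: eq_bigr => k _ /=; congr u.
by rewrite natrD mulrDl addrA; congr (_ + _ + _); rewrite mulrC divfK.
Qed.

(** Exact already for Riemann sums: with N + N nodes per side the nodes of the halves coincide, and
    the inner edges cancel. *)
Lemma boundary_sum_quarters N G a c w h : (0 < N)%N ->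
  boundary_sum (N + N) G a c w h =
  boundary_sum N G a c (w / 2) (h / 2) + boundary_sum N G (a + w / 2) c (w / 2) (h / 2) +
  (boundary_sum N G a (c + h / 2) (w / 2) (h / 2) +
   boundary_sum N G (a + w / 2) (c + h / 2) (w / 2) (h / 2)).
Proof.
move=> N0; rewrite /boundary_sum !sumrB.
rewrite (sum_halves (fun x => G x c)) // (sum_halves (fun x => G x (c + h))) //.
rewrite (sum_halves (fun x => G (a + w) x)) // (sum_halves (fun x => G a x)) //.
have NR : (N%:R : R) != 0 by rewrite pnatr_eq0 -lt0n.
have E x : x / (N + N)%:R = x / 2 / N%:R :> R.
  by rewrite addnn -mul2n natrM invfM mulrA.
have half x y : x + y / 2 + y / 2 = x + y :> R.
  by rewrite -addrA -mulrDl -mulr2n -[y *+ 2]mulr_natr mulfK// pnatr_eq0.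
by rewrite !E !half; ring.
Qed.

Lemma boundary_sumB N G H a c w h :
  boundary_sum N (fun s t => G s t - H s t) a c w h =
  boundary_sum N G a c w h - boundary_sum N H a c w h.
Proof. by rewrite /boundary_sum !sumrB; ring. Qed.

(** Opposite edges differ by a constant, so there is no discretisation error. *)
Lemma boundary_sum_affine N (A D : C) (s0 t0 a c w h : R) : (0 < N)%N ->
  boundary_sum N (fun s t => A + D * (creal (s - s0) + 'i * creal (t - t0))) a c w h = 0.
Proof.
move=> N0; have NR : (N%:R : C) != 0 by rewrite pnatr_eq0 -lt0n.
rewrite /boundary_sum.
under eq_bigr => k _.
  rewrite (_ : _ - _ = - (D * 'i * creal h)); last by rewrite !crealB !crealD; ring.
  over.
under [in X in _ + X]eq_bigr => k _.
  rewrite (_ : _ - _ = D * creal w); last by rewrite !crealB !crealD; ring.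
  over.
have E (x : R) (y : C) : creal (x / N%:R) * (y *+ N) = creal x * y.
  by rewrite -[y *+ N]mulr_natr crealM crealV creal_nat mulrACA mulVf ?mulr1.
rewrite !sumr_const !card_ord (E w) -['i * _ * _]mulrA (E h); ring.
Qed.

Lemma boundary_sum_le N G (a c w h e : R) : 0 <= w -> 0 <= h -> 0 <= e -> (0 < N)%N ->
  (forall s t, a <= s <= a + w -> c <= t <= c + h -> cabs (G s t) <= e) ->
  cabs (boundary_sum N G a c w h) <= 2 * (w + h) * e.
Proof.
move=> w0 h0 e0 N0 He; have NR : (0 : R) < N%:R by rewrite ltr0n.
have step (x : R) k : 0 <= x -> (k < N)%N -> 0 <= k%:R * (x / N%:R) <= x.
  move=> x0 kN; rewrite mulr_ge0 ?divr_ge0 ?ler0n //=.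
  rewrite mulrCA ler_piMr // ler_pdivrMr // mul1r ler_nat; exact: ltnW.
have edge (x : R) (u : nat -> C) (l : C) : 0 <= x -> cabs l = 1 ->
    (forall k, (k < N)%N -> cabs (u k) <= 2 * e) ->
    cabs (l * creal (x / N%:R) * (\sum_(k < N) u k)) <= 2 * x * e.
  move=> x0 l1 hu; rewrite !cabsM l1 mul1r cabs_creal ger0_norm ?divr_ge0 ?ler0n //.
  have : cabs (\sum_(k < N) u k) <= N%:R * (2 * e).
    apply: (le_trans (cabs_sum _ _ _)).
    apply: (@le_trans _ _ (\sum_(k < N) 2 * e)).
      by apply: ler_sum => k _; exact: hu.
    by rewrite sumr_const card_ord -[_ *+ N]mulr_natl.
  move=> hs; apply: (@le_trans _ _ (x / N%:R * (N%:R * (2 * e)))).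
    by apply: ler_wpM2l; rewrite // divr_ge0 ?ler0n.
  by rewrite -mulrA mulKf ?gt_eqF // mulrCA mulrA.
have two (x y : C) : cabs x <= e -> cabs y <= e -> cabs (x - y) <= 2 * e.
  by move=> hx hy; apply: (le_trans (cabsB _ _)); rewrite mulr_natl mulr2n lerD.
have i1 : cabs ('i : C) = 1.
  by apply: cabsE; rewrite normCi creal1.
rewrite mulrDr mulrDl; apply: (le_trans (cabsD _ _)); apply: lerD.
  rewrite -[creal (w / N%:R)]mul1r.
  apply: (edge w (fun k => G (a + k%:R * (w / N%:R)) c - G (a + k%:R * (w / N%:R)) (c + h))) => //.
    exact: cabs1.
  move=> k kN; have := step w k w0 kN => /andP[s0 s1].
  by apply: two; apply: He; rewrite ?lexx ?lerDl ?lerD2l ?s0 ?s1 ?w0 ?h0.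
apply: (edge h (fun k => G (a + w) (c + k%:R * (h / N%:R)) - G a (c + k%:R * (h / N%:R)))) => //.
move=> k kN; have := step h k h0 kN => /andP[s0 s1].
by apply: two; apply: He; rewrite ?lexx ?lerDl ?lerD2l ?s0 ?s1 ?w0 ?h0.
Qed.

Section Bisection.
Variables (G : R -> R -> C) (a0 c0 w0 h0 e : R).
Hypotheses (w0_gt0 : 0 < w0) (h0_gt0 : 0 < h0) (e_gt0 : 0 < e).
Hypothesis G_diff : forall s t, a0 <= s <= a0 + w0 -> c0 <= t <= c0 + h0 -> plane_diff G s t.

(** Smallness for all fine dyadic meshes takes the place of smallness of an integral; the threshold
    may depend on the cell, since only four cells are combined at a time. *)
Let good (m : nat) (p : R * R) : Prop := exists N0, forall k, (N0 <= k)%N ->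
  cabs (boundary_sum (2 ^ k) G p.1 p.2 (w0 / 2 ^+ m) (h0 / 2 ^+ m)) <=
    e * (w0 * h0) / 4 ^+ m.

Let corner (m : nat) (p : R * R) (b : bool * bool) : R * R :=
  (p.1 + b.1%:R * (w0 / 2 ^+ m.+1), p.2 + b.2%:R * (h0 / 2 ^+ m.+1)).

Let good_split m p : (forall b, good m.+1 (corner m p b)) -> good m p.
Proof.
move=> H; have [N1 H1] := H (false, false); have [N2 H2] := H (true, false).
have [N3 H3] := H (false, true); have [N4 H4] := H (true, true).
exists (maxn (maxn N1 N2) (maxn N3 N4)).+1 => -[//|k]; rewrite ltnS !geq_max.
move=> /andP[/andP[k1 k2] /andP[k3 k4]].
rewrite expnS mul2n -addnn boundary_sum_quarters ?expn_gt0 //.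
have half x : x / 2 ^+ m / 2 = x / 2 ^+ m.+1 :> R by rewrite exprS invfM [_^-1 * _ in RHS]mulrC mulrA.
rewrite !half.
have {H1} := H1 _ k1; have {H2} := H2 _ k2; have {H3} := H3 _ k3; have {H4} := H4 _ k4.
rewrite /corner /= !mul1r !mul0r !addr0 => H4 H3 H2 H1.
have -> : e * (w0 * h0) / 4 ^+ m = (e * (w0 * h0) / 4 ^+ m.+1 + e * (w0 * h0) / 4 ^+ m.+1) +
    (e * (w0 * h0) / 4 ^+ m.+1 + e * (w0 * h0) / 4 ^+ m.+1).
  by rewrite exprS; field; rewrite expf_neq0 // pnatr_eq0.
apply: (le_trans (cabsD _ _)); apply: lerD; apply: (le_trans (cabsD _ _)); exact: lerD.
Qed.

Let next m p : R * R :=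
  corner m p (xget (false, false) [set b | ~ good m.+1 (corner m p b)]).

Let next_bad m p : ~ good m p -> ~ good m.+1 (next m p).
Proof.
move=> bad; rewrite /next; case: xgetP => [b _ //|none].
by case: bad; apply: good_split => b; apply: contrapT; exact: none.
Qed.

Let cell := fix cell m := if m is k.+1 then next k (cell k) else (a0, c0).

Let cell_bad : ~ good 0 (a0, c0) -> forall m, ~ good m (cell m).
Proof. by move=> bad; elim=> [//|m IH]; exact: next_bad. Qed.

Let cell_step m : (cell m).1 <= (cell m.+1).1 <= (cell m).1 + w0 / 2 ^+ m.+1 /\
  (cell m).2 <= (cell m.+1).2 <= (cell m).2 + h0 / 2 ^+ m.+1.
Proof.
have hw : 0 <= w0 / 2 ^+ m.+1 by rewrite divr_ge0 ?exprn_ge0 ?ltW.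
have hh : 0 <= h0 / 2 ^+ m.+1 by rewrite divr_ge0 ?exprn_ge0 ?ltW.
rewrite /= /next /corner; case: (xget _ _) => [[] []] /=;
  by rewrite ?mul1r ?mul0r ?addr0 !lerDl !lexx ?hw ?hh.
Qed.

Let nested (x : nat -> R) (w : R) : 0 < w ->
  (forall m, x m <= x m.+1 <= x m + w / 2 ^+ m.+1) ->
  exists s, forall m, x m <= s <= x m + w / 2 ^+ m.
Proof.
move=> w_gt0 hx.
have up m k : x m <= x (m + k)%N <= x m + (w / 2 ^+ m - w / 2 ^+ (m + k)).
  elim: k => [|k /andP[l u]]; first by rewrite addn0 subrr addr0 lexx.
  have /andP[l' u'] := hx (m + k)%N; rewrite addnS (le_trans l l') /=.
  apply: (le_trans u'); apply: (le_trans (lerD u (lexx _))).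
  rewrite -addrA lerD2l -addrA lerD2l exprS.
  rewrite (_ : - _ + _ = - (w / (2 * 2 ^+ (m + k)))) //.
  by field; rewrite expf_neq0 // pnatr_eq0.
have ub m k : x k <= x m + w / 2 ^+ m.
  have hp j : 0 <= w / 2 ^+ j by rewrite divr_ge0 ?exprn_ge0 ?ltW.
  have [mk|km] := leqP m k.
    have /andP[_] := up m (k - m)%N; rewrite subnKC // => /le_trans; apply.
    by rewrite lerD2l lerBlDr lerDl.
  have /andP[+ _] := up k (m - k)%N; rewrite subnKC 1?ltnW // => /le_trans; apply.
  by rewrite lerDl.
exists (sup (range x)) => m; apply/andP; split.
  apply: ub_le_sup; last by exists m.
  by exists (x 0%N + w / 2 ^+ 0) => _ [k _ <-]; exact: ub.
apply: ge_sup; first by exists (x m); exists m.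
by move=> _ [k _ <-]; exact: ub.
Qed.

Lemma goursat_bisection : exists N0, forall k, (N0 <= k)%N ->
  cabs (boundary_sum (2 ^ k) G a0 c0 w0 h0) <= e * (w0 * h0).
Proof.
suff : good 0 (a0, c0) by rewrite /good /= !expr0 !divr1.
apply: contrapT => bad.
have [s hs] : exists s, forall m, (cell m).1 <= s <= (cell m).1 + w0 / 2 ^+ m.
  by apply: nested => // m; exact: (cell_step m).1.
have [t ht] : exists t, forall m, (cell m).2 <= t <= (cell m).2 + h0 / 2 ^+ m.
  by apply: nested => // m; exact: (cell_step m).2.
have [D HD] : plane_diff G s t.
  by apply: G_diff; [have := hs 0%N|have := ht 0%N]; rewrite expr0 divr1.
set S := w0 + h0; have S0 : 0 < S by rewrite addr_gt0.
(* On a cell of generation m, where w + h = S / 2^m, the bound 2 (w + h) * eta * (w + h) with this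
   eta is exactly e * (w0 * h0) / 4^m. *)
have eta0 : 0 < e * (w0 * h0) / (2 * S ^+ 2).
  by rewrite divr_gt0 ?mulr_gt0 ?exprn_gt0.
have [d d0 Hd] := HD _ eta0.
have [m Sm] : exists m : nat, S / 2 ^+ m < d.
  have [m hm] : exists m : nat, S / d < m%:R.
    by exists (Num.Def.truncn (S / d)).+1; exact: truncnS_gt.
  exists m; rewrite ltr_pdivrMr ?exprn_gt0 // mulrC -ltr_pdivrMr //.
  apply: (lt_le_trans hm); rewrite -natrX ler_nat; exact/ltnW/ltn_expl.
have p2 : (0 : R) < 2 ^+ m by rewrite exprn_gt0.
apply: (cell_bad bad (m := m)); exists 0%N => k _.
set a := (cell m).1; set c := (cell m).2; set w := w0 / 2 ^+ m; set h := h0 / 2 ^+ m.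
have w_gt0 : 0 < w by rewrite divr_gt0.
have h_gt0 : 0 < h by rewrite divr_gt0.
have wh : w + h = S / 2 ^+ m by rewrite -mulrDl.
have near_le (x y z l : R) : y <= x <= y + l -> y <= z <= y + l -> `|x - z| <= l.
  move=> /andP[y1 y2] /andP[y3 y4]; rewrite ler_norml lerBlDr lerBrDr; apply/andP; split.
    rewrite addrC lerBlDr; lra.
  lra.
have N0 : (0 < 2 ^ k)%N by rewrite expn_gt0.
pose L s' t' := G s t + D * (creal (s' - s) + 'i * creal (t' - t)).
have -> : boundary_sum (2 ^ k) G a c w h =
    boundary_sum (2 ^ k) (fun s' t' => G s' t' - L s' t') a c w h.
  by rewrite boundary_sumB /L boundary_sum_affine // subr0.
apply: (@le_trans _ _ (2 * (w + h) * (e * (w0 * h0) / (2 * S ^+ 2) * (w + h)))).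
  apply: boundary_sum_le => //; rewrite ?ltW //.
    by rewrite mulr_gt0 // addr_gt0.
  move=> s' t' hs' ht'; rewrite /L opprD addrA.
  have n1 : `|s' - s| <= w by apply: (near_le _ a) => //; exact: hs.
  have n2 : `|t' - t| <= h by apply: (near_le _ c) => //; exact: ht.
  apply: (le_trans (Hd _ _ _ _)); first by apply: (le_lt_trans n1); apply: le_lt_trans Sm; rewrite -wh lerDl ltW.
    by apply: (le_lt_trans n2); apply: le_lt_trans Sm; rewrite -wh lerDr ltW.
  by apply: ler_wpM2l; [exact: ltW|exact: lerD].
rewrite wh (_ : (4 : R) = 2 ^+ 2); last by rewrite expr2 -natrM.
rewrite -exprM mulnC exprM.
have alg (x y z : R) : x != 0 -> z != 0 ->
    2 * (x / z) * (y / (2 * x ^+ 2) * (x / z)) = y / z ^+ 2.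
  by move=> x0 z0; field; rewrite x0 z0.
by rewrite alg // gt_eqF.
Qed.

End Bisection.

Lemma expR_quadratic (x : R) : `|x| <= 1 / 2 -> `|expR x - 1 - x| <= 2 * x ^+ 2.
Proof.
move=> hx; have [x1 x2] : - (1 / 2) <= x /\ x <= 1 / 2 by move: hx; rewrite ler_norml => /andP.
have l1 : 1 + x <= expR x by exact: expR_ge1Dx.
rewrite ger0_norm; last by rewrite -addrA -opprD subr_ge0.
have l2 : 1 - x <= expR (- x) by exact: expR_ge1Dx.
have p : 0 < 1 - x by lra.
have l3 : expR x * (1 - x) <= 1.
  apply: (le_trans (ler_wpM2l (expR_ge0 x) l2)); by rewrite -expRD subrr expR0.
have l4 : expR x <= 2 by nra.
nra.
Qed.

Lemma cos_quadratic (x : R) : `|cos x - 1| <= x ^+ 2 / 2.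
Proof.
rewrite cos_half addrAC subrr add0r normrN normrM ger0_norm //.
rewrite ger0_norm ?sqr_ge0 // -[_ ^+ 2]real_normK ?num_real //.
have h : `|sin (x / 2)| <= `|x / 2| by exact: sin_le_norm.
have : `|sin (x / 2)| ^+ 2 <= `|x / 2| ^+ 2 by rewrite lerXn2r ?nnegrE.
rewrite [leRHS]real_normK ?num_real // => h2.
apply: (le_trans (ler_wpM2l _ h2)) => //.
by rewrite expr_div_n; lra.
Qed.

Lemma sin_quadratic (x : R) : `|x| <= 1 -> `|sin x - x| <= x ^+ 2.
Proof.
wlog x0 : x / 0 < x => [H|] hx.
  have [x0|x0|<-] := ltgtP 0 x; first exact: H.
    have := H (- x); rewrite oppr_gt0 normrN sinN -opprD normrN sqrrN; exact.
  by rewrite sin0 subrr normr0 expr2 mulr0.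
have [c /andP[c0 cx] ->] := sin_mvt x0.
rewrite -{2}[x]mul1r -mulrBl normrM (gtr0_norm x0) expr2.
apply: ler_wpM2r; first exact: ltW.
apply: (le_trans (cos_quadratic c)).
have : c * c <= x * x by apply: ler_pM; rewrite ?ltW.
rewrite gtr0_norm // in hx; rewrite expr2; nra.
Qed.

Lemma exp_cis_quadratic (s t : R) : `|s| <= 1 / 2 -> `|t| <= 1 / 2 ->
  cabs (creal (expR s) * cis t - 1 - (creal s + 'i * creal t)) <= 4 * (`|s| + `|t|) ^+ 2.
Proof.
move=> hs ht.
have -> : creal (expR s) * cis t - 1 - (creal s + 'i * creal t) =
  creal (expR s - 1 - s) * cis t + creal s * (cis t - 1) + (cis t - 1 - 'i * creal t).
  by rewrite !crealB creal1; ring.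
have h1 : cabs (creal (expR s - 1 - s) * cis t) <= 2 * s ^+ 2.
  by rewrite cabsM cabs_cis mulr1 cabs_creal; exact: expR_quadratic.
have h2 : cabs (creal s * (cis t - 1)) <= `|s| * `|t|.
  by rewrite cabsM cabs_creal; apply: ler_wpM2l => //; exact: cabs_cisB1_le.
have h3 : cabs (cis t - 1 - 'i * creal t) <= t ^+ 2 / 2 + t ^+ 2.
  apply: (le_trans (cabs_le_ReIm _)).
  have -> : complex.Re (cis t - 1 - 'i * creal t) = cos t - 1.
    by rewrite !cReB cReM /= !mul0r mulr0 !subr0.
  have -> : complex.Im (cis t - 1 - 'i * creal t) = sin t - t.
    by rewrite !cImB cImM /= !mul0r add0r mul1r subr0.
  apply: lerD; first exact: cos_quadratic.
  by apply: sin_quadratic; move: ht; lra.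
apply: (le_trans (cabsD _ _)); apply: (le_trans (lerD (cabsD _ _) (lexx _))).
have := lerD (lerD h1 h2) h3 => /le_trans; apply.
rewrite -(real_normK (num_real s)) -(real_normK (num_real t)).
have : 0 <= `|s| by []. have : 0 <= `|t| by [].
move: (`|s|) (`|t|) => x y; nra.
Qed.

Lemma derivable_bound (h : C -> C) (w : C) : derivable h w 1 -> exists D : C,
  forall e : R, 0 < e -> exists2 d : R, 0 < d & forall v : C, cabs v < d ->
    cabs (h (w + v) - h w - D * v) <= e * cabs v.
Proof.
move=> /cvg_ex[/= D HD]; exists D => e e0.
move/cvg_cabsP/(_ e e0) : HD.
rewrite /dnbhs /within /prop_near1 /= => /nbhs_ballP[d /= d0 Hd].
have dE : d = creal (complex.Re d).
  apply: Cx_eqP => //=; have := d0; rewrite ltcE /= => /andP[/eqP -> _].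
  by [].
exists (complex.Re d); first by move: d0; rewrite {1}dE -creal0 ltr_creal.
move=> v hv; have [->|v0] := eqVneq v 0.
  by rewrite addr0 subrr mulr0 subrr cabs0 mulr0.
have := Hd v; rewrite /ball /= sub0r normrN normCx {1}dE ltr_creal => /(_ hv v0) h1.
have -> : h (w + v) - h w - D * v = v * (v^-1 *: (h (v *: 1 + w) - h w) - D).
  rewrite mulrBr [v * D]mulrC; congr (_ - _).
  by rewrite /GRing.scale /= mulrA mulfV // mul1r /GRing.scale /= mulr1 [v + w]addrC.
by rewrite cabsM mulrC ler_wpM2r // ?cabs_ge0 // ltW.
Qed.

Lemma plane_diff_polar (h : C -> C) (s0 t0 : R) :
  derivable h (creal (expR s0) * cis t0) 1 ->
  plane_diff (fun s t => h (creal (expR s) * cis t)) s0 t0.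
Proof.
set w0 := creal _ * _ => /derivable_bound[D HD]; exists (D * w0) => e e0.
have w00 : 0 < cabs w0.
  by rewrite cabsM cabs_cis mulr1 cabs_creal gtr0_norm ?expR_gt0.
set A := cabs w0; set B := cabs D.
have B0 : 0 <= B by exact: cabs_ge0.
have e1 : 0 < e / (6 * A) by rewrite divr_gt0 // mulr_gt0.
have [d d0 Hd] := HD _ e1.
have q : 0 < e / (8 * (A * B + 1)).
  by rewrite divr_gt0 // mulr_gt0 // ltr_wpDl // mulr_ge0 // ltW.
(* The three bounds ensure, in this order, the quadratic expansion of the exponential, the use of
   the differentiability of h, and the smallness of the quadratic remainder after multiplication by
   D * w0. *)
pose r := Num.min (1 / 4) (Num.min (d / (6 * A)) (e / (8 * (A * B + 1)) / 2)).
exists r.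
  rewrite /r !lt_min (divr_gt0 ltr01) //= !divr_gt0 // ?mulr_gt0 //.
  by rewrite ltr_wpDl // mulr_ge0 // ltW.
move=> s t; rewrite /r !lt_min => /andP[s1 /andP[s2 s3]] /andP[t1 /andP[t2 t3]].
set x := `|s - s0| + `|t - t0|.
have x0 : 0 <= x by rewrite addr_ge0.
have x1 : x <= 1 / 2 by rewrite /x; move: s1 t1; clear; lra.
have x2 : x < d / (3 * A).
  have -> : d / (3 * A) = d / (6 * A) + d / (6 * A).
    by field; rewrite gt_eqF.
  exact: ltrD.
have x3 : x <= e / (8 * (A * B + 1)).
  apply/ltW; rewrite [ltRHS](splitr _); exact: ltrD.
have := @exp_cis_quadratic (s - s0) (t - t0).
set E := creal (expR (s - s0)) * cis (t - t0) - 1 - _ => hE.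
have {}hE : cabs E <= 4 * x ^+ 2.
  by apply: hE; move: s1 t1; clear; lra.
set v := w0 * (creal (expR (s - s0)) * cis (t - t0) - 1).
have wv : creal (expR s) * cis t = w0 + v.
  rewrite /v /w0 mulrBr mulr1 addrC subrK mulrACA -crealM -expRD -cisD.
  by rewrite ![_ + (_ - _)]addrC !subrK.
set X := creal (s - s0) + 'i * creal (t - t0).
have i1 : cabs ('i : C) = 1 by apply: cabsE; rewrite normCi creal1.
have hX : cabs X <= x.
  by apply: (le_trans (cabsD _ _)); rewrite cabsM i1 mul1r !cabs_creal.
have vE : v = w0 * (E + X) by rewrite /v /E -/X; congr (_ * _); ring.
have hv : cabs v <= A * (3 * x).
  rewrite vE cabsM; apply: ler_wpM2l; first exact: ltW.
  apply: (le_trans (cabsD _ _)); move: hE hX x0 x1; clear; nra.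
have hvd : cabs v < d.
  apply: (le_lt_trans hv); rewrite mulrA mulrC [A * 3]mulrC.
  by rewrite -ltr_pdivlMr ?mulr_gt0.
rewrite wv; have -> : h (w0 + v) - h w0 - D * w0 * X =
    (h (w0 + v) - h w0 - D * v) + D * w0 * E by rewrite vE; ring.
apply: (le_trans (cabsD _ _)).
have l1 := Hd _ hvd.
have l2 : e / (6 * A) * cabs v <= e / 2 * x.
  apply: (le_trans (ler_wpM2l (ltW e1) hv)).
  have alg (p y x' : R) : p != 0 -> y / (6 * p) * (p * (3 * x')) = y / 2 * x'.
    by move=> p0; field.
  by rewrite alg // gt_eqF.
have l3 : cabs (D * w0 * E) <= e / 2 * x.
  rewrite cabsM [cabs (D * w0)]cabsM -/A -/B.
  have AB : 0 <= A * B by rewrite mulr_ge0 // ltW.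
  apply: (@le_trans _ _ (B * A * (4 * x ^+ 2))); first by apply: ler_wpM2l; rewrite // [B * A]mulrC.
  have : (A * B + 1) * x <= e / 8.
    have p : 0 < A * B + 1 by rewrite ltr_wpDl.
    rewrite mulrC -ler_pdivlMr // -mulrA -invfM; exact: x3.
  rewrite [B * A]mulrC; move: AB x0; clear; nra.
rewrite [e]splitr mulrDl; apply: lerD => //; exact: le_trans l1 l2.
Qed.

(** In logarithmic coordinates h (exp (s + i t)) is periodic in t, so the two horizontal edges of
    the rectangle cancel, and the vertical ones are 2 pi i times the means over the two circles. *)
Lemma circle_invariance (h : C -> C) (r1 r2 : R) : 0 < r1 -> r1 < r2 ->
  (forall w, r1 <= cabs w <= r2 -> derivable h w 1) ->
  forall e : R, 0 < e -> exists N0, forall k, (N0 <= k)%N ->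
    cabs (mean (2 ^ k) (fun l => h (creal r2 * l)) - mean (2 ^ k) (fun l => h (creal r1 * l)))
      <= e.
Proof.
move=> r10 r12 hh e e0; have r20 : 0 < r2 by exact: lt_trans r12.
pose G s t := h (creal (expR s) * cis t).
set w := ln r2 - ln r1; have w0 : 0 < w by rewrite subr_gt0 ltr_ln ?posrE.
have pi2 : 0 < 2 * pi :> R by rewrite mulr_gt0 ?pi_gt0.
have e1 : 0 < e / w by rewrite divr_gt0.
have Gd s t : ln r1 <= s <= ln r1 + w -> 0 <= t <= 0 + 2 * pi -> plane_diff G s t.
  rewrite addrC subrK => /andP[s1 s2] _; apply: plane_diff_polar; apply: hh.
  rewrite cabsM cabs_cis mulr1 cabs_creal gtr0_norm ?expR_gt0 //.
  by rewrite -{1}(lnK (x := r1)) ?posrE // -(lnK (x := r2)) ?posrE // !ler_expR s1 s2.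
have [N0 HN] := goursat_bisection w0 pi2 e1 Gd.
exists N0 => k /HN {HN}; rewrite /boundary_sum.
have k0 : (2 ^ k)%:R != 0 :> C by rewrite pnatr_eq0 -lt0n expn_gt0.
rewrite big1 ?mulr0 ?add0r; last first.
  by move=> i _; rewrite /G ?add0r cis_2pi cis0 subrr.
rewrite [_ + w]addrC subrK.
set d := mean _ _ - mean _ _.
have -> : 'i * creal (2 * pi / (2 ^ k)%:R) *
    (\sum_(k0 < 2 ^ k) (G (ln r2) (0 + k0%:R * (2 * pi / (2 ^ k)%:R)) -
       G (ln r1) (0 + k0%:R * (2 * pi / (2 ^ k)%:R)))) = 'i * (creal (2 * pi) * d).
  rewrite /d /mean -mulrBr -sumrB crealM crealV creal_nat -!mulrA.
  congr (_ * (_ * (_ * _))); apply: eq_bigr => i _.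
  by rewrite /G !lnK ?posrE // add0r /uroot cisX !mulrA.
rewrite !cabsM (_ : cabs ('i : C) = 1); last by apply: cabsE; rewrite normCi creal1.
rewrite mul1r cabs_creal gtr0_norm // -/w mulrA divfK ?gt_eqF // [e * _]mulrC.
by rewrite ler_pM2l.
Qed.

End Goursat.

(** * Taylor coefficients *)

Lemma Cx_cauchy_cvg (R : realType) (u : nat -> Cx R) :
  (forall e : R, 0 < e -> exists n0, forall n, (n0 <= n)%N -> cabs (u n - u n0) <= e) ->
  cvg (u n @[n --> \oo]).
Proof.
move=> uc.
have real_cvg (v : Cx R -> R) : (forall z w : Cx R, `|v z - v w| <= cabs (z - w)) ->
    cvg (v (u n) @[n --> \oo]).
  move=> hv; apply/cauchy_cvgP/cauchy_exP => e e0.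
  have e2 : 0 < e / 2 by rewrite divr_gt0.
  have [n0 H0] := uc _ e2; exists (v (u n0)).
  exists n0 => // n /= hn; rewrite /ball /=.
  apply: (le_lt_trans (hv _ _)); rewrite cabsBC.
  by apply: (le_lt_trans (H0 _ hn)); rewrite ltr_pdivrMr // ltr_pMr // ltr1n.
have hRe : cvg (complex.Re (u n) @[n --> \oo]).
  by apply: real_cvg => z w; rewrite -cReB; exact: Re_le_cabs.
have hIm : cvg (complex.Im (u n) @[n --> \oo]).
  by apply: real_cvg => z w; rewrite -cImB; exact: Im_le_cabs.
apply/cvg_ex; exists (lim (complex.Re (u n) @[n --> \oo]) +i*
  lim (complex.Im (u n) @[n --> \oo]))%C.
exact: cvg_ReIm.
Qed.

Section CircleMeans.
Variable R : realType.
Local Notation C := (Cx R).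

Lemma cabs_sum_le (q : nat) (u : nat -> C) (e : R) :
  (forall j, (j < q)%N -> cabs (u j) <= e) -> cabs (\sum_(j < q) u j) <= q%:R * e.
Proof.
move=> hu; apply: (le_trans (cabs_sum _ _ _)).
apply: (@le_trans _ _ (\sum_(j < q) e)); first by apply: ler_sum => j _; exact: hu.
by rewrite sumr_const card_ord mulr_natl.
Qed.

Lemma cabs_mean_cst M (u : C -> C) (e : R) : (0 < M)%N ->
  (forall l, cabs l = 1 -> cabs (u l) <= e) -> cabs (mean M u) <= e.
Proof.
move=> M0 hu; have MR : (0 : R) < M%:R by rewrite ltr0n.
rewrite /mean cabsM cabsV cabs_nat ler_pdivrMl //.
by apply: (cabs_sum_le (u := fun i => u (uroot R M ^+ i))) => j _; apply: hu; exact: cabs_urootX.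
Qed.

Definition circle_continuous (u : C -> C) := forall l : C, cabs l = 1 -> u x @[x --> l] --> u l.

Lemma circle_continuous_modulus (u : C -> C) (e : R) : circle_continuous u -> 0 < e ->
  exists2 K : R, 0 <= K & forall l m : C, cabs l = 1 -> cabs m = 1 ->
    cabs (u (m * l) - u l) <= e + K * cabs (m - 1) ^+ 2.
Proof.
move=> uc e0.
have row1 (z : 'rV[C]_1) : enorm z = cabs (z ord0 ord0).
  by rewrite /enorm big_ord1 sqrtr_sqr ger0_norm // cabs_ge0.
have up : scont (fun z : 'rV[C]_1 => u (z ord0 ord0)).
  move=> z Sz; apply: (@cvg_comp _ _ _ (fun w : 'rV[C]_1 => w ord0 ord0) u _ (nbhs (z ord0 ord0))).
    have : (w @[w --> within (@unit_sphere R 1) (nbhs z)] --> z) by exact: cvg_within.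
    by move=> /(@cvg_rowP R 1) /(_ ord0).
  by apply: uc; rewrite -row1.
have upRe : scont (fun z : 'rV[C]_1 => complex.Re (u (z ord0 ord0))).
  by move=> z Sz; apply: cvg_Re; exact: up.
have upIm : scont (fun z : 'rV[C]_1 => complex.Im (u (z ord0 ord0))).
  by move=> z Sz; apply: cvg_Im; exact: up.
have e2 : 0 < e / 2 by rewrite divr_gt0.
have [K1 K10 h1] := scont_rot_modulus upRe e2.
have [K2 K20 h2] := scont_rot_modulus upIm e2.
exists (K1 + K2); first exact: addr_ge0.
move=> l m l1 m1; apply: (le_trans (cabs_le_ReIm _)).
have Sl : (@unit_sphere R 1) (const_mx l) by rewrite /unit_sphere /= row1 mxE.
have := h1 _ _ Sl m1; have := h2 _ _ Sl m1; rewrite !mxE cReB cImB mulrDl => {}h2 {}h1.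
move: (lerD h1 h2) => /le_trans; apply.
by rewrite [e in leRHS]splitr addrACA.
Qed.

Lemma uroot_near (M : nat) (l : C) : (0 < M)%N -> cabs l = 1 -> exists j m,
  [/\ l = uroot R M ^+ j * m, cabs m = 1 & cabs (m - 1) <= 2 * pi / M%:R].
Proof.
move=> M0 /cis_surj[t tpi ->].
have MR : (0 : R) < M%:R by rewrite ltr0n.
have pi0 : (0 : R) < pi by exact: pi_gt0.
set d := 2 * pi / M%:R; have d0 : 0 < d by rewrite divr_gt0 // mulr_gt0.
have t0 : 0 <= t + 2 * pi by move: tpi pi0; rewrite ler_norml => /andP[]; lra.
set j := Num.Def.truncn ((t + 2 * pi) / d).
have td : 0 <= (t + 2 * pi) / d by rewrite divr_ge0 // ltW.
have /andP[j1 j2] : j%:R <= (t + 2 * pi) / d < j.+1%:R by exact: truncn_itv.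
exists j, (cis (t + 2 * pi - j%:R * d)); split.
    by rewrite cisX -cisD addrC subrK cisD cis_2pi mulr1.
  exact: cabs_cis.
apply: (le_trans (cabs_cisB1_le _)); rewrite ger0_norm.
  move: (ltW j2); rewrite ler_pdivrMr // -natr1 mulrDl mul1r; clear; lra.
by rewrite subr_ge0 -ler_pdivlMr.
Qed.

(** Every rotation is a rotation of the grid, which leaves the mean unchanged, followed by one of
    angle O(1 / M). *)
Lemma mean_shift (u : C -> C) (e : R) : circle_continuous u -> 0 < e ->
  exists M0, forall M l, (M0 <= M)%N -> (0 < M)%N -> cabs l = 1 ->
    cabs (mean M (fun m => u (l * m)) - mean M u) <= e.
Proof.
move=> uc e0; have e2 : 0 < e / 2 by rewrite divr_gt0.
have [K K0 HK] := circle_continuous_modulus uc e2.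
pose d := 2 * pi : R; have d0 : 0 < d by rewrite mulr_gt0 // pi_gt0.
exists (Num.Def.truncn (K * d ^+ 2 / (e / 2))).+1 => M l hM M0 l1.
have MR : (0 : R) < M%:R by rewrite ltr0n.
have [j [m [-> m1 hm]]] := uroot_near M0 l1.
have -> : mean M (fun x => u (uroot R M ^+ j * m * x)) = mean M (fun x => u (m * x)).
  rewrite -(mean_rot M (fun x => u (m * x)) j); apply: eq_mean => x _.
  by congr u; rewrite mulrCA mulrA.
rewrite -meanB; apply: (cabs_mean_cst M0) => x x1; apply: (le_trans (HK _ _ x1 m1)); rewrite [leRHS]splitr lerD2l.
have : cabs (m - 1) ^+ 2 <= (d / M%:R) ^+ 2.
  by rewrite lerXn2r // ?nnegrE ?cabs_ge0 // divr_ge0 ?ler0n // ltW.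
move=> /(ler_wpM2l K0) /le_trans; apply.
rewrite expr_div_n mulrA ler_pdivrMr ?exprn_gt0 // [leRHS]mulrC -ler_pdivrMr //.
apply: (@le_trans _ _ M%:R).
  by apply/ltW; apply: (lt_le_trans (truncnS_gt _)); rewrite ler_nat.
by rewrite expr2 ler_peMr ?ler0n // ler1n.
Qed.

Lemma sum_mul_split (M q : nat) (F : nat -> C) :
  \sum_(i < M * q) F i = \sum_(i < M) \sum_(j < q) F (i * q + j)%N.
Proof.
elim: M => [|M IH]; first by rewrite mul0n !big_ord0.
by rewrite mulSnr big_split_ord big_ord_recr /= IH.
Qed.

Lemma mean_refine M q (u : C -> C) : (0 < M)%N -> (0 < q)%N ->
  mean (M * q) u = q%:R^-1 * \sum_(j < q) mean M (fun m => u (uroot R (M * q) ^+ j * m)).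
Proof.
move=> M0 q0; rewrite /mean (sum_mul_split M q (fun i => u (uroot R (M * q) ^+ i))).
rewrite -mulr_sumr exchange_big /= natrM invfM -mulrA mulrCA; congr (_ * (_ * _)).
apply: eq_bigr => j _; apply: eq_bigr => i _; congr u.
rewrite exprD mulrC [(i * q)%N]mulnC exprM; congr (_ * _ ^+ _).
rewrite /uroot cisX; congr cis.
by rewrite natrM; field; rewrite !pnatr_eq0 -!lt0n M0 q0.
Qed.

(** Dyadic grids are nested: the finer mean is an average of rotated copies of the coarser one, each
    controlled by [mean_shift]. The limit plays the role of the integral over the circle. *)
Lemma mean_pow2_cauchy (u : C -> C) (e : R) : circle_continuous u -> 0 < e ->
  exists n0, forall n m, (n0 <= n)%N -> (n <= m)%N ->
    cabs (mean (2 ^ m) u - mean (2 ^ n) u) <= e.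
Proof.
move=> uc e0; have [M0 HM] := mean_shift uc e0; exists M0 => n m hn nm.
rewrite -(subnKC nm) expnD mean_refine ?expn_gt0 //.
set q := (2 ^ (m - n))%N; have q0 : (0 < q)%N by rewrite expn_gt0.
have qR : (q%:R : C) != 0 by rewrite pnatr_eq0 -lt0n.
have qR' : (0 : R) < q%:R by rewrite ltr0n.
have -> : mean (2 ^ n) u = q%:R^-1 * \sum_(j < q) mean (2 ^ n) u.
  by rewrite sumr_const card_ord -[X in _ = _ * X]mulr_natl mulrA mulVf ?mul1r.
rewrite -mulrBr -sumrB cabsM cabsV cabs_nat ler_pdivrMl //.
apply: (cabs_sum_le (u := fun j => mean (2 ^ n) (fun m0 => u (uroot R (2 ^ n * q) ^+ j * m0)) - _)).
move=> j _; apply: HM; rewrite ?expn_gt0 ?cabs_urootX //.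
exact: leq_trans hn (ltnW (ltn_expl _ _)).
Qed.

Lemma mean_pow2_cvg (u : C -> C) : circle_continuous u ->
  cvg (mean (2 ^ n) u @[n --> \oo]).
Proof.
move=> uc; apply: Cx_cauchy_cvg => e e0; have [n0 H0] := mean_pow2_cauchy uc e0.
by exists n0 => n hn; exact: H0.
Qed.

End CircleMeans.

Lemma sqr_small (R : realType) (x e : R) : 0 <= x -> 0 < e -> exists2 d : R, 0 < d & x * d <= e.
Proof.
move=> x0 e0; exists (e / (x + 1)); first by rewrite divr_gt0 // ltr_wpDl.
by rewrite mulrA ler_pdivrMr ?ltr_wpDl // mulrC ler_pM2l // lerDl.
Qed.

Lemma limr_le_cst (R : realType) (u : nat -> R) (a b : R) :
  u n @[n --> \oo] --> a -> (forall n, u n <= b) -> a <= b.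
Proof.
move=> ua hu; have /cvg_lim <- // := ua.
by apply: limr_le; [apply/cvg_ex; exists a|exact: nearW].
Qed.

Section Taylor.
Variable R : realType.
Local Notation C := (Cx R).
Implicit Types h : C -> C.

Definition disc_holomorphic h := forall w : C, cabs w < 1 -> derivable h w 1.

Lemma disc_cvg h (w : C) : disc_holomorphic h -> cabs w < 1 -> h x @[x --> w] --> h w.
Proof.
by move=> hh w1; have /derivable1_diffP/differentiable_continuous := hh w w1.
Qed.

Lemma cvg_Cmul T (F : set_system T) {FF : Filter F} (f g : T -> C) (a b : C) :
  f x @[x --> F] --> a -> g x @[x --> F] --> b -> f x * g x @[x --> F] --> a * b.
Proof. exact: cvgM. Qed.

Lemma cvg_Cscale T (F : set_system T) {FF : Filter F} (c : C) (f : T -> C) (a : C) :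
  f x @[x --> F] --> a -> c * f x @[x --> F] --> c * a.
Proof. apply: cvg_Cmul; exact: cvg_cst. Qed.

Lemma cvg_CX T (F : set_system T) {FF : Filter F} k (f : T -> C) (a : C) :
  f x @[x --> F] --> a -> f x ^+ k @[x --> F] --> a ^+ k.
Proof.
move=> fa; elim: k => [|k IH]; first exact: cvg_cst.
have -> : (fun x => f x ^+ k.+1) = (fun x => f x * f x ^+ k) by apply/funext => x; rewrite exprS.
rewrite exprS; exact: cvg_Cmul.
Qed.

Lemma cvg_comp_mull h (a l : C) : h x @[x --> a * l] --> h (a * l) ->
  h (a * x) @[x --> l] --> h (a * l).
Proof.
have cs : a * x @[x --> l] --> a * l by apply: (@cvg_Cscale _ (nbhs l)); exact: cvg_id.
move=> hc; exact: (@continuous_cvg _ _ _ (nbhs l) _ (fun x => a * x) h (a * l) hc cs).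
Qed.

Lemma cabs_scaled (r : R) (l : C) : 0 <= r -> cabs l = 1 -> cabs (creal r * l) = r.
Proof. by move=> r0 l1; rewrite cabsM l1 mulr1 cabs_creal ger0_norm. Qed.

Lemma disc_circle_continuous h (r : R) (p : C -> C) : disc_holomorphic h -> 0 <= r < 1 ->
  circle_continuous p -> circle_continuous (fun l => h (creal r * l) * p l).
Proof.
move=> hh /andP[r0 r1] pc l l1.
have c1 : h (creal r * x) @[x --> l] --> h (creal r * l).
  by apply: cvg_comp_mull; apply: (disc_cvg hh); rewrite cabs_scaled.
exact: (cvg_Cmul c1 (pc l l1)).
Qed.

Lemma circle_continuous_conjX k : circle_continuous (fun l : C => l^* ^+ k).
Proof. by move=> l _; apply: (@cvg_CX _ (nbhs l)); apply: cvg_conj; exact: cvg_id. Qed.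

Lemma derivableXn k (w : C) : derivable (fun x : C => x ^+ k) w 1.
Proof.
have -> : (fun x : C => x ^+ k) = (@id C) ^+ k.
  by apply/funext => x; rewrite fctE.
by apply: derivableX; exact: derivable_id.
Qed.

(** Cauchy's formula on the circle of radius 1 / 2; [taylor_mean] shows that the radius does not
    matter. *)
Definition taylor_coef h k : C :=
  lim (creal (2 ^+ k) * mean (2 ^ n) (fun l => h (creal (1 / 2) * l) * l^* ^+ k) @[n --> \oo]).

Section Coefficients.
Variable h : C -> C.
Hypothesis hh : disc_holomorphic h.

Lemma circle_means_const (g : C -> C) (r1 r2 : R) (l : C) : 0 < r1 < 1 -> 0 < r2 < 1 ->
  (forall w, 0 < cabs w < 1 -> derivable g w 1) ->
  mean (2 ^ n) (fun l => g (creal r1 * l)) @[n --> \oo] --> l ->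
  mean (2 ^ n) (fun l => g (creal r2 * l)) @[n --> \oo] --> l.
Proof.
move=> /andP[r10 r11] /andP[r20 r21] hg /cvg_cabsP c1; apply/cvg_cabsP => e e0.
have e2 : 0 < e / 3 by rewrite divr_gt0.
have [N0 HN] : exists N0, forall k, (N0 <= k)%N ->
    cabs (mean (2 ^ k) (fun l => g (creal r2 * l)) - mean (2 ^ k) (fun l => g (creal r1 * l))) <= e / 3.
  have [r12|r12|->] := ltgtP r1 r2.
    apply: circle_invariance => // w /andP[w1 w2].
    by apply: hg; rewrite (lt_le_trans r10 w1) (le_lt_trans w2 r21).
    have [N0 HN] : exists N0, forall k, (N0 <= k)%N ->
        cabs (mean (2 ^ k) (fun l => g (creal r1 * l)) - mean (2 ^ k) (fun l => g (creal r2 * l))) <= e / 3.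
      apply: circle_invariance => // w /andP[w1 w2].
      by apply: hg; rewrite (lt_le_trans r20 w1) (le_lt_trans w2 r11).
    by exists N0 => k /HN; rewrite cabsBC.
  by exists 0%N => k _; rewrite subrr cabs0 ltW.
have hN : \forall n \near \oo, (N0 <= n)%N by exists N0.
near=> n.
apply: (le_lt_trans (cabs_triangle (mean (2 ^ n) (fun l => g (creal r1 * l))) _ _)).
have a1 : cabs (mean (2 ^ n) (fun l => g (creal r2 * l)) -
    mean (2 ^ n) (fun l => g (creal r1 * l))) <= e / 3.
  by apply: HN; near: n.
have a2 : cabs (mean (2 ^ n) (fun l => g (creal r1 * l)) - l) < e / 3.
  by near: n; exact: c1.
by move: a1 a2 e0; clear; lra.
Unshelve. all: end_near. Qed.

Lemma taylor_mean k (r : R) : 0 < r < 1 ->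
  mean (2 ^ n) (fun l => h (creal r * l) * l^* ^+ k) @[n --> \oo] -->
    creal (r ^+ k) * taylor_coef h k.
Proof.
move=> r01; have [r0 r1] := andP r01.
pose g (w : C) := h w * (w ^+ k)^-1.
have hg w : 0 < cabs w < 1 -> derivable g w 1.
  move=> /andP[w0 w1]; apply: derivableM; first exact: hh.
  apply: derivableV; last exact: derivableXn.
  by rewrite expf_neq0 // -cabs_eq0 gt_eqF.
have gE (s : R) : 0 < s -> forall n, mean (2 ^ n) (fun l => g (creal s * l)) =
    creal (s ^- k) * mean (2 ^ n) (fun l => h (creal s * l) * l^* ^+ k).
  move=> s0 n; rewrite -meanZ; apply: eq_mean => l l1.
  rewrite /g exprMn invfM -crealX -crealV mulrCA; congr (_ * (_ * _)).
  by rewrite conj_unit // exprVn.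
have half : 0 < (1 / 2 : R) < 1 by apply/andP; split; lra.
have [h0 h1] := andP half.
have c0 : mean (2 ^ n) (fun l => g (creal (1 / 2) * l)) @[n --> \oo] --> taylor_coef h k.
  have E : (fun n => creal (2 ^+ k) * mean (2 ^ n) (fun l => h (creal (1 / 2) * l) * l^* ^+ k)) =
      (fun n => mean (2 ^ n) (fun l => g (creal (1 / 2) * l))).
    by apply/funext => n; rewrite gE // -exprVn div1r invrK.
  rewrite /taylor_coef -E; apply/cvg_ex.
  have /cvg_ex[c hc] : cvg (mean (2 ^ n) (fun l => h (creal (1 / 2) * l) * l^* ^+ k) @[n --> \oo]).
    apply: mean_pow2_cvg; apply: disc_circle_continuous => //; first by rewrite ltW.
    exact: circle_continuous_conjX.
  exists (creal (2 ^+ k) * c); exact: (@cvg_Cscale _ \oo _ _ (fun n => mean (2 ^ n) _) c hc).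
have c1 := circle_means_const half r01 hg c0.
have E : (fun n => mean (2 ^ n) (fun l => h (creal r * l) * l^* ^+ k)) =
    (fun n => creal (r ^+ k) * mean (2 ^ n) (fun l => g (creal r * l))).
  apply/funext => n; rewrite gE // mulrA -crealM divff ?creal1 ?mul1r //.
  by rewrite expf_neq0 // gt_eqF.
rewrite E; exact: (@cvg_Cscale _ \oo _ _ (fun n => mean (2 ^ n) _) _ c1).
Qed.

Lemma disc_bounded_near0 : exists B d : R, [/\ 0 <= B, 0 < d < 1 &
  forall w, cabs w < d -> cabs (h w) <= B].
Proof.
have /disc_cvg : disc_holomorphic h by [].
move=> /(_ 0); rewrite cabs0 => /(_ ltr01)/cvg_cabsP/(_ 1 ltr01).
rewrite /prop_near1 => /nbhs_ballP[d /= d0 Hd].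
have dE : d = creal (complex.Re d).
  apply: Cx_eqP => //=; have := d0; rewrite ltcE /= => /andP[/eqP -> _].
  by [].
have d1 : 0 < complex.Re d by move: d0; rewrite {1}dE -creal0 ltr_creal.
exists (cabs (h 0) + 1), (Num.min (complex.Re d) (1 / 2)); split.
    by rewrite addr_ge0 // cabs_ge0.
  by rewrite lt_min gt_min d1 /= [X in _ || X](_ : _ = true) ?orbT //; lra.
move=> w; rewrite lt_min => /andP[wd _].
have := Hd w; rewrite /ball /= sub0r normrN normCx {1}dE ltr_creal => /(_ wd) h1.
by rewrite -lerBlDl; apply: (le_trans (cabs_subl _ _)); exact: ltW.
Qed.

(** The limiting means of h (w) w^k do not depend on the radius, and they are O(t^k) on the circle
    of radius t because h is bounded near 0. *)
Lemma taylor_mean_neg (r : R) k : 0 < r < 1 -> (0 < k)%N ->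
  mean (2 ^ n) (fun l => h (creal r * l) * l ^+ k) @[n --> \oo] --> (0 : C).
Proof.
move=> r01 k0; have [r0 r1] := andP r01.
have [B [d [B0 /andP[d0 d1] HB]]] := disc_bounded_near0.
have mE (s : R) n : mean (2 ^ n) (fun l => h (creal s * l) * (creal s * l) ^+ k) =
    creal (s ^+ k) * mean (2 ^ n) (fun l => h (creal s * l) * l ^+ k).
  by rewrite -meanZ; apply: eq_mean => l l1; rewrite exprMn crealX; ring.
suff c1 : mean (2 ^ n) (fun l => h (creal r * l) * (creal r * l) ^+ k) @[n --> \oo] --> (0 : C).
  have -> : (fun n => mean (2 ^ n) (fun l => h (creal r * l) * l ^+ k)) =
      (fun n => creal (r ^- k) * mean (2 ^ n) (fun l => h (creal r * l) * (creal r * l) ^+ k)).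
    apply/funext => n; rewrite mE mulrA -crealM mulVf ?creal1 ?mul1r //.
    by rewrite expf_neq0 // gt_eqF.
  rewrite -(mulr0 (creal (r ^- k))); exact: (@cvg_Cscale _ \oo _ _ (fun n => mean (2 ^ n) _) _ c1).
have /cvg_ex[c hc] : cvg (mean (2 ^ n) (fun l => h (creal r * l) * (creal r * l) ^+ k) @[n --> \oo]).
  apply: (@mean_pow2_cvg _ (fun l => h (creal r * l) * (creal r * l) ^+ k)).
  apply: disc_circle_continuous => //; first by rewrite ltW.
  move=> l l1; apply: (cvg_comp_mull (h := fun x => x ^+ k)).
  exact: (@cvg_CX _ (nbhs (creal r * l)) _ k (fun x => x) _ (@cvg_id _ _)).
suff c0 : c = 0 by rewrite -c0.
apply: cabs_small => e e0; have [s s0 hs] := sqr_small B0 e0.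
set t := Num.min (d / 2) s.
have t01 : 0 < t < 1.
  by rewrite lt_min gt_min divr_gt0 //= s0 /= [X in X || _](_ : _ = true) //; lra.
have [t0 t1] := andP t01.
have hg w : 0 < cabs w < 1 -> derivable (fun x => h x * x ^+ k) w 1.
  move=> /andP[_ w1]; apply: derivableM; [exact: hh|exact: derivableXn].
have ct := circle_means_const r01 t01 hg hc.
apply: (limr_le_cst (cvg_cabs ct)) => n; apply: cabs_mean_cst; first by rewrite expn_gt0.
move=> l l1; rewrite cabsM cabsX cabs_scaled ?(ltW t0) //.
apply: le_trans hs; apply: ler_pM; rewrite ?cabs_ge0 ?exprn_ge0 ?(ltW t0) //.
  apply: HB; rewrite cabs_scaled ?(ltW t0) // /t gt_min; apply/orP; left; lra.
apply: (@le_trans _ _ t); last by rewrite /t ge_min lexx orbT.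
by rewrite -[leRHS]expr1; apply: ler_wiXn2l => //; exact: ltW.
Qed.

Lemma taylor_le (r B : R) k : 0 < r < 1 -> (forall w, cabs w = r -> cabs (h w) <= B) ->
  cabs (taylor_coef h k) * r ^+ k <= B.
Proof.
move=> r01 HB; have [r0 r1] := andP r01.
have := cvg_cabs (taylor_mean r01 (k := k)).
rewrite cabsM cabs_creal ger0_norm ?exprn_ge0 ?(ltW r0) // mulrC => ct.
apply: (limr_le_cst (ct _)) => n; apply: cabs_mean_cst; first by rewrite expn_gt0.
move=> l l1; rewrite cabsM cabsX cabs_conj l1 expr1n mulr1; apply: HB.
by rewrite cabs_scaled // ltW.
Qed.

End Coefficients.
End Taylor.

Section TaylorSeries.
Variable R : realType.
Local Notation C := (Cx R).
Implicit Types h : C -> C.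

Lemma mean_fejerE M L (u : C -> C) :
  mean M (fun m => creal (fejer L m) * u m) =
  L%:R^-1 * \sum_(a < L) \sum_(b < L) mean M (fun m => u m * (m ^+ a * m^* ^+ b)).
Proof.
transitivity (mean M (fun m => L%:R^-1 * \sum_(a < L) \sum_(b < L) u m * (m ^+ a * m^* ^+ b))).
  apply: eq_mean => m m1; rewrite fejerE mulrC mulrCA mulr_sumr; congr (_ * _).
  by apply: eq_bigr => a _; rewrite mulr_sumr.
rewrite meanZ mean_sum; congr (_ * _); apply: eq_bigr => a _; exact: mean_sum.
Qed.

Lemma cvg_Csum T (F : set_system T) {FF : Filter F} (m : nat) (f : nat -> T -> C) (a : nat -> C) :
  (forall i, (i < m)%N -> f i x @[x --> F] --> a i) ->
  \sum_(i < m) f i x @[x --> F] --> \sum_(i < m) a i.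
Proof.
elim: m => [|m IH] H.
  rewrite big_ord0; have -> : (fun x => \sum_(i < 0) f i x) = (fun _ : T => 0 : C).
    by apply/funext => x; rewrite big_ord0.
  exact: cvg_cst.
rewrite big_ord_recr /=; have -> : (fun x => \sum_(i < m.+1) f i x) =
    (fun x => \sum_(i < m) f i x + f m x).
  by apply/funext => x; rewrite big_ord_recr.
have H1 : \sum_(i < m) f i x @[x --> F] --> \sum_(i < m) a i.
  by apply: IH => i im; apply: H; exact: ltnW.
exact: (cvgD H1 (H m (ltnSn m))).
Qed.

Lemma sum_shifted (L b : nat) (c : nat -> C) : (b < L)%N ->
  \sum_(a < L) (if (a <= b)%N then c (b - a)%N else 0) = \sum_(k < b.+1) c k.
Proof.
move=> bL; rewrite -big_mkcond /= -(big_ord_widen L (fun a => c (b - a)%N) bL).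
rewrite (reindex_inj rev_ord_inj) /=; apply: eq_bigr => k _; congr c.
by rewrite subSS subKn // -ltnS.
Qed.

Section Series.
Variable h : C -> C.
Hypothesis hh : disc_holomorphic h.

Lemma disc_rot (l : C) : cabs l = 1 -> disc_holomorphic (fun w => h (l * w)).
Proof.
move=> l1 w w1; apply/derivable1_diffP.
apply: (@differentiable_comp _ _ _ _ (fun x : C => l * x) h).
  exact: (@differentiableM _ _ (fun=> l) id).
by apply/derivable1_diffP; apply: hh; rewrite cabsM l1 mul1r.
Qed.

Lemma taylor_coef_rot (l : C) k : cabs l = 1 ->
  taylor_coef (fun w => h (l * w)) k = l ^+ k * taylor_coef h k.
Proof.
move=> l1; have r01 : 0 < (1 / 2 : R) < 1 by apply/andP; split; lra.
have [r0 r1] := andP r01.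
have c1 := @taylor_mean R h hh k _ r01.
have c2 := @taylor_mean R (fun w => h (l * w)) (disc_rot l1) k _ r01.
pose v (x : C) := h (creal (1 / 2) * x) * x^* ^+ k.
have vc : circle_continuous v.
  have r01' : 0 <= (1 / 2 : R) < 1 by rewrite ltW.
  exact: (disc_circle_continuous hh r01' (@circle_continuous_conjX R k)).
have c3 : mean (2 ^ n) (fun m => v (l * m)) @[n --> \oo] -->
    creal ((1 / 2) ^+ k) * taylor_coef h k.
  move/cvg_cabsP : c1 => c1; apply/cvg_cabsP => e e0.
  have e2 : 0 < e / 2 by rewrite divr_gt0.
  have [M0 HM] := mean_shift vc e2.
  have hn : \forall n \near \oo, (M0 <= n)%N by exists M0.
  near=> n; apply: (le_lt_trans (cabs_triangle (mean (2 ^ n) v) _ _)).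
  rewrite [ltRHS]splitr; apply: ler_ltD.
    apply: HM; rewrite ?expn_gt0 //; apply: (@leq_trans n); last exact/ltnW/ltn_expl.
    by near: n.
  by near: n; exact: c1.
have c4 : mean (2 ^ n) (fun m => h (l * (creal (1 / 2) * m)) * m^* ^+ k) @[n --> \oo] -->
    l ^+ k * (creal ((1 / 2) ^+ k) * taylor_coef h k).
  have E : (fun n => mean (2 ^ n) (fun m => h (l * (creal (1 / 2) * m)) * m^* ^+ k)) =
      (fun n => l ^+ k * mean (2 ^ n) (fun m => v (l * m))).
    apply/funext => n; rewrite -meanZ; apply: eq_mean => m m1.
    rewrite /v [creal _ * (l * m)]mulrCA (rmorphM cconj l m) exprMn [RHS]mulrCA; congr (_ * _).
    by rewrite mulrA -exprMn mul_conj_unit // expr1n mul1r.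
  rewrite E; exact: (@cvg_Cscale _ _ \oo _ _ (fun n => mean (2 ^ n) _) _ c3).
have /= E := cvg_unique (@norm_hausdorff _ _) c2 c4.
have p0 : creal ((1 / 2) ^+ k) != 0 :> C.
  by rewrite -cabs_eq0 cabs_creal normr_eq0 expf_neq0 // gt_eqF.
by apply: (mulfI p0); rewrite E mulrCA.
Unshelve. all: end_near. Qed.

Section Radius.
Variable r : R.
Hypothesis r01 : 0 < r < 1.

Definition taylor_sum m : C := \sum_(k < m) taylor_coef h k * creal (r ^+ k).

(** Since the negative frequencies of h vanish, its Fejer mean at 1 is the Cesaro mean of the Taylor
    partial sums. *)
Lemma fejer_taylor L : mean (2 ^ n) (fun m => creal (fejer L m) * h (creal r * m)) @[n --> \oo] -->
  L%:R^-1 * \sum_(b < L) taylor_sum b.+1.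
Proof.
have -> : (fun n => mean (2 ^ n) (fun m => creal (fejer L m) * h (creal r * m))) =
    (fun n => L%:R^-1 * \sum_(b < L) \sum_(a < L)
       mean (2 ^ n) (fun m => h (creal r * m) * (m ^+ a * m^* ^+ b))).
  by apply/funext => n; rewrite mean_fejerE exchange_big.
apply: cvg_Cscale.
apply: (@cvg_Csum _ \oo _ L (fun b n => \sum_(a < L)
  mean (2 ^ n) (fun m => h (creal r * m) * (m ^+ a * m^* ^+ b)))
  (fun b => taylor_sum b.+1)) => b bL.
rewrite /taylor_sum -(sum_shifted (fun k => taylor_coef h k * creal (r ^+ k)) bL).
apply: (@cvg_Csum _ \oo _ L (fun a n =>
  mean (2 ^ n) (fun m => h (creal r * m) * (m ^+ a * m^* ^+ b)))
  (fun a => if (a <= b)%N then taylor_coef h (b - a) * creal (r ^+ (b - a)) else 0)) => a aL.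
have [ab|ba] := leqP a b.
  have -> : (fun n => mean (2 ^ n) (fun m => h (creal r * m) * (m ^+ a * m^* ^+ b))) =
      (fun n => mean (2 ^ n) (fun m => h (creal r * m) * m^* ^+ (b - a))).
    apply/funext => n; apply: eq_mean => m m1; congr (_ * _).
    by rewrite -{1}(subnKC ab) exprD mulrA -exprMn mul_conj_unit // expr1n mul1r.
  by rewrite mulrC; exact: taylor_mean.
have -> : (fun n => mean (2 ^ n) (fun m => h (creal r * m) * (m ^+ a * m^* ^+ b))) =
    (fun n => mean (2 ^ n) (fun m => h (creal r * m) * m ^+ (a - b))).
  apply/funext => n; apply: eq_mean => m m1; congr (_ * _).
  rewrite -{1}(subnK (ltnW ba)) exprD -mulrA -exprMn mul_conj_unit // expr1n mulr1.
  by [].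
by apply: taylor_mean_neg => //; rewrite subn_gt0.
Qed.

Lemma fejer_mean_taylor (e : R) : 0 < e -> exists L0, forall L, (L0 <= L)%N -> (0 < L)%N ->
  cabs (L%:R^-1 * \sum_(b < L) taylor_sum b.+1 - h (creal r)) <= e.
Proof.
move=> e0; have [r0 r1] := andP r01; have e2 : 0 < e / 2 by rewrite divr_gt0.
pose u (m : C) := h (creal r * m) * m^* ^+ 0.
have uc : circle_continuous u.
  apply: disc_circle_continuous => //; first by rewrite ltW.
  exact: circle_continuous_conjX.
have [K K0 HK] := circle_continuous_modulus uc e2.
exists (Num.Def.truncn (K * 2 / (e / 2))).+1 => L hL L0.
have LR : (0 : R) < L%:R by rewrite ltr0n.
have ct := @fejer_taylor L.
have bound n : (L < n)%N -> cabs (mean (2 ^ n) (fun m => creal (fejer L m) * h (creal r * m)) -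
    h (creal r)) <= e.
  move=> Ln; have LM : (L < 2 ^ n)%N by apply: (ltn_trans Ln); exact: ltn_expl.
  have f1 : rmean (2 ^ n) (@fejer R L) = 1 by apply: rmean_fejer; rewrite L0 ltnW.
  have -> : mean (2 ^ n) (fun m => creal (fejer L m) * h (creal r * m)) - h (creal r) =
      mean (2 ^ n) (fun m => creal (fejer L m) * (h (creal r * m) - h (creal r))).
    transitivity (mean (2 ^ n) (fun m => creal (fejer L m) * h (creal r * m)) -
      mean (2 ^ n) (fun m => creal (fejer L m)) * h (creal r)).
      by rewrite mean_creal f1 creal1 mul1r.
    by rewrite -meanZr -meanB; apply: eq_mean => m m1; rewrite mulrBr.
  pose v (m : C) : R := e / 2 * fejer L m + K * (fejer L m * cabs (m - 1) ^+ 2).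
  apply: (@le_trans _ _ (rmean (2 ^ n) v)).
    apply: cabs_mean_le => m m1; rewrite cabsM cabs_creal ger0_norm ?fejer_ge0 //.
    have := HK 1 m (cabs1 R) m1; rewrite /u !expr0 !mulr1 => hm.
    apply: (le_trans (ler_wpM2l (fejer_ge0 L m) hm)).
    have alg (p q k x : R) : p * (q + k * x) = q * p + k * (p * x) by ring.
    by rewrite /v alg.
  rewrite /v rmeanD (rmeanZ _ (e / 2)) (rmeanZ _ K) f1 mulr1 rmean_fejer_moment ?L0 //.
  rewrite [leRHS]splitr lerD2l mulrA ler_pdivrMr // [leRHS]mulrC -ler_pdivrMr //.
  by apply/ltW; apply: (lt_le_trans (truncnS_gt _)); rewrite ler_nat.
move/cvg_cabsP : ct => ct.
apply/ler_addgt0Pr => d d0.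
have [N _ HN] := ct d d0.
set n := maxn N L.+1.
apply: (le_trans (cabs_triangle (mean (2 ^ n) (fun m => creal (fejer L m) * h (creal r * m))) _ _)).
rewrite addrC; apply: lerD; first by apply: bound; rewrite /n leq_max ltnSn orbT.
by rewrite cabsBC ltW //; apply: HN; rewrite /= /n leq_maxl.
Qed.

(** By Fejer's theorem h (r) is the limit of the Cesaro means of the partial sums. Under geometric
    decay the partial sums converge themselves, necessarily to the same limit. *)
Lemma taylor_sum_tail (B t : R) m : 0 <= t < 1 ->
  (forall k, cabs (taylor_coef h k) * r ^+ k <= B * t ^+ k) ->
  cabs (h (creal r) - taylor_sum m) <= B * t ^+ m / (1 - t).
Proof.
move=> t01 Hc; have [t0 t1] := andP t01; have [r0 r1] := andP r01.
have B0 : 0 <= B.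
  by have := Hc 0%N; rewrite !expr0 !mulr1; apply: le_trans; exact: cabs_ge0.
have t1' : 0 < 1 - t by rewrite subr_gt0.
have diff a b : (a <= b)%N -> cabs (taylor_sum b - taylor_sum a) <= B * t ^+ a / (1 - t).
  move=> ab; rewrite /taylor_sum -(big_mkord xpredT (fun k => taylor_coef h k * creal (r ^+ k))).
  rewrite -(big_mkord xpredT (fun k => taylor_coef h k * creal (r ^+ k))).
  have -> : \sum_(0 <= k < b) taylor_coef h k * creal (r ^+ k) =
      \sum_(0 <= k < a) taylor_coef h k * creal (r ^+ k) +
      \sum_(a <= k < b) taylor_coef h k * creal (r ^+ k) by rewrite -big_cat_nat.
  rewrite addrAC subrr add0r.
  apply: (le_trans (cabs_sum _ _ _)).
  apply: (@le_trans _ _ (\sum_(a <= k < b) B * t ^+ k)).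
    apply: ler_sum => k _; apply: (le_trans _ (Hc k)).
    by rewrite cabsM cabs_creal ger0_norm // exprn_ge0 // ltW.
  by rewrite -mulr_sumr -mulrA; apply: ler_wpM2l => //; exact: geometric_sum_le.
set D := B / (1 - t).
have D0 : 0 <= D by rewrite divr_ge0 // ltW.
apply/ler_addgt0Pr => e e0.
have e2 : 0 < e / 2 by rewrite divr_gt0.
have [L0 HL] := fejer_mean_taylor e2.
set L := (maxn (maxn L0 m) (Num.Def.truncn (m%:R * D / (e / 2))).+1).
have L0' : (0 < L)%N by rewrite /L leq_max orbT.
have LR : (0 : R) < L%:R by rewrite ltr0n.
apply: (le_trans (cabs_triangle (L%:R^-1 * \sum_(b < L) taylor_sum b.+1) _ _)).
have h1 : cabs (h (creal r) - L%:R^-1 * \sum_(b < L) taylor_sum b.+1) <= e / 2.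
  by rewrite cabsBC; apply: HL; rewrite // /L !leq_max leqnn.
have h2 : cabs (L%:R^-1 * \sum_(b < L) taylor_sum b.+1 - taylor_sum m) <=
    B * t ^+ m / (1 - t) + e / 2.
  have -> : taylor_sum m = L%:R^-1 * \sum_(b < L) taylor_sum m.
    rewrite sumr_const card_ord -[X in _ = _ * X]mulr_natl mulrA mulVf ?mul1r //.
    by rewrite pnatr_eq0 -lt0n.
  rewrite -mulrBr -sumrB cabsM cabsV cabs_nat ler_pdivrMl //.
  apply: (le_trans (cabs_sum _ _ _)).
  (* The first m partial sums have total weight m / L in the Cesaro mean, so their crude bound [D]
     is harmless for large L. *)
  apply: (@le_trans _ _ (\sum_(b < L) (B * t ^+ m / (1 - t) + (if (b < m)%N then D else 0)))).
    apply: ler_sum => b _; have [bm|mb] := ltnP b m.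
      rewrite cabsBC; apply: (le_trans (diff _ _ bm)); rewrite ler_wpDl //.
        by rewrite divr_ge0 ?mulr_ge0 ?exprn_ge0 ?(ltW t1').
      rewrite /D -mulrA; apply: ler_wpM2l => //.
      by rewrite ler_piMl ?invr_ge0 ?(ltW t1') // exprn_ile1 // ltW.
    by rewrite addr0; apply: diff; exact: leqW.
  rewrite big_split /= sumr_const card_ord -[_ *+ L]mulr_natl mulrDr lerD2l.
  apply: (@le_trans _ _ (m%:R * D)).
    have mL : (m <= L)%N by rewrite /L !leq_max leqnn orbT.
    by rewrite -big_mkcond /= -(big_ord_widen L (fun=> D) mL) sumr_const card_ord mulr_natl.
  rewrite -ler_pdivrMr //.
  by apply/ltW; apply: (lt_le_trans (truncnS_gt _)); rewrite ler_nat /L leq_maxr.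
move: (lerD h1 h2); clear; lra.
Qed.

End Radius.

Lemma taylor_coef0 : taylor_coef h 0 = h 0.
Proof.
apply/eqP; rewrite -subr_eq0; apply/eqP; apply: cabs_small => e e0.
have h0 : h x @[x --> (0 : C)] --> h 0 by apply: (disc_cvg hh); rewrite cabs0.
move/cvg_cabsP/(_ e e0) : h0.
rewrite /prop_near1 => /nbhs_ballP[d /= d0 Hd].
have dE : d = creal (complex.Re d).
  by apply: Cx_eqP => //=; have := d0; rewrite ltcE /= => /andP[/eqP -> _].
have d1 : 0 < complex.Re d by move: d0; rewrite {1}dE -creal0 ltr_creal.
set r := Num.min (complex.Re d / 2) (1 / 2).
have r01 : 0 < r < 1.
  by rewrite lt_min gt_min divr_gt0 //= divr_gt0 //= [X in _ || X](_ : _ = true) ?orbT //; lra.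
have [r0 r1] := andP r01.
have rd : r < complex.Re d by rewrite /r gt_min; apply/orP; left; lra.
have ct := @taylor_mean R h hh 0 r r01.
rewrite expr0 creal1 mul1r in ct.
have c2 : mean (2 ^ n) (fun l => h (creal r * l) * l^* ^+ 0) - h 0 @[n --> \oo] -->
    taylor_coef h 0 - h 0.
  by apply: cvgB; [exact: ct|exact: cvg_cst].
apply: (limr_le_cst (cvg_cabs c2)) => n.
rewrite -[X in _ - X](@mean_cst R (2 ^ n) (h 0)) ?expn_gt0 // -meanB.
apply: cabs_mean_cst; first by rewrite expn_gt0.
move=> l l1; rewrite expr0 mulr1 ltW //; apply: Hd.
by rewrite /ball /= sub0r normrN normCx {1}dE ltr_creal cabs_scaled // ltW.
Qed.

End Series.

Lemma taylor_tail h (r t B : R) m (w : C) : disc_holomorphic h -> 0 < r < 1 -> 0 <= t < 1 ->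
  (forall w, cabs w = r -> cabs (h w) <= B) -> cabs w <= t * r ->
  cabs (h w - \sum_(k < m) taylor_coef h k * w ^+ k) <= B * t ^+ m / (1 - t).
Proof.
move=> hh r01 /andP[t0 t1] HB wtr; have [r0 r1] := andP r01.
have hc k : cabs (taylor_coef h k) * r ^+ k <= B by exact: taylor_le.
have B0 : 0 <= B by apply: le_trans (hc 0%N); rewrite mulr1 cabs_ge0.
have t1' : 0 < 1 - t by rewrite subr_gt0.
have [->|w0] := eqVneq w 0.
  case: m => [|m].
    rewrite big_ord0 subr0 mulr1 -taylor_coef0 //.
    apply: (@le_trans _ _ B); first by have := hc 0%N; rewrite mulr1.
    by rewrite ler_pdivlMr // ler_piMr // lerBlDr lerDl.
  rewrite big_ord_recl expr0 mulr1 taylor_coef0 // big1 ?addr0 ?subrr ?cabs0.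
    by rewrite divr_ge0 ?mulr_ge0 ?exprn_ge0 ?(ltW t1').
  by move=> i _; rewrite expr0n /= mulr0.
set s := cabs w; have s0 : 0 < s by rewrite lt_neqAle cabs_ge0 eq_sym cabs_eq0 w0.
have s1 : s < 1.
  by apply: (le_lt_trans wtr); apply: le_lt_trans r1; rewrite ler_piMl // ltW.
have sne : creal s != 0 by rewrite -cabs_eq0 cabs_creal normr_eq0 gt_eqF.
have [l wE l1] : exists2 l : C, w = l * creal s & cabs l = 1.
  exists (w / creal s); first by rewrite divfK.
  by rewrite cabsM cabsV cabs_creal gtr0_norm // divff ?gt_eqF.
have s01 : 0 < s < 1 by rewrite s0.
have hl := disc_rot hh l1.
have t01 : 0 <= t < 1 by rewrite t0.
have := @taylor_sum_tail _ hl s s01 B t m t01.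
have -> : taylor_sum (fun w => h (l * w)) s m = \sum_(k < m) taylor_coef h k * w ^+ k.
  apply: eq_bigr => k _; rewrite taylor_coef_rot // wE exprMn crealX.
  by rewrite [l ^+ k * _]mulrC mulrA.
rewrite -wE; apply=> k; rewrite taylor_coef_rot // cabsM cabsX l1 expr1n mul1r.
have h1 : s ^+ k <= (t * r) ^+ k by rewrite lerXn2r ?nnegrE ?mulr_ge0 ?(ltW r0) ?(ltW s0).
apply: (le_trans (ler_wpM2l (cabs_ge0 _) h1)).
by rewrite exprMn mulrCA [B * _]mulrC; apply: ler_wpM2l => //; exact: exprn_ge0.
Qed.

End TaylorSeries.

(** * Homogeneous expansion in the ball *)

Lemma lagrange_interpolation (F : fieldType) (k : nat) (x : 'I_k -> F) : injective x ->
  exists L : 'I_k -> {poly F}, (forall i, (size (L i) <= k)%N) /\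
    forall p : {poly F}, (size p <= k)%N -> forall w, p.[w] = \sum_i p.[x i] * (L i).[w].
Proof.
move=> xi.
pose L i : {poly F} := \prod_(j | j != i) ((x i - x j)^-1 *: ('X - (x j)%:P)).
have sL i : (size (L i) <= k)%N.
  have k0 : (0 < k)%N by apply: leq_ltn_trans (ltn_ord i).
  apply: (leq_trans (size_prod_leq _ _)); rewrite leq_subLR.
  apply: (@leq_trans (\sum_(j | j != i) 2).+1).
    by rewrite ltnS; apply: leq_sum => j _; apply: (leq_trans (size_scale_leq _ _)); rewrite size_XsubC.
  rewrite sum_nat_const muln2 -addnn; set c := #|_|.
  have -> : c = k.-1 by rewrite /c cardC1 card_ord.
  by rewrite -addnS prednK.
have Lx i j : (L i).[x j] = (i == j)%:R.
  rewrite horner_prod; have [<-|ij] := eqVneq i j.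
    rewrite big1 // => l li; rewrite hornerZ hornerXsubC mulVf // subr_eq0.
    by rewrite (inj_eq xi) eq_sym.
  rewrite (bigD1 j) 1?eq_sym //= hornerZ hornerXsubC subrr mulr0 mul0r //.
exists L; split=> // p sp w.
suff : p - \sum_i p.[x i] *: L i = 0.
  move=> /subr0_eq E; rewrite {1}E; rewrite horner_sum; apply: eq_bigr => i _.
  by rewrite hornerZ.
apply: (@roots_geq_poly_eq0 _ _ [seq x i | i <- enum 'I_k]).
    apply/allP => _ /mapP[j _ ->]; rewrite rootE !hornerE horner_sum (bigD1 j) //=.
  rewrite hornerZ Lx eqxx mulr1 big1 ?addr0 ?subrr // => i ij.
  by rewrite hornerZ Lx (negPf ij) mulr0.
  by rewrite map_inj_uniq // enum_uniq.
rewrite size_map size_enum_ord; apply: (leq_trans (size_polyD _ _)); rewrite geq_max sp size_polyN.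
apply: (leq_trans (size_sum _ _ _)); apply/bigmax_leqP => i _.
exact: leq_trans (size_scale_leq _ _) (sL i).
Qed.

(** * Polynomials on the sphere in the real coordinates *)

Section RealPolynomials.
Variables (R : realType) (n : nat).
Local Notation C := (Cx R).
Local Notation Cn := 'rV[Cx R]_n.
Local Notation S := (@unit_sphere R n).

(* The degree is counted in the real coordinates: conj(z_j) is a generator too. *)
Inductive rpoly : nat -> (Cn -> C) -> Prop :=
| rpoly_cst d c : rpoly d (fun=> c)
| rpoly_coord d j : rpoly d.+1 (fun z => z ord0 j)
| rpoly_conj d j : rpoly d.+1 (fun z => (z ord0 j)^*)
| rpolyD d P Q : rpoly d P -> rpoly d Q -> rpoly d (fun z => P z + Q z)
| rpolyM d e P Q : rpoly d P -> rpoly e Q -> rpoly (d + e) (fun z => P z * Q z).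

Lemma rpoly_le d e P : (d <= e)%N -> rpoly d P -> rpoly e P.
Proof.
move=> de H; elim: H e de => {d P} [d c|d j|d j|d P Q _ IP _ IQ|d e P Q _ IP _ IQ] f.
- by move=> _; exact: rpoly_cst.
- by case: f => // f _; exact: rpoly_coord.
- by case: f => // f _; exact: rpoly_conj.
- by move=> df; apply: rpolyD; [exact: IP|exact: IQ].
- move=> def; rewrite -(subnK (leq_trans (leq_addl d e) def)); apply: rpolyM; last exact: IQ.
  by apply: IP; rewrite leq_subRL ?(leq_trans (leq_addl d e)) // addnC.
Qed.

Lemma rpoly_scale d c P : rpoly d P -> rpoly d (fun z => c * P z).
Proof. by move=> HP; rewrite -[d]add0n; apply: rpolyM => //; exact: rpoly_cst. Qed.

Lemma rpoly_sum d m (P : nat -> Cn -> C) : (forall i, (i < m)%N -> rpoly d (P i)) ->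
  rpoly d (fun z => \sum_(i < m) P i z).
Proof.
elim: m => [|m IH] H.
  have -> : (fun z => \sum_(i < 0) P i z) = (fun=> 0).
    by apply/funext => z; rewrite big_ord0.
  exact: rpoly_cst.
have -> : (fun z => \sum_(i < m.+1) P i z) = (fun z => \sum_(i < m) P i z + P m z).
  by apply/funext => z; rewrite big_ord_recr.
by apply: rpolyD; [apply: IH => i im; apply: H; exact: ltnW|exact: H].
Qed.

Lemma rpoly_expr d k P : rpoly d P -> rpoly (d * k) (fun z => P z ^+ k).
Proof.
move=> HP; elim: k => [|k IH].
  have -> : (fun z => P z ^+ 0) = (fun=> 1) by apply/funext => z; rewrite expr0.
  exact: rpoly_cst.
have -> : (fun z => P z ^+ k.+1) = (fun z => P z * P z ^+ k).
  by apply/funext => z; rewrite exprS.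
by rewrite mulnS; exact: rpolyM.
Qed.

Lemma rpoly_horner k (p : {poly C}) j : (size p <= k.+1)%N -> rpoly k (fun z => p.[z ord0 j]).
Proof.
move=> sp; have -> : (fun z : Cn => p.[z ord0 j]) =
    (fun z => \sum_(i < k.+1) p`_i * z ord0 j ^+ i).
  by apply/funext => z; rewrite (horner_coef_wide _ sp).
apply: (rpoly_sum (P := fun i z => p`_i * z ord0 j ^+ i)) => i ik; apply: rpoly_scale.
by apply: (@rpoly_le (1 * i)); [rewrite mul1n -ltnS|apply: rpoly_expr; exact: rpoly_coord].
Qed.

Lemma scont_rpoly d P : rpoly d P -> scont P.
Proof.
have coord j : scont (fun z : Cn => z ord0 j).
  move=> z _; have : (w @[w --> within S (nbhs z)] --> z) by exact: cvg_within.
  by move=> /(@cvg_rowP R n) /(_ j).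
elim=> {d P} [d c|d j|d j|d P Q _ IP _ IQ|d e P Q _ IP _ IQ].
- exact: scont_cst.
- exact: coord.
- exact: (scont_conj (coord j)).
- exact: (scontD IP IQ).
- exact: (scontM IP IQ).
Qed.

End RealPolynomials.

Lemma seq_cvg_unique (R : realType) (u : nat -> Cx R) (a b : Cx R) :
  u n @[n --> \oo] --> a -> u n @[n --> \oo] --> b -> a = b.
Proof. by move=> ua ub; exact: (cvg_unique (@norm_hausdorff _ _) ua ub). Qed.

Section HomogeneousExpansion.
Variables (R : realType) (n : nat).
Local Notation C := (Cx R).
Local Notation Cn := 'rV[Cx R]_n.
Local Notation S := (@unit_sphere R n).
Variable f : Cn -> C.
Hypothesis fh : holomorphic_on_ball f.

Lemma line_holomorphic (p q : Cn) (a : C) :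
  (forall w : C, cabs w < 1 -> enorm (a *: (p + w *: q)) < 1) ->
  disc_holomorphic (fun w => f (a *: (p + w *: q))).
Proof.
move=> H w w1; apply/derivable1_diffP.
apply: (@differentiable_comp _ _ _ _ (fun x : C => a *: (p + x *: q)) f); last exact: fh (H w w1).
have d1 : differentiable (fun x : C => x *: q) w.
  exact: (@differentiableZl _ _ _ id q).
have d2 : differentiable (fun x : C => p + x *: q) w.
  exact: (@differentiableD _ _ _ (fun=> p) _ _ _ d1).
exact: (@differentiableZ _ _ _ _ a _ d2).
Qed.

Lemma slice_holomorphic (rho : R) (z : Cn) : 0 <= rho -> rho * enorm z <= 1 ->
  disc_holomorphic (fun w => f (w *: (creal rho *: z))).
Proof.
move=> r0 rz.
have := @line_holomorphic 0 (creal rho *: z) 1.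
have -> : (fun w : C => f (1 *: (0 + w *: (creal rho *: z)))) =
    (fun w => f (w *: (creal rho *: z))).
  by apply/funext => w; rewrite scale1r add0r.
apply=> w w1; rewrite scale1r add0r !enormZ cabs_creal ger0_norm //.
apply: (le_lt_trans _ w1); rewrite -[leRHS]mulr1; apply: ler_wpM2l => //; exact: cabs_ge0.
Qed.

(** Scaling by 1 + |z| brings every slice into the ball, so that the terms are defined off the
    sphere too, as interpolation along affine lines requires; by [slice_coef] every admissible
    scaling gives the same value. *)
Definition homogeneous_part k (z : Cn) : C := creal ((1 + enorm z) ^+ k) *
  taylor_coef (fun w => f (w *: (creal (1 + enorm z)^-1 *: z))) k.

(** The circles of radii rho' / (rho + rho') and rho / (rho + rho') in the two scaled slices run
    through the same points of the ball. *)
Lemma slice_coef_scale k (rho rho' : R) (z : Cn) :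
  0 < rho -> rho * enorm z <= 1 -> 0 < rho' -> rho' * enorm z <= 1 ->
  creal (rho' ^+ k) * taylor_coef (fun w => f (w *: (creal rho *: z))) k =
  creal (rho ^+ k) * taylor_coef (fun w => f (w *: (creal rho' *: z))) k.
Proof.
move=> r0 rz r0' rz'; have s0 : 0 < rho + rho' by rewrite addr_gt0.
have sne : rho + rho' != 0 by rewrite gt_eqF.
have b1 : 0 < rho' / (rho + rho') < 1.
  by rewrite divr_gt0 //= ltr_pdivrMr // mul1r ltrDr.
have b2 : 0 < rho / (rho + rho') < 1.
  by rewrite divr_gt0 //= ltr_pdivrMr // mul1r ltrDl.
have c1 := @taylor_mean R _ (slice_holomorphic (ltW r0) rz) k _ b1.
have c2 := @taylor_mean R _ (slice_holomorphic (ltW r0') rz') k _ b2.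
have E : (fun n0 => mean (2 ^ n0) (fun l => f ((creal (rho' / (rho + rho')) * l) *: (creal rho *: z)) * l^* ^+ k)) =
   (fun n0 => mean (2 ^ n0) (fun l => f ((creal (rho / (rho + rho')) * l) *: (creal rho' *: z)) * l^* ^+ k)).
  apply/funext => N; apply: eq_mean => l l1.
  have -> : (creal (rho' / (rho + rho')) * l) *: (creal rho *: z) =
      (creal (rho / (rho + rho')) * l) *: (creal rho' *: z); last by [].
  rewrite !scalerA; congr (_ *: _).
  by rewrite mulrAC -crealM [RHS]mulrAC -crealM [rho' / _ * _]mulrAC [rho' * rho]mulrC [in RHS]mulrAC.
rewrite E in c1; move: (seq_cvg_unique c1 c2); clear c1 c2 E.
rewrite !expr_div_n !(crealM (_ ^+ k)).
have p0 : creal ((rho + rho') ^- k) != 0 :> C.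
  by rewrite -cabs_eq0 cabs_creal normr_eq0; apply: invr_neq0; apply: expf_neq0.
by rewrite ![_ * creal ((rho + rho') ^- k)]mulrC -!mulrA => /(mulfI p0).
Qed.

Lemma slice_coef k (rho : R) (z : Cn) : 0 < rho -> rho * enorm z <= 1 ->
  taylor_coef (fun w => f (w *: (creal rho *: z))) k = creal (rho ^+ k) * homogeneous_part k z.
Proof.
move=> r0 rz; have z0 := enorm_ge0 z.
have N0 : 0 < 1 + enorm z by rewrite ltr_pwDl.
have Nz : (1 + enorm z)^-1 * enorm z <= 1 by rewrite mulrC ler_pdivrMr // mul1r lerDr.
have Ni : 0 < (1 + enorm z)^-1 by rewrite invr_gt0.
rewrite /homogeneous_part mulrCA -(@slice_coef_scale k rho) // mulrA -crealM -exprMn.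
by rewrite divff ?gt_eqF // expr1n creal1 mul1r.
Qed.

Lemma homogeneous_part_rot k (l : C) (z : Cn) : cabs l = 1 ->
  homogeneous_part k (l *: z) = l ^+ k * homogeneous_part k z.
Proof.
move=> l1; have z0 := enorm_ge0 z.
have N0 : 0 < 1 + enorm z by rewrite ltr_pwDl.
have Nz : (1 + enorm z)^-1 * enorm z <= 1 by rewrite mulrC ler_pdivrMr // mul1r lerDr.
have Ni : 0 <= (1 + enorm z)^-1 by rewrite invr_ge0 ltW.
rewrite /homogeneous_part enormZ l1 mul1r mulrCA; congr (_ * _).
rewrite -(taylor_coef_rot (slice_holomorphic Ni Nz) k l1).
have -> : (fun w : C => f (w *: (creal (1 + enorm z)^-1 *: (l *: z)))) =
    (fun w => f ((l * w) *: (creal (1 + enorm z)^-1 *: z))); last by [].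
apply/funext => w; have -> : w *: (creal (1 + enorm z)^-1 *: (l *: z)) =
    (l * w) *: (creal (1 + enorm z)^-1 *: z); last by [].
by rewrite !scalerA mulrAC [w * l]mulrC.
Qed.

Lemma sphere_scaled (r : R) (w : Cn) : 0 < r -> enorm w = r ->
  exists2 z, S z & w = creal r *: z.
Proof.
move=> r0 wr; exists (creal r^-1 *: w).
  by rewrite /unit_sphere /= enormZ cabs_creal gtr0_norm ?invr_gt0 // wr mulVf // gt_eqF.
by rewrite scalerA -crealM divff ?gt_eqF // creal1 scale1r.
Qed.

Lemma ball_scont (r : R) : 0 <= r < 1 -> scont (fun z => f (creal r *: z)).
Proof.
move=> /andP[r0 r1] z Sz.
have d : differentiable (fun w : Cn => f (creal r *: w)) z.
  apply: (@differentiable_comp _ _ _ _ (fun x : Cn => creal r *: x) f).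
    exact: (@differentiableZ _ _ _ id).
  by apply: fh; rewrite /unit_ball /= enormZ cabs_creal ger0_norm // Sz mulr1.
apply: cvg_trans (differentiable_continuous d).
by apply: cvg_app; exact: cvg_within.
Qed.

Lemma circle_bounded (r : R) : 0 <= r < 1 ->
  exists2 B : R, 0 <= B & forall z, S z -> cabs (f (creal r *: z)) <= B.
Proof.
move=> r01; have [B B0 HB] := scont_bounded (scont_cabs (ball_scont r01)).
by exists B => // z /HB; rewrite ger0_norm // cabs_ge0.
Qed.

Lemma slice_circle_bound (r B : R) (z : Cn) : 0 < r < 1 ->
  (forall z, S z -> cabs (f (creal r *: z)) <= B) -> S z ->
  forall w : C, cabs w = r -> cabs (f (w *: (creal 1 *: z))) <= B.
Proof.
move=> /andP[r0 r1] HB Sz w wr; rewrite scale1r.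
have [v Sv ->] : exists2 v, S v & w *: z = creal r *: v.
  by apply: sphere_scaled; rewrite // enormZ wr Sz mulr1.
exact: HB.
Qed.

Lemma sphere_coef k z : S z ->
  taylor_coef (fun w => f (w *: z)) k = homogeneous_part k z.
Proof.
move=> Sz; have z1 : 1 * enorm z <= 1 by rewrite Sz mulr1.
by have := slice_coef k ltr01 z1; rewrite expr1n creal1 scale1r mul1r.
Qed.

Lemma homogeneous_growth : slice_growth homogeneous_part.
Proof.
move=> s s01; have [s0 s1] := andP s01.
have s01' : 0 <= s < 1 by rewrite ltW.
have [B B0 HB] := circle_bounded s01'; exists B => // k z Sz.
have z1 : 1 * enorm z <= 1 by rewrite Sz mulr1.
have := @taylor_le R _ (slice_holomorphic ler01 z1) s B k s01 (slice_circle_bound s01 HB Sz).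
by rewrite scale1r sphere_coef.
Qed.

Lemma homogeneous_tail (s t B : R) m (w : C) (z : Cn) : 0 < s < 1 -> 0 <= t < 1 ->
  (forall z, S z -> cabs (f (creal s *: z)) <= B) -> S z -> cabs w <= t * s ->
  cabs (f (w *: z) - (slice_poly homogeneous_part m z).[w]) <= B * t ^+ m / (1 - t).
Proof.
move=> s01 t01 HB Sz ws.
have z1 : 1 * enorm z <= 1 by rewrite Sz mulr1.
have := @taylor_tail R _ s t B m w (slice_holomorphic ler01 z1) s01 t01
  (slice_circle_bound s01 HB Sz) ws.
rewrite scale1r slice_polyE; congr (cabs (_ - _) <= _).
by apply: eq_bigr => k _; rewrite sphere_coef.
Qed.

Lemma homogeneous_limit (rho e : R) : 0 <= rho < 1 -> 0 < e ->
  exists m0, forall m z, (m0 <= m)%N -> S z ->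
    cabs (f (creal rho *: z) - (slice_poly homogeneous_part m z).[creal rho]) <= e.
Proof.
move=> /andP[r0 r1] e0; set s := (rho + 1) / 2.
have s01 : 0 < s < 1 by rewrite /s; apply/andP; split; lra.
have [s0 s1] := andP s01.
have s01' : 0 <= s < 1 by rewrite ltW.
have [B B0 HB] := circle_bounded s01'.
set t := rho / s.
have t01 : 0 <= t < 1.
  by rewrite divr_ge0 ?(ltW s0) //= ltr_pdivrMr // mul1r /s; lra.
have [t0 t1] := andP t01; have t1' : 0 < 1 - t by rewrite subr_gt0.
have D0 : 0 <= B / (1 - t) by rewrite divr_ge0 // ltW.
have [d d0 hd] := sqr_small D0 e0.
have : t ^+ m @[m --> \oo] --> 0 by apply: cvg_expr; rewrite ger0_norm.
move=> /cvgrPdist_lt/(_ d d0)[m0 _ Hm]; exists m0 => m z hm Sz.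
have ws : cabs (creal rho) <= t * s by rewrite cabs_creal ger0_norm // /t divfK // gt_eqF.
apply: (le_trans (homogeneous_tail m s01 t01 HB Sz ws)).
rewrite mulrAC; apply: (le_trans _ hd); apply: ler_wpM2l => //.
by have := Hm m hm; rewrite /= sub0r normrN ger0_norm ?exprn_ge0 // => /ltW.
Qed.

Lemma ball_bounded : exists2 B : R, 0 <= B & forall v, enorm v <= 1 / 2 -> cabs (f v) <= B.
Proof.
have s01 : 0 < (3 / 4 : R) < 1 by apply/andP; split; lra.
have s01' : 0 <= (3 / 4 : R) < 1 by apply/andP; split; lra.
have t01 : 0 <= (2 / 3 : R) < 1 by apply/andP; split; lra.
have [B B0 HB] := circle_bounded s01'.
exists (Num.max (cabs (f 0)) (B * (2 / 3) ^+ 0 / (1 - 2 / 3))).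
  by rewrite le_max cabs_ge0.
move=> v hv; rewrite le_max; have [v0|v0] := eqVneq (enorm v) 0.
  by move/eqP: v0; rewrite enorm_eq0 => /eqP ->; rewrite lexx.
have v1 : 0 < enorm v by rewrite lt_neqAle eq_sym v0 enorm_ge0.
have [z Sz vE] := sphere_scaled v1 erefl.
apply/orP; right; rewrite {1}vE.
have := @homogeneous_tail (3 / 4) (2 / 3) B 0 (creal (enorm v)) z s01 t01 HB Sz.
rewrite slice_polyE big_ord0 subr0; apply.
rewrite cabs_creal ger0_norm ?enorm_ge0 //; move: hv; lra.
Qed.

End HomogeneousExpansion.

Lemma disc_holomorphic_mean (R : realType) M (u : Cx R -> Cx R -> Cx R) :
  (forall l, cabs l = 1 -> disc_holomorphic (u l)) ->
  disc_holomorphic (fun w => mean M (fun l => u l w)).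
Proof.
move=> hu w w1; rewrite /mean.
suff ds N (g : nat -> Cx R -> Cx R) : (forall i, derivable (g i) w 1) ->
    derivable (fun x => \sum_(i < N) g i x) w 1.
  apply: derivableM; first exact: derivable_cst.
  by apply: (ds M (fun i => u (uroot R M ^+ i))) => i; apply: hu => //; exact: cabs_urootX.
move=> dg; elim: N => [|N IH].
  have -> : (fun x => \sum_(i < 0) g i x) = (fun=> 0) by apply/funext => x; rewrite big_ord0.
  exact: derivable_cst.
have -> : (fun x => \sum_(i < N.+1) g i x) = (fun x => \sum_(i < N) g i x + g N x).
  by apply/funext => x; rewrite big_ord_recr.
exact: (derivableD IH (dg N)).
Qed.

Lemma cvg_Csum_fin (R : realType) T (F : set_system T) {FF : Filter F} (I : finType)
  (f : I -> T -> Cx R) (a : I -> Cx R) : (forall i, f i x @[x --> F] --> a i) ->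
  \sum_i f i x @[x --> F] --> \sum_i a i.
Proof.
move=> H; elim: (index_enum I) => [|i r IH].
  have -> : (fun x => \sum_(i <- [::]) f i x) = (fun=> 0) by apply/funext => x; rewrite big_nil.
  by rewrite big_nil; exact: cvg_cst.
have -> : (fun x => \sum_(j <- i :: r) f j x) = (fun x => f i x + \sum_(j <- r) f j x).
  by apply/funext => x; rewrite big_cons.
rewrite big_cons; exact: (cvgD (H i) IH).
Qed.

(** * Polynomiality of the homogeneous parts *)

Section Interpolation.
Variables (R : realType) (n : nat).
Local Notation C := (Cx R).
Local Notation Cn := 'rV[Cx R]_n.
Local Notation S := (@unit_sphere R n).
Variable f : Cn -> C.
Hypothesis fh : holomorphic_on_ball f.
Local Notation F := (homogeneous_part f).

Section Lagrange.
Variables (k : nat) (x : 'I_k.+1 -> C) (L : 'I_k.+1 -> {poly C}).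
Hypothesis x1 : forall i, cabs (x i) <= 1.
Hypothesis L_interp : forall p : {poly C}, (size p <= k.+1)%N ->
  forall w, p.[w] = \sum_i p.[x i] * (L i).[w].

Section Scale.
Variables (p q : Cn) (W B : R).
Hypothesis W4 : 4 <= W.
Hypothesis HB : forall v, enorm v <= 1 / 2 -> cabs (f v) <= B.

Let A := 1 + enorm p + enorm q.
Let rho := (A * W)^-1.
Let approx (N : nat) (w : C) : C := mean (2 ^ N) (fun l =>
  f ((creal (1 / 2) * l) *: (creal rho *: (p + w *: (creal W *: q)))) * l^* ^+ k).

Let A1 : 1 <= A.
Proof. by rewrite /A -addrA lerDl addr_ge0 // enorm_ge0. Qed.

Let W0 : 0 < W. Proof. by apply: lt_le_trans W4. Qed.

Let AW : 0 < A * W. Proof. by rewrite mulr_gt0 // (lt_le_trans ltr01 A1). Qed.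

Let rho0 : 0 < rho. Proof. by rewrite invr_gt0. Qed.

Let point_le w : cabs w <= 1 -> rho * enorm (p + w *: (creal W *: q)) <= 1.
Proof.
move=> w1; rewrite /rho mulrC ler_pdivrMr // mul1r.
apply: (le_trans (enormD _ _)); rewrite !enormZ cabs_creal (gtr0_norm W0).
have p0 := enorm_ge0 p; have q0 := enorm_ge0 q.
have : cabs w * (W * enorm q) <= W * enorm q.
  by rewrite ler_piMl // mulr_ge0 // ltW.
have : enorm p <= enorm p * W by rewrite ler_peMr //; apply: le_trans W4; lra.
by rewrite /A !mulrDl mul1r [enorm q * W]mulrC; move: W0; lra.
Qed.

Let approx_limit (v : C) : cabs v <= 1 ->
  approx N (v * creal W^-1) @[N --> \oo] --> creal ((1 / 2) ^+ k) * (creal (rho ^+ k) * F k (p + v *: q)).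
Proof.
move=> v1; have vE : p + v *: q = p + (v * creal W^-1) *: (creal W *: q).
  by rewrite scalerA -mulrA -crealM mulVf ?gt_eqF // creal1 mulr1.
have w1 : cabs (v * creal W^-1) <= 1.
  rewrite cabsM cabs_creal gtr0_norm ?invr_gt0 // ler_pdivrMr // mul1r.
  by apply: (le_trans v1); apply: le_trans W4; lra.
rewrite vE -(slice_coef fh k rho0 (point_le w1)).
apply: taylor_mean; last by apply/andP; split; lra.
by apply: slice_holomorphic => //; [exact: ltW|exact: point_le].
Qed.

Let approx_holomorphic N : disc_holomorphic (approx N).
Proof.
apply: (@disc_holomorphic_mean _ _ (fun l w =>
  f ((creal (1 / 2) * l) *: (creal rho *: (p + w *: (creal W *: q)))) * l^* ^+ k)) => l l1.
have H : disc_holomorphic (fun w => f ((creal (1 / 2) * l * creal rho) *: (p + w *: (creal W *: q)))).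
  apply: line_holomorphic => // w w1; rewrite enormZ !cabsM !cabs_creal l1 mulr1.
  rewrite (gtr0_norm rho0) gtr0_norm; last lra.
  by have := point_le (ltW w1); rewrite -mulrA; lra.
have E : (fun w => f ((creal (1 / 2) * l) *: (creal rho *: (p + w *: (creal W *: q)))) * l^* ^+ k) =
   (fun w => f ((creal (1 / 2) * l * creal rho) *: (p + w *: (creal W *: q))) * l^* ^+ k).
  by apply/funext => w; rewrite [(creal _ * l) *: (_ *: _)]scalerA.
move=> w w1; rewrite E; apply: derivableM; [exact: H|exact: derivable_cst].
Qed.

Let approx_le N w : cabs w <= 1 -> cabs (approx N w) <= B.
Proof.
move=> w1; apply: cabs_mean_cst; first by rewrite expn_gt0.
move=> l l1; rewrite cabsM cabsX cabs_conj l1 expr1n mulr1; apply: HB.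
rewrite !enormZ cabsM l1 mulr1 !cabs_creal (gtr0_norm rho0) gtr0_norm; last lra.
by have := point_le w1; lra.
Qed.

(** Divided by (2 A W)^k, the term F k (p + v q) is a limit of uniformly bounded holomorphic
    functions of the small variable v / W. Interpolation at k + 1 nodes reproduces their Taylor
    polynomials of degree k, and the remainder is O(W^-(k+1)). Undoing the division costs W^k, so a
    factor 1 / W survives. *)
Lemma interpolation_error (v : C) : cabs v <= 1 ->
  cabs (F k (p + v *: q) - \sum_i F k (p + x i *: q) * (L i).[v]) <=
  (2 * A) ^+ k * (2 * B * 2 ^+ k.+1) * (1 + \sum_i cabs (L i).[v]) / W.
Proof.
move=> v1; set Lam := 1 + _.
have Wne : W != 0 by rewrite gt_eqF.
set t := 2 / W.
have t01 : 0 <= t < 1.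
  by rewrite divr_ge0 ?(ltW W0) //= ltr_pdivrMr // mul1r (lt_le_trans _ W4) // ltr_nat.
have [t0 t1] := andP t01.
have B0 : 0 <= B.
  apply: le_trans (HB (v := 0) _); first exact: cabs_ge0.
  by rewrite (_ : enorm 0 = 0) ?divr_ge0 //; apply/eqP; rewrite enorm_eq0.
set d := 2 * B * t ^+ k.+1.
have half : 0 < (1 / 2 : R) < 1 by apply/andP; split; lra.
have tay N (u : C) : cabs u <= 1 -> cabs (approx N (u * creal W^-1) -
    \sum_(j < k.+1) taylor_coef (approx N) j * (u * creal W^-1) ^+ j) <= d.
  move=> u1; have h1 : forall w : C, cabs w = 1 / 2 -> cabs (approx N w) <= B.
    by move=> w wr; apply: approx_le; rewrite wr; lra.
  have h2 : cabs (u * creal W^-1) <= t * (1 / 2).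
    rewrite cabsM cabs_creal gtr0_norm ?invr_gt0 // /t.
    rewrite [leRHS](_ : _ = 1 * W^-1); last by field.
    by apply: ler_wpM2r => //; rewrite invr_ge0 ltW.
  have h3 : cabs (approx N (u * creal W^-1) -
      \sum_(j < k.+1) taylor_coef (approx N) j * (u * creal W^-1) ^+ j) <= B * t ^+ k.+1 / (1 - t).
    have T := @taylor_tail R (approx N) (1 / 2) t B k.+1 (u * creal W^-1) (@approx_holomorphic N) half t01 h1.
    exact: T h2.
  apply: (le_trans h3).
  have -> : d = B * (t ^+ k.+1 * 2) by rewrite /d; ring.
  rewrite -mulrA; apply: ler_wpM2l => //; apply: ler_wpM2l; first exact: exprn_ge0.
  rewrite -[leLHS]mul1r ler_pdivrMr ?subr_gt0 //.
  have : t <= 1 / 2 by rewrite /t ler_pdivrMr //; move: W4; lra.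
  lra.
have step N : cabs (approx N (v * creal W^-1) - \sum_i approx N (x i * creal W^-1) * (L i).[v]) <= d * Lam.
  pose P : {poly C} := \poly_(j < k.+1) (taylor_coef (approx N) j * creal W^-1 ^+ j).
  have PE (u : C) : P.[u] = \sum_(j < k.+1) taylor_coef (approx N) j * (u * creal W^-1) ^+ j.
    rewrite horner_poly; apply: eq_bigr => j _; rewrite exprMn -mulrA; congr (_ * _).
    by rewrite mulrC.
  have -> : approx N (v * creal W^-1) - \sum_i approx N (x i * creal W^-1) * (L i).[v] =
      (approx N (v * creal W^-1) - P.[v]) -
      \sum_i (approx N (x i * creal W^-1) - P.[x i]) * (L i).[v].
    rewrite (L_interp (size_poly _ _) v) -/P.
    under [X in _ = _ - X]eq_bigr do rewrite mulrBl.
    by rewrite sumrB; ring.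
  apply: (le_trans (cabsB _ _)); rewrite /Lam mulrDr mulr1; apply: lerD.
    by rewrite PE; exact: tay.
  apply: (le_trans (cabs_sum _ _ _)); rewrite mulr_sumr; apply: ler_sum => i _.
  by rewrite cabsM; apply: ler_wpM2r; [exact: cabs_ge0|rewrite PE; exact: tay].
set E := F k _ - _.
have lim : approx N (v * creal W^-1) - \sum_i approx N (x i * creal W^-1) * (L i).[v] @[N --> \oo] -->
    creal ((1 / 2) ^+ k) * (creal (rho ^+ k) * E).
  have -> : creal ((1 / 2) ^+ k) * (creal (rho ^+ k) * E) =
      creal ((1 / 2) ^+ k) * (creal (rho ^+ k) * F k (p + v *: q)) -
      \sum_(i < k.+1) (creal ((1 / 2) ^+ k) * (creal (rho ^+ k) * F k (p + x i *: q))) * (L i).[v].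
    rewrite /E !mulrBr; congr (_ - _); rewrite !mulr_sumr; apply: eq_bigr => i _.
    by rewrite !mulrA.
  have c1 := approx_limit v1.
  have c2 : \sum_(i < k.+1) approx N (x i * creal W^-1) * (L i).[v] @[N --> \oo] -->
     \sum_(i < k.+1) (creal ((1 / 2) ^+ k) * (creal (rho ^+ k) * F k (p + x i *: q))) * (L i).[v].
    apply: (@cvg_Csum_fin _ _ \oo _ _ (fun i N => approx N (x i * creal W^-1) * (L i).[v])) => i.
    apply: (@cvg_Cmul _ _ \oo); [exact: approx_limit|exact: cvg_cst].
  exact: (cvgB c1 c2).
have ct := cvg_cabs lim.
have {ct}: cabs (creal ((1 / 2) ^+ k) * (creal (rho ^+ k) * E)) <= d * Lam.
  by apply: limr_le_cst (ct _) step.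
rewrite !cabsM !cabs_creal !ger0_norm ?exprn_ge0 ?(ltW rho0) ?divr_ge0 //.
have A0 : 0 < A by apply: lt_le_trans A1.
have p1 : 0 < (2 * A * W) ^+ k by rewrite exprn_gt0 // !mulr_gt0.
have -> : (1 / 2) ^+ k * (rho ^+ k * cabs E) = cabs E / (2 * A * W) ^+ k.
  rewrite mulrA -exprMn -exprVn mulrC; congr (_ * _ ^+ _).
  by rewrite /rho div1r -invfM mulrA.
rewrite ler_pdivrMr // => /le_trans; apply.
rewrite /d /t expr_div_n !exprMn [W ^+ k.+1]exprS.
have Wk : W ^+ k != 0 by rewrite expf_neq0.
rewrite le_eqVlt; apply/orP; left; apply/eqP.
by field; rewrite Wne Wk.
Qed.

End Scale.

Lemma homogeneous_interpolation (p q : Cn) (v : C) : cabs v <= 1 ->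
  F k (p + v *: q) = \sum_i F k (p + x i *: q) * (L i).[v].
Proof.
move=> v1; apply/eqP; rewrite -subr_eq0; apply/eqP; apply: cabs_small => e e0.
have [B B0 HB] := ball_bounded fh.
set K := (2 * (1 + enorm p + enorm q)) ^+ k * (2 * B * 2 ^+ k.+1) * (1 + \sum_i cabs (L i).[v]).
have K0 : 0 <= K.
  rewrite !mulr_ge0 ?exprn_ge0 ?mulr_ge0 ?addr_ge0 ?enorm_ge0 ?sumr_ge0 //.
  by move=> i _; exact: cabs_ge0.
pose W := 4 + K / e.
have W4 : 4 <= W by rewrite lerDl divr_ge0 // ltW.
have W0 : 0 < W by apply: lt_le_trans W4.
apply: (le_trans (interpolation_error p q W4 HB v1)); rewrite -/K.
rewrite ler_pdivrMr // /W mulrDr [e * (K / e)]mulrC divfK ?gt_eqF //.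
by rewrite lerDr mulr_ge0 // ltW.
Qed.

End Lagrange.

(** Interpolation treats one coordinate at a time: [mix m a z] takes its first m coordinates from z
    and the others from a, and each coordinate contributes degree k. The degree n k is crude, but
    linear growth in k is what Bernstein's inequality on the blocks requires. *)
Lemma rpoly_homogeneous_part k : exists2 P, rpoly (n * k) P & forall z, S z -> F k z = P z.
Proof.
pose x (i : 'I_k.+1) : C := creal (i.+1%:R / k.+1%:R).
have xi : injective x.
  move=> i j /creal_inj /(mulIf _) E; apply/val_inj.
  have /E /eqP : (k.+1%:R : R)^-1 != 0 by rewrite invr_eq0 pnatr_eq0.
  by rewrite eqr_nat eqSS => /eqP.
have x1 i : cabs (x i) <= 1.
  rewrite cabs_creal ger0_norm ?divr_ge0 ?ler0n // ler_pdivrMr ?ltr0n // mul1r ler_nat.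
  exact: ltn_ord.
have [L [sL HL]] := lagrange_interpolation xi.
pose mix (m : nat) (a z : Cn) : Cn := \row_(j < n) (if (j < m)%N then z ord0 j else a ord0 j).
have H m a : (m <= n)%N -> exists2 P, rpoly (m * k) P &
    forall z : Cn, (forall j, cabs (z ord0 j) <= 1) -> F k (mix m a z) = P z.
  elim: m a => [|m IH] a mn.
    exists (fun=> F k a); first exact: rpoly_cst.
    by move=> z _; congr (F k _); apply/rowP => j; rewrite mxE.
  pose jm := Ordinal mn.
  pose b (i : 'I_k.+1) : Cn := \row_(j < n) (if j == jm then x i else a ord0 j).
  pose rep i Q := rpoly (m * k) Q /\
    forall z : Cn, (forall j, cabs (z ord0 j) <= 1) -> F k (mix m (b i) z) = Q z.
  have [Q HQ] : exists Q : 'I_k.+1 -> Cn -> C, forall i, rep i (Q i).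
    have ex i : exists Q, rep i Q by have [Q h1 h2] := IH (b i) (ltnW mn); exists Q.
    by have [Q HQ] := boolp.choice ex; exists Q.
  exists (fun z => \sum_(i < k.+1) Q (inord i) z * (L (inord i)).[z ord0 jm]).
    apply: (@rpoly_sum _ _ _ _ (fun i z => Q (inord i) z * (L (inord i)).[z ord0 jm])) => i _.
    by rewrite mulSn addnC; apply: rpolyM; [exact: (HQ _).1|exact: rpoly_horner].
  move=> z z1.
  pose p : Cn := \row_(j < n) (if (j < m)%N then z ord0 j else if j == jm then 0 else a ord0 j).
  pose q : Cn := \row_(j < n) (j == jm)%:R.
  have mixE (u : C) (c : Cn) : (forall j, c ord0 j = if j == jm then u else a ord0 j) ->
      mix m c z = p + u *: q.
    move=> hc; apply/rowP => j; rewrite !mxE hc.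
    case: ltnP => jm1; last by case: eqP => _; rewrite ?mulr1 ?mulr0 ?add0r ?addr0.
    by rewrite (_ : j == jm = false) ?mulr0 ?addr0 //; apply/eqP => E; rewrite E ltnn in jm1.
  have -> : mix m.+1 a z = p + z ord0 jm *: q.
    apply/rowP => j; rewrite !mxE ltnS leq_eqVlt.
    have [->|jne] := eqVneq j jm; first by rewrite eqxx ltnn /= mulr1 add0r.
    rewrite (_ : (j == m :> nat) = false) /= ?mulr0 ?addr0 //.
    by apply/eqP => E; case/eqP: jne; apply/val_inj.
  rewrite (homogeneous_interpolation x1 HL p q (z1 jm)).
  apply: eq_bigr => i _; rewrite inord_val -((HQ i).2 z z1) (mixE (x i)) //.
  by move=> j; rewrite mxE.
have [P HP PE] := H n 0 (leqnn n); exists P => // z Sz.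
rewrite -PE; first by congr (F k _); apply/rowP => j; rewrite mxE ltn_ord.
by move=> j; rewrite -Sz; exact: cabs_le_enorm.
Qed.

Lemma homogeneous_part_seq : homogeneous_seq F.
Proof.
split; last by move=> k l z; exact: homogeneous_part_rot.
move=> k; have [P HP PE] := rpoly_homogeneous_part k.
have cP := scont_rpoly HP.
move=> z Sz; rewrite PE //; apply: cvg_trans (cP z Sz).
apply: near_eq_cvg; near=> w; rewrite PE //; near: w; exact: withinT.
Unshelve. all: end_near. Qed.

End Interpolation.

(** * Bernstein inequalities on great circles *)

Lemma conj_mul (R : realType) (z w : Cx R) : (z * w)^* = z^* * w^*.
Proof. exact: rmorphM. Qed.

Lemma conj_add (R : realType) (z w : Cx R) : (z + w)^* = z^* + w^*.
Proof. exact: rmorphD. Qed.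

Section TrigonometricPolynomials.
Variable R : realType.
Local Notation C := (Cx R).
Implicit Types (g : C -> C) (p : {poly C}).

Definition trig_poly d g := exists2 p : {poly C}, (size p <= (2 * d).+1)%N &
  forall l, cabs l = 1 -> g l = p.[l] * l^* ^+ d.

Lemma trig_polyM d e g h : trig_poly d g -> trig_poly e h -> trig_poly (d + e) (fun l => g l * h l).
Proof.
move=> [p sp pE] [q sq qE]; exists (p * q).
  apply: (leq_trans (size_polyMleq _ _)); rewrite mulnDr; move: sp sq; clear; lia.
by move=> l l1; rewrite pE // qE // hornerM exprD; ring.
Qed.

Lemma trig_polyD d g h : trig_poly d g -> trig_poly d h -> trig_poly d (fun l => g l + h l).
Proof.
move=> [p sp pE] [q sq qE]; exists (p + q).
  by apply: (leq_trans (size_polyD _ _)); rewrite geq_max sp sq.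
by move=> l l1; rewrite pE // qE // hornerD mulrDl.
Qed.

Lemma trig_poly_shift d p : (size p <= 3)%N -> trig_poly d.+1 (fun l => p.[l] * l^*).
Proof.
move=> sp; exists (p * 'X^d).
  apply: (leq_trans (size_polyMleq _ _)); rewrite size_polyXn; move: sp; clear; lia.
move=> l l1; rewrite hornerM hornerXn exprS -mulrA; congr (_ * _).
by rewrite mulrCA -exprMn mul_conj_unit // expr1n mulr1.
Qed.

Lemma trig_poly_cst d c : trig_poly d (fun=> c).
Proof.
exists (c%:P * 'X^d).
  apply: (leq_trans (size_polyMleq _ _)); rewrite size_polyXn.
  have := size_polyC_leq1 c; clear; lia.
by move=> l l1; rewrite hornerM hornerXn hornerC -mulrA -exprMn mul_conj_unit // expr1n mulr1.
Qed.

Lemma trig_poly_rot d g m : cabs m = 1 -> trig_poly d g -> trig_poly d (fun l => g (m * l)).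
Proof.
move=> m1 [p sp pE]; exists ((m^* ^+ d) *: \poly_(i < (2 * d).+1) (p`_i * m ^+ i)).
  exact: leq_trans (size_scale_leq _ _) (size_poly _ _).
move=> l l1; rewrite pE ?cabsM ?m1 ?l1 ?mulr1 // hornerZ horner_poly (horner_coef_wide _ sp).
rewrite conj_mul [(m^* * _) ^+ d]exprMn.
have -> : \sum_(i < (2 * d).+1) p`_i * (m * l) ^+ i = \sum_(i < (2 * d).+1) p`_i * m ^+ i * l ^+ i.
  by apply: eq_bigr => i _; rewrite exprMn mulrA.
by ring.
Qed.

(** The derivative with respect to the angle, divided by i. *)
Definition trig_deriv d p l : C :=
  \sum_(i < (2 * d).+1) (i%:R - d%:R) * p`_i * (l ^+ i * l^* ^+ d).

(** d times the triangle at 2 d minus the triangle at 0 is a sawtooth, linear in between and equal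
    to i - d. Differentiation thus becomes convolution with a kernel of L^1 norm at most 2 d. *)
Lemma trig_kernel M d i : (3 * d < M)%N -> (i <= 2 * d)%N -> (0 < d)%N ->
  mean M (fun m : C => creal (fejer d m) * (d%:R * (m^* ^+ d - m ^+ d)) * (m ^+ i * m^* ^+ d)) =
  i%:R - d%:R.
Proof.
move=> dM id2 d0.
transitivity (mean M (fun m : C => d%:R * (creal (fejer d m) * (m ^+ i * m^* ^+ (2 * d)) -
    creal (fejer d m) * (m ^+ i * m^* ^+ 0)))).
  apply: eq_mean => m m1; rewrite mul2n -addnn exprD expr0.
  have E : m ^+ d * m^* ^+ d = 1 by rewrite -exprMn mul_conj_unit // expr1n.
  transitivity (creal (fejer d m) * d%:R * (m ^+ i * (m^* ^+ d * m^* ^+ d)) -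
    creal (fejer d m) * d%:R * (m ^+ i * (m ^+ d * m^* ^+ d))); first by ring.
  by rewrite E; ring.
rewrite meanZ meanB !mean_fejer; [|lia..].
rewrite -creal_nat -crealB -crealM /tri subn0 sub0n addn0.
have dR : (d%:R : R) != 0 by rewrite pnatr_eq0 -lt0n.
rewrite -mulrBl mulrCA mulfV // mulr1.
have [di|id] := leqP d i.
  have -> : (d - (i - 2 * d + (2 * d - i)) = i - d)%N by lia.
  have -> : (d - i = 0)%N by lia.
  by rewrite subr0 natrB // crealB !creal_nat.
have -> : (d - (i - 2 * d + (2 * d - i)) = 0)%N by lia.
by rewrite sub0r natrB ?(ltnW id) // crealN crealB !creal_nat opprB.
Qed.

Lemma trig_deriv_bound d g p (B : R) : (0 < d)%N -> (size p <= (2 * d).+1)%N ->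
  (forall l, cabs l = 1 -> g l = p.[l] * l^* ^+ d) ->
  (forall l, cabs l = 1 -> cabs (g l) <= B) ->
  forall l, cabs l = 1 -> cabs (trig_deriv d p l) <= 2 * d%:R * B.
Proof.
move=> d0 sp gE HB l l1; set M := (3 * d).+1.
have -> : trig_deriv d p l = mean M (fun m =>
    creal (fejer d m) * (d%:R * (m^* ^+ d - m ^+ d)) * g (l * m)).
  transitivity (mean M (fun m : C => \sum_(i < (2 * d).+1) (p`_i * (l ^+ i * l^* ^+ d)) *
      (creal (fejer d m) * (d%:R * (m^* ^+ d - m ^+ d)) * (m ^+ i * m^* ^+ d)))).
    rewrite mean_sum; apply: eq_bigr => i _; rewrite meanZ trig_kernel //; last by rewrite -ltnS.
    by ring.
  apply: eq_mean => m m1; rewrite gE ?cabsM ?l1 ?m1 ?mulr1 // (horner_coef_wide _ sp).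
  rewrite mulr_suml mulr_sumr; apply: eq_bigr => i _.
  by rewrite conj_mul !exprMn; ring.
pose v (m : C) : R := 2 * d%:R * B * fejer d m.
apply: (@le_trans _ _ (rmean M v)).
  apply: cabs_mean_le => m m1; rewrite /v cabsM; have B0 : 0 <= B by apply: le_trans (HB _ l1); exact: cabs_ge0.
  rewrite mulrC [leRHS]mulrAC [leRHS]mulrC; apply: ler_pM; rewrite ?cabs_ge0 //.
    by apply: HB; rewrite cabsM l1 m1 mulr1.
  rewrite cabsM [cabs (d%:R * _)]cabsM cabs_creal cabs_nat ger0_norm ?fejer_ge0 // mulrC [2 * _]mulrC.
  apply: ler_wpM2r; first exact: fejer_ge0.
  apply: ler_wpM2l; first exact: ler0n.
  apply: (le_trans (cabsB _ _)); rewrite !cabsX cabs_conj m1 !expr1n.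
  by rewrite lexx.
rewrite /v (rmeanZ _ (2 * d%:R * B)) rmean_fejer ?mulr1 //.
by rewrite d0 /M; lia.
Qed.

Lemma trig_poly_lip d g (B t : R) l : (0 < d)%N -> trig_poly d g ->
  (forall l, cabs l = 1 -> cabs (g l) <= B) -> cabs l = 1 ->
  cabs (g (l * cis t) - g l) <= 2 * d%:R * B * `|t|.
Proof.
move=> d0 [p sp gE] HB l1.
(* [K] bounds the second-order remainder of one step. Dividing t into N equal steps leaves a total
   remainder K t^2 / N, which disappears in the limit. *)
set K := 4 * d%:R ^+ 2 * \sum_(i < (2 * d).+1) cabs p`_i.
have K0 : 0 <= K.
  by rewrite mulr_ge0 ?mulr_ge0 ?exprn_ge0 ?ler0n // sumr_ge0 // => i _; exact: cabs_ge0.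
have dR : (0 : R) < d%:R by rewrite ltr0n.
have step s m : cabs m = 1 -> d%:R * `|s| <= 1 / 2 ->
    cabs (g (m * cis s) - g m) <= 2 * d%:R * B * `|s| + K * s ^+ 2.
  move=> m1 ds.
  have E : g (m * cis s) - g m = 'i * creal s * trig_deriv d p m +
      \sum_(i < (2 * d).+1) p`_i * (m ^+ i * m^* ^+ d) *
        (cis ((i%:R - d%:R) * s) - 1 - 'i * creal ((i%:R - d%:R) * s)).
    rewrite !gE ?cabsM ?m1 ?cabs_cis ?mulr1 // !(horner_coef_wide _ sp) !mulr_suml.
    rewrite -sumrB /trig_deriv mulr_sumr -big_split /=; apply: eq_bigr => i _.
    rewrite conj_mul -cisN !exprMn !cisX.
    have -> : cis ((i%:R - d%:R) * s) = cis (i%:R * s) * cis (d%:R * - s).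
      by rewrite -cisD mulrBl mulrN.
    by rewrite crealM crealB !creal_nat; ring.
  rewrite E; apply: (le_trans (cabsD _ _)); apply: lerD.
    rewrite !cabsM (_ : cabs 'i = 1); last by apply: cabsE; rewrite normCi creal1.
    rewrite mul1r cabs_creal mulrC; apply: ler_wpM2r => //.
    exact: (trig_deriv_bound d0 sp gE HB).
  apply: (le_trans (cabs_sum _ _ _)).
  rewrite /K mulrAC mulr_sumr; apply: ler_sum => i _.
  rewrite !cabsM !cabsX cabs_conj m1 !expr1n !mulr1 mulrC; apply: ler_wpM2r; first exact: cabs_ge0.
  have idd : `|i%:R - d%:R| <= d%:R :> R.
    rewrite ler_norml lerBlDr -natrD ler_nat; apply/andP; split.
      by rewrite lerBrDr addrC subrr ler0n.
    by rewrite addnn -mul2n -ltnS.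
  have xd : `|(i%:R - d%:R) * s| <= d%:R * `|s| by rewrite normrM; apply: ler_wpM2r.
  have z0 : `|0 : R| <= 1 / 2 by rewrite normr0; lra.
  have := exp_cis_quadratic z0 (le_trans xd ds).
  rewrite expR0 creal1 creal0 mul1r normr0 !add0r => /le_trans; apply.
  rewrite -mulrA; apply: ler_wpM2l => //.
  rewrite -(real_normK (num_real s)) -exprMn; apply: lerXn2r; rewrite ?nnegrE ?mulr_ge0 //.
have iter N s m : cabs m = 1 -> d%:R * `|s| <= 1 / 2 ->
    cabs (g (m * cis (N%:R * s)) - g m) <= N%:R * (2 * d%:R * B * `|s| + K * s ^+ 2).
  move=> m1 ds; elim: N => [|N IH].
    by rewrite !mul0r cis0 mulr1 subrr cabs0.
  apply: (le_trans (cabs_triangle (g (m * cis (N%:R * s))) _ _)).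
  rewrite -natr1 [leRHS]mulrDl mul1r addrC; apply: lerD; first exact: IH.
  have -> : m * cis ((N%:R + 1) * s) = m * cis (N%:R * s) * cis s.
    by rewrite mulrDl mul1r cisD mulrA.
  by apply: step; rewrite // cabsM m1 cabs_cis mulr1.
apply/ler_addgt0Pr => e e0.
pose N := (Num.Def.truncn (2 * d%:R * `|t| + K * t ^+ 2 / e)).+1.
have NR : (0 : R) < N%:R by rewrite ltr0n.
have hN : 2 * d%:R * `|t| + K * t ^+ 2 / e <= N%:R by apply/ltW/truncnS_gt.
have h1 : 0 <= K * t ^+ 2 / e.
  by apply: divr_ge0; [apply: mulr_ge0 => //; exact: sqr_ge0|exact: ltW].
have h2 : 0 <= 2 * d%:R * `|t| by rewrite !mulr_ge0 // ltW.
have tN : d%:R * `|t / N%:R| <= 1 / 2.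
  rewrite normrM normfV (gtr0_norm NR) mulrA ler_pdivrMr //; move: hN h1; clear; lra.
have := iter N (t / N%:R) l l1 tN; rewrite [N%:R * (t / _)]mulrC divfK ?gt_eqF // => /le_trans; apply.
rewrite normrM normfV (gtr0_norm NR) expr_div_n.
rewrite (_ : _ * (_ + _) = 2 * d%:R * B * `|t| + K * t ^+ 2 / N%:R); last first.
  by field; rewrite gt_eqF.
rewrite lerD2l ler_pdivrMr // [leRHS]mulrC -ler_pdivrMr //; move: hN h2; clear; lra.
Qed.

Lemma trig_poly_chord : exists2 K : R, 0 <= K & forall d g (B : R) m, (0 < d)%N -> trig_poly d g ->
  (forall l, cabs l = 1 -> cabs (g l) <= B) -> cabs m = 1 ->
  cabs (g m - g 1) <= K * d%:R * B * cabs (m - 1) /\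
  cabs (g m + g m^* - 2 * g 1) <= (K * d%:R) ^+ 2 * B * cabs (m - 1) ^+ 2.
Proof.
have [C0 C0p HC] := chord_bound R; exists (2 * C0); first by rewrite mulr_ge0 // ltW.
move=> d g B m d0 gt gB m1.
have lip (h : C -> C) (b : R) (l x : C) : trig_poly d h -> (forall l, cabs l = 1 -> cabs (h l) <= b) ->
    cabs l = 1 -> cabs x = 1 -> cabs (h (x * l) - h x) <= 2 * C0 * d%:R * b * cabs (l - 1).
  move=> ht hb l1 x1; have [t tpi ->] := cis_surj l1.
  apply: (le_trans (trig_poly_lip t d0 ht hb x1)).
  have b0 : 0 <= b by apply: le_trans (hb _ x1); exact: cabs_ge0.
  have -> : 2 * C0 * d%:R * b * cabs (cis t - 1) = 2 * d%:R * b * (C0 * cabs (cis t - 1)) by ring.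
  by apply: ler_wpM2l; [rewrite !mulr_ge0 // ler0n|exact: HC].
split; first by have := lip g B m 1 gt gB m1 (cabs1 R); rewrite mul1r.
(* The second difference is h 1 - h (conj m), a first difference of a polynomial of the same degree
   that is itself O(|m - 1|). *)
pose h (l : C) := g (m * l) - g l.
have ht : trig_poly d h.
  have hm : trig_poly d (fun l => (-1) * g l).
    by rewrite -[d]add0n; apply: trig_polyM => //; exact: trig_poly_cst.
  have := trig_polyD (trig_poly_rot m1 gt) hm; congr trig_poly.
  by apply/funext => l; rewrite mulN1r.
have hb l : cabs l = 1 -> cabs (h l) <= 2 * C0 * d%:R * B * cabs (m - 1).
  by move=> l1; rewrite /h mulrC; apply: lip.
have m1' : cabs m^* = 1 by rewrite cabs_conj.
have := lip h _ m m^* ht hb m1 m1'.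
rewrite [m^* * m]mulrC mul_conj_unit // => H.
have -> : g m + g m^* - 2 * g 1 = h 1 - h m^*.
  by rewrite /h mulr1 mul_conj_unit //; ring.
apply: (le_trans H); rewrite le_eqVlt; apply/orP; left; apply/eqP; ring.
Qed.

End TrigonometricPolynomials.

Section GreatCircles.
Variables (R : realType) (n : nat).
Local Notation C := (Cx R).
Local Notation Cn := 'rV[Cx R]_n.
Local Notation S := (@unit_sphere R n).

Definition great_circle (z u : Cn) (l : C) : Cn :=
  creal (complex.Re l) *: z + creal (complex.Im l) *: u.

Lemma great_circle_through z w : S z -> S w -> exists u m,
  [/\ S u, redot z u = 0, cabs m = 1, w = great_circle z u m &
      sphere_reflect z w = great_circle z u m^*].
Proof.
move=> Sz Sw; set c := redot w z; set v := w - creal c *: z.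
have zz : redot z z = 1 by rewrite redot_self Sz expr1n.
have zv : redot z v = 0 by rewrite /v redotDr redotNr redotZr zz mulr1 redotC subrr.
have wE : w = creal c *: z + v by rewrite /v addrC subrK.
have vv : enorm v ^+ 2 = 1 - c ^+ 2.
  have := enormD_sqr (creal c *: z) v; rewrite -wE Sw redotZl zv !mulr0 addr0 enormZ Sz mulr1.
  by rewrite cabs_creal real_normK ?num_real // expr1n => ->; rewrite addrAC subrr add0r.
have refl : sphere_reflect z w = creal c *: z - v.
  rewrite /sphere_reflect -/c [X in _ - X]wE opprD addrA -scalerBl -crealB; congr (creal _ *: z - v).
  by ring.
(* If w is z or - z it determines no tangent direction; then i z serves, being orthogonal to z for
   [redot]. *)
have [v0|v0] := eqVneq v 0.
{
  have c1 : c ^+ 2 = 1.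
    by move: vv; rewrite v0 (_ : enorm 0 = 0) ?expr0n /=; [lra|apply/eqP; rewrite enorm_eq0].
  exists ('i *: z), (creal c); rewrite conj_creal.
  have gz : great_circle z ('i *: z) (creal c) = creal c *: z.
    by rewrite /great_circle /= scale0r addr0.
  split; rewrite ?gz.
  - by rewrite /unit_sphere /= enormZ Sz mulr1; apply: cabsE; rewrite normCi creal1.
  - rewrite /redot big1 // => j _; rewrite mxE cReM cRe_conj cIm_conj cReM cImM /=; ring.
  - by rewrite cabs_creal; apply/eqP; rewrite -sqrp_eq1 ?normr_ge0 // real_normK ?num_real // c1.
  - by rewrite wE v0 addr0.
  - by rewrite refl v0 subr0.
}
have s0 : 0 < enorm v by rewrite lt_neqAle eq_sym enorm_eq0 v0 enorm_ge0.
have [s sE] : exists s, enorm v = s by exists (enorm v).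
rewrite sE in s0 vv.
exists (creal s^-1 *: v), (c +i* s)%C.
have vE : creal s *: (creal s^-1 *: v) = v.
  by rewrite scalerA -crealM mulfV ?gt_eqF // creal1 scale1r.
split.
- by rewrite /unit_sphere /= enormZ cabs_creal gtr0_norm ?invr_gt0 // sE mulVf // gt_eqF.
- by rewrite redotZr zv mulr0.
- by rewrite /cabs /= vv addrC subrK sqrtr1.
- by rewrite /great_circle /= vE.
- by rewrite refl /great_circle /= crealN scaleNr vE.
Qed.

Lemma great_circle_isometry z u (l m : C) : S z -> S u -> redot z u = 0 ->
  enorm (great_circle z u l - great_circle z u m) = cabs (l - m).
Proof.
move=> Sz Su zu; apply/eqP; rewrite -(@eqrXn2 _ 2) ?enorm_ge0 ?cabs_ge0 //.
have -> : great_circle z u l - great_circle z u m =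
    creal (complex.Re (l - m)) *: z + creal (complex.Im (l - m)) *: u.
  by rewrite cReB cImB !crealB !scalerBl /great_circle opprD addrACA.
rewrite enormD_sqr redotZl redotZr zu !mulr0 addr0 !enormZ Sz Su !mulr1 !cabs_creal.
by rewrite !real_normK ?num_real // /cabs sqr_sqrtr // addr_ge0 // sqr_ge0.
Qed.

Lemma great_circle_sphere z u (l : C) : S z -> S u -> redot z u = 0 -> cabs l = 1 ->
  S (great_circle z u l).
Proof.
move=> Sz Su zu l1; have := great_circle_isometry l 0 Sz Su zu.
rewrite subr0 l1 => E; rewrite /unit_sphere /= -[RHS]E; congr enorm.
by rewrite /great_circle /= !scale0r addr0 subr0.
Qed.

Lemma great_circle1 z u : great_circle z u 1 = z.
Proof. by rewrite /great_circle /= scale1r scale0r addr0. Qed.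

Lemma rpoly_great_circle d P z u : rpoly d P -> trig_poly d (fun l => P (great_circle z u l)).
Proof.
have coord (a b : C) e : trig_poly e.+1 (fun l : C => creal (complex.Re l) * a + creal (complex.Im l) * b).
  pose p : {poly C} := ((a - 'i * b) / 2) *: 'X^2 + ((a + 'i * b) / 2)%:P.
  have sp : (size p <= 3)%N.
    apply: (leq_trans (size_polyD _ _)); rewrite geq_max (leq_trans (size_scale_leq _ _)) ?size_polyXn //=.
    exact: leq_trans (size_polyC_leq1 _) _.
  have [q sq qE] := trig_poly_shift e sp; exists q => // l l1; rewrite -qE //.
  rewrite /p hornerD hornerZ hornerXn hornerC mulrDl expr2 -mulrA -[l * l * _]mulrA mul_conj_unit //.
  have lE := ReImE l.
  have lcE : l^* = creal (complex.Re l) - 'i * creal (complex.Im l).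
    by apply: Cx_eqP; rewrite ?cRe_conj ?cIm_conj ?cReB ?cImB ?cReM ?cImM /=; ring.
  have i2 : 'i * 'i = -1 :> C by rewrite -expr2 sqrCi.
  rewrite mulr1; move: (complex.Re l) (complex.Im l) lE lcE => x y -> ->.
  transitivity (creal x * a - 'i * 'i * creal y * b); last by field.
  by rewrite i2; ring.
elim=> {d P} [d c|d j|d j|d P Q _ IP _ IQ|d e P Q _ IP _ IQ].
- exact: trig_poly_cst.
- have := coord (z ord0 j) (u ord0 j) d; congr trig_poly.
  by apply/funext => l; rewrite !mxE.
- have := coord (z ord0 j)^* (u ord0 j)^* d; congr trig_poly.
  apply/funext => l; rewrite !mxE conj_add !conj_mul !conj_creal.
  by [].
- exact: trig_polyD.
- exact: trig_polyM.
Qed.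

(** Any two points of the sphere lie on a great circle, an isometric image of the unit circle on
    which the polynomial is trigonometric of the same degree. *)
Lemma rpoly_lip : exists2 K : R, 0 <= K & forall d P (B : R), (0 < d)%N -> rpoly d P ->
  (forall z, S z -> cabs (P z) <= B) -> forall z w, S z -> S w ->
  cabs (P w - P z) <= K * d%:R * B * enorm (w - z) /\
  cabs (P w + P (sphere_reflect z w) - 2 * P z) <= (K * d%:R) ^+ 2 * B * enorm (w - z) ^+ 2.
Proof.
have [K K0 HK] := trig_poly_chord R; exists K => // d P B d0 HP HB z w Sz Sw.
have [u [m [Su zu m1 -> ->]]] := great_circle_through Sz Sw.
have gB l : cabs l = 1 -> cabs (P (great_circle z u l)) <= B.
  by move=> l1; apply: HB; exact: great_circle_sphere.
have E : enorm (great_circle z u m - z) = cabs (m - 1).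
  by rewrite -[X in _ - X](great_circle1 z u) great_circle_isometry.
have [h1 h2] := HK d _ B m d0 (rpoly_great_circle z u HP) gB m1.
by rewrite E; split; [move: h1|move: h2]; rewrite great_circle1.
Qed.

End GreatCircles.

(** * Dyadic sums of polynomials are Lipschitz *)

Lemma cvg_Cext (R : realType) T (F : set_system T) (f g : T -> Cx R) (l : Cx R) :
  (forall x, g x = f x) -> f x @[x --> F] --> l -> g x @[x --> F] --> l.
Proof. by move=> E; have -> : g = f by exact/funext. Qed.

Lemma cvg_Cadd (R : realType) T (F : set_system T) {FF : Filter F} (f g : T -> Cx R)
  (a b : Cx R) :
  f x @[x --> F] --> a -> g x @[x --> F] --> b -> f x + g x @[x --> F] --> a + b.
Proof. exact: cvgD. Qed.

Lemma conj_sub (R : realType) (z w : Cx R) : (z - w)^* = z^* - w^*.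
Proof. exact: rmorphB. Qed.

Section SphereDerivatives.
Variables (R : realType) (n : nat).
Local Notation C := (Cx R).
Local Notation Cn := 'rV[Cx R]_n.
Local Notation S := (@unit_sphere R n).
Implicit Types (z v : Cn) (P : Cn -> C).

Lemma line_proj_near v z : S z -> \forall h \near (0 : R)^',
  [/\ h != 0, 0 < enorm (z + creal h *: v), S (sphere_proj (z + creal h *: v)) &
      enorm (sphere_proj (z + creal h *: v) - z) <= 2 * `|h| * enorm v].
Proof.
move=> Sz; have d0 : 0 < 1 / (2 * (enorm v + 1)).
  by rewrite divr_gt0 // mulr_gt0 // ltr_wpDl // enorm_ge0.
near=> h.
have h0 : h != 0 by near: h; exact: nbhs_dnbhs_neq.
have hd : `|h| < 1 / (2 * (enorm v + 1)).
  near: h; apply: nbhs_dnbhs; exists (1 / (2 * (enorm v + 1))) => //= x.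
  by rewrite /ball_ /= sub0r normrN.
have v0 := enorm_ge0 v.
have hv : `|h| * enorm v <= 1 / 2.
  have : `|h| * (2 * (enorm v + 1)) < 1 by rewrite -ltr_pdivlMr // mulr_gt0 // ltr_wpDl.
  have : 0 <= `|h| by []. nra.
set w := z + creal h *: v; have wz : enorm (w - z) = `|h| * enorm v.
  by rewrite /w addrC addKr enormZ cabs_creal.
have N1 : `|enorm w - 1| <= `|h| * enorm v.
  by rewrite -wz -[X in _ - X]Sz; exact: enorm_dist.
have N0 : 0 < enorm w by move: N1; rewrite ler_norml => /andP[+ _]; move: hv; lra.
have w0 : w != 0 by rewrite -enorm_eq0 gt_eqF.
split => //; first exact: sphere_proj_in.
have -> : sphere_proj w - z = creal (1 - enorm w) *: sphere_proj w + (w - z).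
  have pw : creal (enorm w) *: sphere_proj w = w.
    by rewrite /sphere_proj scalerA -crealM divff ?gt_eqF // creal1 scale1r.
  by rewrite crealB creal1 scalerBl scale1r pw addrA subrK.
apply: (le_trans (enormD _ _)); rewrite enormZ cabs_creal (sphere_proj_in w0) mulr1 wz.
rewrite distrC; move: N1; clear; lra.
Unshelve. all: end_near. Qed.

Lemma sphere_quotient_le v P (L : R) z : 0 <= L -> S z ->
  (forall w, S w -> cabs (P w - P z) <= L * enorm (w - z)) ->
  \forall h \near (0 : R)^', cabs (sphere_quotient v P z h) <= 2 * L * enorm v.
Proof.
move=> L0 Sz HL; have := line_proj_near v Sz; apply: filterS => h [h0 _ Sp hp].
have hh : 0 < `|h| by rewrite normr_gt0.
rewrite /sphere_quotient cabsM cabs_creal normfV ler_pdivrMl //.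
apply: (le_trans (HL _ Sp)); apply: (le_trans (ler_wpM2l L0 hp)).
by rewrite le_eqVlt; apply/orP; left; apply/eqP; ring.
Qed.

Lemma cvg_dnbhs0_id : (h : R) @[h --> (0 : R)^'] --> (0 : R).
Proof. exact: (@cvg_within_filter _ _ _ (nbhs (0 : R))). Qed.

Lemma cvg_line_norm v z : S z -> enorm (z + creal h *: v) @[h --> (0 : R)^'] --> (1 : R).
Proof.
move=> Sz; rewrite -[X in _ --> X]Sz; apply: cvg_enorm; apply/cvg_enormP => e e0.
have e2 : 0 < e / 2 by rewrite divr_gt0.
have [d d0 hd] := sqr_small (enorm_ge0 v) e2.
have /cvgrPdist_le /(_ d d0) := cvg_dnbhs0_id.
apply: filterS => h; rewrite sub0r normrN => hh.
rewrite addrC addKr enormZ cabs_creal.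
have : `|h| * enorm v <= e / 2.
  by apply: le_trans hd; rewrite mulrC; apply: ler_wpM2l => //; exact: enorm_ge0.
by move/le_lt_trans; apply; rewrite ltr_pdivrMr // ltr_pMr // ltr1n.
Qed.

Lemma sphere_quotient_coord v z j : S z ->
  sphere_quotient v (fun w => w ord0 j) z h @[h --> (0 : R)^'] -->
    v ord0 j - creal (redot z v) * z ord0 j.
Proof.
move=> Sz; pose N h := enorm (z + creal h *: v).
have Nlim : N h @[h --> (0 : R)^'] --> (1 : R) by exact: cvg_line_norm.
have NV : (N h)^-1 @[h --> (0 : R)^'] --> (1 : R).
  by rewrite -[X in _ --> X]invr1; apply: cvgV => //; exact: oner_neq0.
(* This is h^-1 (N^-1 - 1) with h cancelled, by N^2 - 1 = h (2 <z, v> + h |v|^2). *)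
have EV : - (2 * redot z v + h * enorm v ^+ 2) * ((N h)^-1 * (1 + N h)^-1) @[h --> (0 : R)^'] -->
    - redot z v.
  rewrite (_ : - redot z v = - (2 * redot z v + 0 * enorm v ^+ 2) * (1 * (1 + 1)^-1)); last by field.
  apply: cvgM.
    apply: cvgN; apply: cvgD; first exact: cvg_cst.
    by apply: cvgM; [exact: cvg_dnbhs0_id|exact: cvg_cst].
  apply: cvgM => //; apply: cvgV; first by rewrite -(natrD _ 1 1) pnatr_eq0.
  by apply: cvgD => //; exact: cvg_cst.
have lim : creal (- (2 * redot z v + h * enorm v ^+ 2) * ((N h)^-1 * (1 + N h)^-1)) * z ord0 j +
    creal (N h)^-1 * v ord0 j @[h --> (0 : R)^'] --> v ord0 j - creal (redot z v) * z ord0 j.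
  have -> : v ord0 j - creal (redot z v) * z ord0 j =
      creal (- redot z v) * z ord0 j + creal 1 * v ord0 j.
    by rewrite crealN creal1; ring.
  apply: cvgD; apply: cvgM; [exact: cvg_creal|exact: cvg_cst|exact: cvg_creal|exact: cvg_cst].
apply: cvg_trans lim; apply: near_eq_cvg.
have := line_proj_near v Sz; apply: filterS => h [h0 N0 _ _].
rewrite /sphere_quotient /sphere_proj !mxE -/(N h).
have {}N0 : 0 < N h by exact: N0.
have N1 : 0 < 1 + N h by rewrite addr_gt0.
have Nsq : N h ^+ 2 = 1 + 2 * (h * redot z v) + h ^+ 2 * enorm v ^+ 2.
  by rewrite /N enormD_sqr Sz redotZr enormZ cabs_creal exprMn real_normK ?num_real // expr1n.
have -> : - (2 * redot z v + h * enorm v ^+ 2) * ((N h)^-1 * (1 + N h)^-1) =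
    h^-1 * ((N h)^-1 - 1).
  have h0' : h != 0 by [].
  have e1 : 2 * redot z v + h * enorm v ^+ 2 = (N h ^+ 2 - 1) / h by rewrite Nsq; field.
  by rewrite e1; field; rewrite h0' !gt_eqF.
have hC : creal h^-1 * creal h = 1 by rewrite -crealM mulVf // creal1.
rewrite crealM crealB creal1.
transitivity (creal h^-1 * (creal (N h)^-1 - 1) * z ord0 j + creal h^-1 * creal h * (creal (N h)^-1 * v ord0 j)).
  by rewrite hC mul1r.
by ring.
Qed.

Lemma sphere_quotient_proj v P z (l : C) : S z ->
  sphere_quotient v P z h @[h --> (0 : R)^'] --> l ->
  P (sphere_proj (z + creal h *: v)) @[h --> (0 : R)^'] --> P z.
Proof.
move=> Sz lim.
have h0 : creal h @[h --> (0 : R)^'] --> (0 : C) by exact: (cvg_creal cvg_dnbhs0_id).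
have : P z + creal h * sphere_quotient v P z h @[h --> (0 : R)^'] --> P z + 0 * l.
  by apply: cvgD; [exact: cvg_cst|exact: (cvgM h0 lim)].
rewrite mul0r addr0 => c; apply: cvg_trans c; apply: near_eq_cvg.
have := line_proj_near v Sz; apply: filterS => h [hn _ _ _].
by rewrite /sphere_quotient mulrA -crealM mulfV // creal1 mul1r addrC subrK.
Qed.

Lemma sphere_quotientD v P Q z (p q : C) :
  sphere_quotient v P z h @[h --> (0 : R)^'] --> p ->
  sphere_quotient v Q z h @[h --> (0 : R)^'] --> q ->
  sphere_quotient v (fun w => P w + Q w) z h @[h --> (0 : R)^'] --> p + q.
Proof.
move=> Pp Qq; apply: (cvg_Cext _ (cvg_Cadd Pp Qq)) => h.
by rewrite /sphere_quotient; ring.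
Qed.

Lemma sphere_quotientM v P Q z (p q : C) : S z ->
  sphere_quotient v P z h @[h --> (0 : R)^'] --> p ->
  sphere_quotient v Q z h @[h --> (0 : R)^'] --> q ->
  sphere_quotient v (fun w => P w * Q w) z h @[h --> (0 : R)^'] --> p * Q z + P z * q.
Proof.
move=> Sz Pp Qq.
have c1 := cvg_Cmul Pp (sphere_quotient_proj Sz Qq).
have c2 := cvg_Cscale (c := P z) Qq.
apply: (cvg_Cext _ (cvg_Cadd (c1 _) (c2 _))) => h.
by rewrite /sphere_quotient; ring.
Qed.

Lemma sphere_quotient_conj v P z (p : C) :
  sphere_quotient v P z h @[h --> (0 : R)^'] --> p ->
  sphere_quotient v (fun w => (P w)^*) z h @[h --> (0 : R)^'] --> p^*.
Proof.
move=> /cvg_conj.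
suff -> : (fun h => sphere_quotient v (fun w => (P w)^*) z h) =
  (fun h => (sphere_quotient v P z h)^*) by [].
by apply/funext => h; rewrite /sphere_quotient conj_mul conj_creal (rmorphB cconj).
Qed.

Lemma rpoly_sum_ord d m (P : 'I_m -> Cn -> C) : (forall i, rpoly d (P i)) ->
  rpoly d (fun z => \sum_i P i z).
Proof.
move=> H; elim: (index_enum _) => [|i r IH].
  have -> : (fun z => \sum_(i <- [::]) P i z) = (fun=> 0) by apply/funext => z; rewrite big_nil.
  exact: rpoly_cst.
have -> : (fun z => \sum_(j <- i :: r) P j z) = (fun z => P i z + \sum_(j <- r) P j z).
  by apply/funext => z; rewrite big_cons.
exact: rpolyD.
Qed.

Lemma rpoly_redot v : rpoly 1 (fun z => creal (redot z v)).
Proof.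
have -> : (fun z => creal (redot z v)) =
    (fun z => \sum_j (((v ord0 j)^* / 2) * z ord0 j + (v ord0 j / 2) * (z ord0 j)^*)).
  apply/funext => z; rewrite /redot creal_sum; apply: eq_bigr => j _.
  have E (x : C) : creal (complex.Re x) = (x + x^*) / 2.
    have -> : (2 : C)^-1 = creal 2^-1 by rewrite crealV creal_nat.
    rewrite mulrC; apply: Cx_eqP.
      by rewrite Re_crealM cReD cRe_conj /=; field.
    by rewrite Im_crealM cImD cIm_conj /=; field.
  by rewrite E conj_mul conjCK; field.
apply: rpoly_sum_ord => j; apply: rpolyD; apply: rpoly_scale; [exact: rpoly_coord|exact: rpoly_conj].
Qed.

(** The derivative of z_j along the sphere is v_j - <z, v> z_j, of degree 2; by the product rule
    each differentiation therefore raises the degree bound by one. *)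
Lemma rpoly_deriv d P v : rpoly d P -> exists2 Q, rpoly d.+1 Q &
  forall z, S z -> sphere_quotient v P z h @[h --> (0 : R)^'] --> Q z.
Proof.
have coord j e : rpoly e.+2 (fun z => v ord0 j - creal (redot z v) * z ord0 j).
  have -> : (fun z => v ord0 j - creal (redot z v) * z ord0 j) =
     (fun z => v ord0 j + (-1) * (creal (redot z v) * z ord0 j)).
    by apply/funext => z; rewrite mulN1r.
  apply: rpolyD; first exact: rpoly_cst.
  apply: rpoly_scale; rewrite -add1n; apply: rpolyM; [exact: rpoly_redot|exact: rpoly_coord].
elim=> {d P} [d c|d j|d j|d P Q _ [P' hP PP] _ [Q' hQ QQ]|d e P Q rP [P' hP PP] rQ [Q' hQ QQ]].
- exists (fun=> 0); first exact: rpoly_cst.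
  move=> z Sz; have -> : (fun h => sphere_quotient v (fun=> c) z h) = (fun=> 0).
    by apply/funext => h; rewrite /sphere_quotient subrr mulr0.
  exact: cvg_cst.
- by exists (fun z => v ord0 j - creal (redot z v) * z ord0 j) => // z; exact: sphere_quotient_coord.
- exists (fun z => (v ord0 j)^* - creal (redot z v) * (z ord0 j)^*).
    have -> : (fun z => (v ord0 j)^* - creal (redot z v) * (z ord0 j)^*) =
       (fun z => (v ord0 j)^* + (-1) * (creal (redot z v) * (z ord0 j)^*)).
      by apply/funext => z; rewrite mulN1r.
    apply: rpolyD; first exact: rpoly_cst.
    by apply: rpoly_scale; rewrite -add1n; apply: rpolyM; [exact: rpoly_redot|exact: rpoly_conj].
  move=> z Sz; have := sphere_quotient_conj (sphere_quotient_coord (v := v) (j := j) Sz).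
  by rewrite conj_sub conj_mul conj_creal.
- exists (fun z => P' z + Q' z); first exact: rpolyD.
  by move=> z Sz; apply: sphere_quotientD; [exact: PP|exact: QQ].
- exists (fun z => P' z * Q z + P z * Q' z).
    by apply: rpolyD; [rewrite -addSn|rewrite -addnS]; exact: rpolyM.
  by move=> z Sz; apply: sphere_quotientM => //; [exact: PP|exact: QQ].
Qed.

End SphereDerivatives.

Lemma limr_le_near (R : realType) (u : nat -> R) (a b : R) n0 :
  u n @[n --> \oo] --> a -> (forall n, (n0 <= n)%N -> u n <= b) -> a <= b.
Proof.
move=> ua hu; have /cvg_lim <- // := ua.
by apply: limr_le; [apply/cvg_ex; exists a|exists n0].
Qed.

Section GeometricSeries.
Variables (R : realType) (P : nat -> Cx R) (A t : R).
Hypotheses (t01 : 0 <= t < 1) (HP : forall j, cabs (P j) <= A * t ^+ j).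

Lemma geometric_partial_sums a b : (a <= b)%N ->
  cabs (\sum_(j < b) P j - \sum_(j < a) P j) <= A * t ^+ a / (1 - t).
Proof.
move=> ab; have A0 : 0 <= A.
  by have := HP 0; rewrite expr0 mulr1; apply: le_trans; exact: cabs_ge0.
rewrite -(big_mkord xpredT (fun k => P k)) -(big_mkord xpredT (fun k => P k)).
have -> : \sum_(0 <= k < b) P k = \sum_(0 <= k < a) P k + \sum_(a <= k < b) P k.
  by rewrite -big_cat_nat.
rewrite addrAC subrr add0r; apply: (le_trans (cabs_sum _ _ _)).
apply: (@le_trans _ _ (\sum_(a <= k < b) A * t ^+ k)).
  by apply: ler_sum => k _; exact: HP.
by rewrite -mulr_sumr -mulrA; apply: ler_wpM2l => //; exact: geometric_sum_le.
Qed.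

Lemma geometric_tail_small (e : R) : 0 < e -> exists m0, forall m, (m0 <= m)%N ->
  A * t ^+ m / (1 - t) <= e.
Proof.
move=> e0; have [t0 t1] := andP t01; have t1' : 0 < 1 - t by rewrite subr_gt0.
have A0 : 0 <= A.
  by have := HP 0; rewrite expr0 mulr1; apply: le_trans; exact: cabs_ge0.
have D0 : 0 <= A / (1 - t) by rewrite divr_ge0 // ltW.
have [d d0 hd] := sqr_small D0 e0.
have : t ^+ m @[m --> \oo] --> 0 by apply: cvg_expr; rewrite ger0_norm.
move=> /cvgrPdist_lt/(_ d d0)[m0 _ Hm]; exists m0 => m hm.
rewrite mulrAC; apply: (le_trans _ hd); apply: ler_wpM2l => //.
by have := Hm m hm; rewrite /= sub0r normrN ger0_norm ?exprn_ge0 // => /ltW.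
Qed.

Lemma geometric_series_cvg : cvg (\sum_(j < m) P j @[m --> \oo]).
Proof.
apply: Cx_cauchy_cvg => e e0; have [m0 Hm] := geometric_tail_small e0.
by exists m0 => m hm; apply: (le_trans (geometric_partial_sums hm)); exact: Hm.
Qed.

Lemma geometric_series_tail (l : Cx R) m : \sum_(j < m) P j @[m --> \oo] --> l ->
  cabs (l - \sum_(j < m) P j) <= A * t ^+ m / (1 - t).
Proof.
move=> hl.
have c : \sum_(j < k) P j - \sum_(j < m) P j @[k --> \oo] --> l - \sum_(j < m) P j.
  by apply: cvgB; [exact: hl|exact: cvg_cst].
have c' := cvg_cabs c.
by apply: (limr_le_near (n0 := m) (c' _)) => k; exact: geometric_partial_sums.
Qed.

End GeometricSeries.

(* Balances the bounds [A b^j] and [A (2^p b)^j d^p] at the scale [2^J ~ 1/d]. *)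
Lemma dyadic_sum_bound (R : realType) p (b : R) : 0 < b < 1 -> 1 < 2 ^+ p * b ->
  exists2 K : R, 0 <= K & forall A d : R, 0 <= A -> 0 < d <= 2 -> exists2 J, d^-1 < 2 ^+ J &
    forall a : nat -> R, (forall j, a j <= A * b ^+ j) ->
      (forall j, a j <= A * (2 ^+ p * b) ^+ j * d ^+ p) ->
      forall m, \sum_(j < m) a j <= A * K * b ^+ J.
Proof.
move=> /andP[b0 b1] q1; set q := 2 ^+ p * b.
have q1' : 0 < q - 1 by rewrite subr_gt0.
have b1' : 0 < 1 - b by rewrite subr_gt0.
exists (2 ^+ p / (q - 1) + (1 - b)^-1).
  by rewrite addr_ge0 ?invr_ge0 ?divr_ge0 ?exprn_ge0 // ltW.
move=> A d A0 /andP[d0 d2].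
have ex : exists J, d^-1 < 2 ^+ J.
  exists (Num.Def.truncn d^-1).+1; apply: (lt_trans (truncnS_gt _)).
  by rewrite -natrX ltr_nat; exact: ltn_expl.
have [J HJ Jmin] := ex_minnP ex; exists J => //.
have Jd : 2 ^+ J * d <= 2.
  case: J HJ Jmin => [|J] HJ Jmin; first by rewrite expr0 mul1r.
  have : 2 ^+ J <= d^-1 by rewrite leNgt; apply/negP => /Jmin; rewrite ltnn.
  move=> /(ler_wpM2r (ltW d0)); rewrite mulVf ?gt_eqF // exprS => h; rewrite -mulrA; lra.
move=> a ha1 ha2.
(* Below J the growing bound is summed, from J on the decaying one; [minn] and [maxn] merge the two
   closed forms into one induction. *)
have main m : \sum_(j < m) a j <= A * (d ^+ p * q ^+ minn m J / (q - 1) +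
    (b ^+ J - b ^+ maxn m J) / (1 - b)).
  elim: m => [|m IH].
    rewrite big_ord0 min0n max0n subrr mul0r addr0 expr0 mulr1 mulr_ge0 //.
    by rewrite divr_ge0 ?exprn_ge0 // ltW.
  rewrite big_ord_recr /=; have [mJ|Jm] := ltnP m J.
    rewrite (minn_idPl mJ) (maxn_idPr mJ); rewrite (minn_idPl (ltnW mJ)) (maxn_idPr (ltnW mJ)) in IH.
    apply: (le_trans (lerD IH (ha2 m))); rewrite -/q le_eqVlt; apply/orP; left; apply/eqP.
    by rewrite exprS; field; rewrite !gt_eqF.
  rewrite (minn_idPr (leqW Jm)) (maxn_idPl (leqW Jm)); rewrite (minn_idPr Jm) (maxn_idPl Jm) in IH.
  apply: (le_trans (lerD IH (ha1 m))); rewrite le_eqVlt; apply/orP; left; apply/eqP.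
  by rewrite exprS; field; rewrite !gt_eqF.
move=> m; apply: (le_trans (main m)); rewrite -[leRHS]mulrA; apply: ler_wpM2l => //.
rewrite [leRHS]mulrDl; apply: lerD; last first.
  rewrite mulrC; apply: ler_wpM2l; first by rewrite invr_ge0 ltW.
  by rewrite lerBlDr lerDl exprn_ge0 // ltW.
rewrite [leRHS]mulrAC; apply: ler_wpM2r; first by rewrite invr_ge0 ltW.
apply: (@le_trans _ _ (d ^+ p * q ^+ J)).
  apply: ler_wpM2l; first by rewrite exprn_ge0 // ltW.
  by apply: ler_weXn2l; [exact: ltW|exact: geq_minr].
rewrite /q exprMn -exprM mulnC exprM mulrA -exprMn [d * _]mulrC.
apply: ler_wpM2r; first by rewrite exprn_ge0 // ltW.
by apply: lerXn2r; rewrite ?nnegrE ?mulr_ge0 ?exprn_ge0 // ltW.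
Qed.

Lemma powR_dyadic_le (R : realType) (s d : R) J : 0 < s -> 0 < d -> d^-1 < 2 ^+ J ->
  (2 `^ (- s)) ^+ J <= d `^ s.
Proof.
move=> s0 d0 hJ; have J0 : (0 : R) < 2 ^+ J by rewrite exprn_gt0.
have -> : (2 `^ (- s)) ^+ J = (2 ^+ J) `^ (- s).
  by rewrite -[LHS]powR_mulrn ?powR_ge0 // -powRrM mulrC powRrM powR_mulrn.
rewrite powRN -[leLHS]mul1r ler_pdivrMr ?powR_gt0 // -powRM ?(ltW d0) ?(ltW J0) //.
have h1 : 1 <= d * 2 ^+ J by rewrite mulrC -ler_pdivrMr // mul1r ltW.
by rewrite -[leLHS](powRr0 (d * 2 ^+ J)); apply: ler_powR => //; exact: ltW.
Qed.

Lemma powR2_gt1 (R : realType) (x : R) : 0 < x -> 1 < 2 `^ x.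
Proof. by move=> x0; rewrite /powR pnatr_eq0 /= expR_gt1 mulr_gt0 // ln_gt0 // ltr1n. Qed.

(** * Smoothness of dyadic sums *)

Section DyadicSums.
Variables (R : realType) (n : nat).
Local Notation C := (Cx R).
Local Notation Cn := 'rV[Cx R]_n.
Local Notation S := (@unit_sphere R n).
Implicit Types (b : R) (F : Cn -> C).

(** With b = 2^(-s) the terms have degree comparable to 2^j and size 2^(-s j): the dyadic
    description of the Lipschitz-Zygmund scale. *)
Definition dyadic b F := exists c B (P : nat -> Cn -> C),
  [/\ (0 < c)%N, 0 <= B, forall j, rpoly (c * 2 ^ j) (P j),
      forall j z, S z -> cabs (P j z) <= B * b ^+ j &
      forall z, S z -> \sum_(j < m) P j z @[m --> \oo] --> F z].

Lemma scont_unif_limit F : (forall e : R, 0 < e -> exists2 u, scont u &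
  forall z, S z -> cabs (F z - u z) <= e) -> scont F.
Proof.
move=> H z Sz; apply/cvg_cabsP => e e0; have e3 : 0 < e / 4 by rewrite divr_gt0.
have [u cu hu] := H _ e3.
have /cvg_cabsP/(_ _ e3) c := cu z Sz.
have hS : \forall w \near within S (nbhs z), S w by exact: withinT.
apply: filterS2 c hS => w h1 Sw.
have h2 := hu w Sw; have h3 := hu z Sz.
apply: (le_lt_trans (cabs_triangle (u w) _ _)).
have := cabs_triangle (u z) (u w) (F z); rewrite [cabs (u z - F z)]cabsBC.
by move: h1 h2 h3 e0; clear; lra.
Qed.

Lemma dyadic_scont b F : 0 <= b < 1 -> dyadic b F -> scont F.
Proof.
move=> b01 [c [B [P [c0 B0 rP bP sP]]]]; apply: scont_unif_limit => e e0.
have bP0 : forall j, cabs (0 : C) <= B * b ^+ j.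
  by move=> j; rewrite cabs0 mulr_ge0 // exprn_ge0 //; case/andP: b01.
have [m0 Hm] := geometric_tail_small b01 bP0 e0.
exists (fun z => \sum_(j < m0) P j z).
  by apply: scont_sum => j _; exact: scont_rpoly (rP j).
move=> z Sz; apply: le_trans (Hm m0 (leqnn _)).
exact: (geometric_series_tail b01 (fun j => bP j z Sz) m0 (sP z Sz)).
Qed.

Lemma sphere_reflect_in z w : S z -> S w -> S (sphere_reflect z w).
Proof.
move=> Sz Sw; have [u [m [Su zu m1 _ ->]]] := great_circle_through Sz Sw.
by apply: great_circle_sphere => //; rewrite cabs_conj.
Qed.

(** First differences balance with p = 1, which requires 2 b > 1, that is s < 1. At s = 1 one has 2
    b = 1 and the balance is lost; second differences gain d^2 and balance with p = 2, as 4 b =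
    2. *)
Lemma dyadic_lambda_base s F : 0 < s <= 1 -> dyadic (2 `^ (- s)) F -> lambda_base s F.
Proof.
move=> /andP[s0 s1] dF; set b := 2 `^ (- s) in dF *.
have b0 : 0 < b by exact: powR_gt0.
have b1 : b < 1.
  by rewrite /b powRN invf_lt1 ?powR_gt0 //; exact: powR2_gt1.
have b01 : 0 <= b < 1 by rewrite ltW.
have b01' : 0 < b < 1 by rewrite b0.
split; first by apply/scontP; exact: dyadic_scont dF.
have [K0 K00 HK] := rpoly_lip R n.
have [c [B [P [c0 B0 rP bP sP]]]] := dF.
have d2 z w : S z -> S w -> enorm (w - z) <= 2.
  move=> Sz Sw; apply: (le_trans (enormD _ _)); rewrite enormN Sz Sw.
  by rewrite -(natrD _ 1 1).
have degP j : (0 < c * 2 ^ j)%N by rewrite muln_gt0 c0 expn_gt0.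
have [s1'|s1'] := ltP s 1.
  have q1 : 1 < 2 ^+ 1 * b.
    have -> : 2 ^+ 1 * b = 2 `^ (1 - s).
      by rewrite expr1 /b powRD ?powRr1 //; apply/implyP => _; rewrite pnatr_eq0.
    by apply: powR2_gt1; rewrite subr_gt0.
  have [K K1 HS] := dyadic_sum_bound b01' q1.
  exists ((2 * B + K0 * c%:R * B) * K) => w z Sw Sz.
  have [wz|wz] := eqVneq w z.
    by rewrite wz subrr cabs0 !mulr_ge0 ?addr_ge0 ?mulr_ge0 ?powR_ge0.
  have dpos : 0 < enorm (w - z) <= 2.
    by rewrite d2 // andbT lt_neqAle eq_sym enorm_eq0 subr_eq0 wz enorm_ge0.
  have A0 : 0 <= 2 * B + K0 * c%:R * B by rewrite addr_ge0 ?mulr_ge0.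
  have [J HJ Hsum] := HS _ _ A0 dpos.
  have lim := cvg_cabs (cvgB (sP w Sw) (sP z Sz)).
  apply: (@le_trans _ _ ((2 * B + K0 * c%:R * B) * K * b ^+ J)).
    have Hm m : \sum_(j < m) cabs (P j w - P j z) <= (2 * B + K0 * c%:R * B) * K * b ^+ J.
      apply: (Hsum (fun j => cabs (P j w - P j z))) => j.
          apply: (le_trans (cabsB _ _)); apply: (le_trans (lerD (bP j w Sw) (bP j z Sz))).
          rewrite -mulrDl; apply: ler_wpM2r; first by rewrite exprn_ge0 // ltW.
          have p0 : 0 <= K0 * c%:R * B by rewrite !mulr_ge0.
          by move: p0; clear; lra.
        have [h1 _] := HK _ _ _ (degP j) (rP j) (bP j) z w Sz Sw.
        apply: (le_trans h1); rewrite expr1 natrM natrX [(2 * b) ^+ j]exprMn.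
        rewrite (_ : K0 * (c%:R * 2 ^+ j) * (B * b ^+ j) * _ = K0 * c%:R * B * (2 ^+ j * b ^+ j) * enorm (w - z)); last by ring.
        apply: ler_wpM2r; first exact: enorm_ge0.
        apply: ler_wpM2r; first by rewrite mulr_ge0 ?exprn_ge0 // ltW.
        by rewrite lerDr mulr_ge0.
    have step m : cabs (\sum_(j < m) P j w - \sum_(j < m) P j z) <=
        (2 * B + K0 * c%:R * B) * K * b ^+ J.
      rewrite -sumrB; apply: (le_trans (cabs_sum _ _ _)); exact: Hm.
    exact: (limr_le_cst (lim _ _) step).
  apply: ler_wpM2l; first by rewrite mulr_ge0.
  by apply: powR_dyadic_le => //; case/andP: dpos.
have {s1'} s1' : s = 1 by apply/eqP; rewrite eq_le s1 s1'.
have bE : b = 2^-1 by rewrite /b s1' powR_inv1.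
have q1 : 1 < 2 ^+ 2 * b by rewrite bE; lra.
have [K K1 HS] := dyadic_sum_bound b01' q1.
set A := 4 * B + (K0 * c%:R) ^+ 2 * B.
have A0 : 0 <= A by rewrite addr_ge0 ?mulr_ge0 ?sqr_ge0.
exists (A * K) => z w Sz Sw.
have [wz|wz] := eqVneq w z.
  have -> : sphere_reflect z w = z.
    by rewrite /sphere_reflect wz redot_self Sz expr1n mulr1 creal_nat scaler_nat mulr2n addrK.
  have -> : F w + F z - 2 * F z = 0 by rewrite wz; ring.
  by rewrite cabs0; apply: mulr_ge0; [exact: mulr_ge0|exact: enorm_ge0].
have dpos : 0 < enorm (w - z) <= 2.
  by rewrite d2 // andbT lt_neqAle eq_sym enorm_eq0 subr_eq0 wz enorm_ge0.
have [J HJ Hsum] := HS _ _ A0 dpos.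
have Sr := sphere_reflect_in Sz Sw.
have c2 := cvg_Cscale (c := 2) (sP z Sz).
have lim := cvg_cabs (cvgB (cvgD (sP w Sw) (sP _ Sr)) (c2 _)).
apply: (@le_trans _ _ (A * K * b ^+ J)).
  have Hm m : \sum_(j < m) cabs (P j w + P j (sphere_reflect z w) - 2 * P j z) <= A * K * b ^+ J.
    apply: (Hsum (fun j => cabs (P j w + P j (sphere_reflect z w) - 2 * P j z))) => j.
      apply: (le_trans (cabsB _ _)); apply: (le_trans (lerD (cabsD _ _) (lexx _))).
      rewrite cabsM cabs_nat.
      have := bP j w Sw; have := bP j z Sz; have := bP j _ Sr.
      have : 0 <= (K0 * c%:R) ^+ 2 * B * b ^+ j by rewrite !mulr_ge0 ?sqr_ge0 ?exprn_ge0 // ltW.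
      by rewrite /A mulrDl; move: (b ^+ j) => y; move: (B * y) (mulrA 4 B y) => x; lra.
    have [_ h1] := HK _ _ _ (degP j) (rP j) (bP j) z w Sz Sw.
    apply: (le_trans h1); rewrite natrM natrX.
    rewrite (_ : (K0 * (c%:R * 2 ^+ j)) ^+ 2 * (B * b ^+ j) * _ =
       (K0 * c%:R) ^+ 2 * B * (2 ^+ 2 * b) ^+ j * enorm (w - z) ^+ 2); last first.
      by rewrite [(2 ^+ 2 * b) ^+ j]exprMn -exprM mulnC exprM; ring.
    apply: ler_wpM2r; first by rewrite exprn_ge0 // enorm_ge0.
    apply: ler_wpM2r; first by rewrite exprn_ge0 // mulr_ge0 ?exprn_ge0 // ltW.
    by rewrite lerDr mulr_ge0.
  have step m : cabs (\sum_(j < m) P j w + \sum_(j < m) P j (sphere_reflect z w) -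
      2 * \sum_(j < m) P j z) <= A * K * b ^+ J.
    apply: le_trans (Hm m); rewrite mulr_sumr -big_split -sumrB /=; exact: cabs_sum.
  exact: (limr_le_cst (lim _ _ _ _) step).
apply: ler_wpM2l; first by rewrite mulr_ge0.
have /andP[d0 _] := dpos.
by have := powR_dyadic_le s0 d0 HJ; rewrite -/b s1' powRr1 // enorm_ge0.
Qed.

Lemma lim_le_dnbhs (u : R -> R) (a b : R) :
  u h @[h --> (0 : R)^'] --> a -> (\forall h \near (0 : R)^', u h <= b) -> a <= b.
Proof.
move=> ua hu; have /cvg_lim <- // := ua.
by apply: limr_le; [apply/cvg_ex; exists a|].
Qed.

Lemma sphere_quotient_sum v (P Q : nat -> Cn -> C) z m :
  (forall j, sphere_quotient v (P j) z h @[h --> (0 : R)^'] --> Q j z) ->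
  sphere_quotient v (fun w => \sum_(j < m) P j w) z h @[h --> (0 : R)^'] --> \sum_(j < m) Q j z.
Proof.
move=> H; apply: (cvg_Cext (f := fun h => \sum_(j < m) sphere_quotient v (P j) z h)).
  by move=> h; rewrite /sphere_quotient -mulr_sumr sumrB.
exact: (cvg_Csum (f := fun j h => sphere_quotient v (P j) z h) (a := fun j => Q j z)).
Qed.

(** Bernstein's inequality makes differentiation of the j-th term cost 2^j, so b becomes 2 b. The
    tail of the series has a small Lipschitz constant, hence uniformly small difference quotients,
    which justifies termwise differentiation. *)
Lemma dyadic_deriv b F v : 0 <= b -> 2 * b < 1 -> dyadic b F ->
  sphere_derivable v F /\ dyadic (2 * b) (sphere_deriv v F).
Proof.
move=> b0 b1 [c [B [P [c0 B0 rP bP sP]]]].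
have t01 : 0 <= 2 * b < 1 by rewrite mulr_ge0.
have [K0 K00 HK] := rpoly_lip R n.
have degP j : (0 < c * 2 ^ j)%N by rewrite muln_gt0 c0 expn_gt0.
have lip j z w : S z -> S w -> cabs (P j w - P j z) <= K0 * c%:R * B * enorm (w - z) * (2 * b) ^+ j.
  move=> Sz Sw; have [h1 _] := HK _ _ _ (degP j) (rP j) (bP j) z w Sz Sw.
  apply: (le_trans h1); rewrite natrM natrX exprMn le_eqVlt; apply/orP; left; apply/eqP; ring.
pose rep j Q := rpoly (c * 2 ^ j).+1 Q /\
  forall z, S z -> sphere_quotient v (P j) z h @[h --> (0 : R)^'] --> Q z.
have ex j : exists Q, rep j Q by have [Q h1 h2] := rpoly_deriv v (rP j); exists Q.
have [Q HQ] := boolp.choice ex.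
set B' := 2 * (K0 * c%:R * B) * enorm v.
have B'0 : 0 <= B' by rewrite !mulr_ge0 ?enorm_ge0.
have bQ j z : S z -> cabs (Q j z) <= B' * (2 * b) ^+ j.
  move=> Sz; have ct := cvg_cabs ((HQ j).2 z Sz).
  have L0 : 0 <= K0 * c%:R * B * (2 * b) ^+ j by rewrite !mulr_ge0 ?exprn_ge0 ?mulr_ge0.
  have qb := @sphere_quotient_le R n v (P j) _ z L0 Sz.
  rewrite (_ : B' * _ = 2 * (K0 * c%:R * B * (2 * b) ^+ j) * enorm v); last by rewrite /B'; ring.
  apply: (lim_le_dnbhs (ct _)); apply: qb => w Sw.
  by apply: (le_trans (lip j z w Sz Sw)); rewrite mulrAC.
pose G z := lim (\sum_(j < m) Q j z @[m --> \oo]).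
have GQ z : S z -> \sum_(j < m) Q j z @[m --> \oo] --> G z.
  by move=> Sz; exact: (geometric_series_cvg t01 (fun j => bQ j z Sz)).
have main z : S z -> sphere_quotient v F z h @[h --> (0 : R)^'] --> G z.
  move=> Sz; apply/cvg_cabsP => e e0; have e4 : 0 < e / 4 by rewrite divr_gt0.
  have [m0 Hm] := geometric_tail_small t01 (fun j => bQ j z Sz) e4.
  have tail := Hm m0 (leqnn _).
  pose Sm w := \sum_(j < m0) P j w.
  have L0 : 0 <= K0 * c%:R * B * (2 * b) ^+ m0 / (1 - 2 * b).
    by rewrite divr_ge0 ?mulr_ge0 ?exprn_ge0 ?mulr_ge0 // subr_ge0 ltW.
  have q1 := @sphere_quotient_le R n v (fun w => F w - Sm w) _ z L0 Sz.
  have {}q1 : \forall h \near (0 : R)^', cabs (sphere_quotient v (fun w => F w - Sm w) z h) <= e / 4.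
    have : \forall h \near (0 : R)^', cabs (sphere_quotient v (fun w => F w - Sm w) z h) <=
        2 * (K0 * c%:R * B * (2 * b) ^+ m0 / (1 - 2 * b)) * enorm v.
      apply: q1 => w Sw.
      have ct := cvgB (sP w Sw) (sP z Sz).
      have := @geometric_series_tail R (fun j => P j w - P j z) _ _ t01 (fun j => lip j z w Sz Sw) (F w - F z) m0.
      rewrite sumrB => H.
      have E : F w - Sm w - (F z - Sm z) = F w - F z - (Sm w - Sm z) by ring.
      rewrite E; apply: (le_trans (H _)).
        by apply: (cvg_Cext _ (ct _)) => m; rewrite sumrB.
      by rewrite le_eqVlt; apply/orP; left; apply/eqP; ring.
    apply: filterS => h /le_trans; apply; apply: le_trans tail.
    by rewrite /B' le_eqVlt; apply/orP; left; apply/eqP; ring.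
  have q2 : \forall h \near (0 : R)^', cabs (sphere_quotient v Sm z h - \sum_(j < m0) Q j z) < e / 4.
    have := @sphere_quotient_sum v P Q z m0 (fun j => (HQ j).2 z Sz).
    by move/cvg_cabsP; apply.
  have q3 := geometric_series_tail t01 (fun j => bQ j z Sz) m0 (GQ z Sz).
  apply: filterS2 q1 q2 => h h1 h2.
  have -> : sphere_quotient v F z h - G z = sphere_quotient v (fun w => F w - Sm w) z h +
      (sphere_quotient v Sm z h - \sum_(j < m0) Q j z) - (G z - \sum_(j < m0) Q j z).
    by rewrite /sphere_quotient; ring.
  apply: (le_lt_trans (cabsB _ _)); apply: (le_lt_trans (lerD (cabsD _ _) (lexx _))).
  by move: h1 h2 (le_trans q3 tail) e0; clear; lra.
have derE z : S z -> sphere_deriv v F z = G z.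
  by move=> Sz; apply/cvg_lim; [exact: norm_hausdorff|exact: main].
split; first by move=> z Sz; apply/cvg_ex; exists (G z); exact: main.
exists c.+1, B', Q; split; [by []|exact: B'0| |exact: bQ|].
  by move=> j; apply: rpoly_le (HQ j).1; rewrite mulSn addnC -addn1 leq_add2l expn_gt0.
by move=> z Sz; rewrite (derE z Sz); exact: GQ.
Qed.

Lemma dyadic_sphere_Ck k b F : 0 <= b < 1 -> 2 ^+ k * b < 1 -> dyadic b F -> sphere_Ck k F.
Proof.
elim: k b F => [|k IH] b F b01 kb dF; (split; first by apply/scontP; exact: dyadic_scont dF) => //.
have /andP[b0 b1] := b01.
have b2 : 2 * b < 1.
  apply: le_lt_trans kb; apply: ler_wpM2r => //; rewrite exprS.
  by rewrite ler_peMr // -natrX ler1n expn_gt0.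
move=> v; have [d1 d2] := dyadic_deriv v b0 b2 dF; split => //.
apply: (IH (2 * b)) => //; first by rewrite b2 mulr_ge0.
by rewrite mulrA -exprSr.
Qed.

Lemma dyadic_foldr (vs : seq Cn) b F : 0 <= b -> 2 ^+ size vs * b < 1 -> dyadic b F ->
  dyadic (2 ^+ size vs * b) (foldr (@sphere_deriv R n) F vs).
Proof.
move=> b0; elim: vs => [|v vs IH] /=; first by rewrite expr0 mul1r.
rewrite exprS -mulrA => h dF.
have p0 : 0 <= 2 ^+ size vs * b by rewrite mulr_ge0 // exprn_ge0.
have /IH {}IH : 2 ^+ size vs * b < 1.
  by apply: le_lt_trans h; rewrite ler_peMl // ler1n.
exact: (dyadic_deriv v p0 h (IH dF)).2.
Qed.

Lemma dyadic_Lambda tau F : 0 < tau -> dyadic (2 `^ (- tau)) F -> Lambda tau F.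
Proof.
move=> tau0 dF; set b := 2 `^ (- tau) in dF.
have b0 : 0 < b by exact: powR_gt0.
have b1 : b < 1 by rewrite /b powRN invf_lt1 ?powR_gt0 //; exact: powR2_gt1.
have ex : exists k : nat, tau <= k.+1%:R.
  by exists (Num.Def.truncn tau); apply/ltW/truncnS_gt.
have [k kt kmin] := ex_minnP ex.
have kt' : k%:R < tau.
  case: k kt kmin => [//|k] _ kmin; rewrite ltNge; apply/negP => /kmin; rewrite ltnn //.
exists k; first by rewrite kt' kt.
have E : 2 ^+ k * b = 2 `^ (- (tau - k%:R)).
  rewrite opprB powRD; last by apply/implyP => _; rewrite pnatr_eq0.
  by rewrite powR_mulrn.
have kb : 2 ^+ k * b < 1.
  by rewrite E powRN invf_lt1 ?powR_gt0 //; apply: powR2_gt1; rewrite subr_gt0.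
split; first by apply: (dyadic_sphere_Ck (b := b)) => //; rewrite ltW.
move=> vs; apply: dyadic_lambda_base.
  by rewrite subr_gt0 kt' lerBlDr -natr1 addrC in kt *.
rewrite -E; have := @dyadic_foldr vs b F (ltW b0); rewrite size_tuple => H; exact: H.
Qed.

End DyadicSums.

(** * Jackson and Favard approximation on circles *)

Section JacksonKernel.
Variable R : realType.
Local Notation C := (Cx R).

Lemma mean_conj_var M (u : C -> C) : (0 < M)%N -> mean M (fun m => u m^*) = mean M u.
Proof.
move=> M0; rewrite -(mean_rot M u 1) /mean; congr (_ * _).
rewrite (reindex_inj rev_ord_inj) /=; apply: eq_bigr => i _; congr u.
rewrite conj_unit ?cabs_urootX // -exprS; apply: (mulfI (x := uroot R M ^+ (M - i.+1))).
  by rewrite -cabs_eq0 cabs_urootX oner_neq0.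
by rewrite mulfV -?cabs_eq0 ?cabs_urootX ?oner_neq0 // -exprD subnK // urootXM.
Qed.

Lemma circle_continuousX k : circle_continuous (fun l : C => l ^+ k).
Proof.
move=> l _; have idc : x @[x --> l] --> l by exact: cvg_id.
exact: (@cvg_CX _ _ (nbhs l) _ k (fun x => x) l idc).
Qed.

Lemma fejer_conj L (l : C) : fejer L l^* = fejer L l.
Proof.
rewrite /fejer; congr (_ * _ ^+ 2); rewrite -[RHS]cabs_conj rmorph_sum; congr cabs.
by apply: eq_bigr => a _; rewrite rmorphXn.
Qed.

Lemma fejer_le L (l : C) : (0 < L)%N -> cabs l = 1 ->
  fejer L l * cabs (l - 1) ^+ 2 <= 4 / L%:R.
Proof.
move=> L0 l1; have LR : (0 : R) < L%:R by rewrite ltr0n.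
have -> : fejer L l * cabs (l - 1) ^+ 2 = cabs (l ^+ L - 1) ^+ 2 / L%:R.
  by rewrite subrX1 cabsM exprMn /fejer; ring.
apply: ler_wpM2r; first by rewrite invr_ge0 ltW.
have : cabs (l ^+ L - 1) <= 2.
  by apply: (le_trans (cabsB _ _)); rewrite cabsX l1 expr1n cabs1 -(natrD _ 1 1).
have : 0 <= cabs (l ^+ L - 1) by exact: cabs_ge0.
move: (cabs _) => x; nra.
Qed.

Lemma sum_dist_le (L a : nat) : (a < L)%N ->
  (2 * \sum_(b < L) ((a - b) + (b - a)) <= L * L)%N.
Proof.
move=> aL; rewrite mul2n -addnn {2}(reindex_inj rev_ord_inj) -big_split /=.
apply: (@leq_trans (\sum_(b < L) L)).
  by apply: leq_sum => b _; have := ltn_ord b; lia.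
by rewrite sum_nat_const card_ord.
Qed.

(** The mean of the squared Fejer kernel, by which Jackson's kernel is normalised. *)
Definition jackson_mass L : R := L%:R^-1 * \sum_(a < L) \sum_(b < L) tri R L a b.

Lemma rmean_fejer_sqr M L : (2 * L <= M)%N ->
  rmean M (fun l => fejer L l ^+ 2) = jackson_mass L.
Proof.
move=> LM; apply: (@creal_inj R); rewrite -mean_creal.
transitivity (mean M (fun m : C => L%:R^-1 * \sum_(a < L) \sum_(b < L)
    creal (fejer L m) * (m ^+ a * m^* ^+ b))).
  apply: eq_mean => m _; rewrite expr2 crealM {2}fejerE mulrCA mulr_sumr; congr (_ * _).
  by apply: eq_bigr => a _; rewrite mulr_sumr.
rewrite meanZ mean_sum /jackson_mass crealM crealV creal_nat creal_sum; congr (_ * _).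
apply: eq_bigr => a _; rewrite mean_sum creal_sum; apply: eq_bigr => b _.
by apply: mean_fejer; have := ltn_ord a; have := ltn_ord b; lia.
Qed.

Lemma jackson_mass_ge L : (0 < L)%N -> L%:R / 2 <= jackson_mass L.
Proof.
move=> L0; have LR : (0 : R) < L%:R by rewrite ltr0n.
rewrite /jackson_mass [leRHS]mulrC ler_pdivlMr //.
have H (a : 'I_L) : L%:R / 2 <= \sum_(b < L) tri R L a b.
  rewrite -mulr_suml ler_pdivlMr // -natr_sum.
  rewrite mulrAC ler_pdivrMr // -natrM -natrM ler_nat.
  have := sum_dist_le (ltn_ord a).
  have -> : (\sum_(b < L) (L - (a - b + (b - a))) = L * L - \sum_(b < L) (a - b + (b - a)))%N.
    have E : (\sum_(b < L) (L - (a - b + (b - a))) + \sum_(b < L) (a - b + (b - a)) = L * L)%N.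
      rewrite -big_split /= (eq_bigr (fun=> L)) ?sum_nat_const ?card_ord // => b _.
      by rewrite subnK //; have := ltn_ord a; have := ltn_ord b; lia.
    by rewrite -E addnK.
  by move: (\sum_(b < L) _)%N; lia.
apply: (@le_trans _ _ (\sum_(a < L) L%:R / 2)); last by apply: ler_sum => a _; exact: H.
by rewrite sumr_const card_ord -[leRHS]mulr_natr.
Qed.

Lemma trig_poly_le d e (g : C -> C) : (d <= e)%N -> trig_poly d g -> trig_poly e g.
Proof.
move=> de [p sp pE]; exists (p * 'X^(e - d)).
  apply: (leq_trans (size_polyMleq _ _)); rewrite size_polyXn; move: sp de; clear; lia.
move=> l l1; rewrite pE // hornerM hornerXn -mulrA; congr (_ * _).
rewrite -{2}(subnK de) [l^* ^+ (_ + _)]exprD mulrA -exprMn mul_conj_unit //.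
by rewrite expr1n mul1r.
Qed.

Lemma trig_poly_monomial d i : (i <= 2 * d)%N -> trig_poly d (fun l : C => l^* ^+ i * l ^+ d).
Proof.
move=> id2; exists 'X^(2 * d - i).
  by rewrite size_polyXn ltnS leq_subr.
move=> l l1; rewrite hornerXn.
have E k : l ^+ k * l^* ^+ k = 1 by rewrite -exprMn mul_conj_unit // expr1n.
have l0 : l ^+ i != 0 by rewrite -cabs_eq0 cabsX l1 expr1n oner_neq0.
apply: (mulfI l0); rewrite mulrA E mul1r mulrA -exprD subnKC // mul2n -addnn exprD -mulrA E.
by rewrite mulr1.
Qed.

Lemma trig_poly_sum d m (g : nat -> C -> C) : (forall i, (i < m)%N -> trig_poly d (g i)) ->
  trig_poly d (fun l => \sum_(i < m) g i l).
Proof.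
elim: m => [|m IH] H.
  have -> : (fun l => \sum_(i < 0) g i l) = (fun=> 0) by apply/funext => l; rewrite big_ord0.
  exact: trig_poly_cst.
have -> : (fun l => \sum_(i < m.+1) g i l) = (fun l => \sum_(i < m) g i l + g m l).
  by apply/funext => l; rewrite big_ord_recr.
by apply: trig_polyD; [apply: IH => i im; apply: H; exact: ltnW|exact: H].
Qed.

Lemma trig_poly_scale d (c : C) g : trig_poly d g -> trig_poly d (fun l => c * g l).
Proof. by move=> h; rewrite -[d]add0n; apply: trig_polyM => //; exact: trig_poly_cst. Qed.

Lemma trig_poly_fejer L : trig_poly L.-1 (fun l : C => creal (fejer L l)).
Proof.
have -> : (fun l : C => creal (fejer L l)) =
    (fun l => L%:R^-1 * \sum_(a < L) \sum_(b < L) l ^+ a * l^* ^+ b).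
  by apply/funext => l; rewrite fejerE.
apply: trig_poly_scale.
apply: (trig_poly_sum (g := fun a l => \sum_(b < L) l ^+ a * l^* ^+ b)) => a aL.
apply: (trig_poly_sum (g := fun b l => l ^+ a * l^* ^+ b)) => b bL.
exists 'X^(a + (L.-1 - b)); first by rewrite size_polyXn; lia.
move=> l l1; rewrite hornerXn exprD -mulrA; congr (_ * _).
have E k : l ^+ k * l^* ^+ k = 1 by rewrite -exprMn mul_conj_unit // expr1n.
have bL' : (b <= L.-1)%N by lia.
by rewrite -{2}(subnK bL') [l^* ^+ (_ + b)]exprD mulrA E mul1r.
Qed.

(** At scale 1 / N a power of exponent at most 1 is dominated by a constant plus a quadratic, which
    reduces its integral against Jackson's kernel to the second moment. *)
Lemma powR_le_quadratic (x s : R) N : 0 <= x -> 0 < s <= 1 -> (0 < N)%N ->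
  x `^ s <= N%:R `^ (- s) * (1 + N%:R ^+ 2 * x ^+ 2).
Proof.
move=> x0 /andP[s0 s1] N0; have NR : (0 : R) < N%:R by rewrite ltr0n.
have Ns : 0 < N%:R `^ (- s) by exact: powR_gt0.
have -> : x `^ s = N%:R `^ (- s) * (N%:R * x) `^ s.
  rewrite powRM ?(ltW NR) // mulrA powRN mulVf ?mul1r //.
  by rewrite gt_eqF // powR_gt0.
apply: ler_wpM2l; first exact: ltW.
rewrite -exprMn; have y0 : 0 <= N%:R * x by rewrite mulr_ge0 // ltW.
move: (N%:R * x) y0 => y y0.
have [y1|y1] := leP y 1.
  apply: (@le_trans _ _ 1); last by rewrite lerDl sqr_ge0.
  have -> : 1 = 1 `^ s :> R by rewrite powR1.
  by apply: (ge0_ler_powR (ltW s0)); rewrite ?nnegrE.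
apply: (@le_trans _ _ y); first by apply: ler1_powR => //; exact: ltW.
by rewrite expr2; nra.
Qed.

Section Jackson.
Variables (W : C -> C) (A s : R) (N : nat).
Hypotheses (Wc : circle_continuous W) (s01 : 0 < s <= 1) (A0 : 0 <= A) (N0 : (0 < N)%N).
Hypothesis HW : forall l m, cabs l = 1 -> cabs m = 1 ->
  cabs (W (l * m) + W (l * m^*) - 2 * W l) <= A * cabs (m - 1) `^ s.

(** The largest L with 2 (L - 1) <= N, so that the squared Fejer kernel has degree at most N; N <= 2
    L keeps its width of order 1 / N. *)
Let L := N./2.+1.
Let LN : (N <= 2 * L)%N. Proof. rewrite /L; lia. Qed.
Let LN' : (L.-1 + L.-1 <= N)%N. Proof. rewrite /L; lia. Qed.
Let kap := jackson_mass L.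
Let LR : (0 : R) < L%:R. Proof. by rewrite ltr0n. Qed.
Let kapL : L%:R / 2 <= kap. Proof. exact: jackson_mass_ge. Qed.
Let kap0 : 0 < kap. Proof. by apply: lt_le_trans kapL; rewrite divr_gt0. Qed.

(** The kernel is even, so averaging m with its conjugate produces the second difference bounded in
    [HW]. Twice the error is then at most (1 + 32) A N^(-s) times the mass, and 17 exceeds 33 /
    2. *)
Let kernel_error n l : (2 * L <= 2 ^ n)%N -> cabs l = 1 ->
  cabs (mean (2 ^ n) (fun m => creal (fejer L m ^+ 2) * W (l * m)) - creal kap * W l) <=
    17 * A * N%:R `^ (- s) * kap.
Proof.
move=> Ln l1; set M := (2 ^ n)%N; have M0 : (0 < M)%N by rewrite expn_gt0.
have mk : mean M (fun m => creal (fejer L m ^+ 2)) = creal kap.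
  by rewrite mean_creal rmean_fejer_sqr.
have E1 : mean M (fun m => creal (fejer L m ^+ 2) * W (l * m)) =
    mean M (fun m => creal (fejer L m ^+ 2) * W (l * m^*)).
  rewrite -(mean_conj_var (fun m => creal (fejer L m ^+ 2) * W (l * m)) M0).
  by apply: eq_mean => m _; rewrite fejer_conj.
have E2 : 2 * (mean M (fun m => creal (fejer L m ^+ 2) * W (l * m)) - creal kap * W l) =
    mean M (fun m => creal (fejer L m ^+ 2) * (W (l * m) + W (l * m^*) - 2 * W l)).
  transitivity (mean M (fun m => creal (fejer L m ^+ 2) * W (l * m)) +
     mean M (fun m => creal (fejer L m ^+ 2) * W (l * m^*)) -
     mean M (fun m => creal (fejer L m ^+ 2)) * (2 * W l)).
    by rewrite -E1 mk; ring.
  by rewrite -meanZr -meanD -meanB; apply: eq_mean => m _; ring.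
set B := A * N%:R `^ (- s).
have B0 : 0 <= B by rewrite mulr_ge0 // powR_ge0.
pose v (m : C) : R := B * fejer L m ^+ 2 + B * N%:R ^+ 2 * (4 / L%:R) * fejer L m.
have h : cabs (2 * (mean M (fun m => creal (fejer L m ^+ 2) * W (l * m)) - creal kap * W l)) <=
    rmean M v.
  rewrite E2; apply: cabs_mean_le => m m1; rewrite cabsM cabs_creal ger0_norm ?sqr_ge0 //.
  apply: (le_trans (ler_wpM2l (sqr_ge0 _) (HW l1 m1))).
  have q := powR_le_quadratic (cabs_ge0 (m - 1)) s01 N0.
  apply: (le_trans (ler_wpM2l (sqr_ge0 _) (ler_wpM2l A0 q))).
  have f1 := fejer_le (isT : (0 < L)%N) m1.
  have f0 := fejer_ge0 L m.
  have -> : fejer L m ^+ 2 * (A * (N%:R `^ (- s) * (1 + N%:R ^+ 2 * cabs (m - 1) ^+ 2))) =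
      B * fejer L m ^+ 2 + B * N%:R ^+ 2 * (fejer L m * cabs (m - 1) ^+ 2) * fejer L m.
    by rewrite /B; ring.
  rewrite lerD2l; apply: ler_wpM2r => //; apply: ler_wpM2l => //.
  by rewrite mulr_ge0 // sqr_ge0.
have vE : rmean M v = B * kap + B * N%:R ^+ 2 * (4 / L%:R).
  rewrite /v rmeanD (rmeanZ _ B) (rmeanZ _ (B * N%:R ^+ 2 * (4 / L%:R))).
  rewrite rmean_fejer_sqr // rmean_fejer ?mulr1 //.
  by rewrite /=; apply: leq_trans Ln; rewrite leq_pmull.
rewrite vE cabsM cabs_nat in h.
have NL : N%:R ^+ 2 * (4 / L%:R) <= 32 * kap.
  have n1 : N%:R <= 2 * L%:R :> R by rewrite -natrM ler_nat.
  have n2 : N%:R ^+ 2 <= (2 * L%:R) ^+ 2 :> R by apply: lerXn2r; rewrite ?nnegrE ?mulr_ge0 ?ler0n.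
  apply: (@le_trans _ _ ((2 * L%:R) ^+ 2 * (4 / L%:R))).
    by apply: ler_wpM2r => //; rewrite divr_ge0 // ltW.
  have -> : (2 * L%:R) ^+ 2 * (4 / L%:R) = 16 * L%:R :> R by field; rewrite gt_eqF.
  have -> : 16 * L%:R = 32 * (L%:R / 2) :> R by field.
  exact: ler_wpM2l.
have {NL} : B * N%:R ^+ 2 * (4 / L%:R) <= B * (32 * kap) by rewrite -mulrA; exact: ler_wpM2l.
have -> : 17 * A * N%:R `^ (- s) * kap = 17 * (B * kap) by rewrite /B; ring.
move: h; rewrite [B * (32 * kap)]mulrCA.
have : 0 <= B * kap by apply: mulr_ge0 => //; exact: ltW.
move: (B * N%:R ^+ 2 * (4 / L%:R)) => y; move: (B * kap) => x; move: (cabs _) => z.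
by lra.
Qed.

(** The coefficients of g are limits of grid means, so that g belongs to no particular grid. Its
    distance to the discrete convolution, and the effect of shifting the grid by l, disappear as the
    grid is refined. *)
Lemma jackson : exists2 g, trig_poly N g &
  forall l, cabs l = 1 -> cabs (W l - g l) <= 17 * A * N%:R `^ (- s).
Proof.
have [p sp pE] : trig_poly N (fun l : C => creal (fejer L l) * creal (fejer L l)).
  by apply: (trig_poly_le LN'); apply: trig_polyM; exact: trig_poly_fejer.
pose What i := lim (mean (2 ^ n) (fun m => W m * (m ^+ i * m^* ^+ N)) @[n --> \oo]).
have Wlim i : mean (2 ^ n) (fun m => W m * (m ^+ i * m^* ^+ N)) @[n --> \oo] --> What i.
  apply: (@mean_pow2_cvg R (fun m => W m * (m ^+ i * m^* ^+ N))) => l l1.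
  exact: (cvg_Cmul (Wc l1) (cvg_Cmul (@circle_continuousX i l l1) (@circle_continuous_conjX R N l l1))).
pose g l := creal kap^-1 * \sum_(i < (2 * N).+1) (p`_i * What i) * (l^* ^+ i * l ^+ N).
exists g.
  apply: trig_poly_scale.
  apply: (trig_poly_sum (g := fun i l => (p`_i * What i) * (l^* ^+ i * l ^+ N))) => i iN.
  by apply: trig_poly_scale; exact: trig_poly_monomial.
move=> l l1.
pose v (m : C) := \sum_(i < (2 * N).+1) (p`_i * (l^* ^+ i * l ^+ N)) * (W m * (m ^+ i * m^* ^+ N)).
have vE m : cabs m = 1 -> v m = creal (fejer L (m * l^*) ^+ 2) * W m.
  move=> m1; rewrite expr2 crealM pE ?cabsM ?cabs_conj ?m1 ?l1 ?mulr1 //.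
  rewrite (horner_coef_wide _ sp) !mulr_suml; apply: eq_bigr => i _.
  by rewrite conj_mul conjCK !exprMn; ring.
have vc : circle_continuous v.
  move=> x x1; apply: (@cvg_Csum _ _ (nbhs x) _ _ (fun i m =>
    (p`_i * (l^* ^+ i * l ^+ N)) * (W m * (m ^+ i * m^* ^+ N)))
    (fun i => (p`_i * (l^* ^+ i * l ^+ N)) * (W x * (x ^+ i * x^* ^+ N)))) => i _.
  have c1 := @circle_continuousX i x x1.
  have c2 := @circle_continuous_conjX R N x x1.
  exact: (cvg_Cscale (cvg_Cmul (Wc x1) (cvg_Cmul c1 c2))).
have vlim : mean (2 ^ n) v @[n --> \oo] --> creal kap * g l.
  have -> : creal kap * g l = \sum_(i < (2 * N).+1) (p`_i * (l^* ^+ i * l ^+ N)) * What i.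
    rewrite /g mulrA -crealM mulfV ?gt_eqF // creal1 mul1r; apply: eq_bigr => i _; ring.
  apply: (cvg_Cext (f := fun n => \sum_(i < (2 * N).+1) (p`_i * (l^* ^+ i * l ^+ N)) *
     mean (2 ^ n) (fun m => W m * (m ^+ i * m^* ^+ N)))).
    by move=> n; rewrite mean_sum; apply: eq_bigr => i _; rewrite meanZ.
  apply: (@cvg_Csum _ _ \oo _ _ (fun i n => (p`_i * (l^* ^+ i * l ^+ N)) *
     mean (2 ^ n) (fun m => W m * (m ^+ i * m^* ^+ N)))
    (fun i => (p`_i * (l^* ^+ i * l ^+ N)) * What i)) => i _.
  exact: (@cvg_Cscale _ _ \oo _ _ (fun n => mean (2 ^ n) _) _ (Wlim i)).
set D := 17 * A * N%:R `^ (- s).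
rewrite -(ler_pM2r kap0) -[kap in leLHS](ger0_norm (ltW kap0)) -cabs_creal -cabsM.
have -> : (W l - g l) * creal kap = creal kap * W l - creal kap * g l by ring.
apply/ler_addgt0Pr => e e0; have e2 : 0 < e / 2 by rewrite divr_gt0.
have [M0 HM] := mean_shift vc e2.
move/cvg_cabsP/(_ _ e2) : vlim => [n1 _ Hn].
set n := maxn n1 (maxn M0 (2 * L)).
have h1 : cabs (mean (2 ^ n) v - creal kap * g l) <= e / 2.
  by apply/ltW/Hn; rewrite /= /n leq_maxl.
have h2 : cabs (mean (2 ^ n) (fun m => v (l * m)) - mean (2 ^ n) v) <= e / 2.
  apply: HM => //; last by rewrite expn_gt0.
  by apply: leq_trans (ltnW (ltn_expl n _)); rewrite // /n !leq_max leqnn orbT.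
have h3 : cabs (mean (2 ^ n) (fun m => v (l * m)) - creal kap * W l) <= D * kap.
  have -> : mean (2 ^ n) (fun m => v (l * m)) =
      mean (2 ^ n) (fun m => creal (fejer L m ^+ 2) * W (l * m)).
    apply: eq_mean => m m1; rewrite vE ?cabsM ?l1 ?m1 ?mulr1 //.
    by rewrite mulrAC mul_conj_unit // mul1r.
  apply: kernel_error => //.
  by apply: leq_trans (ltnW (ltn_expl n _)); rewrite // /n !leq_max leqnn !orbT.
apply: (le_trans (cabs_triangle (mean (2 ^ n) (fun m => v (l * m))) _ _)).
rewrite [e]splitr; apply: lerD; first by rewrite cabsBC.
apply: (le_trans (cabs_triangle (mean (2 ^ n) v) _ _)); exact: lerD.
Qed.

End Jackson.

End JacksonKernel.

(** * Derivatives along paths and Favard's inequality *)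

Section PathDerivatives.
Variable R : realType.
Local Notation C := (Cx R).
Implicit Types (g : R -> C) (t : R).

Definition path_deriv g t (d : C) :=
  creal h^-1 * (g (t + h) - g t) @[h --> (0 : R)^'] --> d.

Lemma is_derive_path (v : C -> R) g t d : (forall (x : R) z, v (creal x * z) = x * v z) ->
  (forall z w, v (z - w) = v z - v w) ->
  v (creal h^-1 * (g (t + h) - g t)) @[h --> (0 : R)^'] --> v d ->
  is_derive t (1 : R) (fun s => v (g s)) (v d).
Proof.
move=> vZ vB lim.
have lim' : h^-1 *: (((fun s => v (g s)) \o shift t) (h *: 1) - v (g t)) @[h --> (0 : R)^'] --> v d.
  have -> : (fun h : R => h^-1 *: (((fun s => v (g s)) \o shift t) (h *: 1) - v (g t))) =
      (fun h => v (creal h^-1 * (g (t + h) - g t))); last by [].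
  apply/funext => h; rewrite vZ vB /=.
  have -> : h%:A + t = t + h by rewrite addrC /GRing.scale /= mulr1.
  by [].
apply: DeriveDef; first by apply/cvg_ex; exists (v d).
by rewrite /derive; apply/cvg_lim.
Qed.

(** The factor 2 comes from applying the real mean value theorem to the real and the imaginary
    part. *)
Lemma path_mvt (g g' : R -> C) (E a b : R) : a < b ->
  (forall t, a <= t <= b -> path_deriv g t (g' t)) ->
  (forall t, a <= t <= b -> cabs (g' t) <= E) -> cabs (g b - g a) <= 2 * E * (b - a).
Proof.
move=> ab dg hE.
have part (v : C -> R) : (forall (x : R) z, v (creal x * z) = x * v z) ->
    (forall z w, v (z - w) = v z - v w) -> (forall z, `|v z| <= cabs z) ->
    (forall t, a <= t <= b -> v (creal h^-1 * (g (t + h) - g t)) @[h --> (0 : R)^'] --> v (g' t)) ->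
    `|v (g b) - v (g a)| <= E * (b - a).
  move=> vZ vB vle vlim.
  have der t : a <= t <= b -> is_derive t (1 : R) (fun s => v (g s)) (v (g' t)).
    by move=> tab; apply: is_derive_path => //; exact: vlim.
  have [c cab ->] : exists2 c, c \in `]a, b[ & v (g b) - v (g a) = v (g' c) * (b - a).
    apply: (@MVT _ (fun s => v (g s)) (fun s => v (g' s))) => //.
      by move=> t; rewrite in_itv /= => /andP[t1 t2]; apply: der; rewrite !ltW.
    apply: derivable_within_continuous => t; rewrite in_itv /= => tab.
    by have [] := der t tab.
  move: cab; rewrite in_itv /= => /andP[c1 c2].
  rewrite normrM [`|b - a|]gtr0_norm ?subr_gt0 //; apply: ler_wpM2r.
    by rewrite subr_ge0 ltW.
  by apply: (le_trans (vle _)); apply: hE; rewrite !ltW.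
have hRe := part (@complex.Re R) (@Re_crealM R) (@cReB R) (@Re_le_cabs R)
  (fun t tab => cvg_Re (dg t tab)).
have hIm := part (@complex.Im R) (@Im_crealM R) (@cImB R) (@Im_le_cabs R)
  (fun t tab => cvg_Im (dg t tab)).
apply: (le_trans (cabs_le_ReIm _)); rewrite cReB cImB.
by apply: (le_trans (lerD (hRe _) (hIm _))); rewrite -mulrA mulr_natl mulr2n.
Qed.

Lemma path_mvt_abs (g g' : R -> C) (E a b : R) :
  (forall t, `|t - a| <= `|b - a| -> path_deriv g t (g' t)) ->
  (forall t, `|t - a| <= `|b - a| -> cabs (g' t) <= E) -> cabs (g b - g a) <= 2 * E * `|b - a|.
Proof.
move=> dg hE; have [ab|ba|->] := ltgtP a b; last by rewrite !subrr cabs0 normr0 mulr0.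
  rewrite (gtr0_norm (x := b - a)) ?subr_gt0 // in dg hE *.
  have H t : a <= t <= b -> `|t - a| <= b - a.
    by move=> /andP[t1 t2]; rewrite ger0_norm ?subr_ge0 // lerD2r.
  by apply: (path_mvt (g' := g')) => // t /H; [exact: dg|exact: hE].
rewrite (ltr0_norm (x := b - a)) ?subr_lt0 // in dg hE *; rewrite opprB cabsBC in dg hE *.
have H t : b <= t <= a -> `|t - a| <= a - b.
  by move=> /andP[t1 t2]; rewrite ler0_norm ?subr_le0 // opprB lerD2l lerN2.
by apply: (path_mvt (g' := g')) => // t /H; [exact: dg|exact: hE].
Qed.

Lemma path_derivD g1 g2 t d1 d2 : path_deriv g1 t d1 -> path_deriv g2 t d2 ->
  path_deriv (fun s => g1 s + g2 s) t (d1 + d2).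
Proof.
move=> h1 h2; apply: (cvg_Cext _ (cvg_Cadd h1 h2)) => h; ring.
Qed.

Lemma path_derivZ (c : C) g t d : path_deriv g t d -> path_deriv (fun s => c * g s) t (c * d).
Proof.
move=> h1; have := cvg_Cscale (c := c) h1 => /(_ _) h2; apply: (cvg_Cext _ h2) => h; ring.
Qed.

Lemma path_deriv_cst (c : C) t : path_deriv (fun=> c) t 0.
Proof.
apply: (cvg_Cext (f := fun=> 0)); first by move=> h; rewrite subrr mulr0.
exact: cvg_cst.
Qed.

Lemma path_deriv_sum m (f : nat -> R -> C) (d : nat -> C) t :
  (forall i, (i < m)%N -> path_deriv (f i) t (d i)) ->
  path_deriv (fun s => \sum_(i < m) f i s) t (\sum_(i < m) d i).
Proof.
elim: m => [|m IH] H.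
  rewrite big_ord0; have -> : (fun s => \sum_(i < 0) f i s) = (fun=> 0).
    by apply/funext => s; rewrite big_ord0.
  exact: path_deriv_cst.
rewrite big_ord_recr /=; have -> : (fun s => \sum_(i < m.+1) f i s) =
    (fun s => \sum_(i < m) f i s + f m s).
  by apply/funext => s; rewrite big_ord_recr.
by apply: path_derivD; [apply: IH => i im; apply: H; exact: ltnW|exact: H].
Qed.

Lemma path_deriv_id t : path_deriv (fun s => creal s) t 1.
Proof.
apply/cvg_cabsP => e e0.
near=> h; have h0 : h != 0 by near: h; exact: nbhs_dnbhs_neq.
by rewrite -crealB addrAC subrr add0r -crealM mulVf // creal1 subrr cabs0.
Unshelve. all: end_near. Qed.

Lemma path_deriv_cis (a t : R) : path_deriv (fun s => cis (a * s)) t ('i * creal a * cis (a * t)).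
Proof.
apply/cvg_cabsP => e e0.
have K0 : 0 <= 4 * a ^+ 2 by rewrite mulr_ge0 // sqr_ge0.
have e2 : 0 < e / 2 by rewrite divr_gt0.
have [d d0 hd] := sqr_small K0 e2.
have [d' d'0 hd'] := sqr_small (normr_ge0 a) (divr_gt0 ltr01 (ltr0n _ 2)).
have /cvgrPdist_le /(_ d d0) n1 := @cvg_dnbhs0_id R.
have /cvgrPdist_le /(_ d' d'0) n2 := @cvg_dnbhs0_id R.
have n3 : \forall h \near (0 : R)^', h != 0 by exact: nbhs_dnbhs_neq.
near=> h.
have h0 : h != 0 by near: h.
have h1 : `|h| <= d by rewrite -normrN -sub0r; near: h.
have h2 : `|h| <= d' by rewrite -normrN -sub0r; near: h.
have hp : 0 < `|h| by rewrite normr_gt0.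
have -> : creal h^-1 * (cis (a * (t + h)) - cis (a * t)) - 'i * creal a * cis (a * t) =
    creal h^-1 * cis (a * t) * (cis (a * h) - 1 - 'i * creal (a * h)).
  have hC : creal h^-1 * creal h = 1 by rewrite -crealM mulVf // creal1.
  rewrite (mulrDr a) cisD crealM.
  transitivity (creal h^-1 * (cis (a * t) * cis (a * h) - cis (a * t)) -
    'i * creal a * cis (a * t) * (creal h^-1 * creal h)); last by ring.
  by rewrite hC mulr1.
rewrite !cabsM cabs_cis mulr1 cabs_creal normfV.
have z0 : `|0 : R| <= 1 / 2 by rewrite normr0; lra.
have ah : `|a * h| <= 1 / 2.
  by rewrite normrM; apply: le_trans hd'; apply: ler_wpM2l.
have := exp_cis_quadratic z0 ah.
rewrite expR0 creal1 creal0 mul1r normr0 !add0r => q.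
rewrite mulrC ltr_pdivrMr //; apply: (le_lt_trans q).
rewrite normrM exprMn real_normK ?num_real // mulrA [`|h| ^+ 2]expr2 mulrA.
rewrite ltr_pM2r //; apply: (@le_lt_trans _ _ (e / 2)).
  by apply: le_trans hd; apply: ler_wpM2l.
by rewrite ltr_pdivrMr // ltr_pMr // ltr1n.
Unshelve. all: end_near. Qed.

(** Integrating T1 term by term, without its constant term p_N, gives T0, and U - T0 has derivative
    V - T1 + p_N. Periodicity forces |p_N| <= 2 E, so U - T0 is Lipschitz with constant O(E), and
    Jackson's theorem with s = 1 approximates it up to O(E / N). *)
Lemma favard : exists2 K : R, 0 <= K & forall (U V T1 : C -> C) N (E : R), (0 < N)%N ->
  circle_continuous U -> (forall t, path_deriv (fun s => U (cis s)) t (V (cis t))) ->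
  trig_poly N T1 -> (forall l, cabs l = 1 -> cabs (V l - T1 l) <= E) ->
  exists2 T, trig_poly N T & forall l, cabs l = 1 -> cabs (U l - T l) <= K * E / N%:R.
Proof.
have [C0 C0p HC] := chord_bound R.
exists (17 * (12 * C0)); first by rewrite !mulr_ge0 // ltW.
move=> U V T1 N E N0 Uc UV [p sp pE] VE.
have pi0 : (0 : R) < pi by exact: pi_gt0.
have E0 : 0 <= E by apply: le_trans (VE 1 (cabs1 R)); exact: cabs_ge0.
have i0 : ('i : C) != 0 by rewrite neq0Ci.
pose q i : C := if i == N then 0 else p`_i / ('i * creal (i%:R - N%:R)).
pose T0 (l : C) := \sum_(i < (2 * N).+1) q i * (l ^+ i * l^* ^+ N).
have cisE i t : cis t ^+ i * (cis t)^* ^+ N = cis ((i%:R - N%:R) * t).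
  by rewrite -cisN !cisX -cisD mulrBl mulrN.
have T0t : trig_poly N T0.
  exists (\poly_(i < (2 * N).+1) q i); first exact: size_poly.
  by move=> l l1; rewrite horner_poly mulr_suml; apply: eq_bigr => i _; rewrite mulrA.
have T0c : circle_continuous T0.
  move=> l l1; apply: (@cvg_Csum _ _ (nbhs l) _ _ (fun i l => q i * (l ^+ i * l^* ^+ N))
    (fun i => q i * (l ^+ i * l^* ^+ N))) => i _.
  exact: (cvg_Cscale (cvg_Cmul (@circle_continuousX R i l l1) (@circle_continuous_conjX R N l l1))).
have T0d t : path_deriv (fun s => T0 (cis s)) t (T1 (cis t) - p`_N).
  have -> : T1 (cis t) - p`_N = \sum_(i < (2 * N).+1)
      q i * ('i * creal (i%:R - N%:R) * cis ((i%:R - N%:R) * t)).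
    rewrite pE ?cabs_cis // (horner_coef_wide _ sp) mulr_suml.
    have NN : (N < (2 * N).+1)%N by lia.
    rewrite (bigD1 (Ordinal NN)) //= [RHS](bigD1 (Ordinal NN)) //= /q eqxx mul0r add0r.
    rewrite -mulrA cisE subrr mul0r cis0 mulr1 addrAC subrr add0r; apply: eq_bigr => i iN.
    have {}iN : (i : nat) != N by apply: contraNneq iN => iN; apply/eqP/val_inj.
    rewrite (negPf iN) -mulrA cisE mulrA divfK //.
    rewrite mulf_neq0 // -cabs_eq0 cabs_creal normr_eq0 subr_eq0 eqr_nat //.
  apply: (cvg_Cext (f := fun h => creal h^-1 * (\sum_(i < (2 * N).+1) q i * cis ((i%:R - N%:R) * (t + h)) -
     \sum_(i < (2 * N).+1) q i * cis ((i%:R - N%:R) * t)))).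
    move=> h; congr (_ * (_ - _)); apply: eq_bigr => i _; by rewrite cisE.
  apply: (path_deriv_sum (f := fun i s => q i * cis ((i%:R - N%:R) * s))
    (d := fun i => q i * ('i * creal (i%:R - N%:R) * cis ((i%:R - N%:R) * t)))) => i _.
  by apply: path_derivZ; exact: path_deriv_cis.
pose W l := U l - T0 l.
have Wd t : path_deriv (fun s => W (cis s)) t (V (cis t) - T1 (cis t) + p`_N).
  have h := path_derivD (UV t) (path_derivZ (c := -1) (T0d t)).
  have -> : V (cis t) - T1 (cis t) + p`_N = V (cis t) + -1 * (T1 (cis t) - p`_N) by ring.
  have -> : (fun s => W (cis s)) = (fun s => U (cis s) + -1 * T0 (cis s)); last exact: h.
  by apply/funext => s; rewrite /W mulN1r.
(* With the linear correction - p_N s the path has derivative V - T1; over a full turn the periodic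
   part contributes nothing. *)
have pN : cabs p`_N <= 2 * E.
  have Gd t : path_deriv (fun s => W (cis s) + (- p`_N) * creal s) t (V (cis t) - T1 (cis t)).
    have := path_derivD (Wd t) (path_derivZ (c := - p`_N) (path_deriv_id t)).
    by rewrite mulr1 addrK.
  have pi2 : (0 : R) < 2 * pi by rewrite mulr_gt0.
  have := path_mvt pi2 (fun t _ => Gd t) (fun t _ => VE _ (cabs_cis t)).
  rewrite cis_2pi cis0 creal0 mulr0 addr0 addrAC subrr add0r subr0 cabsM cabsN cabs_creal.
  by rewrite (gtr0_norm pi2) ler_pM2r.
have Wlip (l m : C) : cabs l = 1 -> cabs m = 1 -> cabs (W (l * m) - W l) <= 6 * E * C0 * cabs (m - 1).
  move=> l1 m1; have [a _ ->] := cis_surj l1; have [t tpi ->] := cis_surj m1.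
  rewrite -cisD.
  have := @path_mvt_abs (fun s => W (cis s)) (fun t => V (cis t) - T1 (cis t) + p`_N) (3 * E) a (a + t)
     (fun t _ => Wd t) _.
  rewrite [a + t - a]addrAC subrr add0r => H.
  have {}H : cabs (W (cis (a + t)) - W (cis a)) <= 2 * (3 * E) * `|t|.
    apply: H => s _; apply: (le_trans (cabsD _ _)).
    by have := VE _ (cabs_cis s); move: pN; clear; lra.
  apply: (le_trans H); have := HC t tpi => /(ler_wpM2l (x := 6 * E)) h.
  have {}h := h (mulr_ge0 (ler0n _ _) E0).
  by move: h; rewrite !mulrA; have -> : 2 * 3 * E = 6 * E by ring.
have Wc : circle_continuous W by move=> l l1; exact: (cvgB (Uc l l1) (T0c l l1)).
have A0 : 0 <= 12 * E * C0 by rewrite !mulr_ge0 // ltW.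
have s01 : 0 < (1 : R) <= 1 by rewrite ltr01 lexx.
have HW l m : cabs l = 1 -> cabs m = 1 ->
    cabs (W (l * m) + W (l * m^*) - 2 * W l) <= 12 * E * C0 * cabs (m - 1) `^ 1.
  move=> l1 m1; rewrite powRr1 ?cabs_ge0 //.
  have m1' : cabs m^* = 1 by rewrite cabs_conj.
  have h1 := Wlip l m l1 m1; have h2 := Wlip l m^* l1 m1'.
  have E1 : cabs (m^* - 1) = cabs (m - 1).
    by rewrite -cabs_conj conj_sub conjCK rmorph1.
  have alg (x y z : C) : x + y - 2 * z = (x - z) + (y - z) by ring.
  rewrite alg.
  apply: (le_trans (cabsD _ _)); apply: (le_trans (lerD h1 h2)); rewrite E1.
  by rewrite le_eqVlt; apply/orP; left; apply/eqP; ring.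
have [g gt gW] := jackson Wc s01 A0 N0 HW.
exists (fun l => T0 l + g l); first exact: trig_polyD.
move=> l l1; rewrite opprD addrA; apply: (le_trans (gW l l1)).
rewrite powR_inv1 ?ler0n // le_eqVlt; apply/orP; left; apply/eqP; ring.
Qed.

End PathDerivatives.

(** * Approximation of Lipschitz functions along slices *)

Lemma cvg_creal_inv (R : realType) T (F : set_system T) {FF : Filter F} (f : T -> R) (l : R) :
  l != 0 -> f x @[x --> F] --> l -> creal (f x)^-1 @[x --> F] --> creal l^-1.
Proof. by move=> l0 h; apply: cvg_creal; exact: cvgV. Qed.

Section CircleRegularity.
Variables (R : realType) (n : nat).
Local Notation C := (Cx R).
Local Notation Cn := 'rV[Cx R]_n.
Local Notation S := (@unit_sphere R n).
Implicit Types (x y z w b : Cn) (phi : Cn -> C).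

Definition real_basis (m : 'I_(n + n)) : Cn :=
  match fintype.split m with
  | inl j => delta_mx ord0 j
  | inr j => 'i *: delta_mx ord0 j
  end.

Definition real_coord (m : 'I_(n + n)) w : R :=
  match fintype.split m with
  | inl j => complex.Re (w ord0 j)
  | inr j => complex.Im (w ord0 j)
  end.

Lemma real_basis_expand w : \sum_m creal (real_coord m w) *: real_basis m = w.
Proof.
rewrite big_split_ord /=; under eq_bigr => j _.
  rewrite /real_coord /real_basis -/(unsplit (inl j)) unsplitK; over.
under [X in _ + X]eq_bigr => j _.
  rewrite /real_coord /real_basis -/(unsplit (inr j)) unsplitK; over.
rewrite -big_split /= [RHS]row_sum_delta; apply: eq_bigr => j _.
by rewrite scalerA -scalerDl [w ord0 j in RHS]ReImE [creal _ * 'i]mulrC.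
Qed.

Lemma real_coord_le m w : `|real_coord m w| <= enorm w.
Proof.
rewrite /real_coord; case: (fintype.split m) => j; apply: le_trans (cabs_le_enorm w j).
  exact: Re_le_cabs.
exact: Im_le_cabs.
Qed.

Lemma enorm_real_basis m : enorm (real_basis m) <= 1.
Proof.
have dn j : enorm (delta_mx ord0 j : Cn) <= 1.
  apply: (le_trans (enorm_le_sum _)); rewrite (bigD1 j) //= mxE !eqxx cabs1.
  rewrite big1 ?addr0 // => i ij; rewrite mxE eqxx /= (negPf ij); exact: cabs0.
rewrite /real_basis; case: (fintype.split m) => j //.
rewrite enormZ (_ : cabs 'i = 1) ?mul1r //; apply: cabsE; by rewrite normCi creal1.
Qed.

Lemma sphere_proj_scale (c : R) x : 0 < c -> sphere_proj (creal c *: x) = sphere_proj x.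
Proof.
move=> c0; rewrite /sphere_proj enormZ cabs_creal gtr0_norm // scalerA -crealM.
by rewrite invfM mulrAC mulVf ?mul1r // gt_eqF.
Qed.

Lemma nbhs_enorm_lt z (d : R) : 0 < d -> \forall x \near nbhs z, enorm (x - z) < d.
Proof.
move=> d0; apply: ((cvg_enormP (F := nbhs z) (fun x : Cn => x) z).1 _ _ d0).
exact: cvg_id.
Qed.

Lemma near_sphere_proj z (P : Cn -> Prop) : S z ->
  (\forall w \near within S (nbhs z), P w) -> \forall x \near z, x != 0 /\ P (sphere_proj x).
Proof.
move=> Sz HP; have [e e0 He] := nbhs_enorm HP.
have d0 : 0 < Num.min (1 / 2) (e / 2) by rewrite lt_min !divr_gt0.
apply: filterS (nbhs_enorm_lt z d0) => x; rewrite lt_min => /andP[x1 x2].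
have N1 : `|enorm x - 1| <= enorm (x - z) by have := enorm_dist x z; rewrite (Sz : enorm z = 1).
have N0 : 0 < enorm x by move: N1; rewrite ler_norml => /andP[+ _]; move: x1; clear; lra.
have x0 : x != 0 by rewrite -enorm_eq0 gt_eqF.
split => //; apply: He; last exact: sphere_proj_in.
apply: (@le_lt_trans _ _ (2 * enorm (x - z))).
  have -> : sphere_proj x - z = creal (1 - enorm x) *: sphere_proj x + (x - z).
    have pw : creal (enorm x) *: sphere_proj x = x.
      by rewrite /sphere_proj scalerA -crealM divff ?gt_eqF // creal1 scale1r.
    by rewrite crealB creal1 scalerBl scale1r pw addrA subrK.
  apply: (le_trans (enormD _ _)); rewrite enormZ cabs_creal (sphere_proj_in x0) mulr1.
  by rewrite distrC; move: N1; clear; lra.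
by move: x2; clear; lra.
Qed.

Lemma scont_extension phi z : S z -> scont phi ->
  phi (sphere_proj x) @[x --> z] --> phi z.
Proof.
move=> Sz cphi; apply/(cvg_cabsP (F := nbhs z)) => e e0.
have H := (cvg_cabsP (F := within S (nbhs z)) phi (phi z)).1 (cphi z Sz) e e0.
by apply: filterS (near_sphere_proj Sz (H _)) => x [].
Qed.

Lemma cvg_dnbhs_scale (q : R -> C) (l : C) (c : R) : 0 < c ->
  q k @[k --> (0 : R)^'] --> l -> q (h * c) @[h --> (0 : R)^'] --> l.
Proof.
move=> c0 /cvg_cabsP lim; apply/cvg_cabsP => e e0.
move: (lim e e0); rewrite /dnbhs /within /prop_near1 /= => /nbhs_ballP[d /= d0 Hd].
apply/nbhs_ballP; exists (d / c); first by rewrite /= divr_gt0.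
move=> h; rewrite /ball /= sub0r normrN => hd h0; apply: Hd; last by rewrite mulf_neq0 // gt_eqF.
by rewrite /ball /= sub0r normrN normrM (gtr0_norm c0) -ltr_pdivlMr.
Qed.

(** The extension is homogeneous of degree 0, hence its derivatives are of degree -1, which explains
    the inverse norm. *)
Lemma extension_line_deriv phi b x t : x + creal t *: b != 0 -> sphere_derivable b phi ->
  path_deriv (fun s => phi (sphere_proj (x + creal s *: b))) t
    (creal (enorm (x + creal t *: b))^-1 * sphere_deriv b phi (sphere_proj (x + creal t *: b))).
Proof.
have shift h : x + creal (t + h) *: b = (x + creal t *: b) + creal h *: b.
  by rewrite crealD scalerDl addrA.
rewrite /path_deriv; under eq_fun do rewrite shift.
move: (x + creal t *: b) => y y0 dphi {shift}.
have N0 : 0 < enorm y by rewrite lt_neqAle eq_sym enorm_eq0 y0 enorm_ge0.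
have Ni : 0 < (enorm y)^-1 by rewrite invr_gt0.
have c1 : sphere_quotient b phi (sphere_proj y) (h / enorm y) @[h --> (0 : R)^'] -->
    sphere_deriv b phi (sphere_proj y).
  exact: cvg_dnbhs_scale Ni (dphi _ (sphere_proj_in y0)).
have c2 := cvg_Cscale (c := creal (enorm y)^-1) c1.
apply: (cvg_Cext _ (c2 _)) => h.
have yE : y = creal (enorm y) *: sphere_proj y.
  by rewrite /sphere_proj scalerA -crealM divff ?gt_eqF // creal1 scale1r.
have -> : y + creal h *: b = creal (enorm y) *: (sphere_proj y + creal (h / enorm y) *: b).
  have hE : enorm y * (h / enorm y) = h by rewrite mulrC divfK // gt_eqF.
  by rewrite scalerDr -yE scalerA -crealM hE.
rewrite sphere_proj_scale // /sphere_quotient mulrA -crealM invfM invrK mulrCA mulVf ?mulr1 //.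
by rewrite gt_eqF.
Qed.

Section Gradient.
Variable phi : Cn -> C.
Hypothesis phi_der : forall v, sphere_derivable v phi.
Hypothesis der_cont : forall v, scont (sphere_deriv v phi).

Let D m := sphere_deriv (real_basis m) phi.

Let gradient_near z (e : R) : S z -> 0 < e -> exists2 d : R, 0 < d & forall x, enorm (x - z) < d ->
  x != 0 /\ forall m, cabs (creal (enorm x)^-1 * D m (sphere_proj x) - D m z) <= e.
Proof.
move=> Sz e0.
have lim m : creal (enorm x)^-1 * D m (sphere_proj x) @[x --> z] --> D m z.
  have c1 : creal (enorm x)^-1 @[x --> z] --> (1 : C).
    have -> : (1 : C) = creal (enorm z)^-1 by rewrite (Sz : enorm z = 1) invr1 creal1.
    have N0 : enorm z != 0 by rewrite (Sz : enorm z = 1) oner_neq0.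
    have cN : enorm x @[x --> z] --> enorm z by apply: (cvg_enorm (F := nbhs z)); exact: cvg_id.
    exact: (@cvg_creal_inv _ _ (nbhs z) _ _ _ N0 cN).
  have c2 := @scont_extension (D m) z Sz (@der_cont (real_basis m)).
  have c3 := cvg_Cmul c1 c2.
  by rewrite -[D m z]mul1r; exact: (c3 _).
have H : \forall x \near z, x != 0 /\ forall m, cabs (creal (enorm x)^-1 * D m (sphere_proj x) - D m z) <= e.
  have H1 : \forall x \near z, x != 0.
    have hT : \forall w \near within S (nbhs z), True by exact: nearW.
    by have := near_sphere_proj Sz hT; apply: filterS => x [].
  have H2 : \forall x \near z, forall m, cabs (creal (enorm x)^-1 * D m (sphere_proj x) - D m z) <= e.
    apply: (@filter_forall _ _ _ (nbhs z)) => m.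
    have h := (cvg_cabsP (F := nbhs z) _ _).1 (lim m) e e0.
    by apply: filterS (h _) => x /ltW.
  exact: filterS2 H1 H2.
by have [d d0 Hd] := nbhs_enorm H; exists d.
Qed.

(** Continuous partial derivatives imply differentiability: the increment is split along the real
    coordinate directions, and on each segment the mean value estimate is applied to the extension
    minus its linear part. *)
Lemma extension_differentiable z (e : R) : S z -> 0 < e -> exists2 d : R, 0 < d &
  forall y, enorm (y - z) < d ->
    cabs (phi (sphere_proj y) - phi z - \sum_m creal (real_coord m (y - z)) * D m z) <=
      e * enorm (y - z).
Proof.
move=> Sz e0; set n2 := (n + n)%:R : R.
have n20 : 0 <= n2 by exact: ler0n.
have n2p : 0 < n2 + 1 by rewrite ltr_wpDl.
have e1 : 0 < e / (2 * (n2 + 1)) by rewrite divr_gt0 // mulr_gt0.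
have [d d0 Hd] := gradient_near Sz e1.
exists (d / (n2 + 1)); first by rewrite divr_gt0.
move=> y yd; set r := enorm (y - z); have r0 : 0 <= r by exact: enorm_ge0.
have rd : r * (n2 + 1) < d by rewrite -ltr_pdivlMr.
pose c m := real_coord m (y - z).
have cr m : `|c m| <= r by exact: real_coord_le.
pose p (M : nat) : Cn := z + \sum_(m < n + n | (m < M)%N) creal (c m) *: real_basis m.
have pS (m : 'I_(n + n)) : p m.+1 = p m + creal (c m) *: real_basis m.
  rewrite /p -addrA; congr (_ + _); rewrite (bigD1 m) //= addrC; congr (_ + _).
  apply: eq_bigl => i; rewrite ltnS leq_eqVlt; have [->|im] := eqVneq i m; first by rewrite ltnn eqxx.
  by rewrite (_ : (i == m :> nat) = false) //=; [rewrite andbT|apply/eqP => /val_inj E; rewrite E eqxx in im].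
have pz (M : nat) : enorm (p M - z) <= n2 * r.
  rewrite /p addrC addKr; apply: (@le_trans _ _ (\sum_(m < n + n) r)); last first.
    by rewrite sumr_const card_ord mulr_natl.
  rewrite big_mkcond; elim/big_rec2: _ => [|i a v _ IH]; first by rewrite le_eqVlt enorm_eq0 eqxx.
  apply: (le_trans (enormD _ _)); apply: lerD => //; case: ifP => _; last first.
    by rewrite (_ : enorm 0 = 0) //; apply/eqP; rewrite enorm_eq0.
  rewrite enormZ cabs_creal -[leRHS]mulr1; apply: ler_pM => //; first exact: enorm_ge0.
  exact: enorm_real_basis.
have step (m : 'I_(n + n)) : cabs (phi (sphere_proj (p m.+1)) - phi (sphere_proj (p m)) - creal (c m) * D m z) <=
    2 * (e / (2 * (n2 + 1))) * `|c m|.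
  have near_seg s : `|s| <= `|c m| -> enorm (p m + creal s *: real_basis m - z) < d.
    move=> hs; apply: le_lt_trans rd; rewrite mulrDr mulr1 [r * n2]mulrC addrAC.
    apply: (le_trans (enormD _ _)); apply: lerD; first exact: pz.
    rewrite enormZ cabs_creal -[leRHS]mulr1; apply: ler_pM => //; first exact: enorm_ge0.
      exact: le_trans hs (cr m).
    exact: enorm_real_basis.
  have := @path_mvt_abs R (fun s => phi (sphere_proj (p m + creal s *: real_basis m)) + (- D m z) * creal s)
    (fun s => creal (enorm (p m + creal s *: real_basis m))^-1 *
       D m (sphere_proj (p m + creal s *: real_basis m)) + - D m z * 1) (e / (2 * (n2 + 1))) 0 (c m).
  rewrite creal0 scale0r addr0 mulr0 addr0 !subr0 -pS => H.
  have -> : phi (sphere_proj (p m.+1)) - phi (sphere_proj (p m)) - creal (c m) * D m z =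
      phi (sphere_proj (p m.+1)) + - D m z * creal (c m) - phi (sphere_proj (p m)) by ring.
  apply: H => s; rewrite subr0 => hs; have [x0 Hx] := Hd _ (near_seg s hs).
    apply: path_derivD; first exact: extension_line_deriv.
    by apply: path_derivZ; exact: path_deriv_id.
  by rewrite mulr1; exact: Hx.
have p0 : p 0%N = z by rewrite /p big1 ?addr0.
have pn : p (n + n)%N = y.
  rewrite /p (eq_bigl xpredT); last by move=> i; rewrite ltn_ord.
  by rewrite real_basis_expand addrC subrK.
have -> : phi (sphere_proj y) - phi z - \sum_m creal (c m) * D m z =
    \sum_m (phi (sphere_proj (p (nat_of_ord m).+1)) - phi (sphere_proj (p m)) - creal (c m) * D m z).
  rewrite [RHS]big_split /= sumrN; congr (_ - _).
  rewrite -(big_mkord xpredT (fun m => phi (sphere_proj (p m.+1)) - phi (sphere_proj (p m)))).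
  by rewrite telescope_sumr // pn p0 (sphere_proj_id Sz).
apply: (le_trans (cabs_sum _ _ _)).
apply: (@le_trans _ _ (\sum_(m < n + n) (2 * (e / (2 * (n2 + 1))) * r))).
  apply: ler_sum => m _; apply: (le_trans (step m)); apply: ler_wpM2l => //.
  by rewrite mulr_ge0 // ltW.
rewrite sumr_const card_ord -[_ *+ _]mulr_natl -/n2.
have -> : n2 * (2 * (e / (2 * (n2 + 1))) * r) = n2 / (n2 + 1) * (e * r).
  by field; rewrite gt_eqF //; clear -n2p.
apply: ler_piMl; first by rewrite mulr_ge0 // ltW.
by rewrite ler_pdivrMr // mul1r lerDl.
Qed.

End Gradient.

End CircleRegularity.

Section CircleApproximation.
Variables (R : realType) (n : nat).
Local Notation C := (Cx R).
Local Notation Cn := 'rV[Cx R]_n.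
Local Notation S := (@unit_sphere R n).
Implicit Types (x y z w u v : Cn) (phi : Cn -> C).

Definition gradient_form phi z u : C :=
  \sum_(m < n + n) creal (real_coord m u) * sphere_deriv (real_basis R m) phi z.

Lemma real_coordD m u v : real_coord m (u + v) = real_coord m u + real_coord m v.
Proof. by rewrite /real_coord; case: (fintype.split m) => j; rewrite mxE ?cReD ?cImD. Qed.

Lemma real_coordZ m (c : R) u : real_coord m (creal c *: u) = c * real_coord m u.
Proof.
by rewrite /real_coord; case: (fintype.split m) => j; rewrite mxE ?cReM ?cImM /= ?mul0r ?subr0 ?addr0.
Qed.

Lemma gradient_formD phi z u v : gradient_form phi z (u + v) =
  gradient_form phi z u + gradient_form phi z v.
Proof.
rewrite /gradient_form -big_split; apply: eq_bigr => m _.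
by rewrite real_coordD crealD mulrDl.
Qed.

Lemma gradient_formZ phi z c u : gradient_form phi z (creal c *: u) = creal c * gradient_form phi z u.
Proof.
rewrite /gradient_form mulr_sumr; apply: eq_bigr => m _.
by rewrite real_coordZ crealM mulrA.
Qed.

Lemma gradient_form_le phi z u : cabs (gradient_form phi z u) <=
  enorm u * \sum_(m < n + n) cabs (sphere_deriv (real_basis R m) phi z).
Proof.
apply: (le_trans (cabs_sum _ _ _)); rewrite mulr_sumr; apply: ler_sum => m _.
by rewrite cabsM cabs_creal; apply: ler_wpM2r; [exact: cabs_ge0|exact: real_coord_le].
Qed.

Lemma circle_chain phi z t : (forall v, sphere_derivable v phi) ->
  (forall v, scont (sphere_deriv v phi)) -> S z ->
  path_deriv (fun s => phi (cis s *: z)) t (gradient_form phi (cis t *: z) ('i *: (cis t *: z))).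
Proof.
move=> dphi cphi Sz; have shift h : cis (t + h) *: z = cis h *: (cis t *: z).
  by rewrite addrC cisD scalerA.
rewrite /path_deriv; under eq_fun do rewrite shift.
have : S (cis t *: z) by apply: sphereZ => //; exact: cabs_cis.
move: (cis t *: z) => w Sw {z Sz shift}.
apply/cvg_cabsP => e e0; set A := \sum_(m < n + n) cabs (sphere_deriv (real_basis R m) phi w).
have A0 : 0 <= A by apply: sumr_ge0 => m _; exact: cabs_ge0.
have e2 : 0 < e / 2 by rewrite divr_gt0.
have e3 : 0 < e / (2 * (A + 1)) by rewrite divr_gt0 // mulr_gt0 // ltr_wpDl.
have [d d0 Hd] := extension_differentiable dphi cphi Sw e2.
have dc : \forall h \near (0 : R)^', cabs (creal h^-1 * (cis h - 1) - 'i) < e / (2 * (A + 1)).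
  have H := (cvg_cabsP (F := (0 : R)^') _ _).1 (@path_deriv_cis R 1 0) _ e3.
  by apply: filterS (H _) => h; rewrite add0r !mul1r cis0 creal1 !mulr1.
near=> h.
have h0 : h != 0 by near: h; exact: nbhs_dnbhs_neq.
have hd : `|h| < d.
  near: h; apply: (@nbhs_dnbhs _ _ (fun h => `|h| < d)); apply/nbhs_ballP; exists d => // q.
  by rewrite /ball /= sub0r normrN.
have hc : cabs (creal h^-1 * (cis h - 1) - 'i) < e / (2 * (A + 1)) by near: h.
set q := creal h^-1 * (cis h - 1) - 'i in hc.
have yw : cis h *: w - w = creal h *: ('i *: w + q *: w).
  rewrite -scalerDl scalerA /q [_ + (_ - _)]addrC subrK mulrA -crealM divff // creal1 mul1r.
  by rewrite scalerBl scale1r.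
have yS : S (cis h *: w) by apply: sphereZ => //; exact: cabs_cis.
have yd : enorm (cis h *: w - w) <= `|h|.
  have -> : cis h *: w - w = (cis h - 1) *: w by rewrite scalerBl scale1r.
  by rewrite enormZ (Sw : enorm w = 1) mulr1; exact: cabs_cisB1_le.
have := Hd _ (le_lt_trans yd hd); rewrite (sphere_proj_id yS) -/(gradient_form _ _ _).
rewrite {1}yw gradient_formZ gradient_formD => HL.
have qE (P L1 L2 : C) : creal h^-1 * P - L1 = creal h^-1 * (P - creal h * (L1 + L2)) + L2.
  by rewrite mulrBr [creal h^-1 * (creal h * _)]mulrA -crealM mulVf // creal1 mul1r; ring.
rewrite (qE _ _ (gradient_form phi w (q *: w))).
apply: (le_lt_trans (cabsD _ _)).
have -> : e = e / 2 + e / 2 by field.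
apply: ler_ltD.
  rewrite cabsM cabs_creal normfV ler_pdivrMl ?normr_gt0 //.
  by apply: (le_trans HL); rewrite mulrC; apply: ler_wpM2r => //; exact: ltW.
apply: (le_lt_trans (gradient_form_le _ _ _)); rewrite -/A enormZ (Sw : enorm w = 1) mulr1.
apply: (@le_lt_trans _ _ (cabs q * (A + 1))).
  by apply: ler_wpM2l; [exact: cabs_ge0|rewrite lerDl].
apply: (@lt_le_trans _ _ (e / (2 * (A + 1)) * (A + 1))); first by rewrite ltr_pM2r // ltr_wpDl.
by rewrite invfM mulrA mulfVK // gt_eqF // ltr_wpDl.
Unshelve. all: end_near. Qed.

Lemma trig_poly1 (a b : C) : trig_poly 1 (fun l : C => l * a + l^* * b).
Proof.
exists (a *: 'X^2 + b%:P).
  apply: (leq_trans (size_polyD _ _)); rewrite geq_max.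
  rewrite (leq_trans (size_scale_leq _ _)) ?size_polyXn //=.
  by rewrite (leq_trans (size_polyC_leq1 _)).
move=> l l1; rewrite hornerD hornerZ hornerXn hornerC expr1.
have -> : (a * l ^+ 2 + b) * l^* = l * a * (l * l^*) + l^* * b by ring.
by rewrite mul_conj_unit // mulr1.
Qed.

Lemma trig_poly_real_coord m w : trig_poly 1 (fun l : C => creal (real_coord m (l *: w))).
Proof.
have conjE (u : C) : u^* = creal (complex.Re u) - 'i * creal (complex.Im u).
  by rewrite {1}[u]ReImE conj_add conj_mul !conj_creal conjCi mulNr.
have ReE (u : C) : creal (complex.Re u) = (u + u^*) / 2 by rewrite conjE {2}[u]ReImE; field.
have ImE (u : C) : creal (complex.Im u) = 'i * (u^* - u) / 2.
  have -> : 'i * (u^* - u) / 2 = - ('i ^+ 2) * creal (complex.Im u).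
    by rewrite conjE {3}[u]ReImE; field.
  by rewrite sqrCi opprK mul1r.
rewrite /real_coord; case: (fintype.split m) => j.
  have -> : (fun l : C => creal (complex.Re ((l *: w) ord0 j))) =
      (fun l => l * (w ord0 j / 2) + l^* * ((w ord0 j)^* / 2)).
    by apply/funext => l; rewrite ReE mxE conj_mul mulrDl !mulrA.
  exact: trig_poly1.
have -> : (fun l : C => creal (complex.Im ((l *: w) ord0 j))) =
    (fun l => l * (- 'i * w ord0 j / 2) + l^* * ('i * (w ord0 j)^* / 2)).
  by apply/funext => l; rewrite ImE mxE conj_mul; field.
exact: trig_poly1.
Qed.

Definition circle_approx phi (p B : R) := forall N z, (0 < N)%N -> S z ->
  exists2 g, trig_poly N g &
    forall l, cabs l = 1 -> cabs (phi (l *: z) - g l) <= B * N%:R `^ (- p).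

Lemma circle_extension phi z : S z -> scont phi ->
  circle_continuous (fun x : C => phi (sphere_proj (x *: z))).
Proof.
move=> Sz cphi l l1; have Slz : S (l *: z) by exact: sphereZ.
rewrite (sphere_proj_id Slz).
have cs : k *: z @[k --> l] --> l *: z.
  apply/(cvg_enormP (F := nbhs l)) => e e0.
  have H := (cvg_cabsP (F := nbhs l) (fun k : C => k) l).1 (@cvg_id _ _) _ e0.
  by apply: filterS (H _) => k; rewrite -scalerBl enormZ (Sz : enorm z = 1) mulr1.
have ce := scont_extension Slz cphi.
by move=> A HA; exact: (cs _ (ce A HA)).
Qed.

(** On a slice the reflection used in [zygmund] is conjugation of the parameter, so that the Zygmund
    condition restricts to the second difference in the hypothesis of [jackson]. *)
Lemma sphere_reflect_circle z (m : C) : S z -> cabs m = 1 ->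
  sphere_reflect z (m *: z) = m^* *: z.
Proof.
move=> Sz m1; have -> : m^* *: z = creal (2 * complex.Re m) *: z - m *: z.
  rewrite -scalerBl; congr (_ *: _); apply: Cx_eqP.
    by rewrite cReB cRe_conj /=; ring.
  by rewrite cImB cIm_conj /= sub0r.
have rE : redot z (m *: z) = complex.Re m.
  have -> : complex.Re m = enorm z ^+ 2 * complex.Re m by rewrite (Sz : enorm z = 1) expr1n mul1r.
  rewrite enorm_sqr mulr_suml; apply: eq_bigr => j _; rewrite mxE conj_mul.
  by rewrite mulrCA mulrC -cabs_sqr Re_crealM cRe_conj.
by rewrite /sphere_reflect redotC rE.
Qed.

Lemma circle_approx_base phi s : 0 < s <= 1 -> lambda_base s phi ->
  exists2 B, 0 <= B & circle_approx phi s B.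
Proof.
move=> s01 [/scontP cphi hphi].
have [A A0 HA] : exists2 A, 0 <= A & forall z l m, S z -> cabs l = 1 -> cabs m = 1 ->
    cabs (phi ((l * m) *: z) + phi ((l * m^*) *: z) - 2 * phi (l *: z)) <= A * cabs (m - 1) `^ s.
  have dist z l m : S z -> cabs l = 1 -> enorm ((l * m) *: z - l *: z) = cabs (m - 1).
    move=> Sz l1; rewrite -scalerBl enormZ (Sz : enorm z = 1) mulr1 -[X in _ - X]mulr1 -mulrBr.
    by rewrite cabsM l1 mul1r.
  case: ifP hphi => [s1|s1] [M HM].
    exists (2 * `|M|); first by rewrite mulr_ge0.
    move=> z l m Sz l1 m1.
    have H k : cabs k = 1 -> cabs (phi ((l * k) *: z) - phi (l *: z)) <= `|M| * cabs (k - 1) `^ s.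
      move=> k1; rewrite -(dist z l k Sz l1).
      apply: (le_trans (HM _ _ _ _)); first by apply: sphereZ => //; rewrite cabsM l1 k1 mulr1.
        exact: sphereZ.
      by apply: ler_wpM2r; [exact: powR_ge0|exact: ler_norm].
    have alg (a b c : C) : a + b - 2 * c = (a - c) + (b - c) by ring.
    rewrite (alg (phi _)); apply: (le_trans (cabsD _ _)).
    have Hm := H m m1; have := H m^*; rewrite cabs_conj m1 => /(_ erefl) Hn.
    have E : cabs (m^* - 1) = cabs (m - 1).
      by rewrite -[LHS]cabs_conj conj_sub conjCK conjC1.
    rewrite E in Hn; move: Hm Hn; clear; lra.
  have s1E : s = 1 by apply/eqP; rewrite eq_le (andP s01).2 leNgt s1.
  exists `|M|; first by [].
  move=> z l m Sz l1 m1; rewrite s1E powRr1 ?cabs_ge0 // -(dist z l m Sz l1).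
  have Slz : S (l *: z) by exact: sphereZ.
  have := HM _ _ Slz (sphereZ m1 Slz); rewrite sphere_reflect_circle // !scalerA ![_ * l]mulrC.
  move=> h; apply: (le_trans h); apply: ler_wpM2r; [exact: enorm_ge0|exact: ler_norm].
exists (17 * A); first by rewrite mulr_ge0.
move=> N z N0 Sz.
have cW := circle_extension Sz cphi.
have E l : cabs l = 1 -> sphere_proj (l *: z) = l *: z by move=> l1; apply: sphere_proj_id; exact: sphereZ.
have [l m l1 m1|g gt Hg] := jackson cW s01 A0 N0.
  have mc : cabs m^* = 1 by rewrite cabs_conj.
  by rewrite !E ?cabsM ?l1 ?m1 ?mc ?mulr1 //; exact: HA.
by exists g => // l l1; have := Hg l l1; rewrite E.
Qed.

(** Along a slice the derivative is the gradient applied to i l z. Approximants of the partial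
    derivatives, multiplied by coordinates of degree 1, approximate it, and Favard's inequality
    gains the factor 1 / N. *)
Lemma circle_approx_step phi p : 0 < p -> scont phi -> (forall v, sphere_derivable v phi) ->
  (forall v, scont (sphere_deriv v phi)) ->
  (forall v, exists2 B, 0 <= B & circle_approx (sphere_deriv v phi) p B) ->
  exists2 B, 0 <= B & circle_approx phi (p + 1) B.
Proof.
move=> p0 cphi dphi cder happ.
have [Q HQ] := boolp.choice (fun m : 'I_(n + n) =>
  (fun H => let: ex_intro2 B B0 HB := H in ex_intro (fun B => 0 <= B /\ circle_approx
    (sphere_deriv (real_basis R m) phi) p B) B (conj B0 HB)) (happ (real_basis R m))).
have [K K0 HK] := favard R.
have [M M0 HM] := scont_bounded (scont_cabs cphi).
set Bs := \sum_m Q m; have Bs0 : 0 <= Bs by apply: sumr_ge0 => m _; exact: (HQ m).1.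
exists (M + K * (Bs * 2 `^ p)); first by rewrite addr_ge0 ?mulr_ge0 ?powR_ge0.
(* The coordinates of i l z use up one degree, so degree 1 is settled by the zero polynomial and the
   bound of phi; afterwards [N] is the degree minus 2. *)
move=> N z N0 Sz; case: N N0 => [//|[|N]] _.
  exists (fun=> 0); first exact: trig_poly_cst.
  move=> l l1; rewrite subr0 powR1 mulr1.
  have := HM _ (sphereZ l1 Sz); rewrite ger0_norm ?cabs_ge0 // => h.
  by apply: (le_trans h); rewrite lerDl !mulr_ge0 ?powR_ge0.
have N1 : (0 : R) < N.+1%:R by rewrite ltr0n.
have N2 : (0 : R) < N.+2%:R by rewrite ltr0n.
have [G HG] := boolp.choice (fun m : 'I_(n + n) =>
  (fun H => let: ex_intro2 g gt Hg := H in ex_intro (fun g => trig_poly N.+1 g /\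
     forall l, cabs l = 1 -> cabs (sphere_deriv (real_basis R m) phi (l *: z) - g l) <= Q m * N.+1%:R `^ (- p))
     g (conj gt Hg)) ((HQ m).2 N.+1 z (isT : (0 < N.+1)%N) Sz)).
pose U (x : C) := phi (sphere_proj (x *: z)).
pose V l := gradient_form phi (l *: z) ('i *: (l *: z)).
pose T1 l := \sum_(m < n + n) creal (real_coord m ('i *: (l *: z))) * G m l.
have UE l : cabs l = 1 -> U l = phi (l *: z).
  by move=> l1; rewrite /U sphere_proj_id //; exact: sphereZ.
have dU t : path_deriv (fun s => U (cis s)) t (V (cis t)).
  have -> : (fun s => U (cis s)) = (fun s => phi (cis s *: z)).
    by apply/funext => s; rewrite UE // cabs_cis.
  exact: circle_chain.
have tT : trig_poly N.+2 T1.
  have H m : trig_poly N.+2 (fun l => creal (real_coord m ('i *: (l *: z))) * G m l).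
    apply: (trig_polyM (d := 1) _ (HG m).1).
    have -> : (fun l : C => creal (real_coord m ('i *: (l *: z)))) =
        (fun l => creal (real_coord m (l *: ('i *: z)))).
      by apply/funext => l; rewrite scalerA mulrC -scalerA.
    exact: trig_poly_real_coord.
  pose Tm (i : nat) l := if insub i is Some m then creal (real_coord m ('i *: (l *: z))) * G m l else 0.
  have -> : T1 = (fun l => \sum_(m < n + n) Tm m l).
    by apply/funext => l; apply: eq_bigr => m _; rewrite /Tm valK.
  by apply: trig_poly_sum => i iN; rewrite /Tm insubT; exact: H.
have VT l : cabs l = 1 -> cabs (V l - T1 l) <= Bs * N.+1%:R `^ (- p).
  move=> l1; rewrite /V /T1 /gradient_form -sumrB.
  apply: (le_trans (cabs_sum _ _ _)); rewrite mulr_suml; apply: ler_sum => m _.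
  rewrite -mulrBr cabsM cabs_creal -[leRHS]mul1r.
  apply: ler_pM; rewrite ?cabs_ge0 //; last exact: (HG m).2.
  apply: (le_trans (real_coord_le _ _)).
  rewrite !enormZ l1 (Sz : enorm z = 1) !mulr1 le_eqVlt; apply/orP; left; apply/eqP.
  by apply: cabsE; rewrite normCi creal1.
have [T tTp HT] := HK U V T1 N.+2 _ isT (circle_extension Sz cphi) dU tT VT.
exists T => // l l1; rewrite -(UE l l1).
apply: (le_trans (HT l l1)).
(* The lost degree costs a factor 2^p, because N + 1 >= (N + 2) / 2. *)
have powN : N.+1%:R `^ (- p) <= 2 `^ p * N.+2%:R `^ (- p) :> R.
  have -> : 2 `^ p * N.+2%:R `^ (- p) = (N.+2%:R / 2) `^ (- p) :> R.
    rewrite powRM ?invr_ge0 // ?(ltW N2) // mulrC; congr (_ * _).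
    by rewrite -(powR_inv1 (ler0n R 2)) -powRrM mulN1r opprK.
  rewrite !powRN lef_pV2 ?posrE ?powR_gt0 ?divr_gt0 //.
  apply: ge0_ler_powR; rewrite ?nnegrE ?divr_ge0 ?(ltW N1) ?(ltW N2) ?(ltW p0) //.
  by rewrite ler_pdivrMr // -natrM ler_nat; lia.
have pE : N.+2%:R `^ (- (p + 1)) = N.+2%:R `^ (- p) / N.+2%:R :> R.
  rewrite opprD powRD; last by apply/implyP => _; rewrite gt_eqF.
  by rewrite powR_inv1 // ltW.
rewrite pE mulrA; apply: ler_wpM2r; first by rewrite invr_ge0 ltW.
apply: (@le_trans _ _ (K * (Bs * 2 `^ p) * N.+2%:R `^ (- p))); last first.
  by apply: ler_wpM2r; [exact: powR_ge0|rewrite lerDr].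
by rewrite -!mulrA; apply: ler_wpM2l => //; apply: ler_wpM2l.
Qed.

Lemma smooth_circle_approx k s phi : 0 < s <= 1 -> sphere_Ck k phi ->
  (forall vs : k.-tuple Cn, lambda_base s (foldr (@sphere_deriv R n) phi vs)) ->
  exists2 B, 0 <= B & circle_approx phi (k%:R + s) B.
Proof.
move=> s01; elim: k phi => [|k IH] phi [cphi Hk] HL.
  by rewrite add0r; apply: circle_approx_base => //; exact: (HL [tuple]).
have cder v : scont (sphere_deriv v phi).
  by case: k {IH HL} Hk => [|k] Hk; have [_ [/scontP]] := Hk v.
have -> : k.+1%:R + s = (k%:R + s) + 1 by rewrite -natr1 addrAC.
apply: circle_approx_step => //.
- by rewrite ltr_wpDl // (andP s01).1.
- exact/scontP.
- by move=> v; exact: (Hk v).1.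
- move=> v; apply: IH; first exact: (Hk v).2.
  move=> vs; have := HL [tuple of rcons vs v].
  by rewrite /= foldr_rcons.
Qed.

Lemma Lambda_slice_approx (tau : R) phi : 0 < tau -> Lambda tau phi ->
  scont phi /\ exists2 B, 0 <= B & slice_approx phi (2 `^ (- tau)) B.
Proof.
move=> tau0 [k /andP[k1 k2] [Ck HL]].
have s01 : 0 < tau - k%:R <= 1 by rewrite subr_gt0 k1 lerBlDr addrC natr1.
split; first by case: k Ck {k1 k2 HL s01} => [|k] [/scontP].
have [B B0 HB] := smooth_circle_approx s01 Ck HL; exists B => // j z Sz.
have [g [p sp pE] Hg] := HB (2 ^ j)%N z (expn_gt0 2 j) Sz.
exists (fun i => p`_i) => l l1; have := Hg l l1; rewrite pE // addrCA subrr addr0.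
rewrite (horner_coef_wide _ sp) mulr_suml.
have -> : (2 ^ j)%:R `^ (- tau) = (2 `^ (- tau)) ^+ j :> R.
  by rewrite natrX -[RHS]powR_mulrn ?powR_ge0 // -powRrM mulrC powRrM powR_mulrn.
by under [X in _ - X]eq_bigr do rewrite -mulrA.
Qed.

End CircleApproximation.

(** * Rotation invariance of the surface measure *)

Section TupleMeasure.
Variable R : realType.
Local Notation Rm := (measurableTypeR R).
Local Notation leb := (lebesgue_tuple R).
Local Open Scope ereal_scope.

Definition line_translation (c : R) (x : Rm) : Rm := (x + c)%R.

Lemma measurable_line_translation c : measurable_fun setT (line_translation c).
Proof. by apply: measurable_funD => //; exact: measurable_cst. Qed.

HB.instance Definition _ c :=
  isMeasurableFun.Build _ _ _ _ (line_translation c) (measurable_line_translation c).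

Lemma lebesgue_translation (c : R) (A : set Rm) : measurable A ->
  lebesgue_measure [set x | A (x + c)%R] = lebesgue_measure A.
Proof.
move=> mA; apply/esym.
apply: (@lebesgue_measure_unique _ (pushforward (@lebesgue_measure R) (line_translation c))) => //.
move=> _ [[a b] _ <-] /=; rewrite /pushforward.
have -> : line_translation c @^-1` [set` `]a, b]] = [set` `](a - c)%R, (b - c)%R]].
  by apply/seteqP; split=> x /=; rewrite !in_itv /= /line_translation ltrBlDr lerBrDr.
rewrite !lebesgue_measure_itv /= !lte_fin ltrD2r; case: ifP => // _.
by rewrite !EFinN -!EFinD; congr (_%:E); ring.
Qed.

Lemma lebesgue_tuple_fst m (A : set (m.+1.-tuple Rm)) :
  leb m.+1 A = \int[lebesgue_measure]_x leb m [set y | A (tuple_cons (x, y))].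
Proof.
rewrite /= /lebesgue_step /pushforward /product_measure1; apply: eq_integral => x _ /=.
by congr (leb m _); apply/seteqP; split=> y; rewrite /xsection /= inE.
Qed.

(** Tonelli's theorem: the first coordinate may also be integrated innermost. *)
Lemma lebesgue_tuple_snd m (A : set (m.+1.-tuple Rm)) : measurable A ->
  leb m.+1 A = \int[leb m]_y lebesgue_measure [set x | A (tuple_cons (x, y))].
Proof.
move=> mA; have mB : measurable (@tuple_cons R m @^-1` A).
  by rewrite -[X in measurable X]setTI; exact: measurable_tuple_cons.
transitivity ((lebesgue_measure \x leb m) (@tuple_cons R m @^-1` A)) => //.
transitivity ((lebesgue_measure \x^ leb m) (@tuple_cons R m @^-1` A)).
  by apply: product_measure_unique => //= ? ? ? ?; rewrite product_measure2E.
rewrite /product_measure2; apply: eq_integral => y _ /=.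
by congr (lebesgue_measure _); apply/seteqP; split=> x; rewrite /ysection /= inE.
Qed.

Lemma measurable_tuple_slice m (A : set (m.+1.-tuple Rm)) x : measurable A ->
  measurable [set y : m.-tuple Rm | A (tuple_cons (x, y))].
Proof.
move=> mA; rewrite -[X in measurable X]setTI.
exact: (measurableT_comp (@measurable_tuple_cons R m)).
Qed.

Definition tuple_box m (c : m.-tuple Rm) (r : R) : set (m.-tuple Rm) :=
  [set t | forall i, (`|tnth t i - tnth c i| < r)%R].

Lemma measurable_tuple_box m (c : m.-tuple Rm) r : measurable (tuple_box c r).
Proof.
have -> : tuple_box c r =
    \bigcap_(i in [set: 'I_m]) ((@tnth m Rm)^~ i @^-1` [set` `](tnth c i - r)%R, (tnth c i + r)%R[]).
  by apply/seteqP; split=> t H i; have := H i; rewrite /= in_itv /= -ltr_distl => h //; exact: h.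
apply: fin_bigcap_measurable => // i _; rewrite -[X in measurable X]setTI.
by apply: measurable_tnth => //; exact: measurable_itv.
Qed.

Lemma tnth_tuple_cons0 m (x : Rm) (y : m.-tuple Rm) : tnth (tuple_cons (x, y)) ord0 = x.
Proof. by []. Qed.

Lemma tnth_tuple_consS m (x : Rm) (y : m.-tuple Rm) k :
  tnth (tuple_cons (x, y)) (lift ord0 k) = tnth y k.
Proof. exact: tnthS. Qed.

Lemma lebesgue_tuple_box m (c : m.-tuple Rm) (r : R) : (0 < r)%R ->
  leb m (tuple_box c r) = ((2 * r) ^+ m)%:E.
Proof.
move=> r0; elim: m c => [|m IH] c.
  rewrite expr0 /= diracE mem_set //; by move=> [].
rewrite lebesgue_tuple_fst.
have cE k : tnth c (lift ord0 k) = tnth [tuple of behead c] k by rewrite tnth_behead; congr tnth; apply/val_inj; rewrite /= inordK // ltnS.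
have E x : leb m [set y | tuple_box c r (tuple_cons (x, y))] =
    ((2 * r) ^+ m)%:E * (\1_[set` `](thead c - r)%R, (thead c + r)%R[] x)%:E.
  rewrite indicE; have [xB|xB] := boolP (x \in [set` `](thead c - r)%R, (thead c + r)%R[]).
    rewrite mule1 -(IH [tuple of behead c]); congr (leb m _); apply/seteqP; split=> y H i.
      by have := H (lift ord0 i); rewrite tnth_tuple_consS cE.
    have [k ->|->] := unliftP ord0 i; first by rewrite tnth_tuple_consS cE; exact: H.
    by move: xB; rewrite inE /= in_itv /= -ltr_distl.
  rewrite mule0 (_ : [set y | _] = set0) ?measure0 //; apply/seteqP; split=> y //= H.
  by move: xB; rewrite notin_setE /= in_itv /= -ltr_distl; apply; exact: (H ord0).
under eq_integral do rewrite E.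
rewrite ge0_integralZl //; first last.
- by rewrite lee_fin exprn_ge0 // mulr_ge0 // ltW.
- by apply/measurable_EFinP; exact: measurable_indic.
- rewrite [X in _ * X]integral_indic // setIT [X in _ * X]lebesgue_measure_itv /= lte_fin.
  rewrite ltrBlDr -addrA ltrDl addr_gt0 // -EFinD -EFinM exprS.
  by congr _%:E; ring.
Qed.

Definition tuple_shear m (i : 'I_m) (g : m.-tuple Rm -> Rm) (t : m.-tuple Rm) : m.-tuple Rm :=
  [tuple (tnth t j + (if j == i then g t else 0))%R | j < m].

Lemma measurable_tuple_shear m (i : 'I_m) g : measurable_fun setT g ->
  measurable_fun setT (tuple_shear i g).
Proof.
move=> mg; apply/measurable_fun_tnthP => j.
rewrite (_ : _ \o _ = fun t => (tnth t j + (if j == i then g t else 0))%R); last first.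
  by apply/funext => t /=; rewrite tnth_mktuple.
apply: measurable_funD; first exact: measurable_tnth.
by case: eqP => _ //; exact: measurable_cst.
Qed.

(** As g does not depend on coordinate i, every line in that direction is translated by a constant.
    The coordinates before i are peeled off one at a time, and at i the order of integration is
    exchanged. *)
Lemma lebesgue_tuple_shear m (i : 'I_m) g (B : set (m.-tuple Rm)) : measurable_fun setT g ->
  (forall t u : m.-tuple Rm, (forall j, j != i -> tnth t j = tnth u j) -> g t = g u) ->
  measurable B -> leb m (tuple_shear i g @^-1` B) = leb m B.
Proof.
elim: m i g B => [[]//|m IH] i g B mg ig mB.
have mS : measurable (tuple_shear i g @^-1` B).
  by rewrite -[X in measurable X]setTI; exact: measurable_tuple_shear.
move: ig mS; have [k ->|->] := unliftP ord0 i => ig mS.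
  rewrite !lebesgue_tuple_fst; apply: eq_integral => x _.
  pose h y := g (tuple_cons (x, y)).
  have shE y : tuple_shear (lift ord0 k) g (tuple_cons (x, y)) = tuple_cons (x, tuple_shear k h y).
    apply: eq_from_tnth => j; rewrite tnth_mktuple; have [l ->|->] := unliftP ord0 j.
      by rewrite !tnth_tuple_consS tnth_mktuple (inj_eq (@lift_inj _ _)).
    by rewrite !tnth_tuple_cons0 addr0.
  transitivity (leb m (tuple_shear k h @^-1` [set y | B (tuple_cons (x, y))])).
    by congr (leb m _); apply/seteqP; split=> y /=; rewrite shE.
  apply: IH; last exact: measurable_tuple_slice.
    apply: (measurableT_comp mg).
    exact: (measurableT_comp (@measurable_tuple_cons R m)).
  move=> t u tu; apply: ig => j; have [l ->|-> _] := unliftP ord0 j; last by [].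
  by rewrite (inj_eq (@lift_inj _ _)) !tnth_tuple_consS; exact: tu.
rewrite !lebesgue_tuple_snd //; apply: eq_integral => y _.
have shE x : tuple_shear ord0 g (tuple_cons (x, y)) =
    tuple_cons ((x + g (tuple_cons (0%R, y)))%R, y).
  apply: eq_from_tnth => j; rewrite tnth_mktuple; have [l ->|->] := unliftP ord0 j.
    by rewrite !tnth_tuple_consS addr0.
  rewrite !tnth_tuple_cons0 eqxx; congr (_ + _)%R; apply: ig => l.
  by have [p ->|->] := unliftP ord0 l; rewrite ?eqxx // !tnth_tuple_consS.
rewrite -[RHS](lebesgue_translation (g (tuple_cons (0%R, y)))).
  by congr (lebesgue_measure _); apply/seteqP; split=> x /=; rewrite shE.
rewrite -[X in measurable X]setTI.
exact: (measurableT_comp (@measurable_tuple_cons R m)).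
Qed.

Definition measure_preserving m (f : m.-tuple Rm -> m.-tuple Rm) :=
  measurable_fun setT f /\ forall B, measurable B -> leb m (f @^-1` B) = leb m B.

Lemma measure_preserving_comp m (f g : m.-tuple Rm -> m.-tuple Rm) :
  measure_preserving f -> measure_preserving g -> measure_preserving (f \o g).
Proof.
move=> [mf pf] [mg pg]; split; first exact: measurableT_comp.
move=> B mB; rewrite comp_preimage pg ?pf //.
by rewrite -[X in measurable X]setTI; exact: mf.
Qed.

Lemma measure_preserving_shear m (i j : 'I_m) (a : R) : j != i ->
  measure_preserving (tuple_shear i (fun t => (a * tnth t j)%R)).
Proof.
move=> ij; have mg : measurable_fun setT (fun t : m.-tuple Rm => (a * tnth t j)%R).
  by apply: measurable_funM; [exact: measurable_cst|exact: measurable_tnth].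
split; first exact: measurable_tuple_shear.
move=> B mB; apply: lebesgue_tuple_shear => // t u; move/(_ j ij); exact: (congr1 (fun x => (a * x)%R)).
Qed.

Variable n : nat.

Definition tuple_rot (c s : R) (k : nat) (t : (n + n).-tuple Rm) : (n + n).-tuple Rm :=
  [tuple match fintype.split i with
   | inl j => if (j < k)%N then (c * tnth t (lshift n j) - s * tnth t (rshift n j))%R else tnth t i
   | inr j => if (j < k)%N then (s * tnth t (lshift n j) + c * tnth t (rshift n j))%R else tnth t i
   end | i < n + n].

(* A plane rotation is a product of three shears. *)
Lemma measure_preserving_rot (c s : R) k : (c ^+ 2 + s ^+ 2 = 1)%R -> c != (- 1)%R -> (k <= n)%N ->
  measure_preserving (tuple_rot c s k).
Proof.
move=> cs1 c1; have c10 : (1 + c != 0)%R by rewrite addrC addr_eq0.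
elim: k => [|k IH] kn.
  have -> : tuple_rot c s 0 = id.
    apply/funext => t; apply: eq_from_tnth => i; rewrite tnth_mktuple.
    by case: (fintype.split i).
  by split.
(* For c = cos x and s = sin x this is - tan (x / 2), whence the exclusion of c = -1. *)
pose j0 := Ordinal kn; pose a := (- s / (1 + c))%R.
pose X := tuple_shear (lshift n j0) (fun t => (a * tnth t (rshift n j0))%R).
pose Y := tuple_shear (rshift n j0) (fun t => (s * tnth t (lshift n j0))%R).
have pX : measure_preserving X by apply: measure_preserving_shear; rewrite eq_rlshift.
have pY : measure_preserving Y by apply: measure_preserving_shear; rewrite eq_lrshift.
have -> : tuple_rot c s k.+1 = X \o (Y \o (X \o tuple_rot c s k)).
  apply/funext => t; apply: eq_from_tnth => i.
  have rl k' j : tnth (tuple_rot c s k' t) (lshift n j) = if (j < k')%N then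
      (c * tnth t (lshift n j) - s * tnth t (rshift n j))%R else tnth t (lshift n j).
    by rewrite tnth_mktuple -[lshift n j]/(unsplit (inl j)) unsplitK.
  have rr k' j : tnth (tuple_rot c s k' t) (rshift n j) = if (j < k')%N then
      (s * tnth t (lshift n j) + c * tnth t (rshift n j))%R else tnth t (rshift n j).
    by rewrite tnth_mktuple -[rshift n j]/(unsplit (inr j)) unsplitK.
  have jk (j : 'I_n) : (j < k.+1)%N = (j == j0) || (j < k)%N by rewrite ltnS leq_eqVlt.
  move: (rl k) (rr k) (rl k.+1) (rr k.+1) => {rl rr}; rewrite /comp.
  move: (tuple_rot c s k t) (tuple_rot c s k.+1 t) => u v ul ur vl vr.
  have s2 : (s ^+ 2 = (1 - c) * (1 + c))%R.
    by have -> : (s ^+ 2 = c ^+ 2 + s ^+ 2 - c ^+ 2)%R; [ring|rewrite cs1; ring].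
  have e1 : (1 + a * s = c)%R.
    have -> : (1 + a * s = 1 - s ^+ 2 / (1 + c))%R by rewrite /a; field.
    by rewrite s2 mulfK //; ring.
  have e2 : (a + a * c = - s)%R by rewrite /a; field.
  have uj0l : tnth u (lshift n j0) = tnth t (lshift n j0) by rewrite ul /= ltnn.
  have uj0r : tnth u (rshift n j0) = tnth t (rshift n j0) by rewrite ur /= ltnn.
  rewrite -(splitK i); case: (fintype.split i) => j; rewrite /X /Y !tnth_mktuple /= !eq_shift /= ?eqxx.
    rewrite vl jk; have [->|jj] /= := eqVneq j j0; last by rewrite !addr0 ul.
    rewrite uj0l uj0r; move: (tnth t _) (tnth t _) => x y.
    have alg (A B D p q : R) : (1 + A * B = D -> A + A * D = - B ->
        D * p - B * q = p + A * q + 0 + A * (q + 0 + B * (p + A * q)))%R.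
      by move=> <- h; rewrite -mulNr -h; ring.
    exact: alg.
  rewrite vr jk; have [->|jj] /= := eqVneq j j0; last by rewrite !addr0 ur.
  rewrite uj0l uj0r; move: (tnth t _) (tnth t _) => x y.
  have alg (A B D p q : R) : (1 + A * B = D -> B * p + D * q = q + 0 + B * (p + A * q) + 0)%R.
    by move=> <-; ring.
  exact: alg.
apply: measure_preserving_comp => //; apply: measure_preserving_comp => //.
by apply: measure_preserving_comp => //; apply: IH; exact: ltnW.
Qed.

End TupleMeasure.

Section SurfaceIntegral.
Variables (R : realType) (n : nat).
Local Notation C := (Cx R).
Local Notation Cn := 'rV[Cx R]_n.
Local Notation S := (@unit_sphere R n).
Local Notation Rm := (measurableTypeR R).
Local Notation mu := (surface_measure R n).
Implicit Types (z w : Cn) (t : (n + n).-tuple Rm).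

Lemma tnth_real_coords z m : tnth (real_coords z) m = real_coord m z.
Proof. by rewrite tnth_mktuple. Qed.

Lemma real_coord_of_real_coords t m : real_coord m (of_real_coords t) = tnth t m.
Proof.
rewrite -[m in RHS]splitK /real_coord; case: (fintype.split m) => j; by rewrite mxE.
Qed.

Lemma real_coordsK : cancel (@real_coords R n) (@of_real_coords R n).
Proof.
move=> z; rewrite -[LHS]real_basis_expand -[RHS]real_basis_expand; apply: eq_bigr => m _.
by rewrite real_coord_of_real_coords tnth_real_coords.
Qed.

Lemma measurable_real_coords : measurable_fun setT (@real_coords R n : CnBorel R n -> (n + n).-tuple Rm).
Proof. by move=> _ B mB; exists B. Qed.

Lemma measurable_sphere : measurable (S : set (CnBorel R n)).
Proof.
have -> : S = @real_coords R n @^-1` (@tuple_norm R n @^-1` [set 1]).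
  by apply/seteqP; split=> z; rewrite /= /tuple_norm real_coordsK.
rewrite -[X in measurable X]setTI; apply: measurable_real_coords => //.
rewrite -[X in measurable X]setTI; exact: measurable_tuple_norm.
Qed.

Lemma enorm_le_coords z : enorm z <= \sum_m `|real_coord m z|.
Proof.
apply: (le_trans (enorm_le_sum _)); rewrite big_split_ord /= -big_split /=.
apply: ler_sum => j _; apply: (le_trans (cabs_le_ReIm _)).
rewrite /real_coord -[lshift n j]/(unsplit (inl j)) -[rshift n j]/(unsplit (inr j)).
by rewrite !unsplitK.
Qed.

Let qbox (q : (n + n).-tuple rat * nat) : set (CnBorel R n) :=
  @real_coords R n @^-1` (tuple_box [tuple of map (fun x : rat => ratr x : Rm) q.1] q.2.+1%:R^-1).

Let measurable_qbox q : measurable (qbox q).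
Proof.
rewrite -[X in measurable X]setTI; apply: measurable_real_coords => //.
exact: measurable_tuple_box.
Qed.

(** The sigma-algebra comes from the coordinates, continuity from the topology; rational boxes
    connect the two. Each point of a superlevel set lies in such a box on which the inequality
    persists within the sphere, and [unpickle] enumerates the boxes. *)
Lemma measurable_scont (u : Cn -> R) : scont u ->
  measurable_fun (S : set (CnBorel R n)) (fun z : CnBorel R n => u z : Rm).
Proof.
move=> cu; apply: (measurability _ (RGenOInfty.measurableE R)) => _ [_ [a ->] <-].
pose good q := `[< forall w, S w -> qbox q w -> a < u w >].
pose G i : set (CnBorel R n) := if @unpickle ((n + n).-tuple rat * nat)%type i is Some q then
  (if good q then qbox q else set0) else set0.
have -> : S `&` (fun z => u z) @^-1` `]a, +oo[ = S `&` \bigcup_i G i.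
  apply/seteqP; split=> z [Sz Hz]; split => //; last first.
    have [i _] := Hz; rewrite /G; case: unpickle => // q; case: ifP => // /asboolP gq qz.
    by rewrite /= in_itv /= andbT; exact: gq.
  move: Hz; rewrite /= in_itv /= andbT => uz.
  have H : \forall w \near within S (nbhs z), a < u w.
    have e0 : 0 < u z - a by rewrite subr_gt0.
    have /cvgrPdist_lt/(_ _ e0) := cu z Sz; apply: filterS => w.
    by rewrite ltr_norml => /andP[_]; lra.
  have [d d0 Hd] := nbhs_enorm H.
  have [k Hk] : exists k : nat, (n + n)%:R * 2 * k.+1%:R^-1 < d.
    have N0 : 0 < 2 * ((n + n)%:R * 2 + 1) :> R by rewrite mulr_gt0 // ltr_wpDl // mulr_ge0.
    have [k Hk] := inv_small (divr_gt0 d0 N0); exists k.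
    have {}Hk := Hk k (leqnn k); apply: (@le_lt_trans _ _ ((n + n)%:R * 2 * (d / (2 * ((n + n)%:R * 2 + 1))))).
      by apply: ler_wpM2l; rewrite // mulr_ge0.
    have N1 : 0 <= (n + n)%:R * 2 :> R by rewrite mulr_ge0.
    by rewrite mulrA ltr_pdivrMr //; move: N1 d0; move: ((n + n)%:R * 2) => N; clear; nra.
  have exq m : exists x : rat, `|real_coord m z - ratr x| < k.+1%:R^-1.
    have h : real_coord m z - k.+1%:R^-1 < real_coord m z + k.+1%:R^-1.
      have : 0 < k.+1%:R^-1 :> R by rewrite invr_gt0 ltr0n.
      by move=> h; rewrite ltrD2l (lt_trans _ h) // oppr_lt0.
    have [x] := rat_in_itvoo h; rewrite in_itv /= -ltr_distlC => hx; by exists x.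
  have [Q HQ] := boolp.choice exq.
  pose q := ([tuple Q m | m < n + n], k).
  have zq : qbox q z.
    by move=> m; rewrite tnth_real_coords tnth_map tnth_mktuple; exact: HQ.
  exists (pickle q) => //; rewrite /G pickleK ifT //; apply/asboolP => w Sw wq.
  apply: Hd => //; apply: le_lt_trans Hk; apply: (le_trans (enorm_le_coords _)).
  rewrite -mulrA mulr_natl -[X in _ *+ X]card_ord -sumr_const; apply: ler_sum => m _.
  have -> : real_coord m (w - z) = real_coord m w - real_coord m z.
    by rewrite real_coordD -scaleN1r -creal1 -crealN real_coordZ mulN1r.
  have := wq m; have := zq m; rewrite !tnth_real_coords.
  move: (tnth _ m) => x; rewrite ![q.2]/=; move: (k.+1%:R^-1) => y.
  by rewrite /= !ltr_norml ler_norml => /andP[h1 h2] /andP[h3 h4]; apply/andP; split; lra.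
apply: measurableI; first exact: measurable_sphere.
apply: bigcupT_measurable => i; rewrite /G; case: unpickle => // q.
by case: ifP.
Qed.

Lemma surface_measureE (A : set (CnBorel R n)) :
  mu A = ((n + n)%:R%:E * lebesgue_tuple R (n + n) (@tuple_proj R n @^-1` A `&` @punctured_ball R n))%E.
Proof. by []. Qed.

Lemma surface_measure_fin : (mu S < +oo)%E.
Proof.
rewrite surface_measureE; apply: lte_mul_pinfty => //.
apply: (@le_lt_trans _ _ (lebesgue_tuple R (n + n) (tuple_box [tuple 0 | _ < n + n] 1))).
  have mS : measurable (@tuple_proj R n @^-1` S).
    rewrite -[X in measurable X]setTI; apply: measurable_tuple_proj => //.
    exact: measurable_sphere.
  apply: le_measure; rewrite ?inE; first exact: measurableI mS (@measurable_punctured_ball R n).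
    exact: measurable_tuple_box.
  move=> t [_ /andP[_ t1]] m; rewrite tnth_mktuple subr0 -real_coord_of_real_coords.
  exact: le_lt_trans (real_coord_le _ _) t1.
by rewrite lebesgue_tuple_box // ltry.
Qed.

Lemma scont_integrable (u : Cn -> R) : scont u ->
  mu.-integrable (S : set (CnBorel R n)) (EFin \o (fun z : CnBorel R n => u z)).
Proof.
move=> cu; apply: measurable_bounded_integrable.
- exact: measurable_sphere.
- exact: surface_measure_fin.
- exact: measurable_scont.
- have [B B0 HB] := scont_bounded cu; exists B; split; first exact: num_real.
  by move=> x xB z Sz; apply: (le_trans (HB z Sz)); exact: ltW.
Qed.

Definition sphere_integral (u : Cn -> R) : R :=
  Rintegral mu (S : set (CnBorel R n)) (fun z : CnBorel R n => u z).

Definition sphere_rotation (l : C) (z : CnBorel R n) : CnBorel R n := l *: (z : Cn).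

Lemma measurable_real_coord m :
  measurable_fun setT (fun z : CnBorel R n => real_coord m z : Rm).
Proof.
rewrite (_ : (fun _ => _) = (@tnth _ Rm)^~ m \o @real_coords R n); last first.
  by apply/funext => z; rewrite /= tnth_real_coords.
apply: measurableT_comp; [exact: measurable_tnth|exact: measurable_real_coords].
Qed.

Lemma measurable_sphere_rotation l : measurable_fun setT (sphere_rotation l).
Proof.
have mRe j : measurable_fun setT (fun z : CnBorel R n => complex.Re ((z : Cn) ord0 j) : Rm).
  have := measurable_real_coord (lshift n j).
  by rewrite /real_coord -[lshift n j]/(unsplit (inl j)) unsplitK.
have mIm j : measurable_fun setT (fun z : CnBorel R n => complex.Im ((z : Cn) ord0 j) : Rm).
  have := measurable_real_coord (rshift n j).
  by rewrite /real_coord -[rshift n j]/(unsplit (inr j)) unsplitK.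
apply: measurable_of_real_coordsP => j.
  rewrite (_ : (fun _ => _) = fun z : CnBorel R n =>
    complex.Re l * complex.Re ((z : Cn) ord0 j) - complex.Im l * complex.Im ((z : Cn) ord0 j)); last first.
    by apply/funext => z; rewrite mxE cReM.
  apply: measurable_funB.
    by apply: measurable_funM; [exact: measurable_cst|exact: mRe].
  by apply: measurable_funM; [exact: measurable_cst|exact: mIm].
rewrite (_ : (fun _ => _) = fun z : CnBorel R n =>
  complex.Re l * complex.Im ((z : Cn) ord0 j) + complex.Im l * complex.Re ((z : Cn) ord0 j)); last first.
  by apply/funext => z; rewrite mxE cImM.
apply: measurable_funD.
  by apply: measurable_funM; [exact: measurable_cst|exact: mIm].
by apply: measurable_funM; [exact: measurable_cst|exact: mRe].
Qed.

Lemma surface_measure_rot (l : C) (A : set (CnBorel R n)) : cabs l = 1 -> l != -1 ->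
  measurable A -> mu (sphere_rotation l @^-1` A) = mu A.
Proof.
move=> l1 lN mA; set c := complex.Re l; set s := complex.Im l.
have cs : c ^+ 2 + s ^+ 2 = 1.
  by have := congr1 (fun x => x ^+ 2) l1; rewrite /cabs sqr_sqrtr ?addr_ge0 ?sqr_ge0 // expr1n.
have cN : c != -1.
  apply: contraNneq lN => cE; apply/eqP; apply: Cx_eqP => /=; first by rewrite -/c cE.
  rewrite -/s oppr0; apply/eqP; rewrite -sqrf_eq0; apply/eqP; move: cs; rewrite cE; lra.
have [mr pr] := measure_preserving_rot cs cN (leqnn n).
have rE t : of_real_coords (tuple_rot c s n t) = l *: of_real_coords t.
  apply/rowP => j; rewrite !mxE; apply: Cx_eqP.
    rewrite cReM /= tnth_mktuple -[lshift n j]/(unsplit (inl j)) unsplitK ltn_ord.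
    by [].
  rewrite cImM /= tnth_mktuple -[rshift n j]/(unsplit (inr j)) unsplitK ltn_ord.
  by rewrite addrC.
rewrite !surface_measureE; congr (_ * _)%E; rewrite -[RHS]pr; last first.
  apply: measurableI; last exact: measurable_punctured_ball.
  by rewrite -[X in measurable X]setTI; exact: measurable_tuple_proj.
have nE t : tuple_norm (tuple_rot c s n t) = tuple_norm t.
  by rewrite /tuple_norm rE enormZ l1 mul1r.
have pE t : tuple_proj (tuple_rot c s n t) = sphere_rotation l (tuple_proj t).
  rewrite /tuple_proj /sphere_rotation /sphere_proj rE enormZ l1 mul1r !scalerA.
  by rewrite mulrC.
congr (lebesgue_tuple R (n + n) _); apply/seteqP.
by split=> t; rewrite /= /punctured_ball /= nE pE.
Qed.

Lemma sphere_integral_rot_neq (l : C) (u : Cn -> R) : cabs l = 1 -> l != -1 -> scont u ->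
  sphere_integral (fun z => u (l *: z)) = sphere_integral u.
Proof.
move=> l1 lN cu; pose f := (EFin \o (fun z : CnBorel R n => u z)) \_ (S : set (CnBorel R n)).
have mf : measurable_fun setT f.
  apply/(measurable_restrictT _ measurable_sphere).
  by apply/measurable_EFinP; exact: measurable_scont.
have preS : sphere_rotation l @^-1` (S : set (CnBorel R n)) = S.
  apply/seteqP; split=> z; rewrite /= /unit_sphere /= enormZ l1 mul1r //.
have fE z : S z -> f z = (u z)%:E by move=> Sz; rewrite /f patchE mem_set.
have fi : mu.-integrable (sphere_rotation l @^-1` (S : set (CnBorel R n))) (f \o sphere_rotation l).
  rewrite preS; apply: eq_integrable (scont_integrable (scont_rot l1 cu)).
    exact: measurable_sphere.
  by move=> z; rewrite inE => Sz /=; rewrite fE //; exact: sphereZ.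
rewrite /sphere_integral /Rintegral; congr fine.
transitivity (\int[pushforward mu (sphere_rotation l)]_(z in (S : set (CnBorel R n))) f z)%E.
  rewrite (integral_pushforward (measurable_sphere_rotation l) mf fi measurable_sphere) preS.
  by apply: eq_integral => z; rewrite inE => Sz /=; rewrite fE //; exact: sphereZ.
transitivity (\int[mu]_(z in (S : set (CnBorel R n))) f z)%E.
  apply: eq_measure_integral => [|mphi A mA _]; first exact: measurable_sphere_rotation.
  exact: (surface_measure_rot l1 lN mA).
by apply: eq_integral => z; rewrite inE => Sz; exact: fE.
Qed.

Lemma sphere_integral_rot (l : C) (u : Cn -> R) : cabs l = 1 -> scont u ->
  sphere_integral (fun z => u (l *: z)) = sphere_integral u.
Proof.
(* The decomposition into shears leaves out l = -1, which is the square of i. *)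
move=> l1 cu; have [->|lN] := eqVneq l (-1); last exact: sphere_integral_rot_neq.
have i1 : cabs ('i : C) = 1 by apply: cabsE; rewrite normCi creal1.
have iN : ('i : C) != -1.
  apply/eqP => /(congr1 (fun x => x ^+ 2)); rewrite sqrCi sqrrN expr1n => /eqP.
  by rewrite eq_sym -subr_eq0 opprK -mulr2n pnatr_eq0.
rewrite -(sphere_integral_rot_neq i1 iN cu).
rewrite -(sphere_integral_rot_neq i1 iN (scont_rot i1 cu)).
by congr sphere_integral; apply/funext => z; rewrite scalerA -expr2 sqrCi.
Qed.

End SurfaceIntegral.

(** * The surface integral as a faithful functional *)

Section SphereFunctional.
Variables (R : realType) (n : nat).
Local Notation C := (Cx R).
Local Notation Cn := 'rV[Cx R]_n.
Local Notation S := (@unit_sphere R n).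
Local Notation Rm := (measurableTypeR R).
Local Notation mu := (surface_measure R n).
Local Notation SB := (@unit_sphere R n : set (CnBorel R n)).
Local Notation I := (@sphere_integral R n).
Implicit Types (z w : Cn) (t : (n + n).-tuple Rm).

Definition superlevel (u : Cn -> R) (a : R) : set (CnBorel R n) :=
  SB `&` [set z : CnBorel R n | a < u z].

Lemma measurable_superlevel (u : Cn -> R) (a : R) : scont u ->
  measurable (superlevel u a).
Proof.
move=> cu; rewrite /superlevel; have -> : [set z : CnBorel R n | a < u z] = (fun z : CnBorel R n => u z : Rm) @^-1` `]a, +oo[.
  by apply/seteqP; split=> z; rewrite /= in_itv /= andbT.
by apply: measurable_scont => //; exact: measurable_sphere.
Qed.

(** The cone over the superlevel set contains a box around z0 / 2, and boxes have positive Lebesgue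
    measure. *)
Lemma superlevel_measure_gt0 (u : Cn -> R) (a : R) z0 : scont u -> S z0 -> a < u z0 ->
  (0 < mu (superlevel u a))%E.
Proof.
move=> cu Sz0 az; set A := superlevel u a.
have H : \forall w \near within S (nbhs z0), a < u w.
  have e0 : 0 < u z0 - a by rewrite subr_gt0.
  have /cvgrPdist_lt/(_ _ e0) := cu z0 Sz0; apply: filterS => w.
  by rewrite ltr_norml => /andP[_]; lra.
have [d d0 Hd] := nbhs_enorm (near_sphere_proj Sz0 H).
have N0 : 0 <= (n + n)%:R :> R by [].
have N1 : 0 < 2 * ((n + n)%:R + 1) :> R by rewrite mulr_gt0 // ltr_wpDl.
have n0 : (0 < n + n)%N.
  rewrite addnn double_gt0 lt0n; apply/eqP => nE; move: Sz0; rewrite /unit_sphere /= /enorm.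
  rewrite big1 ?sqrtr0 => [/eqP|j _]; first by rewrite eq_sym oner_eq0.
  by exfalso; move: (ltn_ord j); rewrite [X in (_ < X)%N]nE.
pose d' := Num.min d (1 / 2); have d'0 : 0 < d' by rewrite lt_min d0 /= divr_gt0.
pose r := d' / (2 * ((n + n)%:R + 1)); have r0 : 0 < r by exact: divr_gt0.
have rd : (n + n)%:R * r < d' / 2.
  rewrite /r mulrCA ltr_pdivlMr // -[X in _ < X]mulr1 -!mulrA ltr_pM2l //.
  have -> : (n + n)%:R * ((2 * ((n + n)%:R + 1))^-1 * 2) = (n + n)%:R / ((n + n)%:R + 1) :> R.
    by field; rewrite gt_eqF // ltr_wpDl.
  by rewrite ltr_pdivrMr ?ltr_wpDl // mul1r ltrDl.
pose zh := creal 2^-1 *: z0.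
have sub : tuple_box (real_coords zh) r `<=` @tuple_proj R n @^-1` A `&` @punctured_ball R n.
  move=> t Ht; set w := of_real_coords t.
  have wd : enorm (w - zh) < d' / 2.
    apply: le_lt_trans rd; apply: (le_trans (enorm_le_coords _)).
    rewrite mulr_natl -[X in _ *+ X]card_ord -sumr_const; apply: ler_sum => m _.
    have -> : real_coord m (w - zh) = tnth t m - tnth (real_coords zh) m.
      rewrite real_coordD -scaleN1r -creal1 -crealN real_coordZ mulN1r.
      by rewrite tnth_real_coords real_coord_of_real_coords.
    exact: ltW (Ht m).
  have zE : creal 2 *: zh = z0 by rewrite scalerA -crealM divff // creal1 scale1r.
  have w2 : enorm (creal 2 *: w - z0) < d.
    rewrite -zE -scalerBr enormZ cabs_creal ger0_norm //.
    have h : d' <= d by rewrite ge_min lexx.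
    by move: wd h; lra.
  have [w0 uw] := Hd _ w2; have wN0 : w != 0.
    by apply: contraNneq w0 => ->; rewrite scaler0.
  have two0 : 0 < 2 :> R by [].
  rewrite (sphere_proj_scale _ two0) in uw.
  split; first by split => //; exact: sphere_proj_in.
  rewrite /punctured_ball /= /tuple_norm -/w lt_neqAle eq_sym enorm_eq0 wN0 enorm_ge0 /=.
  have -> : w = zh + (w - zh) by rewrite addrC subrK.
  apply: (le_lt_trans (enormD _ _)).
  have -> : enorm zh = 2^-1.
    by rewrite enormZ cabs_creal (Sz0 : enorm z0 = 1) mulr1 ger0_norm // invr_ge0.
  have h : d' <= 1 / 2 by rewrite ge_min lexx orbT.
  by move: wd h; lra.
rewrite surface_measureE mule_gt0 //; first by rewrite lte_fin ltr0n.
apply: (@lt_le_trans _ _ (lebesgue_tuple R (n + n) (tuple_box (real_coords zh) r))).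
  by rewrite lebesgue_tuple_box // lte_fin exprn_gt0 // mulr_gt0.
apply: le_measure; rewrite ?inE //; first exact: measurable_tuple_box.
apply: measurableI; last exact: measurable_punctured_ball.
rewrite -[X in measurable X]setTI; apply: measurable_tuple_proj => //.
exact: measurable_superlevel.
Qed.

(** A continuous function that violates the bound at one point violates it on a set of positive
    measure. *)
Lemma ae_scont_le (u : Cn -> R) (a : R) : scont u ->
  {ae mu, forall z : CnBorel R n, SB z -> u z <= a} -> forall z, S z -> u z <= a.
Proof.
move=> cu [N [mN N0 HN]] z Sz; rewrite leNgt; apply/negP => az.
have := superlevel_measure_gt0 cu Sz az; rewrite ltNge => /negP; apply.
rewrite -N0; apply: le_measure; rewrite ?inE //; first exact: measurable_superlevel.
move=> w [Sw /= aw]; apply: HN => /= /(_ Sw); by rewrite leNgt aw.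
Qed.

Lemma sphere_integral_faithful (u : Cn -> R) : scont u -> (forall z, S z -> 0 <= u z) ->
  I u <= 0 -> forall z, S z -> u z = 0.
Proof.
move=> cu u0 Iu z Sz; apply/eqP; rewrite eq_le u0 // andbT leNgt; apply/negP => uz.
have h2 : u z / 2 < u z by lra.
have hp : 0 < u z / 2 by rewrite divr_gt0.
have mS := @measurable_sphere R n.
set A := superlevel u (u z / 2).
have mA : measurable A by exact: measurable_superlevel.
have Apos : (0 < mu A)%E by exact: (superlevel_measure_gt0 cu Sz h2).
have mu' : measurable_fun SB (EFin \o (fun w : CnBorel R n => u w)).
  by apply/measurable_EFinP; exact: measurable_scont.
have : (0 < \int[mu]_(w in SB) (u w)%:E)%E.
  apply: (@lt_le_trans _ _ (\int[mu]_(w in A) (u w)%:E)%E); last first.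
    have p0 w : SB w -> (0 <= (EFin \o (fun w : CnBorel R n => u w)) w)%E.
      by move=> Sw; rewrite /= lee_fin u0.
    have sub : A `<=` SB by move=> w [].
    exact: (ge0_subset_integral mu mA mS mu' p0 sub).
  apply: (@lt_le_trans _ _ (\int[mu]_(w in A) (cst (u z / 2)%:E w))%E).
    by rewrite integral_cst // mule_gt0 // lte_fin.
  apply: ge0_le_integral => //.
  - by move=> w _; rewrite lee_fin ltW.
  - by apply: (measurable_funS mS _ mu') => w [].
  - by move=> w [_ /= h]; rewrite lee_fin ltW.
- have fi : (\int[mu]_(w in SB) (u w)%:E)%E \is a fin_num.
    exact: (integrable_fin_num mS (scont_integrable cu)).
  by rewrite -(fineK fi) lte_fin ltNge Iu.
Qed.

Lemma sphere_integral_functional : rot_functional I.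
Proof.
have mS := @measurable_sphere R n; split.
- by move=> u v cu cv; apply: RintegralD => //; exact: scont_integrable.
- by move=> c u cu; apply: RintegralZl => //; exact: scont_integrable.
- by move=> u v cu cv uv; apply: le_Rintegral => //; exact: scont_integrable.
- by move=> u l cu l1; exact: sphere_integral_rot.
- exact: sphere_integral_faithful.
Qed.

Lemma sphere_integral_dominated (v : nat -> Cn -> R) : (forall i, scont (v i)) ->
  (forall i z, S z -> 0 <= v i z <= 1) ->
  {ae mu, forall z : CnBorel R n, SB z -> v i z @[i --> \oo] --> (0 : R)} ->
  I (v i) @[i --> \oo] --> (0 : R).
Proof.
move=> cv v01 lim.
have mS := @measurable_sphere R n.
have ione : mu.-integrable SB (cst 1%:E).
  exact: (scont_integrable (@scont_cst _ _ _ (1 : R))).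
have lim' : {ae mu, forall z : CnBorel R n, SB z -> (v i z)%:E @[i --> \oo] --> (0%:E : \bar R)}.
  apply: filterS lim => z h Sz; apply/fine_cvgP; split; first exact: nearW.
  exact: h.
have h := dominated_convergence mS
  (fun i => (measurable_EFinP _ _).2 (measurable_scont (cv i))) (measurable_cst _) lim' ione.
have [|_ _] := h.
  apply: nearW => z i Sz; rewrite /= lee_fin ger0_norm.
    by case/andP: (v01 i z Sz).
  by case/andP: (v01 i z Sz).
rewrite integral0 => /fine_cvgP[_]; exact.
Qed.

Lemma hardy1_mass (f : Cn -> C) : hardy1 f ->
  exists N : R, forall r, 0 < r < 1 -> I (fun z => cabs (f (creal r *: z))) <= N.
Proof.
move=> [hf hs]; set s := ereal_sup _ in hs.
exists (fine s) => r r01.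
have ru : 0 <= r < 1 by case/andP: r01 => /ltW -> ->.
have mS := @measurable_sphere R n.
have rs : (sphere_mean f r <= s)%E.
  by apply: ereal_sup_ubound; exists r => //=; rewrite in_itv.
have fi : sphere_mean f r \is a fin_num.
  apply: (integrable_fin_num mS); apply: scont_integrable; apply: scont_cabs.
  exact: ball_scont.
apply: fine_le => //; rewrite fin_real // hs andbT.
by apply: lt_le_trans rs; rewrite ltNye; case/fin_numP: fi => ->.
Qed.

End SphereFunctional.

(** * The boundary function as a sum of blocks *)

Section BlockSeries.
Variables (R : realType) (n : nat).
Local Notation C := (Cx R).
Local Notation Cn := 'rV[Cx R]_n.
Local Notation S := (@unit_sphere R n).
Variables (f : Cn -> C) (I : (Cn -> R) -> R).
Hypotheses (fh : holomorphic_on_ball f) (HI : rot_functional I).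
Local Notation F := (homogeneous_part f).

(** Index 0 is the low-pass part and index i + 1 the block at scale 2^i, so that partial sums over j
    telescope to low-pass multipliers. *)
Definition dyadic_mult j k : C :=
  if j is i.+1 then creal (block_mult R (2 ^ i) k) else creal (low_mult R 1 k).

Definition dyadic_block j : Cn -> {poly C} := slice_poly (fun k z => dyadic_mult j k * F k z) (2 * 2 ^ j).

Lemma dyadic_mult0 j k : (2 * 2 ^ j <= k)%N -> dyadic_mult j k = 0.
Proof.
case: j => [|j] h /=; first by rewrite low_mult0.
rewrite block_mult0 //; apply: leq_trans h; rewrite expnS mulnA; lia.
Qed.

Lemma dyadic_mult_sum m k : \sum_(j < m.+1) dyadic_mult j k = creal (low_mult R (2 ^ m) k).
Proof.
elim: m => [|m IH]; first by rewrite big_ord1.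
by rewrite big_ord_recr IH /= -crealD expnS low_multS // expn_gt0.
Qed.

Lemma dyadic_block_sum m z (x : C) : \sum_(j < m.+1) (dyadic_block j z).[x] =
  \sum_(k < 2 * 2 ^ m) creal (low_mult R (2 ^ m) k) * F k z * x ^+ k.
Proof.
under eq_bigr => j _.
  rewrite slice_polyE.
  have -> : \sum_(k < 2 * 2 ^ j) dyadic_mult j k * F k z * x ^+ k =
      \sum_(k < 2 * 2 ^ m) dyadic_mult j k * F k z * x ^+ k.
    have jm : (2 * 2 ^ j <= 2 * 2 ^ m)%N by rewrite leq_mul2l /= leq_exp2l // -ltnS.
    rewrite (big_ord_widen _ (fun k => dyadic_mult j k * F k z * x ^+ k) jm) big_mkcond.
    apply: eq_bigr => k _; case: ltnP => // /dyadic_mult0 ->; by rewrite !mul0r.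
  over.
rewrite exchange_big; apply: eq_bigr => k _.
by rewrite -!mulr_suml dyadic_mult_sum.
Qed.

Lemma dyadic_block_cvg (r : R) z : 0 <= r < 1 -> S z ->
  \sum_(j < m) (dyadic_block j z).[creal r] @[m --> \oo] --> f (creal r *: z).
Proof.
move=> r01 Sz; have r0 : 0 <= r by case/andP: r01.
have [B [t [B0 t01 HB]]] := slice_growth_tail (homogeneous_growth fh) r01.
apply/cvg_cabsP => e e0; have e2 : 0 < e / 2 by rewrite divr_gt0.
have e3 : 0 < e / 3 by rewrite divr_gt0.
have [m0 Hm0] := homogeneous_limit fh r01 e3.
have e4 : 0 < e / (3 * (B + 1)) by rewrite divr_gt0 // mulr_gt0 // ltr_wpDl.
have [T HT] := exp_small t01 e4.
exists (m0 + T).+1 => // -[//|m] /=; rewrite ltnS => hm; rewrite dyadic_block_sum cabsBC.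
have m2 : (m < 2 ^ m)%N by exact: ltn_expl.
have h0 := Hm0 (2 * 2 ^ m)%N z _ Sz.
have {}h0 := h0 (leq_trans (leq_trans (leq_addr _ _) hm) (leq_trans (ltnW m2) (leq_pmull _ (isT : (0 < 2)%N)))).
apply: (le_lt_trans (cabs_triangle (slice_poly F (2 * 2 ^ m) z).[creal r] _ _)).
have h1 : cabs ((slice_poly F (2 * 2 ^ m) z).[creal r] -
    \sum_(k < 2 * 2 ^ m) creal (low_mult R (2 ^ m) k) * F k z * creal r ^+ k) <= e / 3.
  rewrite slice_polyE -sumrB; apply: (le_trans (cabs_sum _ _ _)).
  apply: (@le_trans _ _ (B * t ^+ (2 ^ m))); last first.
    have tm : t ^+ (2 ^ m) <= t ^+ T.
      case/andP: t01 => t0 t1; apply: ler_wiXn2l; rewrite // ?ltW //.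
      exact: leq_trans (leq_trans (leq_addl _ _) hm) (ltnW m2).
    apply: (@le_trans _ _ (B * (e / (3 * (B + 1))))).
      by apply: ler_wpM2l => //; exact: le_trans tm HT.
    rewrite mulrA ler_pdivrMr ?mulr_gt0 ?ltr_wpDl //.
    have -> : e / 3 * (3 * (B + 1)) = B * e + e by field.
    by rewrite lerDl ltW.
  apply: le_trans (HB (2 ^ m)%N (2 * 2 ^ m)%N z Sz).
  rewrite -(big_mkord xpredT (fun i => cabs (F i z * creal r ^+ i -
    creal (low_mult R (2 ^ m) i) * F i z * creal r ^+ i))).
  have alg (x : C) (l : R) i : 0 <= l <= 1 ->
      cabs (x * creal r ^+ i - creal l * x * creal r ^+ i) = (1 - l) * (cabs x * r ^+ i).
    move=> l01; have -> : x * creal r ^+ i - creal l * x * creal r ^+ i = creal (1 - l) * (x * creal r ^+ i).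
      by rewrite crealB creal1; ring.
    rewrite !cabsM -crealX !cabs_creal ger0_norm ?subr_ge0; last by case/andP: l01.
    by rewrite ger0_norm // exprn_ge0.
  have term i : cabs (F i z * creal r ^+ i - creal (low_mult R (2 ^ m) i) * F i z * creal r ^+ i) =
      (1 - low_mult R (2 ^ m) i) * (cabs (F i z) * r ^+ i).
    by apply: alg; exact: low_mult_bound.
  rewrite (big_cat_nat (leq0n (2 ^ m)) (leq_pmull _ (isT : (0 < 2)%N))) /=.
  rewrite big_nat big1 ?add0r => [|i /andP[_ im]]; last first.
    by rewrite term low_mult1 ?expn_gt0 ?(ltnW im) // subrr mul0r.
  apply: ler_sum => i _; rewrite term; apply: ler_piMl; first by rewrite mulr_ge0 ?cabs_ge0 ?exprn_ge0.
  by have /andP[h _] := low_mult_bound R (2 ^ m) i; rewrite gerBl.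
by move: h0 h1 e0; clear; lra.
Qed.

Hypothesis n0 : (0 < n)%N.
Variables (a A : R).
Hypotheses (a01 : 0 < a < 1) (A0 : 0 <= A).
Hypothesis block_le : forall j z, S z -> cabs (dyadic_block j z).[1] <= A * a ^+ j.

Lemma dyadic_block_le j (r : R) z : 0 <= r <= 1 -> S z ->
  cabs (dyadic_block j z).[creal r] <= A * a ^+ j.
Proof.
move=> /andP[r0]; rewrite le_eqVlt => /orP[/eqP ->|r1] Sz; first by rewrite creal1; exact: block_le.
have HF := homogeneous_mult (dyadic_mult j) (homogeneous_part_seq fh).
have r01 : 0 <= r < 1 by rewrite r0.
have [_ H] := slice_poly_damp HI (2 * 2 ^ j) HF r01.
by apply: H => // w Sw; rewrite creal1; exact: block_le.
Qed.

(** The bounds on the blocks persist at all smaller radii, so the tails are uniform in r and the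
    radial limit is taken term by term. In particular it exists at every point of the sphere. *)
Lemma boundary_value_blocks z : S z ->
  \sum_(j < m) (dyadic_block j z).[1] @[m --> \oo] --> boundary_value f z.
Proof.
move=> Sz; have a01' : 0 <= a < 1 by case/andP: a01 => /ltW -> ->.
have P1 j : cabs (dyadic_block j z).[1] <= A * a ^+ j by exact: block_le.
have c1 := geometric_series_cvg a01' P1.
set L := lim (_ @ \oo) in c1.
suff -> : boundary_value f z = L by [].
have fin m : \sum_(j < m) (dyadic_block j z).[creal r] @[r --> (1 : R)^'-] -->
    \sum_(j < m) (dyadic_block j z).[1].
  have cr : creal r @[r --> (1 : R)^'-] --> (1 : C).
    rewrite -[X in _ --> X]creal1; apply: (@cvg_creal _ _ ((1 : R)^'-)).
    by apply: cvg_at_left_filter; exact: cvg_id.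
  have term j : (dyadic_block j z).[creal r] @[r --> (1 : R)^'-] --> (dyadic_block j z).[1].
    rewrite /dyadic_block slice_polyE.
    have -> : (fun r : R => (slice_poly (fun k z => dyadic_mult j k * F k z) (2 * 2 ^ j) z).[creal r]) =
       (fun r : R => \sum_(k < 2 * 2 ^ j) dyadic_mult j k * F k z * creal r ^+ k).
      by apply/funext => r; rewrite slice_polyE.
    have h k : (k < 2 * 2 ^ j)%N -> dyadic_mult j k * F k z * creal r ^+ k @[r --> (1 : R)^'-] -->
        dyadic_mult j k * F k z * 1 ^+ k.
      move=> _; have h1 := @cvg_CX _ _ ((1 : R)^'-) _ k _ _ cr.
      exact: (@cvg_Cscale _ _ ((1 : R)^'-) _ _ _ _ (h1 _)).
    exact: (@cvg_Csum _ _ ((1 : R)^'-) _ _ _ (fun k => dyadic_mult j k * F k z * 1 ^+ k) h).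
  exact: (@cvg_Csum _ _ ((1 : R)^'-) _ _ _ (fun j => (dyadic_block j z).[1]) (fun j _ => term j)).
have fL : f (creal r *: z) @[r --> (1 : R)^'-] --> L.
  apply/cvg_cabsP => e e0; have e4 : 0 < e / 4 by rewrite divr_gt0.
  have [m Hm] := geometric_tail_small a01' P1 e4.
  have tail1 := geometric_series_tail a01' P1 m c1.
  have H := (cvg_cabsP (F := (1 : R)^'-) _ _).1 (fin m) _ e4.
  have H0 : \forall r \near (1 : R)^'-, 0 <= r < 1.
    have h0 : \forall r \near (1 : R)^'-, 0 < r by apply: nbhs_left_gt; exact: ltr01.
    have h1 : \forall r \near (1 : R)^'-, r < 1 by exact: nbhs_left_lt.
    by apply: filterS2 h0 h1 => r /ltW -> ->.
  apply: filterS2 (H _) H0 => r hr r01.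
  have r01' : 0 <= r <= 1 by case/andP: r01 => -> /ltW ->.
  have Pr j : cabs (dyadic_block j z).[creal r] <= A * a ^+ j by exact: dyadic_block_le.
  have tailr := geometric_series_tail a01' Pr m (dyadic_block_cvg r01 Sz).
  have hm := Hm m (leqnn m).
  apply: (le_lt_trans (cabs_triangle (\sum_(j < m) (dyadic_block j z).[creal r]) _ _)).
  have := cabs_triangle (\sum_(j < m) (dyadic_block j z).[1])
    (\sum_(j < m) (dyadic_block j z).[creal r]) L.
  rewrite ![cabs (_ - L)]cabsBC.
  have alg (x y u v p q : R) : 0 < e -> y < e / 4 -> u <= q -> v <= q -> q <= e / 4 -> x <= y + u ->
    v + x < e by lra.
  exact: alg hr tail1 tailr hm.
exact: (cvg_lim (@norm_hausdorff _ _) fL).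
Qed.

Lemma boundary_value_dyadic : dyadic a (boundary_value f).
Proof.
have [Q HQ] := boolp.choice (fun k => (fun H => let: ex_intro2 P HP PE := H in
  ex_intro (fun P => rpoly (n * k) P /\ forall z, S z -> F k z = P z) P (conj HP PE))
  (rpoly_homogeneous_part fh k)).
exists (2 * n)%N, A, (fun j z => \sum_(k < 2 * 2 ^ j) dyadic_mult j k * Q k z).
have QE j z : S z -> \sum_(k < 2 * 2 ^ j) dyadic_mult j k * Q k z = (dyadic_block j z).[1].
  move=> Sz; rewrite slice_polyE; apply: eq_bigr => k _.
  by rewrite expr1n mulr1 (HQ k).2.
split => //.
- by rewrite muln_gt0.
- move=> j; apply: (rpoly_sum (P := fun k z => dyadic_mult j k * Q k z)) => k kj.
  apply: rpoly_scale; apply: rpoly_le (HQ k).1.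
  by rewrite mulnAC [(2 * _ * _)%N]mulnC leq_mul2l (ltnW kj) orbT.
- by move=> j z Sz; rewrite QE //; exact: block_le.
- move=> z Sz; have -> : (fun m => \sum_(j < m) \sum_(k < 2 * 2 ^ j) dyadic_mult j k * Q k z) =
    (fun m => \sum_(j < m) (dyadic_block j z).[1]).
  by apply/funext => m; apply: eq_bigr => j _; exact: QE.
  exact: boundary_value_blocks.
Qed.

End BlockSeries.

(** * The boundary function and its argument function *)

Section Reflection.
Variables (R : realType) (n : nat).
Local Notation C := (Cx R).
Local Notation Cn := 'rV[Cx R]_n.
Local Notation S := (@unit_sphere R n).
Local Notation mu := (surface_measure R n).
Local Notation SB := (@unit_sphere R n : set (CnBorel R n)).
Local Notation I := (@sphere_integral R n).

(* The sphere is connected, so |g| cannot take both values. *)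
Lemma unimodular_dichotomy (g : Cn -> C) : scont g ->
  (forall z, S z -> cabs (g z) * `|cabs (g z) - 1| <= 0) ->
  (forall z, S z -> g z = 0) \/ (forall z, S z -> cabs (g z) = 1).
Proof.
move=> cg Hg.
have half : (0 <= (1 / 2 : R)) && ((1 / 2 : R) <= 1) by apply/andP; split; lra.
have half0 : (1 / 2 : R) = 0 -> False by lra.
have half1 : (1 / 2 : R) = 1 -> False by lra.
have H01 z : S z -> cabs (g z) = 0 \/ cabs (g z) = 1.
  move=> Sz; have := Hg z Sz; rewrite le_eqVlt ltNge mulr_ge0 ?cabs_ge0 // orbF.
  rewrite mulf_eq0 normr_eq0 subr_eq0 => /orP[] /eqP; by [left|right].
have conn z w : S z -> S w -> cabs (g z) = 0 -> cabs (g w) = 0.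
  move=> Sz Sw gz; have [//|gw] := H01 w Sw; exfalso.
  have [u [m [Su zu m1 wE _]]] := great_circle_through Sz Sw.
  have [t0 _ mE] := cis_surj m1.
  pose p t := great_circle z u (cis (t * t0)).
  have Sp t : S (p t) by apply: great_circle_sphere => //; exact: cabs_cis.
  pose h t := cabs (g (p t)).
  have h0 : h 0 = 0 by rewrite /h /p mul0r cis0 great_circle1.
  have h1 : h 1 = 1 by rewrite /h /p mul1r -mE -wE.
  have ch : continuous h.
    move=> t; apply/cvgrPdist_lt => e e0.
    have /cvgrPdist_lt/(_ _ e0) := scont_cabs cg (Sp t).
    move=> /nbhs_enorm [d d0 Hd].
    have e1 : 0 < d / (`|t0| + 1) by rewrite divr_gt0 // ltr_wpDl.
    apply/nbhs_ballP; exists (d / (`|t0| + 1)) => //= s; rewrite /ball /= => ts.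
    apply: Hd; last exact: Sp.
    rewrite great_circle_isometry //.
    have -> : cis (s * t0) - cis (t * t0) = (cis ((s - t) * t0) - 1) * cis (t * t0).
      by rewrite mulrBl mul1r -cisD mulrBl subrK.
    rewrite cabsM cabs_cis mulr1; apply: (le_lt_trans (cabs_cisB1_le _)).
    rewrite normrM distrC; move: ts; rewrite ltr_pdivlMr ?ltr_wpDl //.
    apply: le_lt_trans; apply: ler_wpM2l => //; by rewrite lerDl.
  have [c _ hc] : exists2 c, c \in `[0, 1] & h c = 1 / 2.
    apply: IVT; first exact: ler01.
      exact: continuous_subspaceT.
    by rewrite h0 h1 minElt maxElt ltr01.
  by have := H01 _ (Sp c); rewrite -/(h c) hc => -[].
have [[z0 [Sz0 gz0]]|ne] := pselect (exists z, S z /\ cabs (g z) = 0).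
  by left => w Sw; apply/eqP; rewrite -cabs_eq0; apply/eqP; exact: conn gz0.
right => z Sz; have [gz|//] := H01 z Sz; by exfalso; apply: ne; exists z.
Qed.

(** The measure is a multiple of the image of the punctured ball under radial projection, which
    lands on the sphere. *)
Lemma ae_sphere : {ae mu, forall z : CnBorel R n, SB z}.
Proof.
exists (~` SB); split; first exact: measurableC (@measurable_sphere R n).
  rewrite surface_measureE (_ : _ `&` _ = set0) ?measure0 ?mule0 //.
  apply/seteqP; split => // t [/= + /andP[t0 _]]; apply.
  by apply: sphere_proj_in; rewrite -enorm_eq0 gt_eqF.
by move=> z.
Qed.

(** [lim] takes the default value 0 where the limit fails to exist, so a nonzero value certifies
    convergence. *)
Lemma boundary_value_cvg (f : Cn -> C) z : boundary_value f z != 0 ->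
  f (creal r *: z) @[r --> (1 : R)^'-] --> boundary_value f z.
Proof.
have [c _|nc] := pselect (cvg (f (creal r *: z) @[r --> (1 : R)^'-])); first exact: c.
by rewrite /boundary_value (dvgP nc) eqxx.
Qed.

(** Needed because f is reflected by phi = conj psi. Conjugation reverses the frequencies, i
    becoming 2 * 2^j - i. *)
Lemma slice_approx_conj (phi : Cn -> C) (a B : R) : slice_approx phi a B ->
  slice_approx (fun z => (phi z)^*) a B.
Proof.
move=> H j z Sz; have [c Hc] := H j z Sz.
pose N := (2 ^ j)%N; exists (fun i => (c (2 * N - i)%N)^*) => l l1.
have ll k : l ^+ k * l^* ^+ k = 1 by rewrite -exprMn mul_conj_unit // expr1n.
apply: le_trans (Hc l l1); rewrite -[leRHS]cabs_conj conj_sub.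
rewrite le_eqVlt; apply/orP; left; apply/eqP; congr (cabs (_ - _)).
rewrite rmorph_sum [RHS](reindex_inj rev_ord_inj); apply: eq_bigr => i _ /=.
have iN : (i <= 2 * N)%N by rewrite -ltnS.
rewrite subSS -/N !conj_mul; congr (_ * _).
have conjX k : (l ^+ k)^* = l^* ^+ k by exact: rmorphXn.
have -> : (l^* ^+ N)^* = l ^+ N by rewrite -conjX conjCK.
rewrite conjX -[LHS]mulr1 -(ll (2 * N - i)%N) mulrACA -exprD subnKC //.
have -> : l ^+ (2 * N) = l ^+ N * l ^+ N by rewrite mul2n -addnn exprD.
by rewrite mulrA -[l ^+ N * _ * _]mulrA ll mulr1 mulrC.
Qed.

Lemma Lambda_zero (tau : R) : 0 < tau -> Lambda tau (fun _ : Cn => 0 : C).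
Proof.
move=> tau0; apply: (dyadic_Lambda tau0); exists 1%N, 0, (fun _ _ => 0); split; [by []|by []|..].
- by move=> j; exact: rpoly_cst.
- by move=> j w _; rewrite cabs0 mul0r.
- move=> w _; have -> : (fun m => \sum_(j < m) (0 : C)) = (fun=> 0) by apply/funext => m; rewrite big1.
  exact: cvg_cst.
Qed.

Section MainCase.
Variables (tau : R) (f psi : Cn -> C).
Hypotheses (n0 : (0 < n)%N) (tau0 : 0 < tau) (fH : hardy1 f) (psiL : Lambda tau psi).
Hypothesis psi_ae : {ae mu, forall z : CnBorel R n, (boundary_value f z)^* / boundary_value f z = psi z}.
Hypothesis psi1 : forall z, S z -> cabs (psi z) = 1.
Local Notation F := (homogeneous_part f).

Let phi z := (psi z)^*.
Let r i : R := 1 - i.+2%:R^-1.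

Let fh : holomorphic_on_ball f.
Proof. by case: fH. Qed.

Let r01 i : 0 < r i < 1.
Proof.
have i2 : (0 : R) < i.+2%:R by rewrite ltr0n.
by rewrite /r subr_gt0 invf_lt1 // ltr1n /= gtrBl invr_gt0.
Qed.

Let r_ge (e : R) : 0 < e -> exists i0, forall i, (i0 <= i)%N -> 1 - e <= r i.
Proof.
move=> e0; have [i0 Hi] := inv_small e0; exists i0 => i hi.
by rewrite /r lerD2l lerN2; apply: Hi; exact: leqW.
Qed.

Lemma boundary_phi : {ae mu, forall z : CnBorel R n, SB z ->
  boundary_value f z != 0 /\ boundary_value f z = phi z * (boundary_value f z)^*}.
Proof.
apply: filterS psi_ae => z E Sz.
have b0 : boundary_value f z != 0.
  apply/eqP => b0; have := psi1 Sz; rewrite -E b0 invr0 mulr0 cabs0 => /eqP.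
  by rewrite eq_sym oner_eq0.
split => //; rewrite /phi -E conj_mul conjCK.
have -> : (boundary_value f z)^-1^* = ((boundary_value f z)^*)^-1 by exact: fmorphV.
by rewrite divfK // conjC_eq0.
Qed.

Lemma radial_sequence_cvg z : boundary_value f z != 0 ->
  f (creal (r i) *: z) @[i --> \oo] --> boundary_value f z.
Proof.
move=> /boundary_value_cvg lim; apply/cvg_cabsP => e e0.
have := (cvg_cabsP (F := (1 : R)^'-) _ _).1 lim _ e0 => /(_ _).
move=> H; have {H} : \forall s \near (1 : R)^'-, cabs (f (creal s *: z) - boundary_value f z) < e by exact: H.
rewrite /at_left /within /prop_near1 /= => /nbhs_ballP[d /= d0 Hd].
have d2 : 0 < d / 2 by rewrite divr_gt0.
have [i0 Hi] := r_ge d2; exists i0 => // i /= hi.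
have /andP[ri0 ri1] := r01 i; apply: Hd => //.
have := Hi i hi; rewrite /ball /= ger0_norm ?subr_ge0 ?(ltW ri1) //; move: d0; lra.
Qed.

(** Half the tolerance of [refl_tail], which compares two partial sums with each other. *)
Lemma radial_partial_sums : exists m : nat -> nat, (forall i, (i <= m i)%N) /\
  forall i k z, S z -> (m i <= k)%N ->
    cabs (f (creal (r i) *: z) - (slice_poly F k z).[creal (r i)]) <= (2 * i.+1%:R)^-1.
Proof.
have ex i : exists m0, forall k z, S z -> (m0 <= k)%N ->
    cabs (f (creal (r i) *: z) - (slice_poly F k z).[creal (r i)]) <= (2 * i.+1%:R)^-1.
  have /andP[ri0 ri1] := r01 i; have ri : 0 <= r i < 1 by rewrite ltW.
  have e0 : 0 < (2 * i.+1%:R)^-1 :> R by rewrite invr_gt0 mulr_gt0 // ltr0n.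
  have [m0 H] := homogeneous_limit fh ri e0; exists m0 => k z Sz mk; exact: H.
have [m0 Hm] := boolp.choice ex; exists (fun i => maxn (m0 i) i); split.
  by move=> i; exact: leq_maxr.
by move=> i k z Sz mk; apply: Hm => //; apply: leq_trans mk; exact: leq_maxl.
Qed.

(** Only convergence almost everywhere along the radii is known; the cut-off at 1 makes dominated
    convergence applicable and turns it into the error condition. Partial sums may replace f because
    their tails are uniformly small. *)
Lemma boundary_reflected : exists m N, reflected_seq I F phi r m N.
Proof.
have [m [mi Hm]] := radial_partial_sums; have [N HN] := hardy1_mass fH.
have HI := @sphere_integral_functional R n.
have HF := homogeneous_part_seq fh.
have [cpsi _] := Lambda_slice_approx tau0 psiL.
have cphi : scont phi by exact: scont_conj.
pose T i z := (slice_poly F (m i) z).[creal (r i)].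
have cT i : scont (T i) by exact: scont_slice_poly.
have phi1 z : S z -> cabs (phi z) = 1 by move=> Sz; rewrite /phi cabs_conj psi1.
have i1 i : 0 < (i.+1%:R : R) by rewrite ltr0n.
have half i : (2 * i.+1%:R)^-1 + (2 * i.+1%:R)^-1 = i.+1%:R^-1 :> R.
  by field; rewrite gt_eqF.
have small i : (2 * i.+1%:R)^-1 <= 1 :> R.
  by rewrite invf_le1 ?mulr_gt0 // -natrM ler1n.
have fT i z : S z -> cabs (f (creal (r i) *: z) - T i z) <= (2 * i.+1%:R)^-1.
  by move=> Sz; exact: Hm.
have ael : {ae mu, forall z : CnBorel R n, SB z ->
    Num.min 1 (cabs (T i z - phi z * (T i z)^*)) @[i --> \oo] --> (0 : R)}.
  apply: filterS boundary_phi => z H Sz; have [b0 bE] := H Sz.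
  have lim0 := radial_sequence_cvg b0.
  apply/cvgrPdist_le => e e0; have e4 : 0 < e / 4 by rewrite divr_gt0.
  have lim1 := (cvg_cabsP (F := \oo) _ _).1 lim0 _ e4.
  have [i0 Hi0] := inv_small e4.
  have lim2 : \forall i \near \oo, (i.+1%:R)^-1 <= e / 4 :> R by exists i0.
  apply: filterS2 (lim1 _) lim2 => i h1 h2.
  set b := boundary_value f z in bE h1 *.
  have TL : cabs (T i z - b) <= e / 2.
    apply: (le_trans (cabs_triangle (f (creal (r i) *: z)) _ _)).
    rewrite [cabs (T i z - _)]cabsBC.
    have h0 : 0 < (2 * i.+1%:R)^-1 :> R by rewrite invr_gt0 mulr_gt0.
    have alg (x y p q : R) : 0 < p -> q <= e / 4 -> y < e / 4 -> p + p = q -> x <= p -> x + y <= e / 2.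
      by move=> *; lra.
    exact: alg h0 h2 h1 (half i) (fT i z Sz).
  rewrite sub0r normrN ger0_norm; last by rewrite le_min ler01 cabs_ge0.
  rewrite ge_min; apply/orP; right.
  have -> : T i z - phi z * (T i z)^* = (T i z - b) - phi z * (T i z - b)^*.
    by rewrite conj_sub mulrBr -bE; ring.
  apply: (le_trans (cabsB _ _)); rewrite cabsM phi1 // mul1r cabs_conj.
  by move: TL; lra.
have lim : I (fun z => Num.min 1 (cabs (T i z - phi z * (T i z)^*))) @[i --> \oo] --> (0 : R).
  apply: (sphere_integral_dominated _ _ ael) => i; last first.
    by move=> z Sz; rewrite le_min ler01 cabs_ge0 /= ge_min lexx.
  apply: scont_min; first exact: scont_cst.
  apply: scont_cabs; apply: scontB; first exact: cT.
  exact: (scontM cphi (scont_conj (cT i))).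
exists m, (N + I (fun=> 1)); split => //.
- exact: homogeneous_growth.
- by move=> z Sz; rewrite phi1.
- move=> i k z Sz mk; rewrite -half; apply: (le_trans (cabs_triangle (f (creal (r i) *: z)) _ _)).
  by rewrite cabsBC; apply: lerD; [exact: Hm|exact: fT].
- move=> i; have ri := r01 i; have ri' : 0 <= r i < 1 by case/andP: ri => /ltW -> ->.
  have cf := ball_scont fh ri'.
  apply: (@le_trans _ _ (I (fun z => cabs (f (creal (r i) *: z)) + 1))).
    apply: (rotf_le HI); first exact: (scont_cabs (cT i)).
      by apply: scontDr; [exact: scont_cabs|exact: scont_cst].
    move=> z Sz; have := cabs_subl (T i z) (f (creal (r i) *: z)).
    rewrite lerBlDl => h; apply: (le_trans h); rewrite lerD2l cabsBC.
    exact: le_trans (fT i z Sz) (small i).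
  rewrite (rotfD HI (scont_cabs cf) (@scont_cst _ _ _ (1 : R))) lerD2r.
  exact: HN.
- move=> e e0; move/cvgrPdist_le : lim => /(_ e e0)[i0 _ Hi]; exists i0 => i hi.
  by have := Hi i hi; rewrite sub0r normrN ler_norml => /andP[_].
Qed.

Lemma boundary_dyadic : dyadic (2 `^ (- tau)) (boundary_value f).
Proof.
have [m [N HR]] := boundary_reflected; have HI := @sphere_integral_functional R n.
have [_ [B B0 HB]] := Lambda_slice_approx tau0 psiL.
set a := 2 `^ (- tau) in HB *.
have a0 : 0 < a by exact: powR_gt0.
have a01 : 0 < a < 1 by rewrite a0 /a powRN invf_lt1 ?powR_gt0 //; exact: powR2_gt1.
have [D D0 HD] := block_decay HI HR a01 B0 (slice_approx_conj HB).
have HF := homogeneous_part_seq fh.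
have c0 : scont (fun z => (dyadic_block f 0 z).[1]).
  by apply: scont_slice_poly; exact: homogeneous_mult.
have [E E0 HE] := scont_bounded (scont_cabs c0).
have A0 : 0 <= E + D / a by rewrite addr_ge0 // divr_ge0 // ltW.
apply: (boundary_value_dyadic fh HI n0 a01 A0) => -[|j] z Sz.
  rewrite expr0 mulr1; have := HE z Sz; rewrite ger0_norm ?cabs_ge0 // => h.
  by apply: (le_trans h); rewrite lerDl divr_ge0 // ltW.
rewrite slice_polyE.
have -> : \sum_(k < 2 * 2 ^ j.+1) dyadic_mult R j.+1 k * F k z * 1 ^+ k =
    \sum_(k < 4 * 2 ^ j) creal (block_mult R (2 ^ j) k) * F k z.
  have -> : (2 * 2 ^ j.+1 = 4 * 2 ^ j)%N by rewrite expnS mulnA.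
  by apply: eq_bigr => k _; rewrite expr1n mulr1.
apply: (le_trans (HD j z Sz)); rewrite exprS mulrA.
apply: ler_wpM2r; first by rewrite exprn_ge0 // ltW.
by rewrite mulrDl divfK ?gt_eqF // lerDr mulr_ge0 // ltW.
Qed.

End MainCase.

End Reflection.

Theorem corollary1p3 (R : realType) (n : nat) (tau : R)
    (f : 'rV[Cx R]_n -> Cx R) :
  (0 < n)%N -> 0 < tau -> hardy1 f ->
  (exists2 z, unit_ball z & f z != 0) ->
  Lambda_ae tau (fun z => (boundary_value f z)^* / boundary_value f z) ->
  Lambda_ae tau (boundary_value f).
Proof.
move=> n0 tau0 fH _ [psi psiL psiE].
have {}psiE : {ae surface_measure R n, forall z : CnBorel R n,
    (boundary_value f z)^* / boundary_value f z = psi z} by exact: psiE.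
have [cpsi _] := Lambda_slice_approx tau0 psiL.
(* Almost everywhere psi is conj b / b, of modulus 1 when b is nonzero and equal to 0 otherwise, as
   division by 0 gives 0. The continuous function |psi| * ||psi| - 1| is thus at most 0 almost
   everywhere, hence everywhere on the sphere. *)
have [z Sz|psi0|psi1] := unimodular_dichotomy cpsi.
- apply: (@ae_scont_le R n (fun z => cabs (psi z) * `|cabs (psi z) - 1|)); last exact: Sz.
    apply: scontMr; first exact: scont_cabs.
    by apply: scont_norm; apply: scontBr; [exact: scont_cabs|exact: scont_cst].
  apply: filterS psiE => w E _; rewrite -E cabsM cabs_conj cabsV.
  have [b0|b0] := eqVneq (boundary_value f w) 0; first by rewrite b0 cabs0 mul0r mul0r.
  by rewrite divff ?cabs_eq0 // subrr normr0 mulr0.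
(* If psi = 0 then the boundary function vanishes almost everywhere. *)
- exists (fun=> 0); first exact: Lambda_zero.
  apply: filterS2 psiE (ae_sphere R n) => w E Sw.
  have /eqP := E; rewrite (psi0 _ Sw) mulf_eq0 conjC_eq0 invr_eq0 orbb => /eqP; exact.
(* Here the boundary function itself is in the space, without any change on a null set. *)
- exists (boundary_value f); last exact: nearW.
  exact: dyadic_Lambda tau0 (boundary_dyadic n0 tau0 fH psiL psiE psi1).
Qed.
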